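(* Let $A\in\mathbb{R}^{n\times n}$, $B\in\mathbb{R}^{n\times d}$, let $(Z_t)_{t\ge 0}$ be a Lévy process in $\mathbb{R}^d$ without Gaussian part (i.e. $Q=0$ in its Lévy-Khintchine representation) and with characteristic exponent $\Phi$, and let $P_t(x,\cdot)$ be the transition function of the Ornstein-Uhlenbeck process $(X_t^x)_{t\ge 0}$ on $\mathbb{R}^n$ given by $$dX_t = AX_t\,dt + B\,dZ_t,\qquad X_0=x\in\mathbb{R}^n .$$ For $t,\rho>0$ define $$\varphi_t(\rho):=\sup_{|\xi|\le\rho}\int_0^t\operatorname{Re}\Phi\bigl(B^\top e^{sA^\top}\xi\bigr)\,ds .$$ Assume that there exists some $t_0>0$ such that $$\liminf_{|\xi|\to\infty}\frac{\int_0^{t_0}\operatorname{Re}\Phi\bigl(B^\top e^{sA^\top}\xi\bigr)\,ds}{\log(1+|\xi|)}>2n+2. \tag{a}$$ If $$\int_{\mathbb{R}^n}\exp\Bigl(-\int_0^t\operatorname{Re}\Phi\bigl(B^\top e^{sA^\top}\xi\bigr)\,ds\Bigr)|\xi|^{n+2}\,d\xi=O\bigl(\varphi_t^{-1}(1)^{2n+2}\bigr)\quad\text{as } t\to\infty, \tag{b}$$ then there exist $t_1,C>0$ such that for any $x,y\in\mathbb{R}^n$ and $t\ge t_1$, $$\|P_t(x,\cdot)-P_t(y,\cdot)\|_{\mathrm{Var}}\le C\,|e^{tA}(x-y)|\,\varphi_t^{-1}(1). \tag{c}$$ In particular, when the function $\xi\mapsto\int_0^\infty\operatorname{Re}\Phi\bigl(B^\top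 e^{sA^\top}\xi\bigr)\,ds$ is locally bounded on $\mathbb{R}^n$, condition (a) alone (without assuming (b)) implies the conclusion (c).
   Context: The Ornstein-Uhlenbeck process is the unique strong solution of the stated SDE, i.e. $X_t^x=e^{tA}x+\int_0^t e^{(t-s)A}B\,dZ_s$; $Z_t$ is allowed to take values in a proper subspace of $\mathbb{R}^d$. The characteristic exponent $\Phi$ is defined by $\mathbb{E}(e^{i\langle\xi,Z_t\rangle})=e^{-t\Phi(\xi)}$, $\xi\in\mathbb{R}^d$, and in general has the Lévy-Khintchine representation $$\Phi(\xi)=\tfrac12\langle Q\xi,\xi\rangle+i\langle b,\xi\rangle+\int_{z\ne0}\bigl(1-e^{i\langle\xi,z\rangle}+i\langle\xi,z\rangle\mathbf 1_{B(0,1)}(z)\bigr)\nu(dz),$$ where $B(0,1)$ is the unit ball, $Q$ is a positive semi-definite matrix, $b\in\mathbb{R}^d$, and $\nu$ is a $\sigma$-finite measure on $\mathbb{R}^d\setminus\{0\}$ with $\int_{z\neq 0}(1\wedge|z|^2)\,\nu(dz)<\infty$. Here $Q=0$. $M^\top$ is the transpose of the matrix $M$. $\varphi_t^{-1}$ denotes the (generalized) inverse of the non-decreasing function $\rho\mapsto\varphi_t(\rho)$, $\varphi_t^{-1}(u)=\inf\{\rho>0:\varphi_t(\rho)\ge u\}$ with $\inf\emptyset=\infty$. $\|\cdot\|_{\mathrm{Var}}$ is the total variation norm, $\|\mu_1-\mu_2\|_{\mathrm{Var}}=\sup_{\|f\|_\infty\le1}|\int f\,d\mu_1-\int f\,d\mu_2|$.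 *)

(* Defs.v *)
From HB Require Import structures.
From mathcomp Require Import all_boot all_order all_algebra.
From mathcomp Require Import complex.
From mathcomp Require Import all_classical all_reals all_analysis.

Set Implicit Arguments.
Unset Strict Implicit.
Unset Printing Implicit Defensive.

Import Order.TTheory GRing.Theory Num.Theory.
Import numFieldNormedType.Exports.

Local Open Scope classical_set_scope.
Local Open Scope ring_scope.
Local Open Scope complex_scope.

(* Matrices, and in particular column vectors, carry the sigma-algebra
   generated by the coordinate maps, i.e. the Borel sigma-algebra of R^(m x n);
   this is the analogue of the library's instance on [n.-tuple T]. *)
Section measurable_matrix.
Context (R : realType) (m n : nat).

Definition coord_system : set (set 'M[R]_(m, n)) :=
  \bigcup_(k in [set: 'I_m * 'I_n])
    preimage_set_system setT (fun M : 'M[R]_(m, n) => M k.1 k.2) measurable.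

HB.instance Definition _ := @isMeasurable.Build (sigma_display coord_system)
  'M[R]_(m, n) <<s coord_system >> (@sigma_algebra0 _ setT coord_system)
  (@sigma_algebraC _ coord_system) (@sigma_algebra_bigcup _ setT coord_system).

Lemma measurable_coord (i : 'I_m) (j : 'I_n) :
  measurable_fun [set: 'M[R]_(m, n)] (fun M => M i j).
Proof.
move=> _ Y mY; rewrite setTI; apply: sub_sigma_algebra => /=.
by exists (i, j) => //; exists Y => //; rewrite setTI.
Qed.

Lemma measurable_fun_coordP d (T : measurableType d) (f : T -> 'M[R]_(m, n)) :
  (forall i j, measurable_fun [set: T] (fun x => f x i j)) ->
  measurable_fun [set: T] f.
Proof.
move=> mf.
apply: (@measurability _ _ _ _ setT f coord_system) => //.
move=> _ [_ [[i j] _ [Y mY <-]] <-]; rewrite !setTI.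
by have := mf i j measurableT Y mY; rewrite setTI.
Qed.

End measurable_matrix.

Section lebesgue_vector.
Context (R : realType).

Definition vcons n (p : R * 'cV[R]_n) : 'cV[R]_n.+1 :=
  \col_i (if unlift ord0 i is Some j then p.2 j 0 else p.1).

Definition vuncons n (v : 'cV[R]_n.+1) : R * 'cV[R]_n :=
  (v ord0 0, \col_j v (lift ord0 j) 0).

Lemma vconsK n : cancel (@vcons n) (@vuncons n).
Proof.
move=> [x v]; congr pair; first by rewrite mxE unlift_none.
by apply/colP => j; rewrite !mxE liftK.
Qed.

Lemma vunconsK n : cancel (@vuncons n) (@vcons n).
Proof.
by move=> v; apply/colP => i; rewrite !mxE; case: unliftP => [j ->|-> //]; rewrite mxE.
Qed.

Lemma measurable_vcons n : measurable_fun setT (@vcons n).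
Proof.
apply: measurable_fun_coordP => i j.
rewrite (_ : (fun _ => _) = fun p : R * 'cV[R]_n =>
  if unlift ord0 i is Some k then p.2 k 0 else p.1); last first.
  by apply/funext => p; rewrite mxE.
case: (unlift ord0 i) => [k|]; last exact: measurable_fst.
exact: (measurableT_comp (@measurable_coord _ _ _ k 0) measurable_snd).
Qed.

Lemma measurable_vuncons n : measurable_fun setT (@vuncons n).
Proof.
apply/measurable_fun_pairP; split; first exact: measurable_coord.
apply: measurable_fun_coordP => i j /=.
rewrite (_ : (fun _ => _) = fun v : 'cV[R]_n.+1 => v (lift ord0 i) 0).
  exact: measurable_coord.
by apply/funext => v; rewrite mxE.
Qed.

Section step.
Context n (mu : {sigma_finite_measure set 'cV[R]_n -> \bar R}).

Definition lebesgue_step : set 'cV[R]_n.+1 -> \bar R :=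
  pushforward (lebesgue_measure \x mu)%E (@vcons n).

Let step0 : lebesgue_step set0 = 0%E.
Proof. by rewrite /lebesgue_step /pushforward preimage_set0 measure0. Qed.

Let step_ge0 A : (0 <= lebesgue_step A)%E.
Proof. exact: (@measure_ge0 _ _ _ (lebesgue_measure \x mu)%E). Qed.

Let step_sigma_additive : semi_sigma_additive lebesgue_step.
Proof.
exact: (@measure_semi_sigma_additive _ _ _
  (measure_function_pushforward__canonical__measure_function_Measure
     (lebesgue_measure \x mu)%E (@measurable_vcons n))).
Qed.

HB.instance Definition _ := isMeasure.Build _ _ _ lebesgue_step
  step0 step_ge0 step_sigma_additive.

Let step_sigma_finite : sigma_finite setT lebesgue_step.
Proof.
pose m1 : {sigma_finite_measure set (measurableTypeR R) -> \bar R} :=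
  @lebesgue_measure R.
have /sigma_finiteP[F [TF ndF Foo]] := sigma_finiteT m1.
have /sigma_finiteP[G [TG ndG Goo]] := sigma_finiteT mu.
exists (fun k => @vuncons n @^-1` (F k `*` G k)).
  rewrite -preimage_bigcup -[LHS](preimage_setT (@vuncons n)); congr (_ @^-1` _).
  rewrite -setXTT TF TG predeqE => -[x y]; split.
    move=> [/= [k _ Fkx] [l _ Gly]]; exists (maxn k l) => //; split.
    - by move: x Fkx; exact/subsetPset/ndF/leq_maxl.
    - by move: y Gly; exact/subsetPset/ndG/leq_maxr.
  by move=> [k _ []/= ? ?]; split; exists k.
move=> k; have [mF Fk] := Foo k; have [mG Gk] := Goo k; split.
  rewrite -[X in measurable X]setTI; apply: measurable_vuncons => //.
  exact: measurableX.
rewrite /lebesgue_step /pushforward -comp_preimage.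
rewrite (_ : _ \o _ = id) ?preimage_id; last first.
  by apply/funext => p; exact: vconsK.
by rewrite (@product_measure1E _ _ _ _ _ m1)// lte_mul_pinfty// ge0_fin_numE.
Qed.

HB.instance Definition _ := @Measure_isSigmaFinite.Build _ _ _ lebesgue_step
  step_sigma_finite.

End step.

Fixpoint lebesgue_vec n : {sigma_finite_measure set 'cV[R]_n -> \bar R} :=
  match n with
  | 0 => \d_(0 : 'cV[R]_0)
  | k.+1 => lebesgue_step (lebesgue_vec k)
  end.

Lemma lebesgue_vec_box n (a b : 'I_n -> R) : (forall i, a i <= b i) ->
  lebesgue_vec n [set v | forall i, v i 0 \in `[a i, b i]] =
  (\prod_(i < n) (b i - a i))%:E.
Proof.
elim: n a b => [|n IHn] a b ab.
  by rewrite big_ord0 /= diracE mem_set// => -[].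
rewrite big_ord_recl; set S := [set _ | _].
pose B := [set v : 'cV[R]_n |
  forall i, v i 0 \in `[a (lift ord0 i), b (lift ord0 i)]].
have SE : @vcons n @^-1` S = `[a ord0, b ord0] `*` B.
  apply/seteqP; split => -[x v] /=.
    move=> h; split; first by have := h ord0; rewrite mxE unlift_none.
    by move=> i; have := h (lift ord0 i); rewrite mxE liftK.
  by move=> [hx hv] i; rewrite mxE; case: unliftP => [j ->|->] //=.
have -> : lebesgue_vec n.+1 S =
    (lebesgue_measure \x lebesgue_vec n)%E (`[a ord0, b ord0] `*` B).
  by rewrite -SE.
rewrite product_measure1E//; last first.
  rewrite (_ : B = \bigcap_(i in [set: 'I_n])
    (fun v : 'cV[R]_n => v i 0) @^-1` `[a (lift ord0 i), b (lift ord0 i)]).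
    apply: fin_bigcap_measurable => // i _.
    by rewrite -[X in measurable X]setTI; exact: measurable_coord.
  by apply/seteqP; split => v /= h i; [move=> _|]; exact: h.
rewrite IHn// EFinM; congr (_ * _)%E.
apply: (etrans (lebesgue_measure_itv `[a ord0, b ord0])); rewrite /= lte_fin.
case: ltP => // ba; rewrite (_ : a ord0 = b ord0) ?subrr//.
by apply/eqP; rewrite eq_le ab ba.
Qed.

End lebesgue_vector.

Section vectors.
Context {R : realType} {n : nat}.
Implicit Types u v : 'cV[R]_n.

Definition dotv u v : R := \sum_i u i 0 * v i 0.

(* The library norm [`|v|] on matrices is the sup norm. *)
Definition enorm v : R := Num.sqrt (dotv v v).

Definition mexp (M : 'M[R]_n) : 'M[R]_n :=
  lim (series (fun k => (k`!%:R)^-1 *: M ^+ k) @ \oo).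

Definition vintegral (D : set R) (f : R -> 'cV[R]_n) : 'cV[R]_n :=
  \col_i \int[lebesgue_measure]_(s in D) f s i 0.

Definition enorm_infty : set_system 'cV[R]_n :=
  filter_from [set: R] (fun r => [set v | r < enorm v]).

Definition cadlag (f : R -> 'cV[R]_n) : Prop :=
  (forall t, 0 <= t -> f s @[s --> t^'+] --> f t) /\
  (forall t, 0 < t -> cvg (f s @[s --> t^'-])).

Definition var_dist (mu1 mu2 : set 'cV[R]_n -> \bar R) : \bar R :=
  ereal_sup [set `| \int[mu1]_z (f z)%:E - \int[mu2]_z (f z)%:E |%E
    | f in [set f : 'cV[R]_n -> R |
              measurable_fun setT f /\ forall z, `|f z| <= 1]].

End vectors.

Section complex_valued.
Context {R : realType}.

Definition cexp (z : R[i]) : R[i] :=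
  (expR (complex.Re z))%:C * (cos (complex.Im z) +i* sin (complex.Im z)).

Definition cintegral d (T : measurableType d) (mu : {measure set T -> \bar R})
    (D : set T) (f : T -> R[i]) : R[i] :=
  (\int[mu]_(x in D) complex.Re (f x)) +i* (\int[mu]_(x in D) complex.Im (f x)).

End complex_valued.

Section levy.
Context {R : realType} {d : nat}.

Definition levy_measure (nu : {measure set 'cV[R]_d -> \bar R}) : Prop :=
  [/\ nu [set (0 : 'cV[R]_d)] = 0%E, sigma_finite setT nu &
      (\int[nu]_(z in ~` [set (0%R : 'cV[R]_d)])
        (Num.min 1 (enorm z ^+ 2))%R%:E < +oo)%E].

Definition pos_semidef (Q : 'M[R]_d) : Prop :=
  Q^T = Q /\ forall xi : 'cV[R]_d, 0 <= dotv (Q *m xi) xi.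

Definition levy_khintchine (Phi : 'cV[R]_d -> R[i]) (Q : 'M[R]_d)
    (b : 'cV[R]_d) (nu : {measure set 'cV[R]_d -> \bar R}) : Prop :=
  [/\ pos_semidef Q, levy_measure nu &
    forall xi : 'cV[R]_d,
      Phi xi = (2^-1 * dotv (Q *m xi) xi)%:C + 'i%C * (dotv b xi)%:C +
        cintegral nu (~` [set (0 : 'cV[R]_d)]) (fun z =>
          1 - cexp ('i%C * (dotv xi z)%:C) +
          'i%C * (dotv xi z)%:C * (\1_[set y : 'cV[R]_d | enorm y < 1] z)%:C)].

Context {dO : measure_display} {Omega : measurableType dO}.
Variable P : probability Omega R.

Record levy_process (Z : R -> Omega -> 'cV[R]_d) : Prop := {
  levy_measurable : forall t, 0 <= t -> measurable_fun setT (Z t) ;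
  levy_start : {ae P, forall w, Z 0 w = 0} ;
  levy_independent : forall (k : nat) (t : nat -> R)
      (E : nat -> set 'cV[R]_d),
    0 <= t 0%N -> (forall i, t i <= t i.+1) -> (forall i, measurable (E i)) ->
    let G i := [set w | E i (Z (t i.+1) w - Z (t i) w)] in
    P (\bigcap_(i in `I_k) G i) = (\prod_(i < k) P (G i))%E ;
  levy_stationary : forall s t (E : set 'cV[R]_d), 0 <= s -> 0 <= t ->
    measurable E ->
    P [set w | E (Z (s + t) w - Z s w)] = P [set w | E (Z t w - Z 0 w)] ;
  levy_continuous : forall t e, 0 <= t -> 0 < e ->
    P [set w | e < enorm (Z s w - Z t w)]
      @[s --> within [set s | 0 <= s] (nbhs t)] --> 0%E ;
  levy_cadlag : {ae P, forall w, cadlag (Z^~ w)} }.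

Definition char_exponent (Z : R -> Omega -> 'cV[R]_d)
    (Phi : 'cV[R]_d -> R[i]) : Prop :=
  forall t (xi : 'cV[R]_d), 0 <= t ->
    cintegral P setT (fun w => cexp ('i%C * (dotv xi (Z t w))%:C)) =
    cexp (- (t%:C * Phi xi)).

(* X is a solution of dX_t = A X_t dt + B dZ_t, X_0 = x. As the noise is
   additive, the integral form of the equation,
   X_t = x + int_0^t A X_s ds + B Z_t, involves no stochastic integral; it
   determines X up to indistinguishability. *)
Record ou_process n (A : 'M[R]_n) (B : 'M[R]_(n, d))
    (Z : R -> Omega -> 'cV[R]_d) (x : 'cV[R]_n)
    (X : R -> Omega -> 'cV[R]_n) : Prop := {
  ou_measurable : forall t, 0 <= t -> measurable_fun setT (X t) ;
  ou_cadlag : {ae P, forall w, cadlag (X^~ w)} ;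
  ou_sde : {ae P, forall w, forall t, 0 <= t ->
    X t w = x + vintegral `[0, t] (fun s => A *m X s w) + B *m Z t w} }.

Definition ou_transition n (X : 'cV[R]_n -> R -> Omega -> 'cV[R]_n)
    (t : R) (x : 'cV[R]_n) : set 'cV[R]_n -> \bar R :=
  pushforward P (X x t).

End levy.

Section ou_exponent.
Context {R : realType} {n d : nat}.
Variables (A : 'M[R]_n) (B : 'M[R]_(n, d)) (Phi : 'cV[R]_d -> R[i]).
Local Open Scope ereal_scope.

Definition re_exponent (D : set R) (xi : 'cV[R]_n) : \bar R :=
  \int[lebesgue_measure]_(s in D)
    (complex.Re (Phi (B^T *m mexp (s *: A^T) *m xi)))%:E.

Definition phi (t rho : R) : \bar R :=
  ereal_sup [set re_exponent `[0%R, t] xi | xi in [set xi | (enorm xi <= rho)%R]].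

(* As in the library, the infimum of the empty set is +oo. *)
Definition phi_inv (t : R) (u : \bar R) : \bar R :=
  ereal_inf [set rho%:E | rho in [set rho : R | (0 < rho)%R /\ u <= phi t rho]].

Definition log_growth_condition : Prop :=
  exists2 t0 : R, (0 < t0)%R &
    ((2 * n + 2)%N%:R)%:E <
    limf_einf (fun xi => re_exponent `[0%R, t0] xi * ((ln (1 + enorm xi))^-1)%:E)
      enorm_infty.

Definition integral_bigO_condition : Prop :=
  exists M : R, \forall t \near +oo%R,
    \int[lebesgue_vec R n]_xi
      (expeR (- re_exponent `[0%R, t] xi) * (enorm xi ^+ (n + 2))%:E) <=
    M%:E * phi_inv t 1 ^+ (2 * n + 2).

Definition locally_bounded_exponent : Prop :=
  forall xi0 : 'cV[R]_n, exists M : R, \forall xi \near xi0,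
    re_exponent `[0%R, +oo[ xi <= M%:E.

Definition coupling_estimate (Pt : R -> 'cV[R]_n -> set 'cV[R]_n -> \bar R) :
    Prop :=
  exists t1 C : R, [/\ (0 < t1)%R, (0 < C)%R &
    forall (x y : 'cV[R]_n) (t : R), (t1 <= t)%R ->
      var_dist (Pt t x) (Pt t y) <=
      (C * enorm (mexp (t *: A) *m (x - y)))%:E * phi_inv t 1].

End ou_exponent.

(* Main.v *)
(** By independence of the increments and a Riemann-sum argument, [X_t] has the
    characteristic function [cis <xi, e^(tA) x> * exp (- psi_t xi)], where
    [psi_t xi] is the integral of [Phi (B^T e^(s A^T) xi)] over [0 <= s < t]; this is
    again a Levy exponent, whose jumps are distributed as [T (s, z) = e^(sA) B z]
    under [ds * nu].  Put [rho = phi_t^-1 (1)] and cut the jumps at size about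
    [1 / rho].  Since [Re psi_t <= 1] on the ball of radius [rho], the large jumps
    have mass O(1) and the small ones have second moments O(1 / rho^2).

    The large jumps contribute a compound Poisson factor, which does not increase
    the L1 norm of an inverse Fourier transform.  The exponent [psi_S] of the small
    jumps is smooth at scale [rho], so that [n + 1] integrations by parts bound the
    L1 norm of the inverse Fourier transform of [(cis <xi, c> - 1) * exp (- psi_S)],
    with [c = e^(tA) (x - y)], by [C * rho * |c|] times
    [rho^-n * integral of (1 + |xi| / rho)^(n+2) exp (- Re psi_S)], and (b) says
    precisely that the latter is bounded.  When [rho * |c|] is not small the trivial
    bound 2 on the variation distance suffices.

    If the exponent over [[0, oo[] is locally bounded, then dominated convergence
    makes it small near 0, so that [phi_t^-1 (1)] stays bounded below, while the
    left-hand side of (b) is nonincreasing in [t] and finite at [t_0] by (a):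
    hence (b) holds. *)
Require Import Defs.
From HB Require Import structures.
From mathcomp Require Import all_boot all_order all_algebra.
From mathcomp Require Import complex ring lra.
From mathcomp Require Import all_classical all_reals all_analysis measurable_realfun.

Set Implicit Arguments.
Unset Strict Implicit.
Unset Printing Implicit Defensive.

Import Order.TTheory GRing.Theory Num.Theory.
Import numFieldNormedType.Exports.

Local Open Scope classical_set_scope.
Local Open Scope ring_scope.
Local Open Scope complex_scope.

(** * Integration *)

(** The laws are accessible only through characteristic functions, so densities have to be
    constructed: damping by a product of exponentials in the |xi_i| produces Poisson kernels, whose
    integrals over boxes are products of arctangents. Complex identities are stated through values
    of [cos (al + _)] for all phases [al], and [1 + cos] replaces [cos] wherever nonnegativity is
    wanted, for Tonelli or for use as a density.

    The exponents fit together as follows. Decay of order n + 1 in y leaves room for an integrable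
    majorant on R^n. Each of the n + 1 integrations by parts may bring down a derivative of psi_S,
    which grows linearly, and [cis <xi, c> - 1] grows linearly too: hence the weight of degree n +
    2. In (b), the rho^-n of the majorant and the rho^-(n+2) of the weight add up to the power 2n +
    2. In (a), |xi|^(n+2) (1 + |xi|)^-c is integrable when c - (n + 2) > n, that is c > 2n + 2.

    The scale at which jumps are cut is rho / 4, which keeps all the test points used to count jumps
    strictly inside the ball where Re psi_t <= 1. *)

Section integration_tools.
Context d (T : measurableType d) (R : realType).
Variable mu : {measure set T -> \bar R}.
Implicit Types (D : set T) (f g : T -> R).

Lemma integrable_le_norm D f g : measurable D -> measurable_fun D f ->
  (forall x, D x -> `|f x| <= g x) ->
  mu.-integrable D (EFin \o g) -> mu.-integrable D (EFin \o f).
Proof.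
move=> mD mf fg ig; apply: (le_integrable mD _ _ ig).
  exact/measurable_EFinP.
by move=> x Dx /=; rewrite lee_fin (le_trans (fg x Dx))// ler_norm.
Qed.

Lemma integrable_measurable D f :
  mu.-integrable D (EFin \o f) -> measurable_fun D f.
Proof. by move=> /integrableP[/measurable_EFinP]. Qed.

Lemma integrable_norm_lty D f : measurable D ->
  mu.-integrable D (EFin \o f) <->
  measurable_fun D f /\ (\int[mu]_(x in D) `|f x|%:E < +oo)%E.
Proof.
move=> mD; split=> [/integrableP[mf foo]|[mf foo]].
  by split=> //; exact/measurable_EFinP.
by apply/integrableP; split => //; exact/measurable_EFinP.
Qed.

Lemma ge0_integrable_lty D f : measurable D -> measurable_fun D f ->
  (forall x, D x -> 0 <= f x) -> (\int[mu]_(x in D) (f x)%:E < +oo)%E ->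
  mu.-integrable D (EFin \o f).
Proof.
move=> mD mf f0 foo; apply/integrable_norm_lty => //; split => //.
rewrite (eq_integral (fun x => (f x)%:E))// => x xD.
by rewrite ger0_norm// f0//; exact/set_mem.
Qed.

Lemma EFin_Rintegral D f : measurable D -> mu.-integrable D (EFin \o f) ->
  (\int[mu]_(x in D) f x)%:E = (\int[mu]_(x in D) (f x)%:E)%E.
Proof. by move=> mD fi; rewrite /Rintegral fineK//; exact: integrable_fin_num. Qed.

Lemma Rdominated_cvg D (f_ : nat -> T -> R) f g : measurable D ->
  (forall n, measurable_fun D (f_ n)) ->
  (forall x, D x -> f_ n x @[n --> \oo] --> f x) ->
  mu.-integrable D (EFin \o g) ->
  (forall n x, D x -> `|f_ n x| <= g x) ->
  (\int[mu]_(x in D) f_ n x) @[n --> \oo] --> \int[mu]_(x in D) f x.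
Proof.
move=> mD mf_ cf ig fg.
have mf : measurable_fun D f by exact: (measurable_fun_cvg mf_).
have fgl x : D x -> `|f x| <= g x.
  move=> Dx; apply: (cvgr_to_le (cvg_norm (cf x Dx))).
  by near=> n; exact: fg.
have if_ : mu.-integrable D (EFin \o f) by exact: (integrable_le_norm _ _ fgl).
apply: fine_cvg; rewrite fineK; last exact: integrable_fin_num.
apply: (@dominated_cvg _ _ _ mu _ mD (fun n x => (f_ n x)%:E) _ (EFin \o g)) => //.
- by move=> n; exact/measurable_EFinP.
- by move=> x Dx; apply: cvg_EFin; [exact: nearW|exact: cf].
Unshelve. all: by end_near. Qed.

End integration_tools.

Section fubini_tools.
Context d1 d2 (T1 : measurableType d1) (T2 : measurableType d2) (R : realType).
Variables (m1 : {sigma_finite_measure set T1 -> \bar R}).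
Variables (m2 : {sigma_finite_measure set T2 -> \bar R}).

(** Slices are required to be integrable everywhere, because [Rintegral] has a default value on a
    non-integrable slice, which would then enter the identity. The domains are absorbed into
    indicators, which reduces the claim to Fubini on the full product. *)
Lemma Rfubini (D1 : set T1) (D2 : set T2) (f : T1 -> T2 -> R) :
  measurable D1 -> measurable D2 ->
  measurable_fun setT (fun z : T1 * T2 => f z.1 z.2) ->
  (\int[m1]_(x in D1) \int[m2]_(y in D2) `|f x y|%:E < +oo)%E ->
  (forall x, D1 x -> m2.-integrable D2 (EFin \o f x)) ->
  (forall y, D2 y -> m1.-integrable D1 (fun x => (f x y)%:E)) ->
  [/\ m1.-integrable D1 (fun x => (\int[m2]_(y in D2) f x y)%:E),
      m2.-integrable D2 (fun y => (\int[m1]_(x in D1) f x y)%:E) &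
      \int[m1]_(x in D1) \int[m2]_(y in D2) f x y =
      \int[m2]_(y in D2) \int[m1]_(x in D1) f x y].
Proof.
move=> mD1 mD2 mf foo i1 i2.
pose g (z : T1 * T2) := (f z.1 z.2 * (\1_D1 z.1 * \1_D2 z.2))%:E.
have mg : measurable_fun setT g.
  apply/measurable_EFinP; apply: measurable_funM => //.
  apply: measurable_funM; first exact: (measurableT_comp (measurable_indic mD1)).
  exact: (measurableT_comp (measurable_indic mD2)).
have inner1 x : (\int[m2]_y `|g (x, y)| =
    (\1_D1 x)%:E * \int[m2]_(y in D2) `|f x y|%:E)%E.
  rewrite [X in (_ * X)%E]integral_mkcond /=.
  rewrite indicE; case: (boolP (x \in D1)) => xD /=; last first.
    rewrite mul0e integral0_eq// => y _.
    rewrite /g /= !indicE. by rewrite ?(negbTE xD)/= mul0r mulr0 normr0.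
  rewrite mul1e; apply: eq_integral => y _.
  rewrite /g /= ?indicE ?xD patchE /= mul1r.
  by case: (y \in D2); rewrite ?mulr1 ?mulr0 ?normr0.
have ig : (m1 \x m2)%E.-integrable setT g.
  apply/integrable12ltyP; first exact: mg.
  under eq_integral do rewrite inner1.
  apply: le_lt_trans foo.
  rewrite [leRHS]integral_mkcond/= le_eqVlt; apply/orP; left; apply/eqP.
  apply: eq_integral => x _; rewrite indicE patchE.
  by case: (x \in D1); rewrite ?mul1e ?mul0e.
have F1 x : (\int[m2]_y g (x, y) =
    (\1_D1 x * \int[m2]_(y in D2) f x y)%:E)%E.
  rewrite indicE; case: (boolP (x \in D1)) => xD /=; last first.
    rewrite mul0r integral0_eq// => y _.
    by rewrite /g /= !indicE ?(negbTE xD)/= mul0r mulr0.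
  rewrite mul1r EFin_Rintegral//; last exact/i1/set_mem.
  rewrite [RHS]integral_mkcond; apply: eq_integral => y _.
  rewrite /g /= ?indicE ?xD patchE /= mul1r.
  by case: (y \in D2); rewrite ?mulr1 ?mulr0.
have F2 y : (\int[m1]_x g (x, y) =
    (\1_D2 y * \int[m1]_(x in D1) f x y)%:E)%E.
  rewrite indicE; case: (boolP (y \in D2)) => yD /=; last first.
    rewrite mul0r integral0_eq// => x _.
    by rewrite /g /= !indicE ?(negbTE yD)/= !mulr0.
  rewrite mul1r EFin_Rintegral//; last exact/i2/set_mem.
  rewrite [RHS]integral_mkcond; apply: eq_integral => x _.
  rewrite /g /= ?indicE ?yD patchE /= mulr1.
  by case: (x \in D1); rewrite ?mulr1 ?mulr0.
have iF1 : m1.-integrable setT (fun x => (\1_D1 x * \int[m2]_(y in D2) f x y)%:E).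
  have := integrable_fubini_F ig; rewrite /fubini_F.
  by under eq_fun do rewrite F1.
have iF2 : m2.-integrable setT (fun y => (\1_D2 y * \int[m1]_(x in D1) f x y)%:E).
  under eq_fun do rewrite -F2.
  apply/integrableP; split; first exact: (measurable_fubini_G ig).
  have h := (integrable21ltyP m1 m2 mg).1 ig.

  apply: le_lt_trans h; apply: ge0_le_integral => //.
  - by apply: measurableT_comp => //; exact: (measurable_fubini_G ig).
  - apply: (measurable_fun_fubini_tonelli_G (abse \o g)) => //=.
    exact: measurableT_comp.
  - by move=> y _; apply: le_abse_integral => //; exact: measurableT_comp.
have j1 : m1.-integrable D1 (fun x => (\int[m2]_(y in D2) f x y)%:E).
  have := integrableS measurableT mD1 (@subsetT _ _) iF1.
  apply: eq_integrable => // x /set_mem D1x.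
  by rewrite indicE mem_set// mul1r.
have j2 : m2.-integrable D2 (fun y => (\int[m1]_(x in D1) f x y)%:E).
  have := integrableS measurableT mD2 (@subsetT _ _) iF2.
  apply: eq_integrable => // x /set_mem D1x.
  by rewrite indicE mem_set// mul1r.
split => //.
apply: EFin_inj; rewrite !EFin_Rintegral//.
rewrite [LHS]integral_mkcond [RHS]integral_mkcond.
transitivity (\int[m1]_x \int[m2]_y g (x, y))%E.
  apply: eq_integral => x _; rewrite F1 patchE indicE.
  by case: (x \in D1); rewrite ?mul1r ?mul0r.
rewrite (Fubini ig); apply: eq_integral => x _; rewrite F2 patchE indicE.
by case: (x \in D2); rewrite ?mul1r ?mul0r.
Qed.

End fubini_tools.

(** * Translations and products for Lebesgue measure on column vectors *)

Section lebesgue_shift.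
Context (R : realType).
Local Notation mu := (@lebesgue_measure R).

(** The pushforward by a translation gives half-open intervals their length, and this characterises
    Lebesgue measure. *)
Lemma lebesgue_measure_shift (a : R) (A : set R) : measurable A ->
  mu ((fun x => x + a) @^-1` A) = mu A.
Proof.
move=> mA.
have mphi : measurable_fun [set: measurableTypeR R]
    ((fun x => x + a) : measurableTypeR R -> measurableTypeR R).
  by apply: measurable_funD.
pose m := measure_function_pushforward__canonical__measure_function_Measure
  mu mphi.
apply/esym.
apply: (@lebesgue_measure_unique R m) => // _ [[u v] _ <-] /=.
rewrite /m /pushforward /=.
have -> : (fun x => x + a) @^-1` `]u, v] = `](u - a), (v - a)]%classic.
  by apply/seteqP; split => x /=; rewrite !in_itv/= ltrBlDr lerBrDr.
transitivity (mu `]u, v]%classic) => //.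
rewrite lebesgue_measure_itv [RHS]lebesgue_measure_itv/= !lte_fin ltrD2r.
by case: ifPn => // _; rewrite -!EFinB; congr EFin; ring.
Qed.

Lemma ge0_integral_shift (a : R) (f : R -> \bar R) :
  measurable_fun setT f -> (forall x, 0 <= f x)%E ->
  (\int[mu]_x f (x + a)%R = \int[mu]_x f x)%E.
Proof.
move=> mf f0.
have mphi : measurable_fun [set: measurableTypeR R]
    ((fun x => x + a) : measurableTypeR R -> measurableTypeR R).
  by apply: measurable_funD.
rewrite -(@ge0_integral_pushforward _ _ _ _ _ _ mphi mu setT f)//.
apply: (@eq_measure_integral _ _ _ _ mu
  (measure_function_pushforward__canonical__measure_function_Measure mu mphi)).
by move=> A mA _; apply: lebesgue_measure_shift.
Qed.

End lebesgue_shift.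

Section lebesgue_vec_integrals.
Context (R : realType).
Local Notation mu := (@lebesgue_measure R).
Local Notation lv n := (lebesgue_vec R n).

Lemma measurable_vcons1 n (v : 'cV[R]_n) :
  measurable_fun setT (fun x : R => vcons (x, v)).
Proof. by apply: (measurableT_comp (@measurable_vcons R n)). Qed.

Lemma vcons0 n (x : R) (v : 'cV[R]_n) : vcons (x, v) ord0 0 = x.
Proof. by rewrite mxE unlift_none. Qed.

Lemma vconsS n (x : R) (v : 'cV[R]_n) j : vcons (x, v) (lift ord0 j) 0 = v j 0.
Proof. by rewrite mxE liftK. Qed.

Lemma vconsD n (x y : R) (v w : 'cV[R]_n) :
  vcons (x, v) + vcons (y, w) = vcons (x + y, v + w).
Proof. by apply/colP => i; rewrite !mxE /=; case: (unlift ord0 i) => [j|]; rewrite ?mxE. Qed.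

Lemma ge0_integral_vcons n (f : 'cV[R]_n.+1 -> \bar R) :
  measurable_fun setT f -> (forall v, 0 <= f v)%E ->
  (\int[lv n.+1]_v f v = \int[lv n]_w \int[mu]_x f (vcons (x, w)))%E.
Proof.
move=> mf f0.
rewrite (_ : (\int[lv n.+1]_v f v)%E =
  (\int[pushforward (mu \x lv n)%E (@vcons R n)]_v f v)%E)//.
rewrite ge0_integral_pushforward//; last exact: measurable_vcons.
rewrite preimage_setT fubini_tonelli2//.
- by apply: (measurableT_comp mf); exact: measurable_vcons.
- by move=> x; exact: f0.
Qed.

Lemma measurable_shiftv n (a : 'cV[R]_n) : measurable_fun setT (fun v : 'cV[R]_n => v + a).
Proof.
apply: measurable_fun_coordP => i j.
under eq_fun do rewrite mxE.
by apply: measurable_funD => //; exact: measurable_coord.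
Qed.

(** Induction on the dimension: Tonelli through [vcons] splits the translation into one of the first
    coordinate and one of the others. *)
Lemma ge0_integral_shiftv n (a : 'cV[R]_n) (f : 'cV[R]_n -> \bar R) :
  measurable_fun setT f -> (forall v, 0 <= f v)%E ->
  (\int[lv n]_v f (v + a)%R = \int[lv n]_v f v)%E.
Proof.
elim: n a f => [a f mf f0|n IH a f mf f0].
  by apply: eq_integral => v _; congr f; apply/colP => -[].
have mfa : measurable_fun setT (fun v : 'cV[R]_n.+1 => f (v + a)).
  by apply: (measurableT_comp mf); exact: measurable_shiftv.
rewrite (ge0_integral_vcons mfa (fun v => f0 (v + a))) (ge0_integral_vcons mf f0).
rewrite -[a]vunconsK; set y := (vuncons a).1; set b := (vuncons a).2.
rewrite [X in vcons X](_ : _ = (y, b)); last by rewrite /y /b; case: (vuncons a).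
transitivity (\int[lv n]_w \int[mu]_x f (vcons (x, (w + b)%R)))%E.
  apply: eq_integral => w _.
  rewrite -(@ge0_integral_shift _ y (fun x => f (vcons (x, w + b)))) //.
    by apply: eq_integral => x _; rewrite vconsD.
  by apply: (measurableT_comp mf); exact: measurable_vcons1.
rewrite (IH b (fun w => \int[mu]_x f (vcons (x, w)))%E)//.
  apply: (@measurable_fun_fubini_tonelli_G _ _ _ _ _ mu
    (fun p : measurableTypeR R * 'cV[R]_n => f (vcons p))) => //.
  by apply: (measurableT_comp mf); exact: measurable_vcons.
by move=> v; exact: integral_ge0.
Qed.

Lemma integral_shiftv n (a : 'cV[R]_n) (f : 'cV[R]_n -> \bar R) :
  measurable_fun setT f ->
  (\int[lv n]_v f (v + a)%R = \int[lv n]_v f v)%E.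
Proof.
move=> mf; rewrite integralE [RHS]integralE.
congr (_ - _)%E.
  by rewrite -[RHS](@ge0_integral_shiftv _ a _ (measurable_funepos mf) (funepos_ge0 f)); apply: eq_integral => v _; rewrite ?funeposE ?funenegE.
by rewrite -[RHS](@ge0_integral_shiftv _ a _ (measurable_funeneg mf) (funeneg_ge0 f)); apply: eq_integral => v _; rewrite ?funeposE ?funenegE.
Qed.

Lemma integrable_shiftv n (a : 'cV[R]_n) (f : 'cV[R]_n -> \bar R) :
  (lv n).-integrable setT f -> (lv n).-integrable setT (fun v => f (v + a)).
Proof.
move=> /integrableP[mf foo]; apply/integrableP; split.
  by apply: (measurableT_comp mf); exact: measurable_shiftv.
rewrite (@ge0_integral_shiftv _ a (abse \o f))//.
  exact: measurableT_comp.
by move=> v /=; exact: abse_ge0.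
Qed.

Lemma measurable_prod_coord n (f : 'I_n -> R -> R) :
  (forall i, measurable_fun setT (f i)) ->
  measurable_fun setT (fun v : 'cV[R]_n => \prod_i f i (v i 0)).
Proof.
move=> mf; apply: measurable_prod => i _.
by apply: (measurableT_comp (mf i)); exact: measurable_coord.
Qed.

Lemma ge0_integral_prod n (f : 'I_n -> R -> R) (F : 'I_n -> R) :
  (forall i, measurable_fun setT (f i)) -> (forall i x, 0 <= f i x) ->
  (forall i, \int[mu]_x (f i x)%:E = (F i)%:E)%E ->
  (\int[lv n]_v (\prod_i f i (v i 0%R))%:E = (\prod_i F i)%:E)%E.
Proof.
elim: n f F => [|n IH] f F mf f0 fF.
  rewrite big_ord0 /= integral_dirac//.
    by rewrite diracT big_ord0 mul1e.
  by apply/measurable_EFinP; exact: measurable_prod_coord.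
rewrite ge0_integral_vcons//; last 2 first.
  by apply/measurable_EFinP; exact: measurable_prod_coord.
  by move=> v; rewrite lee_fin prodr_ge0.
rewrite big_ord_recl EFinM -(IH (fun i => f (lift ord0 i)))//.
rewrite -fF -ge0_integralZl//; last 3 first.
  apply/measurable_EFinP.
  exact: (measurable_prod_coord (fun i => mf (lift ord0 i))).
  by move=> v _; rewrite lee_fin prodr_ge0.
  by apply: integral_ge0 => x _; rewrite lee_fin.
apply: eq_integral => w _.
under eq_integral do
  [rewrite big_ord_recl vcons0 EFinM; under eq_bigr do rewrite vconsS].
rewrite ge0_integralZr//; last 2 first.
  by move=> x _; rewrite lee_fin.
  by rewrite lee_fin prodr_ge0.
  have mf0 : measurable_fun [set: measurableTypeR R] (f ord0) := mf ord0.
  exact/measurable_EFinP.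
Qed.

End lebesgue_vec_integrals.

(** * Poisson kernels and Fourier inversion *)

Section poisson_kernel.
Context (R : realType).
Local Notation mu := (@lebesgue_measure R).

Lemma cvg0_norm_le (T : Type) (F : set_system T) (FF : Filter F) (f g : T -> R) :
  (forall x, `|f x| <= g x) -> g x @[x --> F] --> 0 -> f x @[x --> F] --> 0.
Proof.
move=> fg g0; apply: (@squeeze_cvgr _ _ _ _ (\- g) g) => //.
  by near=> x; rewrite -ler_norml.
by rewrite -oppr0; apply: cvgN.
Unshelve. all: by end_near. Qed.

Lemma cvgr_expRM (s : R) : 0 < s -> expR (- s * u) @[u --> +oo] --> 0.
Proof.
move=> s0.
have -> : (fun u => expR (- s * u)) = (fun u => expR (- u)) \o (fun u => u * s).
  by apply/funext => u /=; rewrite mulNr mulrC.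
apply: cvg_comp (@cvgr_expR R).
by apply: gt0_cvgMly => //; exact: cvg_id.
Qed.

(** The summand 1 keeps the integrand nonnegative, as the fundamental theorem on a half-line
    requires; the pure cosine integral is recovered later by subtraction. [F] is an explicit
    primitive that tends to 0 at infinity. *)
Lemma integral0y_expR_cos (s al x : R) : 0 < s ->
  (\int[mu]_(u in `[0%R, +oo[) (expR (- s * u) * (1 + cos (al + u * x)))%:E =
   (s^-1 + (s * cos al - x * sin al) / (s ^+ 2 + x ^+ 2))%:E)%E.
Proof.
move=> s0.
have D0 : s ^+ 2 + x ^+ 2 != 0.
  by rewrite gt_eqF// ltr_pwDl ?sqr_ge0// exprn_gt0.
pose F u := expR (- s * u) *
  (- s^-1 + (x * sin (al + u * x) - s * cos (al + u * x)) / (s ^+ 2 + x ^+ 2)).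
have dF (u : R) : is_derive u 1 F (expR (- s * u) * (1 + cos (al + u * x))).
  apply: is_derive_eq; rewrite /GRing.scale/=.
  by field; rewrite D0 gt_eqF.
have dF1 (u : R) : derivable F u 1 by [].
have cF u : {for u, continuous F}.
  by apply: differentiable_continuous; apply/derivable1_diffP.
have f0 (u : R) : 0 <= expR (- s * u) * (1 + cos (al + u * x)).
  by rewrite mulr_ge0 ?expR_ge0// -lerBlDl sub0r cos_geN1.
rewrite (@ge0_continuous_FTC2y _ _ F 0 0) //.
- rewrite -EFinB sub0r; congr EFin.
  by rewrite /F !(mulr0, mul0r) expR0 addr0; field; rewrite D0 gt_eqF.
- apply: continuous_subspaceT => u.
  apply: differentiable_continuous; apply/derivable1_diffP.
  by apply: ex_derive.
- pose C := s^-1 + (`|x| + s) / `|s ^+ 2 + x ^+ 2|.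
  apply: (@cvg0_norm_le _ _ _ _ (fun u => expR (- s * u) * C)); last first.
    rewrite -[X in _ --> X](mul0r C); apply: cvgMl.
    exact: cvgr_expRM.
  move=> u; rewrite normrM ger0_norm ?expR_ge0// ler_wpM2l ?expR_ge0//.
  rewrite (le_trans (ler_normD _ _))// normrN gtr0_norm ?invr_gt0// lerD2l.
  rewrite normrM normfV ler_wpM2r ?invr_ge0//.
  rewrite (le_trans (ler_normB _ _))// !normrM (gtr0_norm s0) lerD//.
    by rewrite ler_piMr// ler_norml sin_geN1 sin_le1.
  by rewrite (ler_piMr (ltW s0))// ler_norml cos_geN1 cos_le1.
- by apply: cvg_at_right_filter; exact: cF.
- by move=> u _; rewrite derive1E; exact: derive_val.
Qed.

Lemma measurable_expR_norm_cos (s al x : R) :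
  measurable_fun setT (fun u : R => expR (- s * `|u|) * cos (al + u * x)).
Proof.
apply: continuous_measurable_fun => u; apply: cvgM.
  apply: continuous_comp; last exact: continuous_expR.
  by apply: cvgM; [exact: cvg_cst|exact: norm_continuous].
apply: continuous_comp; last exact: continuous_cos.
by apply: cvgD; [exact: cvg_cst|apply: cvgM; [exact: cvg_id|exact: cvg_cst]].
Qed.

Lemma measurable_expR_norm (s : R) :
  measurable_fun setT (fun u : R => expR (- s * `|u|)).
Proof.
have := @measurable_expR_norm_cos s 0 0.
by under eq_fun do rewrite mulr0 addr0 cos0 mulr1.
Qed.

Lemma integralT_expR_cos1 (s al x : R) : 0 < s ->
  (\int[mu]_u (expR (- s * `|u|) * (1 + cos (al + u * x)))%:E =
   (2 / s + 2 * s * cos al / (s ^+ 2 + x ^+ 2))%:E)%E.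
Proof.
move=> s0.
have D0 : s ^+ 2 + x ^+ 2 != 0.
  by rewrite gt_eqF// ltr_pwDl ?sqr_ge0// exprn_gt0.
have mf : measurable_fun setT
    (fun u : measurableTypeR R => (expR (- s * `|u|) * (1 + cos (al + u * x)))%:E).
  apply/measurable_EFinP; under eq_fun do rewrite mulrDr mulr1.
  by apply: measurable_funD; [exact: measurable_expR_norm|exact: measurable_expR_norm_cos].
have f0 (u : R) : (0 <= (expR (- s * `|u|) * (1 + cos (al + u * x)))%:E)%E.
  by rewrite lee_fin mulr_ge0 ?expR_ge0// -lerBlDl sub0r cos_geN1.
rewrite -(setUv `[0%R, +oo[%classic) ge0_integral_setU//=; last 2 first.
  by rewrite setUv.
  exact/disj_setPCl.
rewrite setCitvr.
under [X in (X + _)%E]eq_integral.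
  move=> u; rewrite inE/= in_itv/= andbT => u0; rewrite (ger0_norm u0).
  over.
rewrite integral0y_expR_cos//.
rewrite integral_itv_bndo_bndc; last exact: measurable_funS mf.
rewrite -{1}oppr0 ge0_integration_by_substitutionNy//; last first.
  apply: continuous_subspaceT => u; apply: cvgM.
    apply: continuous_comp; last exact: continuous_expR.
    by apply: cvgM; [exact: cvg_cst|exact: norm_continuous].
  apply: cvgD; first exact: cvg_cst.
  apply: continuous_comp; last exact: continuous_cos.
  by apply: cvgD; [exact: cvg_cst|apply: cvgM; [exact: cvg_id|exact: cvg_cst]].
under [X in (_ + X)%E]eq_integral.
  move=> u; rewrite inE/= in_itv/= andbT => u0.
  rewrite /= normrN (ger0_norm u0) (mulNr u x) -(mulrN u x).
  over.
rewrite integral0y_expR_cos// -EFinD; congr EFin.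
  by rewrite sqrrN; field; rewrite D0 gt_eqF.
by rewrite setCitvr; exact: measurable_itv.
Qed.

Lemma integral_cauchy_itv (s a b x : R) : 0 < s -> a < b ->
  (\int[mu]_(y in `[a, b]) (2 * s / (s ^+ 2 + (x - y) ^+ 2))%:E =
  (2 * (atan ((b - x) / s) - atan ((a - x) / s)))%:E)%E.
Proof.
move=> s0 ab.
have D0 (u : R) : s ^+ 2 + (x - u) ^+ 2 != 0.
  by rewrite gt_eqF// ltr_pwDl ?sqr_ge0// exprn_gt0.
pose F u := 2 * atan ((u - x) / s).
have D1 u : 1 + ((u - x) / s) ^+ 2 != 0.
  by rewrite gt_eqF// ltr_pwDl ?sqr_ge0.
have dF (u : R) : is_derive u 1 F (2 * s / (s ^+ 2 + (x - u) ^+ 2)).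
  apply: is_derive_eq.
  rewrite /GRing.scale/=; move: (D1 u) (D0 u) => d1 d2.
  have -> : 1 + ((u - x) / s) ^+ 2 = (s ^+ 2 + (x - u) ^+ 2) / s ^+ 2.
    by field; rewrite gt_eqF.
  by field; rewrite d2 gt_eqF.
have cF u : {for u, continuous F}.
  by apply: differentiable_continuous; apply/derivable1_diffP.
rewrite (@continuous_FTC2 _ _ F _ _ ab) //.
- by rewrite -EFinB /F -mulrBr.
- apply: continuous_subspaceT => u; apply: cvgM; first exact: cvg_cst.
  apply: cvgV => //; apply: cvgD; first exact: cvg_cst.
  exact: (cvgM (cvgB (cvg_cst _) cvg_id) (cvgB (cvg_cst _) cvg_id)).
- split => //.
  + by apply: cvg_at_right_filter; exact: cF.
  + by apply: cvg_at_left_filter; exact: cF.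
- by move=> u _; rewrite derive1E; exact: derive_val.
Qed.

End poisson_kernel.

Section dotv_theory.
Context (R : realType) (n : nat).
Implicit Types u v w : 'cV[R]_n.

Lemma dotvE u v : dotv u v = (u^T *m v) 0 0.
Proof. by rewrite mxE; apply: eq_bigr => i _; rewrite mxE. Qed.

Lemma dotvC u v : dotv u v = dotv v u.
Proof. by apply: eq_bigr => i _; rewrite mulrC. Qed.

Lemma dotvDl u v w : dotv (u + v) w = dotv u w + dotv v w.
Proof. by rewrite !dotvE linearD /= mulmxDl mxE. Qed.

Lemma dotvDr u v w : dotv w (u + v) = dotv w u + dotv w v.
Proof. by rewrite dotvC dotvDl !(dotvC _ w). Qed.

Lemma dotvNl u w : dotv (- u) w = - dotv u w.
Proof. by rewrite !dotvE linearN /= mulNmx mxE. Qed.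

Lemma dotvNr u w : dotv w (- u) = - dotv w u.
Proof. by rewrite dotvC dotvNl dotvC. Qed.

Lemma dotvBr u v w : dotv w (u - v) = dotv w u - dotv w v.
Proof. by rewrite dotvDr dotvNr. Qed.

Lemma dotvZl a u w : dotv (a *: u) w = a * dotv u w.
Proof. by rewrite !dotvE linearZ /= -scalemxAl mxE. Qed.

Lemma dotv0l w : dotv 0 w = 0.
Proof. by rewrite -(scale0r 0) dotvZl mul0r. Qed.

Lemma dotv0r w : dotv w 0 = 0.
Proof. by rewrite dotvC dotv0l. Qed.

Lemma dotv_delta j w : dotv (delta_mx j 0) w = w j 0.
Proof.
rewrite /dotv (bigD1 j)//= mxE !eqxx mul1r big1 ?addr0// => i ij.
by rewrite mxE (negbTE ij) mul0r.
Qed.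

Lemma normr_dotv u v : `|dotv u v| <= \sum_i `|u i 0| * `|v i 0|.
Proof.
by rewrite (le_trans (ler_norm_sum _ _ _))// ler_sum// => i _; rewrite normrM.
Qed.

Lemma enorm_ge0 v : 0 <= enorm v.
Proof. exact: sqrtr_ge0. Qed.

Lemma coord_le_enorm v i : `|v i 0| <= enorm v.
Proof.
rewrite -sqrtr_sqr ler_wsqrtr// expr2 /dotv (bigD1 i)//= lerDl.
by apply: sumr_ge0 => j _; rewrite -expr2 sqr_ge0.
Qed.

Lemma enorm_le_sum v : enorm v <= \sum_i `|v i 0|.
Proof.
have s0 : 0 <= \sum_i `|v i 0| by apply: sumr_ge0.
rewrite -[leRHS]ger0_norm// -sqrtr_sqr ler_wsqrtr// expr2 mulr_suml.
apply: ler_sum => i _; rewrite -expr2 -real_normK ?num_real// expr2.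
by rewrite ler_wpM2l// (bigD1 i)//= lerDl sumr_ge0.
Qed.

Lemma normr_dotv_enorm u v : `|dotv u v| <= enorm u * \sum_i `|v i 0|.
Proof.
rewrite (le_trans (normr_dotv _ _))// mulr_sumr ler_sum// => i _.
by rewrite ler_wpM2r// coord_le_enorm.
Qed.

Lemma measurable_dotv d (T : measurableType d) (f g : T -> 'cV[R]_n) :
  measurable_fun setT f -> measurable_fun setT g ->
  measurable_fun setT (fun x => dotv (f x) (g x)).
Proof.
move=> mf mg; apply: measurable_sum => i; apply: measurable_funM.
  exact: (measurableT_comp (@measurable_coord R n 1 i 0) mf).
exact: (measurableT_comp (@measurable_coord R n 1 i 0) mg).
Qed.

Lemma measurable_enorm : measurable_fun setT (@enorm R n).
Proof.
apply: (measurableT_comp (continuous_measurable_fun (@sqrt_continuous R))).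
exact: measurable_dotv.
Qed.

End dotv_theory.

Lemma dotv_vcons (R : realType) n (x : R) (w : 'cV[R]_n) (y : 'cV[R]_n.+1) :
  dotv (vcons (x, w)) y = x * (vuncons y).1 + dotv w (vuncons y).2.
Proof.
rewrite /dotv big_ord_recl vcons0; congr (_ + _).
by apply: eq_bigr => i _; rewrite vconsS mxE.
Qed.

Lemma dotv_mulmxl (R : realType) m n (M : 'M[R]_(m, n)) (u : 'cV[R]_m) (v : 'cV[R]_n) :
  dotv (M^T *m u) v = dotv u (M *m v).
Proof. by rewrite !dotvE trmx_mul trmxK mulmxA. Qed.

Section measurable_parameter.
Context d1 d2 (T1 : measurableType d1) (T2 : measurableType d2) (R : realType).
Variables (m2 : {sigma_finite_measure set T2 -> \bar R}).

Lemma measurable_Rintegral_param (D : set T2) (f : T1 -> T2 -> R) :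
  measurable D -> measurable_fun setT (fun z : T1 * T2 => f z.1 z.2) ->
  (forall x, m2.-integrable D (EFin \o f x)) ->
  measurable_fun setT (fun x => \int[m2]_(y in D) f x y).
Proof.
move=> mD mf fi.
pose g (z : T1 * T2) := (f z.1 z.2 * \1_D z.2)%:E.
have mg : measurable_fun setT g.
  apply/measurable_EFinP; apply: measurable_funM => //.
  exact: (measurableT_comp (measurable_indic mD)).
apply/measurable_EFinP.
have -> : EFin \o (fun x => \int[m2]_(y in D) f x y) =
  (fun x => \int[m2]_y g^\+ (x, y) - \int[m2]_y g^\- (x, y))%E.
  apply/funext => x /=; rewrite EFin_Rintegral// integral_mkcond integralE.
  congr (_ - _)%E; apply: eq_integral => y _.
    rewrite !funeposE patchE /g indicE /=.
    by case: (y \in D); rewrite ?mulr1 ?mulr0.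
  rewrite !funenegE patchE /g indicE /=.
  by case: (y \in D); rewrite ?mulr1 ?mulr0.
apply: emeasurable_funB.
  apply: measurable_fun_fubini_tonelli_F => //; exact: measurable_funepos.
apply: measurable_fun_fubini_tonelli_F => //; exact: measurable_funeneg.
Qed.

End measurable_parameter.

(** * Integration against a measure with a density *)

Section density.
Context d (T : measurableType d) (R : realType).
Variables (mu nu : {measure set T -> \bar R}) (p : T -> R).
Hypotheses (mp : measurable_fun setT p) (p0 : forall x, 0 <= p x).
Hypothesis nuE : forall E, measurable E -> nu E = (\int[mu]_(x in E) (p x)%:E)%E.
Import HBNNSimple.

Lemma integral_nnsfun_density (h : {nnsfun T >-> R}) :
  (\int[nu]_x (h x)%:E = \int[mu]_x (h x * p x)%:E)%E.
Proof.
transitivity (\int[nu]_x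
    (\sum_(y \in range h) (y * \1_(h @^-1` [set y]) x)%:E))%E.
  apply: eq_integral => x _.
  by rewrite fsumEFin// -fimfunE.
transitivity (\int[mu]_x
    (\sum_(y \in range h) (y * \1_(h @^-1` [set y]) x * p x)%:E))%E; last first.
  apply: eq_integral => x _.
  by rewrite fsumEFin// -mulr_fsuml// -fimfunE.
rewrite ge0_integral_fsum//; last 2 first.
  by move=> y; apply/measurable_EFinP; exact: measurable_funM.
  by move=> y x _; rewrite EFinM nnfun_muleindic_ge0.
rewrite ge0_integral_fsum//; last 2 first.
  move=> y; apply/measurable_EFinP; apply: measurable_funM => //.
  exact: measurable_funM.
  move=> y x _; rewrite EFinM mule_ge0 ?lee_fin// -lee_fin.
  by rewrite EFinM nnfun_muleindic_ge0.
apply: eq_fsbigr => y /[!inE] -[x _ <-].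
under [LHS]eq_integral do rewrite EFinM.
rewrite ge0_integralZl//; last 2 first.
- exact/measurable_EFinP.
- by rewrite lee_fin.
rewrite integral_indic// setIT nuE//.
under [RHS]eq_integral do rewrite -mulrA EFinM.
rewrite ge0_integralZl//; last 3 first.
- by apply/measurable_EFinP; exact: measurable_funM.
- by move=> z _; rewrite lee_fin mulr_ge0.
- by rewrite lee_fin.
congr (_ * _)%E; rewrite integral_mkcond; apply: eq_integral => z _.
by rewrite patchE indicE; case: (z \in _); rewrite ?mul1r ?mul0r.
Qed.

Lemma ge0_integral_density (f : T -> \bar R) :
  measurable_fun setT f -> (forall x, 0 <= f x)%E ->
  (\int[nu]_x f x = \int[mu]_x (f x * (p x)%:E))%E.
Proof.
move=> mf f0.
pose h := nnsfun_approx measurableT mf.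
have hf x : limn (fun k => (h k x)%:E) = f x.
  by apply/cvg_lim => //; exact: cvg_nnsfun_approx.
have nd x : {homo (fun k => (h k x)%:E) : k l / (k <= l)%N >-> (k <= l)%E}.
  by move=> k l kl; rewrite lee_fin; exact/lefP/nd_nnsfun_approx.
have mh k : measurable_fun setT (fun x => (h k x)%:E) by exact/measurable_EFinP.
transitivity (limn (fun k => \int[nu]_x (h k x)%:E)%E).
  rewrite -monotone_convergence//; first exact: eq_integral.
  by move=> k x _; rewrite lee_fin.
transitivity (limn (fun k => \int[mu]_x (h k x * p x)%:E)%E).
  by congr (limn _); apply/funext => k; exact: integral_nnsfun_density.
rewrite -monotone_convergence//.
- apply: eq_integral => x _; apply/cvg_lim => //.
  under eq_fun do rewrite EFinM.
  apply: cvgeZr => //; exact: (cvg_nnsfun_approx measurableT mf (fun z _ => f0 z)).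
- by move=> k; apply/measurable_EFinP; exact: measurable_funM.
- by move=> k x _; rewrite lee_fin mulr_ge0.
- by move=> x _ k l kl; rewrite lee_fin ler_wpM2r// -lee_fin; exact: nd.
Qed.

End density.

(** * Complex-valued functions *)

Notation cmod := ComplexField.Normc.normc.

Section complex_tools.
Context (R : realType).
Implicit Types (z w : R[i]) (t : R).

Definition cis t : R[i] := cos t +i* sin t.

Lemma cReM z w : complex.Re (z * w) =
  complex.Re z * complex.Re w - complex.Im z * complex.Im w.
Proof. by case: z; case: w. Qed.

Lemma cImM z w : complex.Im (z * w) =
  complex.Re z * complex.Im w + complex.Im z * complex.Re w.
Proof. by case: z; case: w. Qed.

Lemma cReD z w : complex.Re (z + w) = complex.Re z + complex.Re w.
Proof. by case: z; case: w. Qed.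

Lemma cImD z w : complex.Im (z + w) = complex.Im z + complex.Im w.
Proof. by case: z; case: w. Qed.

Lemma cReN z : complex.Re (- z) = - complex.Re z.
Proof. by case: z. Qed.

Lemma cImN z : complex.Im (- z) = - complex.Im z.
Proof. by case: z. Qed.

Definition ReImE := (cReM, cImM, cReD, cImD, cReN, cImN).

Lemma eqC z w : complex.Re z = complex.Re w -> complex.Im z = complex.Im w ->
  z = w.
Proof. by case: z => a b; case: w => c d /= -> ->. Qed.

Lemma cisD t u : cis (t + u) = cis t * cis u.
Proof. by apply: eqC; rewrite ReImE /= ?cosD ?sinD; ring. Qed.

Lemma cis0 : cis 0 = 1.
Proof. by apply: eqC; rewrite /= ?cos0 ?sin0. Qed.

Lemma cmodM z w : cmod (z * w) = cmod z * cmod w.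
Proof. exact: ComplexField.Normc.normcM. Qed.

Lemma cmodD z w : cmod (z + w) <= cmod z + cmod w.
Proof. exact: le_normcD. Qed.

Lemma cmodN z : cmod (- z) = cmod z.
Proof. exact: normcN. Qed.

Lemma cmodB z w : cmod (z - w) <= cmod z + cmod w.
Proof. by rewrite -(cmodN w) cmodD. Qed.

Lemma cmod_ge0 z : 0 <= cmod z.
Proof. by case: z => a b; exact: sqrtr_ge0. Qed.

Lemma cmodX z k : cmod (z ^+ k) = cmod z ^+ k.
Proof.
elim: k => [|k IH]; first by rewrite !expr0 ComplexField.Normc.normc1.
by rewrite !exprS cmodM IH.
Qed.

Lemma cmod_cis t : cmod (cis t) = 1.
Proof. by rewrite /= cos2Dsin2 sqrtr1. Qed.

Lemma normr_Re_cmod z : `|complex.Re z| <= cmod z.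
Proof. by case: z => a b /=; rewrite -sqrtr_sqr ler_wsqrtr// lerDl sqr_ge0. Qed.

Lemma cmod_le_ReIm z : cmod z <= `|complex.Re z| + `|complex.Im z|.
Proof.
case: z => a b /=; rewrite -[leRHS]ger0_norm ?addr_ge0// -sqrtr_sqr.
rewrite ler_wsqrtr// sqrrD !real_normK ?num_real// -addrA lerD2l lerDr.
by rewrite mulrn_wge0// mulr_ge0.
Qed.

Lemma cmod_real t : cmod t%:C = `|t|.
Proof. by rewrite /= expr0n/= addr0 sqrtr_sqr. Qed.

Lemma cmodi : cmod ('i%C : R[i]) = 1.
Proof. by rewrite /= expr0n/= expr1n add0r sqrtr1. Qed.

Lemma cexpE z : cexp z = (expR (complex.Re z))%:C * cis (complex.Im z).
Proof. by []. Qed.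

Lemma cexpD z w : cexp (z + w) = cexp z * cexp w.
Proof.
rewrite !cexpE !ReImE expRD cisD; apply: eqC; rewrite !ReImE/=; ring.
Qed.

Lemma cexp0 : cexp (0 : R[i]) = 1.
Proof. by rewrite cexpE /= expR0 cis0 mulr1. Qed.

Lemma cmod_cexp z : cmod (cexp z) = expR (complex.Re z).
Proof. by rewrite cexpE cmodM cmod_cis mulr1 cmod_real ger0_norm ?expR_ge0. Qed.

Lemma cexpMn z k : cexp (k%:R * z) = cexp z ^+ k.
Proof.
elim: k => [|k IH]; first by rewrite mul0r cexp0 expr0.
by rewrite exprS -IH -cexpD; congr cexp; rewrite -natr1 mulrDl mul1r addrC.
Qed.

Definition cmeasurable d (T : measurableType d) (f : T -> R[i]) :=
  measurable_fun setT (fun x => complex.Re (f x)) /\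
  measurable_fun setT (fun x => complex.Im (f x)).

Lemma cmeasurableM d (T : measurableType d) (f g : T -> R[i]) :
  cmeasurable f -> cmeasurable g -> cmeasurable (fun x => f x * g x).
Proof.
move=> [mf1 mf2] [mg1 mg2]; split.
  by under eq_fun do rewrite cReM; apply: measurable_funB; exact: measurable_funM.
by under eq_fun do rewrite cImM; apply: measurable_funD; exact: measurable_funM.
Qed.

Lemma cmeasurableD d (T : measurableType d) (f g : T -> R[i]) :
  cmeasurable f -> cmeasurable g -> cmeasurable (fun x => f x + g x).
Proof.
move=> [mf1 mf2] [mg1 mg2]; split.
  by under eq_fun do rewrite cReD; exact: measurable_funD.
by under eq_fun do rewrite cImD; exact: measurable_funD.
Qed.

Lemma cmeasurableN d (T : measurableType d) (f : T -> R[i]) :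
  cmeasurable f -> cmeasurable (fun x => - f x).
Proof.
move=> [mf1 mf2]; split.
  by under eq_fun do rewrite cReN; exact: measurable_funN.
by under eq_fun do rewrite cImN; exact: measurable_funN.
Qed.

Lemma cmeasurableB d (T : measurableType d) (f g : T -> R[i]) :
  cmeasurable f -> cmeasurable g -> cmeasurable (fun x => f x - g x).
Proof. by move=> mf mg; apply: cmeasurableD => //; exact: cmeasurableN. Qed.

Lemma cmeasurable_cst d (T : measurableType d) z : cmeasurable (fun _ : T => z).
Proof. by split; exact: measurable_cst. Qed.

Lemma cmeasurable_cis d (T : measurableType d) (f : T -> R) :
  measurable_fun setT f -> cmeasurable (fun x => cis (f x)).
Proof.
move=> mf; split; apply: measurableT_comp mf => //;
  apply: continuous_measurable_fun; [exact: continuous_cos|exact: continuous_sin].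
Qed.

Lemma cmeasurable_cexp d (T : measurableType d) (f : T -> R[i]) :
  cmeasurable f -> cmeasurable (fun x => cexp (f x)).
Proof.
move=> [mf1 mf2]; under [X in cmeasurable X]eq_fun do rewrite cexpE.
apply: cmeasurableM; last exact: cmeasurable_cis.
split; last exact: measurable_cst.
by apply: (measurableT_comp _ mf1); apply: continuous_measurable_fun; exact: continuous_expR.
Qed.

Lemma cmeasurable_comp d d' (T : measurableType d) (T' : measurableType d')
    (f : T' -> R[i]) (h : T -> T') :
  cmeasurable f -> measurable_fun setT h -> cmeasurable (fun x => f (h x)).
Proof.
move=> [mf1 mf2] mh; split.
  exact: (measurableT_comp mf1 mh).
exact: (measurableT_comp mf2 mh).
Qed.

Lemma measurable_cmod d (T : measurableType d) (f : T -> R[i]) :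
  cmeasurable f -> measurable_fun setT (fun x => cmod (f x)).
Proof.
move=> [mf1 mf2].
have -> : (fun x => cmod (f x)) = (fun x =>
    Num.sqrt (complex.Re (f x) ^+ 2 + complex.Im (f x) ^+ 2)).
  by apply/funext => x; case: (f x).
apply: (measurableT_comp (continuous_measurable_fun (@sqrt_continuous R))).
by apply: measurable_funD; exact: measurable_funX.
Qed.

End complex_tools.

Section product_poisson_kernel.
Context (R : realType).
Local Notation mu := (@lebesgue_measure R).
Local Notation lv n := (lebesgue_vec R n).

(** The primitive of the Fourier transform of this damping factor is an arctangent, which makes the
    limit as s tends to 0 explicit on boxes. *)
Definition laplace_weight (s : R) n (xi : 'cV[R]_n) : R :=
  \prod_i expR (- s * `|xi i 0|).

(** Fourier transform of [laplace_weight s]. It is not normalised: each factor has total mass 2 pi,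
    the source of the constant (2 pi)^n below. *)
Definition poisson_kernel (s : R) n (x : 'cV[R]_n) : R :=
  \prod_i (2 * s / (s ^+ 2 + x i 0 ^+ 2)).

Lemma laplace_weight_ge0 s n (xi : 'cV[R]_n) : 0 <= laplace_weight s xi.
Proof. by apply: prodr_ge0 => i _; exact: expR_ge0. Qed.

Lemma laplace_weight_le1 s n (xi : 'cV[R]_n) : 0 <= s -> laplace_weight s xi <= 1.
Proof.
move=> s0; apply: prodr_ile1 => i _; rewrite expR_ge0/= expR_le1.
by rewrite mulNr oppr_le0 mulr_ge0.
Qed.

Lemma measurable_laplace_weight s n :
  measurable_fun setT (@laplace_weight s n).
Proof.
apply: (@measurable_prod_coord R n (fun _ x => expR (- s * `|x|))) => i.
exact: measurable_expR_norm.
Qed.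

Lemma measurable_cos : measurable_fun setT (@cos R).
Proof. exact: (continuous_measurable_fun (@continuous_cos R)). Qed.

Lemma integral_laplace_weight s n : 0 < s ->
  (\int[lv n]_xi (laplace_weight s xi)%:E = ((2 / s) ^+ n)%:E)%E.
Proof.
move=> s0; rewrite (@ge0_integral_prod R n (fun _ x => expR (- s * `|x|))
    (fun=> 2 / s)).
- by rewrite prodr_const card_ord.
- by move=> i; exact: measurable_expR_norm.
- by move=> i x; exact: expR_ge0.
(* The phase pi / 2 kills the cosine term of the one-dimensional formula. *)
- move=> i; have := @integralT_expR_cos1 R s (pi / 2) 0 s0.
  rewrite cos_pihalf mulr0 mul0r addr0 => <-; apply: eq_integral => u _.
  by rewrite mulr0 addr0 cos_pihalf addr0 mulr1.
Qed.

(** Integrating out the first coordinate leaves [2 / s + kap * cos], rewritten as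
    [(2 / s - kap) + kap * (1 + cos)]. Both terms are nonnegative since [kap <= 2 / s], and the
    second has the form of the induction hypothesis; the arbitrary phase absorbs the other
    coordinates during the one-dimensional integration. *)
Lemma integral_laplace_weight_cos1 s n al (x : 'cV[R]_n) : 0 < s ->
  (\int[lv n]_xi (laplace_weight s xi * (1 + cos (al + dotv xi x)))%:E =
   ((2 / s) ^+ n + cos al * poisson_kernel s x)%:E)%E.
Proof.
move=> s0; elim: n al x => [|n IH] al x.
  rewrite /= integral_dirac//; last first.
    apply/measurable_EFinP; apply: measurable_funM.
      exact: measurable_laplace_weight.
    apply: measurable_funD => //; apply: (measurableT_comp measurable_cos).
    by apply: measurable_funD => //; exact: measurable_dotv.
  rewrite diracT mul1e; congr EFin.
  by rewrite /laplace_weight /poisson_kernel /dotv !big_ord0 expr0 addr0 mul1r mulr1.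
pose x0 := (vuncons x).1; pose x' := (vuncons x).2.
pose kap := 2 * s / (s ^+ 2 + x0 ^+ 2).
have kap0 : 0 <= kap.
  by rewrite divr_ge0 ?mulr_ge0 ?(ltW s0)// addr_ge0 ?sqr_ge0.
have kapl : kap <= 2 / s.
  rewrite /kap -mulrA ler_pM2l// ler_pdivrMr ?ltr_pwDl ?sqr_ge0 ?exprn_gt0//.
  rewrite mulrDr expr2 mulrA mulVf ?mul1r ?gt_eqF// lerDl.
  by rewrite mulr_ge0 ?sqr_ge0// invr_ge0 ltW.
have c1 (t : R) : 0 <= 1 + cos t by rewrite -lerBlDl sub0r cos_geN1.
have m1 (m : nat) (be : R) (y : 'cV[R]_m) : measurable_fun setT
    (fun xi => laplace_weight s xi * (1 + cos (be + dotv xi y))).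
  apply: measurable_funM; first exact: measurable_laplace_weight.
  apply: measurable_funD => //; apply: (measurableT_comp measurable_cos).
  by apply: measurable_funD => //; exact: measurable_dotv.
have p1 (m : nat) (be : R) (xi y : 'cV[R]_m) :
    0 <= laplace_weight s xi * (1 + cos (be + dotv xi y)).
  by rewrite mulr_ge0 ?laplace_weight_ge0.
rewrite ge0_integral_vcons; last 2 first.
  by apply/measurable_EFinP; exact: m1.
  by move=> v; rewrite lee_fin mulr_ge0 ?laplace_weight_ge0.
transitivity (\int[lv n]_w (((2 / s - kap) * laplace_weight s w)%:E +
   (kap * (laplace_weight s w * (1 + cos (al + dotv w x'))))%:E)%E)%E.
  apply: eq_integral => w _.
  under eq_integral do rewrite /laplace_weight big_ord_recl vcons0 dotv_vcons.
  transitivity (\int[mu]_u ((laplace_weight s w)%:E *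
    (expR (- s * `|u|) * (1 + cos ((al + dotv w x') + u * x0)))%:E)%E)%E.
    apply: eq_integral => u _; rewrite -EFinM; congr EFin.
    rewrite [X in _ * X * _](_ : _ = laplace_weight s w); last first.
      by apply: eq_bigr => i _; rewrite vconsS.
    by rewrite -/x0 -/x' mulrCA mulrA (addrC (u * x0)) addrA.
  rewrite ge0_integralZl//; last 2 first.
  - apply/measurable_EFinP; apply: measurable_funM; first exact: measurable_expR_norm.
    apply: measurable_funD => //; apply: (measurableT_comp measurable_cos).
    by apply: measurable_funD => //; exact: measurable_funM.
  - by rewrite lee_fin laplace_weight_ge0.
  rewrite integralT_expR_cos1// -EFinM -EFinD; congr EFin.
  by rewrite /kap; ring.
rewrite ge0_integralD//; last 4 first.
- by move=> w _; rewrite lee_fin mulr_ge0 ?laplace_weight_ge0 ?subr_ge0.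
- apply/measurable_EFinP; apply: measurable_funM => //.
  exact: measurable_laplace_weight.
- by move=> w _; rewrite lee_fin (mulr_ge0 kap0)// p1.
- by apply/measurable_EFinP; apply: measurable_funM.
under eq_integral do rewrite EFinM.
under [X in (_ + X)%E]eq_integral do rewrite EFinM.
rewrite ge0_integralZl//; last 3 first.
- by apply/measurable_EFinP; exact: measurable_laplace_weight.
- by move=> w _; rewrite lee_fin laplace_weight_ge0.
- by rewrite lee_fin subr_ge0.
rewrite ge0_integralZl//; last 2 first.
- by apply/measurable_EFinP; exact: m1.
- by move=> w _; rewrite lee_fin p1.
rewrite IH integral_laplace_weight// -!EFinM -EFinD; congr EFin.
have -> : poisson_kernel s x = kap * poisson_kernel s x'.
  rewrite /poisson_kernel big_ord_recl; congr (_ * _).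
  by apply: eq_bigr => i _; rewrite mxE.
by rewrite exprS; ring.
Qed.

Lemma integrable_laplace_weight s n : 0 < s ->
  (lv n).-integrable setT (EFin \o (@laplace_weight s n)).
Proof.
move=> s0; apply: ge0_integrable_lty => //.
- exact: measurable_laplace_weight.
- by move=> xi _; exact: laplace_weight_ge0.
- by rewrite integral_laplace_weight// ltry.
Qed.

Lemma measurable_laplace_weight_cos s n al (x : 'cV[R]_n) :
  measurable_fun setT (fun xi => laplace_weight s xi * cos (al + dotv xi x)).
Proof.
apply: measurable_funM; first exact: measurable_laplace_weight.
apply: (measurableT_comp measurable_cos).
by apply: measurable_funD => //; exact: measurable_dotv.
Qed.

Lemma integrable_laplace_weight_cos s n al (x : 'cV[R]_n) : 0 < s ->
  (lv n).-integrable setT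
    (EFin \o (fun xi => laplace_weight s xi * cos (al + dotv xi x))).
Proof.
move=> s0; apply: (integrable_le_norm _ _ _ (integrable_laplace_weight n s0)) => //.
  exact: measurable_laplace_weight_cos.
move=> u _; rewrite normrM ger0_norm ?laplace_weight_ge0//.
by rewrite ler_piMr ?laplace_weight_ge0// ler_norml cos_geN1 cos_le1.
Qed.

Lemma Rintegral_laplace_weight_cos s n al (x : 'cV[R]_n) : 0 < s ->
  \int[lv n]_xi (laplace_weight s xi * cos (al + dotv xi x)) =
  cos al * poisson_kernel s x.
Proof.
move=> s0; have h := @integral_laplace_weight_cos1 s n al x s0.
have : \int[lv n]_xi (laplace_weight s xi +
    laplace_weight s xi * cos (al + dotv xi x)) =
    (2 / s) ^+ n + cos al * poisson_kernel s x.
  rewrite -[RHS]/(fine _%:E) -h /Rintegral; congr fine.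
  by apply: eq_integral => u _; rewrite mulrDr mulr1.
rewrite RintegralD//; [|exact: integrable_laplace_weight|exact: integrable_laplace_weight_cos].
have -> : \int[lv n]_xi laplace_weight s xi = (2 / s) ^+ n.
  by rewrite /Rintegral integral_laplace_weight.
by move=> /addrI.
Qed.

End product_poisson_kernel.

Section density_measure.
Context d (T : measurableType d) (R : realType).
Variables (mu : {measure set T -> \bar R}) (p : T -> R).
Hypotheses (mp : measurable_fun setT p) (p0 : forall x, 0 <= p x).

Let dens (E : set T) : \bar R := (\int[mu]_(x in E) (p x)%:E)%E.

Let dens0 : dens set0 = 0%E.
Proof. by rewrite /dens integral_set0. Qed.

Let dens_ge0 E : (0 <= dens E)%E.
Proof. by apply: integral_ge0 => x _; rewrite lee_fin. Qed.

Let dens_sigma_additive : semi_sigma_additive dens.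
Proof.
move=> /= F mF tF mUF; rewrite /dens; apply: cvg_toP.
  apply: ereal_nondecreasing_is_cvgn => m k mk.
  apply: lee_sum_nneg_natr => // i _ _; apply: integral_ge0 => /= x _.
  by rewrite lee_fin.
rewrite ge0_integral_bigcup//=.
- by apply/measurable_EFinP; exact: measurable_funTS.
- by move=> x _; rewrite lee_fin.
Qed.

Definition density_measure : {measure set T -> \bar R} :=
  HB.pack dens (isMeasure.Build d T R dens dens0 dens_ge0 dens_sigma_additive).

Lemma density_measureE E : density_measure E = (\int[mu]_(x in E) (p x)%:E)%E.
Proof. by []. Qed.

End density_measure.

Section fourier.
Context (R : realType) (n : nat).
Local Notation lv := (lebesgue_vec R n).
Implicit Types f g : 'cV[R]_n -> R[i].

Definition cintegrable f :=
  cmeasurable f /\ lv.-integrable setT (EFin \o (fun xi => cmod (f xi))).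

(* Real part of the Fourier integral of [f]; every density occurring below is
   real, and the imaginary part is [fourier (- 'i * f)]. *)
Definition fourier f (y : 'cV[R]_n) : R :=
  \int[lv]_xi complex.Re (cis (- dotv xi y) * f xi).

Lemma cmeasurable_fourier f y : cmeasurable f ->
  cmeasurable (fun xi => cis (- dotv xi y) * f xi).
Proof.
move=> mf; apply: cmeasurableM => //; apply: cmeasurable_cis.
by apply: measurable_funN; exact: measurable_dotv.
Qed.

Lemma integrable_fourier f y : cintegrable f ->
  lv.-integrable setT (EFin \o (fun xi => complex.Re (cis (- dotv xi y) * f xi))).
Proof.
move=> [mf fi]; apply: (integrable_le_norm _ _ _ fi) => //.
  exact: (cmeasurable_fourier _ mf).1.
by move=> xi _; rewrite (le_trans (normr_Re_cmod _))// cmodM cmod_cis mul1r.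
Qed.

Lemma measurable_fourier f : cintegrable f -> measurable_fun setT (fourier f).
Proof.
move=> fi; apply: (@measurable_Rintegral_param _ _ _ _ R lv setT
  (fun y xi => complex.Re (cis (- dotv xi y) * f xi))) => //; last first.
  by move=> y; exact: integrable_fourier.
suff : cmeasurable (fun z : 'cV[R]_n * 'cV[R]_n => cis (- dotv z.2 z.1) * f z.2).
  by case.
apply: cmeasurableM; last by apply: (cmeasurable_comp fi.1); exact: measurable_snd.
by apply: cmeasurable_cis; apply: measurable_funN; exact: measurable_dotv.
Qed.

Lemma normr_fourier f y : cintegrable f ->
  `|fourier f y| <= \int[lv]_xi cmod (f xi).
Proof.
move=> fi; rewrite (le_trans (le_normr_Rintegral _ (integrable_fourier y fi)))//.
apply: le_Rintegral => //.
- by have := integrable_norm (integrable_fourier y fi).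
- exact: fi.2.
- by move=> xi _; rewrite (le_trans (normr_Re_cmod _))// cmodM cmod_cis mul1r.
Qed.

End fourier.

(** * Inversion of an integrable characteristic function *)

Section charfun_density.
Context (R : realType) (n : nat) d (Omega : measurableType d).
Variables (P : probability Omega R) (Y : Omega -> 'cV[R]_n) (chi : 'cV[R]_n -> R[i]).
Hypothesis mY : measurable_fun setT Y.
Hypothesis chi_int : cintegrable chi.
(** Letting the phase vary encodes E e^(i <xi, Y>) = chi xi: the phases 0 and - pi / 2 give its real
    and imaginary parts. *)
Hypothesis chiE : forall (xi : 'cV[R]_n) (al : R),
  \int[P]_w cos (al + dotv xi (Y w)) = complex.Re (cis al * chi xi).
Local Notation lv := (lebesgue_vec R n).
Local Notation mu := (@lebesgue_measure R).

Let smoothed (s : R) (y : 'cV[R]_n) : R :=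
  \int[lv]_xi (laplace_weight s xi * complex.Re (cis (- dotv xi y) * chi xi)).

Lemma integrable_cos_prob (f : Omega -> R) : measurable_fun setT f ->
  P.-integrable setT (EFin \o (fun w => cos (f w))).
Proof.
move=> mf; apply: (integrable_le_norm (g := cst 1)) => //.
- exact: (measurableT_comp (@measurable_cos R) mf).
- by move=> w _; rewrite ler_norml cos_geN1 cos_le1.
- exact: finite_measure_integrable_cst.
Qed.

(** Replacing [chi] by the expectation it stands for and exchanging the integrals leaves the Fourier
    integral of the weight. In this form [smoothed] is visibly nonnegative, and so is its limit
    [fourier chi]. *)
Lemma smoothedE s y : 0 < s ->
  smoothed s y = \int[P]_w poisson_kernel s (Y w - y).
Proof.
move=> s0.
have mYy xi : measurable_fun setT (fun w => - dotv xi y + dotv xi (Y w)).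
  by apply: measurable_funD => //; exact: measurable_dotv.
transitivity (\int[lv]_xi \int[P]_w
    (laplace_weight s xi * cos (- dotv xi y + dotv xi (Y w)))).
  apply: eq_Rintegral => xi _; rewrite -chiE RintegralZl//.
  exact: integrable_cos_prob.
have iw xi : P.-integrable setT (EFin \o (fun w : Omega =>
    laplace_weight s xi * cos (- dotv xi y + dotv xi (Y w)))).
  apply: (integrable_le_norm (g := cst (laplace_weight s xi))) => //.
  - apply: measurable_funM => //.
    exact: (measurableT_comp (@measurable_cos R) (mYy xi)).
  - move=> w _; rewrite normrM ger0_norm ?laplace_weight_ge0//.
    by rewrite ler_piMr ?laplace_weight_ge0// ler_norml cos_geN1 cos_le1.
  - exact: finite_measure_integrable_cst.
have E w xi : laplace_weight s xi * cos (- dotv xi y + dotv xi (Y w)) =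
    laplace_weight s xi * cos (0 + dotv xi (Y w - y)).
  by rewrite dotvBr add0r addrC.
have mj : measurable_fun setT (fun z : 'cV[R]_n * Omega =>
    laplace_weight s z.1 * cos (- dotv z.1 y + dotv z.1 (Y z.2))).
  apply: measurable_funM.
    by apply: (measurableT_comp (measurable_laplace_weight s (n:=n))); exact: measurable_fst.
  apply: (measurableT_comp (@measurable_cos R)); apply: measurable_funD.
    by apply: measurable_funN; exact: measurable_dotv.
  apply: measurable_dotv; first exact: measurable_fst.
  by apply: (measurableT_comp mY); exact: measurable_snd.
have [] := @Rfubini _ _ _ _ R lv P setT setT (fun xi w =>
    laplace_weight s xi * cos (- dotv xi y + dotv xi (Y w))) _ _ mj => //.
- apply: (@le_lt_trans _ _ (\int[lv]_xi (laplace_weight s xi)%:E)%E); last first.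
    by rewrite integral_laplace_weight// ltry.
  apply: ge0_le_integral => //.
  + by move=> xi _; exact: integral_ge0.
  + apply: (@measurable_fun_fubini_tonelli_F _ _ _ _ R P (fun z : 'cV[R]_n * Omega =>
      (`|laplace_weight s z.1 * cos (- dotv z.1 y + dotv z.1 (Y z.2))|)%:E)) => //.
    by apply/measurable_EFinP; exact: measurableT_comp.
  + by apply/measurable_EFinP; exact: measurable_laplace_weight.
  + move=> xi _; apply: (@le_trans _ _ (\int[P]_w (laplace_weight s xi)%:E)%E).
      apply: ge0_le_integral => //.
      * by apply/measurable_EFinP; apply: measurableT_comp => //; exact: integrable_measurable (iw xi).
      * move=> w _; rewrite lee_fin normrM ger0_norm ?laplace_weight_ge0//.
        by rewrite ler_piMr ?laplace_weight_ge0// ler_norml cos_geN1 cos_le1.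
    by rewrite integral_cst//= probability_setT mule1.
- move=> w _; under eq_fun do rewrite E; exact: integrable_laplace_weight_cos.
- move=> _ _ ->; apply: eq_Rintegral => w _.
  under eq_Rintegral do rewrite E.
  by rewrite Rintegral_laplace_weight_cos// cos0 mul1r.
Qed.

Lemma poisson_kernel_ge0 s m (x : 'cV[R]_m) : 0 <= s -> 0 <= poisson_kernel s x.
Proof.
move=> s0; apply: prodr_ge0 => i _.
by rewrite divr_ge0 ?mulr_ge0// addr_ge0 ?sqr_ge0.
Qed.

Lemma smoothed_ge0 s y : 0 < s -> 0 <= smoothed s y.
Proof.
move=> s0; rewrite smoothedE//; apply: Rintegral_ge0 => w _.
by rewrite poisson_kernel_ge0// ltW.
Qed.

Lemma normr_smoothed s y : 0 < s -> `|smoothed s y| <= \int[lv]_xi cmod (chi xi).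
Proof.
move=> s0.
have bd xi : `|laplace_weight s xi * complex.Re (cis (- dotv xi y) * chi xi)| <=
    cmod (chi xi).
  rewrite normrM ger0_norm ?laplace_weight_ge0//.
  rewrite (le_trans (ler_piMl _ (laplace_weight_le1 xi (ltW s0))))//.
  by rewrite (le_trans (normr_Re_cmod _))// cmodM cmod_cis mul1r.
have i1 : lv.-integrable setT (EFin \o (fun xi =>
    laplace_weight s xi * complex.Re (cis (- dotv xi y) * chi xi))).
  apply: (integrable_le_norm _ _ _ chi_int.2) => //.
  apply: measurable_funM; first exact: measurable_laplace_weight.
  exact: (cmeasurable_fourier _ chi_int.1).1.
rewrite (le_trans (le_normr_Rintegral _ i1))//; apply: le_Rintegral => //.
- by have := integrable_norm i1.
- exact: chi_int.2.
Qed.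

Lemma cvg_smoothed y : smoothed (k.+1%:R^-1) y @[k --> \oo] --> fourier chi y.
Proof.
apply: (Rdominated_cvg (g := fun xi => cmod (chi xi))) => //.
- move=> k; apply: measurable_funM; first exact: measurable_laplace_weight.
  exact: (cmeasurable_fourier _ chi_int.1).1.
- move=> xi _; rewrite -[X in _ --> X]mul1r; apply: cvgMl.
  rewrite /laplace_weight.
  have -> : (fun k : nat => \prod_i expR (- k.+1%:R^-1 * `|xi i 0|)) =
      (fun k => expR (- ((\sum_i `|xi i 0|) * k.+1%:R^-1))).
    apply/funext => k; rewrite -expR_sum; congr expR.
    by rewrite mulr_suml -sumrN; apply: eq_bigr => i _; rewrite mulNr mulrC.
  have h : - ((\sum_i `|xi i 0|) * k.+1%:R^-1) @[k --> \oo] --> (0 : R).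
    rewrite -[X in _ --> X]oppr0; apply: cvgN.
    by rewrite -[X in _ --> X](mulr0 (\sum_i `|xi i 0|)); apply: cvgMr; exact: cvg_harmonic.
  by rewrite -[X in _ --> X]expR0; apply: continuous_cvg h; exact: continuous_expR.
- exact: chi_int.2.
- move=> k xi _; rewrite normrM ger0_norm ?laplace_weight_ge0//.
  rewrite (le_trans (ler_piMl _ (laplace_weight_le1 xi _)))//.
  by rewrite (le_trans (normr_Re_cmod _))// cmodM cmod_cis mul1r.
Qed.

Lemma fourier_charfun_ge0 y : 0 <= fourier chi y.
Proof.
apply: (cvgr_to_ge (@cvg_smoothed y)).
by apply: nearW => k; apply: smoothed_ge0; rewrite invr_gt0.
Qed.


Definition closed_box (a b : 'I_n -> R) : set 'cV[R]_n :=
  [set y | forall i, y i 0 \in `[a i, b i]].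

Definition open_box (a b : 'I_n -> R) : set 'cV[R]_n :=
  [set y | forall i, y i 0 \in `]a i, b i[].

Lemma measurable_coord_box (D : 'I_n -> set R) : (forall i, measurable (D i)) ->
  measurable [set y : 'cV[R]_n | forall i, D i (y i 0)].
Proof.
move=> mD.
rewrite (_ : [set _ | _] = \bigcap_(i in [set: 'I_n])
    ((fun v : 'cV[R]_n => v i 0) @^-1` D i)).
  apply: fin_bigcap_measurable => // i _.
  by rewrite -[X in measurable X]setTI; exact: measurable_coord.
by apply/seteqP; split => v /= h i; [move=> _|]; exact: h.
Qed.

Lemma measurable_closed_box a b : measurable (closed_box a b).
Proof. by apply: (@measurable_coord_box (fun i => `[a i, b i]%classic)). Qed.

Lemma measurable_open_box a b : measurable (open_box a b).
Proof. by apply: (@measurable_coord_box (fun i => `]a i, b i[%classic)). Qed.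

Let box_mass (s : R) a b w : R :=
  \prod_i (2 * (atan ((b i - Y w i 0) / s) - atan ((a i - Y w i 0) / s))).

Lemma measurable_poisson_kernel s m : 0 < s ->
  measurable_fun setT (@poisson_kernel R s m).
Proof.
move=> s0; apply: (@measurable_prod_coord R m
  (fun _ x => 2 * s / (s ^+ 2 + x ^+ 2))) => i.
apply: continuous_measurable_fun => x; apply: cvgM; first exact: cvg_cst.
apply: cvgV; first by rewrite gt_eqF// ltr_pwDl ?sqr_ge0// exprn_gt0.
by apply: cvgD; [exact: cvg_cst|exact: (cvgM cvg_id cvg_id)].
Qed.

Lemma poisson_kernel_le s m (x : 'cV[R]_m) : 0 < s ->
  poisson_kernel s x <= (2 / s) ^+ m.
Proof.
move=> s0; rewrite /poisson_kernel -[m in leRHS]card_ord -prodr_const.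
apply: ler_prod => i _; apply/andP; split.
  by rewrite divr_ge0 ?mulr_ge0 ?(ltW s0)// addr_ge0 ?sqr_ge0.
rewrite -mulrA ler_pM2l// ler_pdivrMr ?ltr_pwDl ?sqr_ge0 ?exprn_gt0//.
rewrite mulrDr expr2 mulrA mulVf ?mul1r ?gt_eqF// lerDl.
by rewrite mulr_ge0 ?sqr_ge0// invr_ge0 ltW.
Qed.

Lemma integral_box_poisson_kernel s a b (x : 'cV[R]_n) : 0 < s ->
  (forall i, a i < b i) ->
  (\int[lv]_(y in closed_box a b) (poisson_kernel s (x - y))%:E =
   (\prod_i (2 * (atan ((b i - x i 0) / s) - atan ((a i - x i 0) / s))))%:E)%E.
Proof.
move=> s0 ab.
pose f (i : 'I_n) (t : R) : R := \1_(`[a i, b i]%classic) t *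
  (2 * s / (s ^+ 2 + (x i 0 - t) ^+ 2)).
rewrite -(@ge0_integral_prod R n f).
- rewrite integral_mkcond; apply: eq_integral => y _.
  rewrite patchE; case: ifPn => [|yn].
    rewrite inE => yb; congr EFin; apply: eq_bigr => i _.
    by rewrite /f indicE mem_set ?mul1r ?mxE//; exact: yb.
  have [i yi] : exists i, y i 0 \notin `[a i, b i].
    apply: contrapT => h; move/negP: yn; apply; rewrite inE => i.
    by apply: contrapT => /negP yi; apply: h; exists i.
  by rewrite (bigD1 i)//= /f indicE memNset ?mul0r//; exact/negP.
- move=> i; apply: measurable_funM; first exact: measurable_indic.
  apply: continuous_measurable_fun => t; apply: cvgM; first exact: cvg_cst.
  apply: cvgV; first by rewrite gt_eqF// ltr_pwDl ?sqr_ge0// exprn_gt0.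
  apply: cvgD; first exact: cvg_cst.
  exact: (cvgM (cvgB (cvg_cst _) cvg_id) (cvgB (cvg_cst _) cvg_id)).
- move=> i t; rewrite /f mulr_ge0// divr_ge0 ?mulr_ge0 ?(ltW s0)//.
  by rewrite addr_ge0 ?sqr_ge0.
- move=> i; rewrite -integral_cauchy_itv// [RHS]integral_mkcond.
  apply: eq_integral => t _; rewrite patchE /f indicE.
  by case: (_ \in _); rewrite ?mul1r ?mul0r.
Qed.

Lemma integral_smoothed s a b : 0 < s -> (forall i, a i < b i) ->
  (\int[lv]_(y in closed_box a b) (smoothed s y)%:E =
   \int[P]_w (box_mass s a b w)%:E)%E.
Proof.
move=> s0 ab; have mB := measurable_closed_box a b.
have mK : measurable_fun setT
    (fun z : 'cV[R]_n * Omega => poisson_kernel s (Y z.2 - z.1)).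
  have mg : measurable_fun setT (fun z : 'cV[R]_n * Omega => Y z.2 - z.1).
    apply: measurable_fun_coordP => i j.
    under eq_fun do rewrite !mxE.
    apply: measurable_funB.
      apply: (measurableT_comp (@measurable_coord R n 1 i j)).
      by apply: (measurableT_comp mY); exact: measurable_snd.
    by apply: (measurableT_comp (@measurable_coord R n 1 i j)); exact: measurable_fst.
  have h := measurableT_comp (@measurable_poisson_kernel s n s0) mg.
  exact: h.
have iK y : P.-integrable setT (EFin \o (fun w => poisson_kernel s (Y w - y))).
  apply: (integrable_le_norm (g := cst ((2 / s) ^+ n))) => //.
  - exact: (measurableT_comp mK (measurable_pair1 y)).
  - by move=> w _; rewrite ger0_norm ?poisson_kernel_le ?poisson_kernel_ge0// ltW.
  - exact: finite_measure_integrable_cst.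
pose g (z : 'cV[R]_n * Omega) : \bar R :=
  ((\1_(closed_box a b) z.1 * poisson_kernel s (Y z.2 - z.1))%:E).
transitivity (\int[lv]_y \int[P]_w g (y, w))%E.
  rewrite integral_mkcond; apply: eq_integral => y _.
  rewrite patchE /g /= indicE; case: ifPn => yb.
    under eq_integral do rewrite mul1r.
    by rewrite smoothedE// EFin_Rintegral.
  by under eq_integral do rewrite mul0r; rewrite integral0.
rewrite fubini_tonelli//; last 2 first.
- apply/measurable_EFinP; apply: measurable_funM => //.
  by apply: (measurableT_comp (measurable_indic mB)); exact: measurable_fst.
- by move=> z; rewrite lee_fin mulr_ge0 ?poisson_kernel_ge0// ltW.
apply: eq_integral => w _; rewrite /box_mass -integral_box_poisson_kernel//.
rewrite [RHS]integral_mkcond; apply: eq_integral => y _.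
by rewrite patchE /g /= indicE; case: ifPn => yb; rewrite ?mul1r ?mul0r.
Qed.

Lemma cvg_atan_sg (u : R) :
  atan (u / k.+1%:R^-1) @[k --> \oo] --> pi / 2 * Num.sg u.
Proof.
have pos (v : R) : 0 < v -> atan (v / k.+1%:R^-1) @[k --> \oo] --> pi / 2.
  move=> v0; apply: (cvg_comp (fun k : nat => v / k.+1%:R^-1) _ _ (@cvgy_atan R)).
  under eq_fun do rewrite invrK mulrC.
  have h1 : k.+1%:R @[k --> \oo] --> (+oo : set_system R).
    by have := @cvgr_idn R; rewrite -(cvg_shiftn 1); under eq_fun do rewrite addn1.
  have h2 : x * v @[x --> (+oo : set_system R)] --> (+oo : set_system R).
    by apply: (@gt0_cvgMly _ _ _ v id v0); exact: cvg_id.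
  exact: (cvg_comp _ _ h1 h2).
case: (ltrgtP u 0) => u0.
- rewrite ltr0_sg// mulrN1; have := pos (- u); rewrite oppr_gt0 => /(_ u0) h.
  rewrite [X in X @ _ --> _](_ : _ = (fun k : nat => - atan (- u / k.+1%:R^-1))).
    exact: cvgN.
  by apply/funext => k; rewrite -atanN mulNr opprK.
- by rewrite gtr0_sg// mulr1; exact: pos.
- by rewrite u0 sgr0 mulr0; under eq_fun do rewrite mul0r atan0; exact: cvg_cst.
Qed.

Lemma cvg_prod_seq (I : Type) (r : seq I) (f : I -> nat -> R) (l : I -> R) :
  (forall i, f i k @[k --> \oo] --> l i) ->
  \prod_(i <- r) f i k @[k --> \oo] --> \prod_(i <- r) l i.
Proof.
move=> fl; elim: r => [|i r IH].
  by rewrite big_nil; under eq_fun do rewrite big_nil; exact: cvg_cst.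
by rewrite big_cons; under eq_fun do rewrite big_cons; exact: cvgM.
Qed.

(** Limit of [box_mass] as s tends to 0: (2 pi)^n when Y lies in the open box, 0 outside the closed
    box, and one factor 1/2 for each coordinate of Y that hits an end of its interval. *)
Let box_weight a b w : R :=
  \prod_i (pi * (Num.sg (b i - Y w i 0) - Num.sg (a i - Y w i 0))).

Lemma cvg_box_mass a b w :
  box_mass (k.+1%:R^-1) a b w @[k --> \oo] --> box_weight a b w.
Proof.
apply: cvg_prod_seq => i.
have -> : pi * (Num.sg (b i - Y w i 0) - Num.sg (a i - Y w i 0)) =
  2 * (pi / 2 * Num.sg (b i - Y w i 0) - pi / 2 * Num.sg (a i - Y w i 0)) by field.
by apply: cvgM; [exact: cvg_cst|apply: cvgB; exact: cvg_atan_sg].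
Qed.

Lemma box_mass_bound s a b w : 0 < s -> (forall i, a i < b i) ->
  0 <= box_mass s a b w <= (2 * pi) ^+ n.
Proof.
move=> s0 ab.
have h i : 0 <= 2 * (atan ((b i - Y w i 0) / s) - atan ((a i - Y w i 0) / s)) <= 2 * pi.
  apply/andP; split.
    rewrite mulr_ge0// subr_ge0; apply: le_atan.
    by rewrite ler_pM2r ?invr_gt0// lerD2r ltW.
  have := atan_ltpi2 ((b i - Y w i 0) / s); have := atan_gtNpi2 ((a i - Y w i 0) / s).
  by lra.
rewrite /box_mass prodr_ge0/=; last by move=> i _; case/andP: (h i).
by rewrite -[n in leRHS]card_ord -prodr_const; apply: ler_prod => i _.
Qed.

Lemma box_weight_bound a b w : (forall i, a i < b i) ->
  (2 * pi) ^+ n * \1_(open_box a b) (Y w) <= box_weight a b w <=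
  (2 * pi) ^+ n * \1_(closed_box a b) (Y w).
Proof.
move=> ab.
have pi0 : 0 <= (pi : R) by exact: pi_ge0.
have h i : 0 <= pi * (Num.sg (b i - Y w i 0) - Num.sg (a i - Y w i 0)) <= 2 * pi.
  have := ab i; case: (sgrP (b i - _)); case: (sgrP (a i - _)); move=> *; nra.
have W0 : 0 <= box_weight a b w by apply: prodr_ge0 => i _; case/andP: (h i).
apply/andP; split.
  rewrite indicE; case: (boolP (_ \in _)); rewrite ?mulr1 ?mulr0// inE => yo.
  rewrite -[n in leLHS]card_ord -prodr_const; apply: ler_prod => i _.
  have := yo i; rewrite in_itv/= => /andP[ai bi].
  rewrite (mulr_ge0 _ pi0)//= gtr0_sg ?subr_gt0// ltr0_sg ?subr_lt0//.
  by rewrite opprK mulrC.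
rewrite indicE; case: (boolP (_ \in _)) => [_|].
  rewrite mulr1 -[n in leRHS]card_ord -prodr_const.
  by apply: ler_prod => i _; exact: h.
move=> yn; rewrite mulr0.
have [i yi] : exists i, Y w i 0 \notin `[a i, b i].
  apply: contrapT => h'; move/negP: yn; apply; rewrite inE => i.
  by apply: contrapT => /negP yi; apply: h'; exists i.
rewrite /box_weight (bigD1 i)//= [X in X * _](_ : _ = 0) ?mul0r//.
move: yi (ab i); rewrite in_itv/= negb_and -!ltNge => /orP[] yi abi.
  by rewrite !gtr0_sg ?subr_gt0 ?(lt_trans yi abi)// subrr mulr0.
by rewrite !ltr0_sg ?subr_lt0 ?(lt_trans abi yi)// subrr mulr0.
Qed.

(** Both sides are limits along s = 1 / (k + 1). Dominated convergence applies on the left because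
    the box has finite volume and [smoothed] is bounded by the L1 norm of [chi], on the right
    because [box_mass] is at most (2 pi)^n. *)
Lemma Rintegral_fourier_box a b : (forall i, a i < b i) ->
  (\int[lv]_(y in closed_box a b) (fourier chi y)%:E =
   \int[P]_w (box_weight a b w)%:E)%E.
Proof.
move=> ab; have mB := measurable_closed_box a b.
have fB : (lv (closed_box a b) < +oo)%E.
  by rewrite lebesgue_vec_box ?ltry// => i; exact: ltW.
have ms s : 0 < s -> measurable_fun setT (smoothed s).
  move=> s0; rewrite (_ : smoothed s = fourier (fun xi => (laplace_weight s xi)%:C * chi xi)).
    apply: measurable_fourier; split.
      apply: cmeasurableM; last exact: chi_int.1.
      by split; [exact: measurable_laplace_weight|exact: measurable_cst].
    apply: (integrable_le_norm _ _ _ chi_int.2) => //.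
      apply: measurable_cmod; apply: cmeasurableM; last exact: chi_int.1.
      by split; [exact: measurable_laplace_weight|exact: measurable_cst].
    move=> xi _; rewrite ger0_norm ?cmod_ge0// cmodM cmod_real.
    by rewrite ger0_norm ?laplace_weight_ge0// ler_piMl ?cmod_ge0// laplace_weight_le1// ltW.
  apply/funext => y; apply: eq_Rintegral => xi _.
  by rewrite mulrCA [in RHS]cReM /= mul0r subr0.
have ic : lv.-integrable (closed_box a b)
    (EFin \o cst (\int[lv]_xi cmod (chi xi))).
  apply: ge0_integrable_lty => //.
    by move=> y _; apply: Rintegral_ge0 => xi _; exact: cmod_ge0.
  rewrite (@integral_cst _ _ _ lv _ mB _%:E) lte_mul_pinfty// lee_fin.
  by apply: Rintegral_ge0 => xi _; exact: cmod_ge0.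
have c1 : \int[lv]_(y in closed_box a b) smoothed k.+1%:R^-1 y @[k --> \oo] -->
    \int[lv]_(y in closed_box a b) fourier chi y.
  apply: (Rdominated_cvg (g := cst (\int[lv]_xi cmod (chi xi)))) => //.
  - by move=> k; apply: measurable_funTS; apply: ms; rewrite invr_gt0.
  - by move=> y _; exact: cvg_smoothed.
  - by move=> k y _; apply: normr_smoothed; rewrite invr_gt0.
have mY' i : measurable_fun setT (fun w => Y w i 0).
  exact: (measurableT_comp (@measurable_coord R n 1 i 0) mY).
have mbm s : 0 < s -> measurable_fun setT (box_mass s a b).
  move=> s0; apply: measurable_prod => i _; apply: measurable_funM => //.
  have ma : measurable_fun setT (@atan R).
    by apply: continuous_measurable_fun; exact: continuous_atan.
  apply: measurable_funB; apply: (measurableT_comp ma); apply: measurable_funM => //;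
    exact: measurable_funB.
have c2 : \int[P]_w box_mass k.+1%:R^-1 a b w @[k --> \oo] -->
    \int[P]_w box_weight a b w.
  apply: (Rdominated_cvg (g := cst ((2 * pi) ^+ n))) => //.
  - by move=> k; apply: mbm; rewrite invr_gt0.
  - by move=> w _; exact: cvg_box_mass.
  - exact: finite_measure_integrable_cst.
  - move=> k w _; have s0 : (0 : R) < k.+1%:R^-1 by rewrite invr_gt0.
    by have /andP[h1 h2] := box_mass_bound w s0 ab; rewrite ger0_norm.
have E : \int[lv]_(y in closed_box a b) fourier chi y = \int[P]_w box_weight a b w.
  rewrite -(cvg_lim (@Rhausdorff R) c1) -(cvg_lim (@Rhausdorff R) c2).
  by congr (limn _); apply/funext => k; rewrite /Rintegral integral_smoothed// invr_gt0.
have i1 : lv.-integrable (closed_box a b) (EFin \o fourier chi).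
  apply: (integrable_le_norm _ _ _ ic) => //.
    by apply: measurable_funTS; exact: measurable_fourier.
  by move=> y _; exact: normr_fourier.
have i2 : P.-integrable setT (EFin \o box_weight a b).
  apply: (integrable_le_norm (g := cst ((2 * pi) ^+ n))) => //.
  - apply: (@measurable_fun_cvg _ _ _ _ (fun k => box_mass k.+1%:R^-1 a b)).
      by move=> k; apply: mbm; rewrite invr_gt0.
    by move=> w _; exact: cvg_box_mass.
  - move=> w _; have /andP[h1 h2] := box_weight_bound w ab.
    have p0 : 0 <= (2 * pi : R) ^+ n by rewrite exprn_ge0// mulr_ge0// pi_ge0.
    rewrite ger0_norm; last by apply: le_trans h1; rewrite mulr_ge0.
    by rewrite (le_trans h2)// ler_piMr// indicE; case: (_ \in _).
  - exact: finite_measure_integrable_cst.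
by rewrite -EFin_Rintegral// E EFin_Rintegral.
Qed.

Lemma integral_indic_preimage (K : R) (E : set 'cV[R]_n) : 0 <= K -> measurable E ->
  (\int[P]_w (K * \1_E (Y w))%:E = K%:E * P (Y @^-1` E))%E.
Proof.
move=> K0 mE.
have mYE : measurable (Y @^-1` E) by rewrite -[X in measurable X]setTI; exact: mY.
under eq_integral do rewrite EFinM.
rewrite ge0_integralZl//; last first.
  by apply/measurable_EFinP; apply: (measurableT_comp (measurable_indic mE) mY).
congr (_ * _)%E; transitivity (\int[P]_w (\1_(Y @^-1` E) w)%:E)%E => //.
by rewrite integral_indic// setIT.
Qed.

Let K0 : 0 <= (2 * pi : R) ^+ n.
Proof. by rewrite exprn_ge0// mulr_ge0// pi_ge0. Qed.

Lemma measurable_box_weight a b : measurable_fun setT (box_weight a b).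
Proof.
apply: (@measurable_fun_cvg _ _ _ _ (fun k => box_mass k.+1%:R^-1 a b)); last first.
  by move=> w _; exact: cvg_box_mass.
move=> k; apply: measurable_prod => i _; apply: measurable_funM => //.
have ma : measurable_fun setT (@atan R).
  by apply: continuous_measurable_fun; exact: continuous_atan.
have mY' : measurable_fun setT (fun w => Y w i 0).
  exact: (measurableT_comp (@measurable_coord R n 1 i 0) mY).
apply: measurable_funB; apply: (measurableT_comp ma); apply: measurable_funM => //;
  exact: measurable_funB.
Qed.

(** The law of Y might charge the faces of the box, so that its values are only squeezed between the
    open and the closed box; passing to orthants removes the ambiguity. *)
Lemma fourier_closed_box_le a b : (forall i, a i < b i) ->
  (\int[lv]_(y in closed_box a b) (fourier chi y)%:E <=
   ((2 * pi) ^+ n)%:E * P (Y @^-1` closed_box a b))%E.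
Proof.
move=> ab; rewrite Rintegral_fourier_box// -integral_indic_preimage//; last first.
  exact: measurable_closed_box.
apply: ge0_le_integral => //.
- move=> w _; rewrite lee_fin; have /andP[h _] := box_weight_bound w ab.
  by apply: le_trans h; rewrite mulr_ge0.
- by apply/measurable_EFinP; exact: measurable_box_weight.
- apply/measurable_EFinP; apply: measurable_funM => //.
  exact: (measurableT_comp (measurable_indic (measurable_closed_box a b)) mY).
- by move=> w _; rewrite lee_fin; have /andP[_] := box_weight_bound w ab.
Qed.

Lemma fourier_open_box_ge a b : (forall i, a i < b i) ->
  (((2 * pi) ^+ n)%:E * P (Y @^-1` open_box a b) <=
   \int[lv]_(y in closed_box a b) (fourier chi y)%:E)%E.
Proof.
move=> ab; rewrite Rintegral_fourier_box// -integral_indic_preimage//; last first.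
  exact: measurable_open_box.
apply: ge0_le_integral => //.
- by move=> w _; rewrite lee_fin mulr_ge0.
- apply/measurable_EFinP; apply: measurable_funM => //.
  exact: (measurableT_comp (measurable_indic (measurable_open_box a b)) mY).
- by apply/measurable_EFinP; exact: measurable_box_weight.
- by move=> w _; rewrite lee_fin; have /andP[] := box_weight_bound w ab.
Qed.

End charfun_density.

Lemma integral_density d (T : measurableType d) (R : realType)
    (mu nu : {measure set T -> \bar R}) (p : T -> R) :
  measurable_fun setT p -> (forall x, 0 <= p x) ->
  (forall E, measurable E -> nu E = (\int[mu]_(x in E) (p x)%:E)%E) ->
  forall f : T -> \bar R, measurable_fun setT f ->
  (\int[nu]_x f x = \int[mu]_x (f x * (p x)%:E))%E.
Proof.
move=> mp p0 nuE f mf; rewrite integralE [RHS]integralE; congr (_ - _)%E.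
  rewrite (ge0_integral_density mp p0 nuE)//; last exact: measurable_funepos.
  by apply: eq_integral => x _; rewrite !funeposE maxe_pMl ?mul0e// lee_fin.
rewrite (ge0_integral_density mp p0 nuE)//; last exact: measurable_funeneg.
by apply: eq_integral => x _; rewrite !funenegE maxe_pMl ?mul0e ?mulNe// lee_fin.
Qed.

(** * Identification of finite measures on orthants *)

Section orthants.
Context (R : realType) (n : nat).

(** Open lower orthants are stable under intersection, generate the sigma-algebra, and are
    increasing unions of open boxes and of closed boxes alike, so that the undetermined mass of the
    faces disappears in the limit. *)
Definition orthant (b : 'I_n -> R) : set 'cV[R]_n := [set y | forall i, y i 0 < b i].

Lemma measurable_orthant b : measurable (orthant b).
Proof.
have := @measurable_coord_box R n (fun i => `]-oo, b i[%classic).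
rewrite (_ : [set y | _] = orthant b); first by apply.
by apply/seteqP; split => y /= h i; have := h i; rewrite in_itv.
Qed.

Lemma near_forall_ord (F : set_system nat) (FF : Filter F) (Q : 'I_n -> nat -> Prop) :
  (forall i, \forall k \near F, Q i k) -> \forall k \near F, forall i, Q i k.
Proof. by move=> h; apply: filter_forall. Qed.

Lemma near_natr_gt (x : R) : \forall k \near \oo, x < k.+1%:R.
Proof.
near=> k; apply: (@lt_trans _ _ k%:R); last by rewrite ltr_nat.
by near: k; exact: nbhs_infty_gtr.
Unshelve. all: by end_near. Qed.

Lemma measurable_orthantE :
  @measurable _ 'cV[R]_n = <<s range orthant >>.
Proof.
apply/seteqP; split; last first.
  apply: smallest_sub; first exact: sigma_algebra_measurable.
  by move=> _ [b _ <-]; exact: measurable_orthant.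
apply: smallest_sub; first exact: smallest_sigma_algebra.
move=> _ [[i j] _ [A mA <-]].
pose T' : measurableType _ := g_sigma_algebraType (range orthant).
pose co : T' -> measurableTypeR R := fun M : 'cV[R]_n => M i j.
suff mco : measurable_fun [set: T'] co by exact: mco.
refine (@measurability _ _ _ _ setT co (@RGenInftyO.G R) (RGenInftyO.measurableE R) _).
move=> _ [_ [x ->] <-]; rewrite setTI.
have -> : co @^-1` `]-oo, x[ =
    \bigcup_k orthant (fun l => if l == i then x else k.+1%:R).
  apply/seteqP; split => y /=; rewrite ?in_itv/=.
    move=> yx.
    have : \forall k \near \oo, forall l, y l 0 < k.+1%:R.
      by apply: near_forall_ord => l; exact: near_natr_gt.
    case => N _ /(_ N (leqnn N)) h; exists N => // l /=.
    by case: eqP => // ->; move: yx; rewrite /co (ord1 j).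
  by move=> [k _ /(_ i)]; rewrite eqxx /co (ord1 j).
by apply: bigcupT_measurable => k; apply: sub_sigma_algebra; exists (fun l => if l == i then x else k.+1%:R).
Qed.

Lemma orthant_measure_unique (m1 m2 : {measure set 'cV[R]_n -> \bar R}) :
  (m1 setT < +oo)%E -> (forall b, m1 (orthant b) = m2 (orthant b)) ->
  forall E, measurable E -> m1 E = m2 E.
Proof.
move=> fin m12; apply: (@measure_unique _ _ _ (range orthant)
  (fun k => orthant (fun=> k.+1%:R))).
- exact: measurable_orthantE.
- move=> _ _ [a _ <-] [b _ <-]; exists (fun i => Num.min (a i) (b i)) => //.
  apply/seteqP; split => y.
    by move=> h; split=> i; have := h i; rewrite lt_min => /andP[].
  by move=> [h1 h2] i; rewrite lt_min h1 h2.
- by move=> k; exists (fun=> k.+1%:R).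
- apply/seteqP; split => // y _.
  have : \forall k \near \oo, forall l, y l 0 < k.+1%:R.
    by apply: near_forall_ord => l; exact: near_natr_gt.
  by case => N _ /(_ N (leqnn N)) h; exists N.
- by move=> _ [b _ <-]; exact: m12.
- move=> k; apply: le_lt_trans fin; apply: le_measure => //; rewrite inE//.
  exact: measurable_orthant.
Qed.

(** The boxes from [ax b k] to [bx b k] increase to [orthant b]: the upper corner stays strictly
    below b, so that closed boxes remain inside the orthant, and the lower corner goes to -oo. *)
Let bx (b : 'I_n -> R) k i := b i - k.+1%:R^-1.
Let ax (b : 'I_n -> R) k i := b i - k.+1%:R^-1 - k.+1%:R.

Lemma ax_lt_bx b k i : ax b k i < bx b k i.
Proof. by rewrite /ax /bx ltrBlDr ltrDl. Qed.

Lemma bx_lt b k i : bx b k i < b i.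
Proof. by rewrite /bx ltrBlDr ltrDl invr_gt0. Qed.

Lemma open_box_orthant b :
  \bigcup_k open_box (ax b k) (bx b k) = orthant b.
Proof.
apply/seteqP; split => y.
  move=> [k _ h] i; have := h i; rewrite in_itv/= => /andP[_ yb].
  exact: (lt_trans yb (bx_lt b k i)).
move=> h; have : \forall k \near \oo, forall i, y i 0 \in `]ax b k i, bx b k i[.
  apply: near_forall_ord => i.
  have yb : 0 < b i - y i 0 by rewrite subr_gt0.
  near=> k; rewrite in_itv/= /ax /bx; apply/andP; split.
    rewrite -addrA -opprD ltrBlDr -ltrBlDl (@lt_trans _ _ k.+1%:R)//.
      by near: k; exact: near_natr_gt.
    by rewrite ltrDr invr_gt0.
  rewrite ltrBrDr -ltrBrDl invf_plt ?posrE//.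
  by near: k; exact: near_natr_gt.
by case => N _ /(_ N (leqnn N)) yN; exists N.
Unshelve. all: by end_near. Qed.

Lemma open_closed_box (a b : 'I_n -> R) : open_box a b `<=` closed_box a b.
Proof. by move=> y h i; have := h i; rewrite !in_itv/= => /andP[/ltW -> /ltW ->]. Qed.

Lemma closed_box_orthant b :
  \bigcup_k closed_box (ax b k) (bx b k) = orthant b.
Proof.
apply/seteqP; split => [y [k _ h] i|].
  have := h i; rewrite in_itv/= => /andP[_ yb].
  exact: (le_lt_trans yb (bx_lt b k i)).
rewrite -open_box_orthant => y [k _ h]; exists k => //.
exact: open_closed_box.
Qed.

Let le_inv k l : (k <= l)%N -> l.+1%:R^-1 <= k.+1%:R^-1 :> R.
Proof. by move=> kl; rewrite lef_pV2 ?posrE// ler_nat. Qed.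

Lemma ax_le b k l i : (k <= l)%N -> ax b l i <= ax b k i.
Proof.
move=> kl; rewrite /ax -!addrA lerD2l -!opprD lerN2.
have := @le_inv k l kl.
have : k.+1%:R <= l.+1%:R :> R by rewrite ler_nat.
have : k.+1%:R^-1 <= 1 :> R by rewrite invf_le1// ler1n.
have : 0 < l.+1%:R^-1 :> R by rewrite invr_gt0.
(* When k < l, the gain l - k >= 1 outweighs the decrease of 1 / (k + 1), which is at most 1. *)
case: (ltngtP k l) kl => // [kl _|-> //].
have : k.+1%:R + 1 <= l.+1%:R :> R by rewrite natr1 ler_nat.
move: (k.+1%:R^-1 : R) (l.+1%:R^-1 : R) (k.+1%:R : R) (l.+1%:R : R).
move=> u v a c; lra.
Qed.

Lemma bx_le b k l i : (k <= l)%N -> bx b k i <= bx b l i.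
Proof. by move=> kl; rewrite /bx lerD2l lerN2 le_inv. Qed.

Lemma cvg_open_box (m : {measure set 'cV[R]_n -> \bar R}) b :
  m (open_box (ax b k) (bx b k)) @[k --> \oo] --> m (orthant b).
Proof.
rewrite -open_box_orthant; apply: nondecreasing_cvg_mu.
- by move=> k; exact: measurable_open_box.
- by rewrite open_box_orthant; exact: measurable_orthant.
- move=> k l kl; apply/subsetPset => y h i; have := h i; rewrite !in_itv/=.
  move=> /andP[h1 h2]; rewrite (le_lt_trans (ax_le _ _ kl) h1).
  by rewrite (lt_le_trans h2 (bx_le _ _ kl)).
Qed.

Lemma cvg_closed_box (m : {measure set 'cV[R]_n -> \bar R}) b :
  m (closed_box (ax b k) (bx b k)) @[k --> \oo] --> m (orthant b).
Proof.
rewrite -closed_box_orthant; apply: nondecreasing_cvg_mu.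
- by move=> k; exact: measurable_closed_box.
- by rewrite closed_box_orthant; exact: measurable_orthant.
- move=> k l kl; apply/subsetPset => y h i; have := h i; rewrite !in_itv/=.
  move=> /andP[h1 h2]; rewrite (le_trans (ax_le _ _ kl) h1).
  by rewrite (le_trans h2 (bx_le _ _ kl)).
Qed.

(** Applied with [m1] the law and [m2] the measure of density [charfun_pdf]: each family of box
    inequalities passes to orthants, in opposite directions. *)
Lemma orthant_sandwich (m1 m2 : {measure set 'cV[R]_n -> \bar R}) :
  (forall a b, (forall i, a i < b i) -> (m1 (open_box a b) <= m2 (closed_box a b))%E) ->
  (forall a b, (forall i, a i < b i) -> (m2 (closed_box a b) <= m1 (closed_box a b))%E) ->
  forall b, m1 (orthant b) = m2 (orthant b).
Proof.
move=> h1 h2 b.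
have sub (m : {measure set 'cV[R]_n -> \bar R}) k :
    (m (closed_box (ax b k) (bx b k)) <= m (orthant b))%E.
  apply: le_measure; rewrite ?inE; [exact: measurable_closed_box|exact: measurable_orthant|].
  by rewrite -closed_box_orthant => y h; exists k.
apply/eqP; rewrite eq_le; apply/andP; split.
  refine (cvge_to_le (@cvg_open_box m1 b) _); apply: nearW => k.
  by rewrite (le_trans (h1 _ _ (ax_lt_bx b k)))// sub.
refine (cvge_to_le (@cvg_closed_box m2 b) _); apply: nearW => k.
by rewrite (le_trans (h2 _ _ (ax_lt_bx b k)))// sub.
Qed.

End orthants.

Section charfun_law.
Context (R : realType) (n : nat) d (Omega : measurableType d).
Variables (P : probability Omega R) (Y : Omega -> 'cV[R]_n) (chi : 'cV[R]_n -> R[i]).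
Hypothesis mY : measurable_fun setT Y.
Hypothesis chi_int : cintegrable chi.
Hypothesis chiE : forall (xi : 'cV[R]_n) (al : R),
  \int[P]_w cos (al + dotv xi (Y w)) = complex.Re (cis al * chi xi).
Local Notation lv := (lebesgue_vec R n).

Definition charfun_pdf (y : 'cV[R]_n) : R := ((2 * pi) ^+ n)^-1 * fourier chi y.

Let K0 : 0 < (2 * pi : R) ^+ n.
Proof. by rewrite exprn_gt0// mulr_gt0// pi_gt0. Qed.

Lemma charfun_pdf_ge0 y : 0 <= charfun_pdf y.
Proof.
by rewrite mulr_ge0 ?invr_ge0 ?(ltW K0)// (fourier_charfun_ge0 mY chi_int chiE).
Qed.

Lemma measurable_charfun_pdf : measurable_fun setT charfun_pdf.
Proof. by apply: measurable_funM => //; exact: measurable_fourier. Qed.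

Lemma integral_charfun_pdf E : measurable E ->
  (\int[lv]_(y in E) (charfun_pdf y)%:E =
   (((2 * pi) ^+ n)^-1)%:E * \int[lv]_(y in E) (fourier chi y)%:E)%E.
Proof.
move=> mE; under eq_integral do rewrite EFinM.
apply: ge0_integralZl => //.
- by apply/measurable_EFinP; apply: measurable_funTS; exact: measurable_fourier.
- by move=> y _; rewrite lee_fin (fourier_charfun_ge0 mY chi_int chiE).
- by rewrite lee_fin invr_ge0 ltW.
Qed.

Lemma charfun_law E : measurable E ->
  P (Y @^-1` E) = (\int[lv]_(y in E) (charfun_pdf y)%:E)%E.
Proof.
pose law := measure_function_pushforward__canonical__measure_function_Measure P mY.
pose dens := density_measure lv measurable_charfun_pdf charfun_pdf_ge0.
suff h : forall E, measurable E -> law E = dens E by move=> /h.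
apply: orthant_measure_unique.
  rewrite /law /= /pushforward preimage_setT probability_setT; exact: ltry.
apply: orthant_sandwich => a b ab.
- rewrite /dens density_measureE integral_charfun_pdf; last exact: measurable_closed_box.
  rewrite lee_pdivlMl//.
  exact: (fourier_open_box_ge mY chi_int chiE).
- rewrite /dens density_measureE integral_charfun_pdf; last exact: measurable_closed_box.
  rewrite lee_pdivrMl//.
  exact: (fourier_closed_box_le mY chi_int chiE).
Qed.

Lemma integral_law_charfun (f : 'cV[R]_n -> \bar R) : measurable_fun setT f ->
  (\int[pushforward P Y]_y f y = \int[lv]_y (f y * (charfun_pdf y)%:E))%E.
Proof.
pose law := measure_function_pushforward__canonical__measure_function_Measure P mY.
apply: (@integral_density _ _ _ lv law) => //.
- exact: measurable_charfun_pdf.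
- exact: charfun_pdf_ge0.
- exact: charfun_law.
Qed.

Lemma integrable_charfun_pdf : lv.-integrable setT (EFin \o charfun_pdf).
Proof.
apply: ge0_integrable_lty => //.
- exact: measurable_charfun_pdf.
- by move=> y _; exact: charfun_pdf_ge0.
- by rewrite -charfun_law// preimage_setT probability_setT ltry.
Qed.

End charfun_law.

(** * Variation distance through densities *)

Section var_dist_bounds.
Context (R : realType) (n : nat) d (Omega : measurableType d).
Variables (P : probability Omega R).
Local Notation lv := (lebesgue_vec R n).

Lemma fourierB (f g : 'cV[R]_n -> R[i]) y : cintegrable f -> cintegrable g ->
  fourier (fun xi => f xi - g xi) y = fourier f y - fourier g y.
Proof.
move=> fi gi; rewrite /fourier -RintegralB//; try exact: integrable_fourier.
by apply: eq_Rintegral => xi _; rewrite mulrBr cReD cReN.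
Qed.

(** The difference of the two densities is the normalised inverse transform of [chi1 - chi2], and a
    test function bounded by 1 sees at most its L1 norm. *)
Lemma var_dist_charfun (Y1 Y2 : Omega -> 'cV[R]_n) (chi1 chi2 : 'cV[R]_n -> R[i]) :
  measurable_fun setT Y1 -> measurable_fun setT Y2 ->
  cintegrable chi1 -> cintegrable chi2 ->
  (forall xi al, \int[P]_w cos (al + dotv xi (Y1 w)) = complex.Re (cis al * chi1 xi)) ->
  (forall xi al, \int[P]_w cos (al + dotv xi (Y2 w)) = complex.Re (cis al * chi2 xi)) ->
  (var_dist (pushforward P Y1) (pushforward P Y2) <=
   (((2 * pi) ^+ n)^-1)%:E *
   \int[lv]_y `|fourier (fun xi => chi1 xi - chi2 xi) y|%:E)%E.
Proof.
move=> mY1 mY2 i1 i2 E1 E2.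
apply: ge_ereal_sup => _ [f [mf f1] <-].
have mf' : measurable_fun setT (EFin \o f) by exact/measurable_EFinP.
rewrite (integral_law_charfun mY1 i1 E1 mf') (integral_law_charfun mY2 i2 E2 mf').
set p1 := charfun_pdf chi1; set p2 := charfun_pdf chi2.
have j (p : 'cV[R]_n -> R) : lv.-integrable setT (EFin \o p) ->
    lv.-integrable setT (fun y => ((f y)%:E * (p y)%:E)%E).
  move=> ip; have := integrable_norm ip; rewrite /= => inp.
  apply: (@integrable_le_norm _ _ _ lv setT (fun y => f y * p y) (fun y => `|p y|)) => //.
  - by apply: measurable_funM => //; exact: integrable_measurable ip.
  - by move=> y _; rewrite normrM ler_piMl.
have ip1 := integrable_charfun_pdf mY1 i1 E1.
have ip2 := integrable_charfun_pdf mY2 i2 E2.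
rewrite -integralB//; [|exact: j|exact: j].
have mF : measurable_fun setT (fourier (fun xi => chi1 xi - chi2 xi)).
  rewrite (_ : fourier _ = (fun y => fourier chi1 y - fourier chi2 y)).
    by apply: measurable_funB; exact: measurable_fourier.
  by apply/funext => y; rewrite fourierB.
have K0 : 0 < (2 * pi : R) ^+ n by rewrite exprn_gt0// mulr_gt0// pi_gt0.
apply: le_trans (le_abse_integral _ measurableT _) _.
  apply: emeasurable_funB; apply: measurable_int; exact: j.
rewrite -ge0_integralZl//; last 2 first.
- by apply/measurable_EFinP; exact: measurableT_comp.
- by rewrite lee_fin invr_ge0 ltW.
apply: ge0_le_integral => //.
- apply: measurableT_comp => //; apply: emeasurable_funB; apply: measurable_int; exact: j.
- apply/measurable_EFinP; apply: measurable_funM => //; exact: measurableT_comp.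
- move=> y _; rewrite -!EFinM -EFinB lee_fin -mulrBr normrM.
  rewrite (le_trans (ler_piMl _ (f1 y)))// /p1 /p2 /charfun_pdf -mulrBr -fourierB//.
  by rewrite normrM gtr0_norm ?invr_gt0.
Qed.

Lemma integral_pushforward_bounded (Y : Omega -> 'cV[R]_n) (f : 'cV[R]_n -> R) :
  measurable_fun setT Y -> measurable_fun setT f -> (forall z, `|f z| <= 1) ->
  exists2 r : R, `|r| <= 1 & (\int[pushforward P Y]_z (f z)%:E)%E = r%:E.
Proof.
move=> mY mf f1.
have mfY : measurable_fun setT (f \o Y) by exact: measurableT_comp.
have ic : P.-integrable setT (EFin \o (f \o Y)).
  apply: (integrable_le_norm (g := cst 1)) => //; first by move=> w _; exact: f1.
  exact: finite_measure_integrable_cst.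
exists (\int[P]_w f (Y w)).
  rewrite (le_trans (le_normr_Rintegral _ ic))//.
  apply: (@le_trans _ _ (\int[P]_w (cst 1 w))).
    apply: le_Rintegral => //; first exact: integrable_norm ic.
      exact: finite_measure_integrable_cst.
    by move=> w _; exact: f1.
  by rewrite /Rintegral /= integral_cst//= probability_setT mule1.
rewrite (@integral_pushforward _ _ _ _ _ _ mY P setT (EFin \o f))//.
  by rewrite EFin_Rintegral.
exact/measurable_EFinP.
Qed.

Lemma var_dist_le2 (Y1 Y2 : Omega -> 'cV[R]_n) :
  measurable_fun setT Y1 -> measurable_fun setT Y2 ->
  (var_dist (pushforward P Y1) (pushforward P Y2) <= 2%:E)%E.
Proof.
move=> mY1 mY2; apply: ge_ereal_sup => _ [f [mf f1] <-].
have [r1 r1b ->] := integral_pushforward_bounded mY1 mf f1.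
have [r2 r2b ->] := integral_pushforward_bounded mY2 mf f1.
rewrite -EFinB lee_fin (le_trans (ler_normB _ _))//; lra.
Qed.

Lemma var_dist_self (Y : Omega -> 'cV[R]_n) : measurable_fun setT Y ->
  (var_dist (pushforward P Y) (pushforward P Y) <= 0)%E.
Proof.
move=> mY; apply: ge_ereal_sup => _ [f [mf f1] <-].
have [r _ ->] := integral_pushforward_bounded mY mf f1.
by rewrite -EFinB subrr abse0.
Qed.

End var_dist_bounds.

(** * Fourier calculus and symbols *)

Section fourier_calculus.
Context (R : realType) (n : nat).
Local Notation lv := (lebesgue_vec R n).
Local Notation mu := (@lebesgue_measure R).
Implicit Types (f g : 'cV[R]_n -> R[i]).

Lemma Rintegral_shiftv (a : 'cV[R]_n) (f : 'cV[R]_n -> R) :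
  measurable_fun setT f -> \int[lv]_v f (v + a) = \int[lv]_v f v.
Proof.
move=> mf; rewrite /Rintegral; congr fine.
by apply: (@integral_shiftv R n a (EFin \o f)); exact/measurable_EFinP.
Qed.

Lemma cintegrable_le f (h : 'cV[R]_n -> R) : cmeasurable f ->
  (forall xi, cmod (f xi) <= h xi) -> lv.-integrable setT (EFin \o h) ->
  cintegrable f.
Proof.
move=> mf fh ih; split => //; apply: (integrable_le_norm _ _ _ ih) => //.
  exact: measurable_cmod.
by move=> xi _; rewrite ger0_norm ?cmod_ge0.
Qed.

Lemma cintegrableMbounded f g (C : R) : cmeasurable g ->
  (forall xi, cmod (g xi) <= C) -> cintegrable f ->
  cintegrable (fun xi => g xi * f xi).
Proof.
move=> mg gC [mf fi]; apply: (@cintegrable_le _ (fun xi => C * cmod (f xi))).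
- exact: cmeasurableM.
- by move=> xi; rewrite cmodM ler_wpM2r// cmod_ge0.
- exact: (integrableZl measurableT C fi).
Qed.

Lemma cintegrableZ f (c : R[i]) : cintegrable f -> cintegrable (fun xi => c * f xi).
Proof.
by apply: (@cintegrableMbounded _ (fun=> c) (cmod c)) => //; exact: cmeasurable_cst.
Qed.

Lemma cintegrable_shift f (a : 'cV[R]_n) : cintegrable f ->
  cintegrable (fun xi => f (xi + a)).
Proof.
move=> [mf fi]; split; first by apply: (cmeasurable_comp mf); exact: measurable_shiftv.
exact: (integrable_shiftv a fi).
Qed.

Lemma fourier_shift f (a y : 'cV[R]_n) : cintegrable f ->
  fourier (fun xi => f (xi + a)) y = fourier (fun xi => cis (dotv a y) * f xi) y.
Proof.
move=> fi; rewrite /fourier.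
rewrite -(@Rintegral_shiftv a (fun xi => complex.Re (cis (- dotv xi y) * (cis (dotv a y) * f xi)))).
  apply: eq_Rintegral => xi _; congr complex.Re.
  by rewrite mulrA -cisD dotvDl opprD addrNK.
apply: (cmeasurable_fourier y _).1; apply: cmeasurableM; last exact: fi.1.
exact: cmeasurable_cst.
Qed.

Lemma fourier_modulation f (b y : 'cV[R]_n) :
  fourier (fun xi => cis (dotv xi b) * f xi) y = fourier f (y - b).
Proof.
apply: eq_Rintegral => xi _; congr complex.Re.
by rewrite mulrA -cisD dotvBr opprB addrC.
Qed.

Lemma fourierZcis f (t : R) y : cintegrable f ->
  fourier (fun xi => cis t * f xi) y =
  cos t * fourier f y + sin t * fourier (fun xi => 'i%C * f xi) y.
Proof.
move=> fi; rewrite /fourier -!RintegralZl//; last 2 first.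
- by apply: integrable_fourier; exact: cintegrableZ.
- exact: integrable_fourier.
rewrite -RintegralD//; last 2 first.
- exact: (integrableZl measurableT _ (integrable_fourier y fi)).
- exact: (integrableZl measurableT _ (integrable_fourier y (cintegrableZ _ fi))).
by apply: eq_Rintegral => xi _; rewrite !ReImE /=; ring.
Qed.

Variable j : 'I_n.
Local Notation e := (delta_mx j 0 : 'cV[R]_n).

(** The derivative is required at every point u of every line, so that one-variable calculus applies
    to [v |-> f (xi + v *: e)] as it stands. *)
Definition is_cpartial f g := forall xi (u : R),
  is_derive u 1 (fun v => complex.Re (f (xi + v *: e))) (complex.Re (g (xi + u *: e))) /\
  is_derive u 1 (fun v => complex.Im (f (xi + v *: e))) (complex.Im (g (xi + u *: e))).

Definition cline_continuous f := forall xi,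
  continuous (fun v : R => complex.Re (f (xi + v *: e))) /\
  continuous (fun v : R => complex.Im (f (xi + v *: e))).

Lemma is_cpartial_continuous f g : is_cpartial f g -> cline_continuous f.
Proof.
move=> fg xi; split => v; have [d1 d2] := fg xi v;
  by apply: differentiable_continuous; apply/derivable1_diffP.
Qed.

Lemma is_cpartialM f f' g g' : is_cpartial f f' -> is_cpartial g g' ->
  is_cpartial (fun xi => f xi * g xi) (fun xi => f' xi * g xi + f xi * g' xi).
Proof.
move=> df dg xi u; have [f1 f2] := df xi u; have [g1 g2] := dg xi u; split.
  under eq_fun do rewrite cReM.
  by apply: is_derive_eq; rewrite !ReImE /GRing.scale/=; ring.
under eq_fun do rewrite cImM.
by apply: is_derive_eq; rewrite !ReImE /GRing.scale/=; ring.
Qed.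

Lemma is_cpartialB f f' g g' : is_cpartial f f' -> is_cpartial g g' ->
  is_cpartial (fun xi => f xi - g xi) (fun xi => f' xi - g' xi).
Proof.
move=> df dg xi u; have [f1 f2] := df xi u; have [g1 g2] := dg xi u; split.
  under eq_fun do rewrite !ReImE.
  by apply: is_derive_eq; rewrite !ReImE.
under eq_fun do rewrite !ReImE.
by apply: is_derive_eq; rewrite !ReImE.
Qed.

Lemma is_cpartialZ f f' (c : R[i]) : is_cpartial f f' ->
  is_cpartial (fun xi => c * f xi) (fun xi => c * f' xi).
Proof.
move=> df xi u; have [f1 f2] := df xi u; split.
  under eq_fun do rewrite cReM.
  by apply: is_derive_eq; rewrite !ReImE /GRing.scale/=; ring.
under eq_fun do rewrite cImM.
by apply: is_derive_eq; rewrite !ReImE /GRing.scale/=; ring.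
Qed.

Lemma is_cpartial_cexp f f' : is_cpartial f f' ->
  is_cpartial (fun xi => cexp (f xi)) (fun xi => f' xi * cexp (f xi)).
Proof.
move=> df xi u; have [f1 f2] := df xi u.
have h0 := is_derive1_comp (is_derive_expR _) f1.
have h1 := is_derive1_comp (is_derive_cos _) f2.
have h2 := is_derive1_comp (is_derive_sin _) f2.
split; [under eq_fun do rewrite cexpE cReM /= mul0r subr0|
        under eq_fun do rewrite cexpE cImM /= mul0r addr0].
  have h := is_deriveM h0 h1.
  by apply: is_derive_eq h _; rewrite cexpE !ReImE /GRing.scale/=; ring.
have h := is_deriveM h0 h2.
by apply: is_derive_eq h _; rewrite cexpE !ReImE /GRing.scale/=; ring.
Qed.

Lemma cline_continuousM f g : cline_continuous f -> cline_continuous g ->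
  cline_continuous (fun xi => f xi * g xi).
Proof.
move=> cf cg xi; have [f1 f2] := cf xi; have [g1 g2] := cg xi; split => v.
  under eq_fun do rewrite cReM.
  by apply: cvgB; apply: cvgM; [exact: f1|exact: g1|exact: f2|exact: g2].
under eq_fun do rewrite cImM.
by apply: cvgD; apply: cvgM; [exact: f1|exact: g2|exact: f2|exact: g1].
Qed.

Lemma cline_continuousD f g : cline_continuous f -> cline_continuous g ->
  cline_continuous (fun xi => f xi + g xi).
Proof.
move=> cf cg xi; have [f1 f2] := cf xi; have [g1 g2] := cg xi; split => v.
  by under eq_fun do rewrite cReD; apply: cvgD; [exact: f1|exact: g1].
by under eq_fun do rewrite cImD; apply: cvgD; [exact: f2|exact: g2].
Qed.

Lemma cline_continuous_cst (c : R[i]) : cline_continuous (fun=> c).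
Proof. by move=> xi; split => v; exact: cvg_cst. Qed.

Lemma cline_continuousZ f (c : R[i]) : cline_continuous f ->
  cline_continuous (fun xi => c * f xi).
Proof. by apply: cline_continuousM; exact: cline_continuous_cst. Qed.

Lemma cline_continuousB f g : cline_continuous f -> cline_continuous g ->
  cline_continuous (fun xi => f xi - g xi).
Proof.
move=> cf cg; apply: cline_continuousD => // xi.
have [g1 g2] := cg xi; split => v.
  by under eq_fun do rewrite cReN; apply: cvgN; exact: g1.
by under eq_fun do rewrite cImN; apply: cvgN; exact: g2.
Qed.

Lemma RFTC2 (F f : R -> R) (a b : R) : a < b -> continuous f ->
  (forall x : R, is_derive x 1 F (f x)) -> \int[mu]_(x in `[a, b]) f x = F b - F a.
Proof.
move=> ab cf dF.
have cF x : {for x, continuous F}.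
  by have := dF x => ?; apply: differentiable_continuous; apply/derivable1_diffP.
rewrite /Rintegral (@continuous_FTC2 _ _ F _ _ ab)//.
- exact: continuous_subspaceT.
- split => //.
  + by apply: cvg_at_right_filter; exact: cF.
  + by apply: cvg_at_left_filter; exact: cF.
- by move=> u _; rewrite derive1E; have := dF u => ?; exact: derive_val.
Qed.

Lemma integrable_continuous_itv (f : R -> R) (a b : R) : continuous f ->
  mu.-integrable `[a, b] (EFin \o f).
Proof.
move=> cf; apply: continuous_compact_integrable; first exact: segment_compact.
exact: continuous_subspaceT.
Qed.

Lemma measurable_line : measurable_fun setT
  (fun z : measurableTypeR R * 'cV[R]_n => z.2 + z.1 *: e).
Proof.
apply: measurable_fun_coordP => i k; under eq_fun do rewrite !mxE.
apply: measurable_funD.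
  by apply: (measurableT_comp (@measurable_coord R n 1 i k)); exact: measurable_snd.
by apply: measurable_funM => //; exact: measurable_fst.
Qed.

(* Integration by parts without boundary terms: translating by [h e_j]
   multiplies the Fourier integral by [cis (h * y_j)], and
   [h = pi / |y_j|] makes this factor equal to [-1]. *)
Lemma fourier_partial f g (y : 'cV[R]_n) : cintegrable f -> cintegrable g ->
  is_cpartial f g -> cline_continuous g -> y j 0 != 0 ->
  fourier (fun xi => 'i%C * g xi) y = - y j 0 * fourier f y.
Proof.
move=> fi gi fg cg yj0.
pose h := pi / `|y j 0|.
have h0 : 0 < h by rewrite divr_gt0 ?pi_gt0// normr_gt0.
pose F (xi : 'cV[R]_n) (u : R) := complex.Re (cis (- dotv xi y) * g (xi + u *: e)).
have dotue (u : R) : dotv (u *: e) y = u * y j 0 by rewrite dotvZl dotv_delta.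
have cF xi : continuous (F xi).
  move=> u; have [g1 g2] := cg xi; rewrite /F; under eq_fun do rewrite cReM.
  by apply: cvgB; apply: cvgM; [exact: cvg_cst|exact: g1|exact: cvg_cst|exact: g2].
(* The increment of f over one step h is the integral of g along the segment. Integrating this
   identity in xi, after Fubini, yields the two evaluations [L] and [Rr] below. *)
have FTC xi : complex.Re (cis (- dotv xi y) * (f (xi + h *: e) - f xi)) =
    \int[mu]_(u in `[0, h]) F xi u.
  pose G u := complex.Re (cis (- dotv xi y) * f (xi + u *: e)).
  have dG (u : R) : is_derive u 1 G (F xi u).
    rewrite /G /F; have [e1 e2] := fg xi u.
    under eq_fun do rewrite cReM.
    by apply: is_derive_eq; rewrite !ReImE /GRing.scale/=; ring.
  rewrite (@RFTC2 G (F xi) 0 h h0 (cF xi) dG).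
  by rewrite /G scale0r addr0 -cReN -cReD -mulrBr.
have mF : measurable_fun setT (fun z : measurableTypeR R * 'cV[R]_n => F z.2 z.1).
  suff : cmeasurable (fun z : measurableTypeR R * 'cV[R]_n =>
      cis (- dotv z.2 y) * g (z.2 + z.1 *: e)) by case.
  apply: cmeasurableM.
    by apply: cmeasurable_cis; apply: measurable_funN; exact: measurable_dotv.
  by apply: (cmeasurable_comp gi.1); exact: measurable_line.
have iF u : lv.-integrable setT (fun xi => (F xi u)%:E).
  exact: (integrable_fourier y (cintegrable_shift (u *: e) gi)).
have Fbd u : (\int[lv]_xi `|F xi u|%:E <= (\int[lv]_xi cmod (g xi))%:E)%E.
  rewrite EFin_Rintegral//; last exact: gi.2.
  have mcg : measurable_fun setT (fun xi => cmod (g xi)) by exact: measurable_cmod gi.1.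
  rewrite -(@ge0_integral_shiftv R n (u *: e) (fun xi => (cmod (g xi))%:E)); last 2 first.
  - exact/measurable_EFinP.
  - by move=> v; rewrite lee_fin cmod_ge0.
  apply: ge0_le_integral => //.
  - apply/measurable_EFinP; apply: measurableT_comp => //.
    exact: integrable_measurable (iF u).
  - apply/measurable_EFinP; apply: (measurableT_comp mcg); exact: measurable_shiftv.
  - move=> xi _; rewrite lee_fin (le_trans (normr_Re_cmod _))//.
    by rewrite cmodM cmod_cis mul1r.
have [_ _ fub] : [/\ mu.-integrable `[0, h] (fun u => (\int[lv]_xi F xi u)%:E),
    lv.-integrable setT (fun xi => (\int[mu]_(u in `[0, h]) F xi u)%:E) &
    \int[mu]_(u in `[0, h]) \int[lv]_xi F xi u =
    \int[lv]_xi \int[mu]_(u in `[0, h]) F xi u].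
  apply: (@Rfubini _ _ _ _ R mu lv `[0, h]%classic setT (fun u xi => F xi u)) => //; last first.
  - by move=> xi _; exact: integrable_continuous_itv.
  - by move=> u _; exact: iF u.
  have h1 : (\int[mu]_(u in `[0%R, h]) \int[lv]_xi `|F xi u|%:E <=
      \int[mu]_(u in `[0%R, h]) (\int[lv]_xi cmod (g xi))%:E)%E.
    apply: ge0_le_integral => //.
    + by move=> u _; exact: integral_ge0.
    + apply: measurable_funTS; apply: (measurable_fun_fubini_tonelli_F
        (fun z : measurableTypeR R * 'cV[R]_n => `|F z.2 z.1|%:E)) => //.
      by apply/measurable_EFinP; exact: measurableT_comp.
  apply: (le_lt_trans h1).
  rewrite integral_cst//= lte_mul_pinfty//.
  - by rewrite lee_fin; apply: Rintegral_ge0 => xi _; exact: cmod_ge0.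
  - by rewrite lebesgue_measure_itv/=; case: ifP => _; rewrite ?ltry// -EFinB ltry.
(* The shifted term contributes - [fourier f y], since h y_j = pi or - pi, and the unshifted one is
   subtracted: hence the factor -2. *)
have L : \int[lv]_xi \int[mu]_(u in `[0, h]) F xi u = - 2 * fourier f y.
  transitivity (fourier (fun xi => f (xi + h *: e) - f xi) y).
    by apply: eq_Rintegral => xi _; rewrite FTC.
  rewrite fourierB//; last exact: cintegrable_shift.
  rewrite fourier_shift// dotue fourierZcis//.
  have -> : cos (h * y j 0) = -1.
    rewrite /h; case: (ltrgtP (y j 0) 0) yj0 => // yj _.
      by rewrite ltr0_norm// invrN mulrN mulNr mulfVK ?lt_eqF// cosN cospi.
    by rewrite gtr0_norm// mulfVK ?gt_eqF// cospi.
  have -> : sin (h * y j 0) = 0.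
    rewrite /h; case: (ltrgtP (y j 0) 0) yj0 => // yj _.
      by rewrite ltr0_norm// invrN mulrN mulNr mulfVK ?lt_eqF// sinN sinpi oppr0.
    by rewrite gtr0_norm// mulfVK ?gt_eqF// sinpi.
  by ring.
(* Over half a period the cosine integrates to 0 and the sine to 2 / y_j, so that only the transform
   of ['i * g] survives. *)
have Rr : \int[mu]_(u in `[0, h]) \int[lv]_xi F xi u =
    2 / y j 0 * fourier (fun xi => 'i%C * g xi) y.
  pose p := fourier g y; pose q := fourier (fun xi => 'i%C * g xi) y.
  transitivity (\int[mu]_(u in `[0, h]) (cos (u * y j 0) * p + sin (u * y j 0) * q)).
    apply: eq_Rintegral => u _.
    transitivity (fourier (fun xi => g (xi + u *: e)) y) => //.
    by rewrite fourier_shift// dotue fourierZcis.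
  pose G u := (sin (u * y j 0) * p - cos (u * y j 0) * q) / y j 0.
  have dG (u : R) : is_derive u 1 G (cos (u * y j 0) * p + sin (u * y j 0) * q).
    by apply: is_derive_eq; rewrite /GRing.scale/=; field.
  have cG : continuous (fun u : R => cos (u * y j 0) * p + sin (u * y j 0) * q).
    move=> u; apply: cvgD; apply: cvgM; try exact: cvg_cst.
      apply: continuous_comp; last exact: continuous_cos.
      by apply: cvgM; [exact: cvg_id|exact: cvg_cst].
    apply: continuous_comp; last exact: continuous_sin.
    by apply: cvgM; [exact: cvg_id|exact: cvg_cst].
  rewrite (@RFTC2 G _ 0 h h0 cG dG).
  rewrite /G !mul0r sin0 cos0.
    have -> : cos (h * y j 0) = -1.
      rewrite /h; case: (ltrgtP (y j 0) 0) yj0 => // yj _.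
        by rewrite ltr0_norm// invrN mulrN mulNr mulfVK ?lt_eqF// cosN cospi.
      by rewrite gtr0_norm// mulfVK ?gt_eqF// cospi.
    have -> : sin (h * y j 0) = 0.
      rewrite /h; case: (ltrgtP (y j 0) 0) yj0 => // yj _.
        by rewrite ltr0_norm// invrN mulrN mulNr mulfVK ?lt_eqF// sinN sinpi oppr0.
      by rewrite gtr0_norm// mulfVK ?gt_eqF// sinpi.
    by rewrite -/q; field.
have := fub; rewrite L Rr => /esym E.
have -> : fourier f y = - 2^-1 * (- 2 * fourier f y) by field.
by rewrite E; field.
Qed.

End fourier_calculus.

(** * Symbol classes and decay of inverse transforms *)

Section symbols.
Context (R : realType) (n : nat) (j : 'I_n) (rho : R).
Hypothesis rho0 : 0 < rho.
Local Notation lv := (lebesgue_vec R n).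
Implicit Types (f g : 'cV[R]_n -> R[i]) (C D : R).

Definition japanese (xi : 'cV[R]_n) : R := 1 + enorm xi / rho.

(* Symbols of order [a] at scale [rho], differentiated [m] times along the
   [j]-th coordinate; each derivative gains a factor [1 / rho]. *)
Fixpoint is_symbol (m a : nat) C f : Prop :=
  [/\ cmeasurable f, cline_continuous j f,
      forall xi, cmod (f xi) <= C * japanese xi ^+ a &
      if m is m'.+1 then
        exists2 g, is_cpartial j f g & is_symbol m' a (C / rho) g
      else True].

Lemma japanese_ge1 xi : 1 <= japanese xi.
Proof. by rewrite /japanese lerDl divr_ge0 ?enorm_ge0// ltW. Qed.

Lemma japanese_ge0 xi : 0 <= japanese xi.
Proof. exact: le_trans (japanese_ge1 xi). Qed.

Lemma is_symbol_cmeasurable m a C f : is_symbol m a C f -> cmeasurable f.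
Proof. by case: m => [|m] []. Qed.

Lemma is_symbol_continuous m a C f : is_symbol m a C f -> cline_continuous j f.
Proof. by case: m => [|m] []. Qed.

Lemma is_symbol_bound m a C f : is_symbol m a C f ->
  forall xi, cmod (f xi) <= C * japanese xi ^+ a.
Proof. by case: m => [|m] []. Qed.

Lemma is_symbol_ge0 m a C f : is_symbol m a C f -> 0 <= C.
Proof.
move=> /is_symbol_bound /(_ 0) h; have := le_trans (cmod_ge0 _) h.
by rewrite pmulr_lge0// exprn_gt0// (lt_le_trans _ (japanese_ge1 _)).
Qed.

Lemma is_symbol_weaken m a C D f : C <= D -> is_symbol m a C f -> is_symbol m a D f.
Proof.
elim: m C D f => [|m IH] C D f CD [mf cf bf df]; split => //.
- by move=> xi; rewrite (le_trans (bf xi))// ler_wpM2r// exprn_ge0// japanese_ge0.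
- by move=> xi; rewrite (le_trans (bf xi))// ler_wpM2r// exprn_ge0// japanese_ge0.
- by have [g fg sg] := df; exists g => //; apply: IH sg; rewrite ler_pM2r ?invr_gt0.
Qed.

Lemma is_symbol_order m a b C f : (a <= b)%N -> is_symbol m a C f -> is_symbol m b C f.
Proof.
move=> ab; elim: m C f => [|m IH] C f sf; have C0 := is_symbol_ge0 sf;
  case: sf => mf cf bf df; split => //.
- by move=> xi; rewrite (le_trans (bf xi))// ler_wpM2l// ler_weXn2l ?japanese_ge1.
- by move=> xi; rewrite (le_trans (bf xi))// ler_wpM2l// ler_weXn2l ?japanese_ge1.
- by have [g fg sg] := df; exists g => //; exact: IH.
Qed.

Lemma is_symbolS m a C f : is_symbol m.+1 a C f -> is_symbol m a C f.
Proof.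
elim: m C f => [|m IH] C f [mf cf bf [g fg sg]]; split => //.
by exists g => //; exact: IH.
Qed.

Lemma is_symbolZ m a C f (c : R[i]) : is_symbol m a C f ->
  is_symbol m a (cmod c * C) (fun xi => c * f xi).
Proof.
elim: m C f => [|m IH] C f [mf cf bf df]; split => //.
- by apply: cmeasurableM => //; exact: cmeasurable_cst.
- exact: cline_continuousZ.
- by move=> xi; rewrite cmodM -mulrA ler_wpM2l// cmod_ge0.
- by apply: cmeasurableM => //; exact: cmeasurable_cst.
- exact: cline_continuousZ.
- by move=> xi; rewrite cmodM -mulrA ler_wpM2l// cmod_ge0.
- have [g fg sg] := df; exists (fun xi => c * g xi); first exact: is_cpartialZ.
  by rewrite -mulrA; exact: IH.
Qed.

Lemma is_symbolB m a C D f g : is_symbol m a C f -> is_symbol m a D g ->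
  is_symbol m a (C + D) (fun xi => f xi - g xi).
Proof.
have bnd C' D' (f' g' : 'cV[R]_n -> R[i]) xi :
    cmod (f' xi) <= C' * japanese xi ^+ a -> cmod (g' xi) <= D' * japanese xi ^+ a ->
    cmod (f' xi - g' xi) <= (C' + D') * japanese xi ^+ a.
  by move=> h1 h2; rewrite (le_trans (cmodB _ _))// mulrDl lerD.
elim: m C D f g => [|m IH] C D f g [mf cf bf df] [mg cg bg dg]; split => //.
- exact: cmeasurableB.
- exact: cline_continuousB.
- by move=> xi; exact: bnd.
- exact: cmeasurableB.
- exact: cline_continuousB.
- by move=> xi; exact: bnd.
- have [f' ff' sf'] := df; have [g' gg' sg'] := dg.
  by exists (fun xi => f' xi - g' xi); [exact: is_cpartialB|rewrite mulrDl; exact: IH].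
Qed.

Lemma is_symbolD m a C D f g : is_symbol m a C f -> is_symbol m a D g ->
  is_symbol m a (C + D) (fun xi => f xi + g xi).
Proof.
move=> sf sg; have := is_symbolB sf (is_symbolZ (-1) sg).
rewrite cmodN ComplexField.Normc.normc1 mul1r.
by rewrite (_ : (fun xi => f xi - -1 * g xi) = (fun xi => f xi + g xi))//;
  apply/funext => xi; rewrite mulN1r opprK.
Qed.

(** By the Leibniz rule each differentiation doubles the number of terms, whence 2^m. *)
Lemma is_symbolM m a b C D f g : is_symbol m a C f -> is_symbol m b D g ->
  is_symbol m (a + b) (2 ^+ m * C * D) (fun xi => f xi * g xi).
Proof.
have bnd C' D' (f' g' : 'cV[R]_n -> R[i]) xi : 0 <= C' ->
    cmod (f' xi) <= C' * japanese xi ^+ a -> cmod (g' xi) <= D' * japanese xi ^+ b ->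
    cmod (f' xi * g' xi) <= (C' * D') * japanese xi ^+ (a + b).
  by move=> C0 h1 h2; rewrite cmodM exprD mulrACA ler_pM// cmod_ge0.
elim: m C D f g => [|m IH] C D f g sf sg.
  have C0 := is_symbol_ge0 sf; case: sf => mf cf bf _; case: sg => mg cg bg _; split => //.
  - exact: cmeasurableM.
  - exact: cline_continuousM.
  - by move=> xi; rewrite expr0 mul1r; exact: bnd.
have C0 := is_symbol_ge0 sf; have D0 := is_symbol_ge0 sg.
have sf' := is_symbolS sf; have sg' := is_symbolS sg.
case: sf => mf cf bf [f' ff' sf]; case: sg => mg cg bg [g' gg' sg]; split => //.
- exact: cmeasurableM.
- exact: cline_continuousM.
- move=> xi; rewrite (le_trans (bnd _ _ _ _ _ C0 (bf xi) (bg xi)))//.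
  rewrite ler_wpM2r ?exprn_ge0 ?japanese_ge0// -mulrA ler_peMl ?mulr_ge0//.
  by rewrite exprn_ege1// ler1n.
- exists (fun xi => f' xi * g xi + f xi * g' xi); first exact: is_cpartialM.
  have := is_symbolD (IH _ _ _ _ sf sg') (IH _ _ _ _ sf' sg).
  apply: is_symbol_weaken; rewrite exprS le_eqVlt; apply/orP; left; apply/eqP.
  by ring.
Qed.

Variables (K : R) (psi psi' : 'cV[R]_n -> R[i]) (N : nat).
Hypothesis mpsi : cmeasurable psi.
Hypothesis dpsi : is_cpartial j psi psi'.
Hypothesis spsi' : forall m, is_symbol m 1 (K / rho) psi'.
Hypothesis ipsi : lv.-integrable setT
  (EFin \o (fun xi => japanese xi ^+ N * expR (- complex.Re (psi xi)))).
Local Notation E := (fun xi => cexp (- psi xi)).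

Lemma cmeasurable_cexp_psi : cmeasurable E.
Proof. by apply: cmeasurable_cexp; exact: cmeasurableN. Qed.

Lemma is_cpartial_cexp_psi : is_cpartial j E (fun xi => - psi' xi * E xi).
Proof.
apply: is_cpartial_cexp => xi u; have [d1 d2] := dpsi xi u; split.
  by under eq_fun do rewrite cReN; apply: is_derive_eq; rewrite cReN.
by under eq_fun do rewrite cImN; apply: is_derive_eq; rewrite cImN.
Qed.

Lemma cmod_symbol_cexp a C f xi : (a <= N)%N -> is_symbol 0 a C f ->
  cmod (f xi * E xi) <= C * (japanese xi ^+ N * expR (- complex.Re (psi xi))).
Proof.
move=> aN sf; have C0 := is_symbol_ge0 sf.
rewrite cmodM cmod_cexp cReN mulrA ler_wpM2r ?expR_ge0//.
rewrite (le_trans (is_symbol_bound sf xi))// ler_wpM2l//.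
by rewrite ler_weXn2l ?japanese_ge1.
Qed.

Lemma cintegrable_symbol m a C f : (a <= N)%N -> is_symbol m a C f ->
  cintegrable (fun xi => f xi * E xi).
Proof.
move=> aN; elim: m C f => [|m IH] C f sf; last exact: IH (is_symbolS sf).
apply: (@cintegrable_le _ _ _
  (fun xi => C * (japanese xi ^+ N * expR (- complex.Re (psi xi))))).
- by apply: cmeasurableM; [exact: is_symbol_cmeasurable sf|exact: cmeasurable_cexp_psi].
- by move=> xi; exact: (@cmod_symbol_cexp a).
- exact: (integrableZl measurableT C ipsi).
Qed.

Let J : R := \int[lv]_xi (japanese xi ^+ N * expR (- complex.Re (psi xi))).

Lemma normr_fourier_symbol a C f y : (a <= N)%N -> is_symbol 0 a C f ->
  `|fourier (fun xi => f xi * E xi) y| <= C * J.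
Proof.
move=> aN sf; have ci := cintegrable_symbol aN sf.
rewrite (le_trans (normr_fourier _ ci))// /J -RintegralZl//.
apply: le_Rintegral => //.
- exact: ci.2.
- exact: (integrableZl measurableT C ipsi).
- by move=> xi _; exact: (@cmod_symbol_cexp a).
Qed.

(** One factor per integration by parts: f is replaced by i (f' - f psi'), and with k derivatives
    left the product f psi' costs 2^k K by the Leibniz bound, against 1 for f'. *)
Definition ibp_constant (m : nat) : R := \prod_(k < m) (1 + 2 ^+ k * K).

Lemma ibp_constantS m : ibp_constant m.+1 = ibp_constant m * (1 + 2 ^+ m * K).
Proof. by rewrite /ibp_constant big_ord_recr. Qed.

(** An integration by parts trades a factor rho |y_j| for a symbol with one derivative fewer and
    order one higher, since psi' has order 1. The sum a + m is therefore constant along the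
    induction, and the weight of degree N dominates throughout. *)
Lemma symbol_decay m a C f (y : 'cV[R]_n) : (a + m <= N)%N -> is_symbol m a C f ->
  y j 0 != 0 ->
  (rho * `|y j 0|) ^+ m * `|fourier (fun xi => f xi * E xi) y| <=
  ibp_constant m * C * J.
Proof.
move=> + + yj0; elim: m a C f => [|m IH] a C f amN sf.
  rewrite expr0 mul1r /ibp_constant big_ord0 mul1r.
  by apply: (normr_fourier_symbol _ _ sf); rewrite -(addn0 a).
have sf' := is_symbolS sf.
have [mf cf bf [g fg sg]] := sf.
pose h xi := 'i%C * (g xi - f xi * psi' xi).
have sh : is_symbol m (a + 1) (C / rho * (1 + 2 ^+ m * K)) h.
  have h1 : is_symbol m (a + 1) (C / rho) g by apply: is_symbol_order sg; rewrite leq_addr.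
  have := is_symbolZ 'i%C (is_symbolB h1 (is_symbolM sf' (spsi' m))).
  by rewrite cmodi mul1r; apply: is_symbol_weaken; rewrite le_eqVlt; apply/orP; left; apply/eqP; ring.
have amN' : ((a + 1) + m <= N)%N by rewrite addn1 addSnnS.
have := IH _ _ _ amN' sh.
have -> : fourier (fun xi => h xi * E xi) y =
    - y j 0 * fourier (fun xi => f xi * E xi) y.
  rewrite -(@fourier_partial R n j (fun xi => f xi * E xi)
    (fun xi => g xi * E xi + f xi * (- psi' xi * E xi)))//.
  - by congr fourier; apply/funext => xi; rewrite /h; ring.
  - by apply: cintegrable_symbol sf; rewrite (leq_trans _ amN)// leq_addr.
  - rewrite (_ : (fun xi => _) = (fun xi => (g xi - f xi * psi' xi) * E xi)).
      apply: (@cintegrable_symbol m (a + 1)); first by rewrite (leq_trans _ amN')// leq_addr.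
      apply: is_symbolB; first by apply: is_symbol_order sg; rewrite leq_addr.
      exact: is_symbolM sf' (spsi' m).
    by apply/funext => xi; ring.
  - by apply: is_cpartialM => //; exact: is_cpartial_cexp_psi.
  - have cE := is_cpartial_continuous is_cpartial_cexp_psi.
    apply: cline_continuousD; apply: cline_continuousM => //.
      exact: is_symbol_continuous sg.
    apply: cline_continuousM => //.
    rewrite (_ : (fun xi => - psi' xi) = (fun xi => (-1) * psi' xi)).
      by apply: cline_continuousZ; exact: is_symbol_continuous (spsi' 0).
    by apply/funext => xi; rewrite mulN1r.
rewrite normrM normrN => h2; rewrite exprS.
have -> : rho * `|y j 0| * (rho * `|y j 0|) ^+ m *
   `|fourier (fun xi => f xi * E xi) y| =
   rho * ((rho * `|y j 0|) ^+ m * (`|y j 0| * `|fourier (fun xi => f xi * E xi) y|)) by ring.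
rewrite (le_trans (ler_wpM2l (ltW rho0) h2))// ibp_constantS le_eqVlt; apply/orP; left.
by apply/eqP; field; rewrite gt_eqF.
Qed.

End symbols.

Section polynomial_weight.
Context (R : realType).
Local Notation mu := (@lebesgue_measure R).

Lemma integral_weight1 (a al : R) : 0 < a -> 1 < al ->
  (\int[mu]_x ((1 + a * `|x|) `^ (- al))%:E = (2 / (a * (al - 1)))%:E)%E.
Proof.
move=> a0 al1.
have pos (x : R) : 0 <= x -> 0 < 1 + a * x by move=> x0; rewrite ltr_pwDl// mulr_ge0// ltW.
have cw (x : R) : 0 <= x -> {for x, continuous (fun x => (1 + a * x) `^ (- al))}.
  move=> x0; have h := is_derive1_powR (- al) (pos x x0).
  have h2 : is_derive x 1 (fun x => 1 + a * x) a.
    by apply: is_derive_eq; rewrite /GRing.scale/=; ring.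
  have h3 := @is_derive1_comp R _ (fun x => 1 + a * x) x _ _ h h2.
  by apply: differentiable_continuous; apply/derivable1_diffP.
rewrite (@ge0_symfun_integralT R (fun x => (1 + a * `|x|) `^ (- al))); last 3 first.
- by move=> x; exact: powR_ge0.
- move=> x; apply: (@continuous_comp _ _ _ (@Num.norm R R) (fun x => (1 + a * x) `^ (- al))).
    exact: norm_continuous.
  exact: cw.
- by move=> x /=; rewrite normrN.
pose F x := (- (a * (al - 1))^-1) * (1 + a * x) `^ (1 - al).
have dF (x : R) : 0 <= x -> is_derive x 1 F ((1 + a * x) `^ (- al)).
  move=> x0; have h := is_derive1_powR (1 - al) (pos x x0).
  have h2 : is_derive x 1 (fun x => 1 + a * x) a.
    by apply: is_derive_eq; rewrite /GRing.scale/=; ring.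
  have h3 := @is_derive1_comp R _ (fun x => 1 + a * x) x _ _ h h2.
  have h4 := is_deriveZ (- (a * (al - 1))^-1) h3.
  apply: is_derive_eq h4 _; rewrite /GRing.scale/= addrAC subrr add0r.
  by field; rewrite ?subr_eq0 !gt_eqF.
have cF0 (x : R) : 0 <= x -> {for x, continuous F}.
  move=> x0; have := dF x x0 => h.
  by apply: differentiable_continuous; apply/derivable1_diffP.
have -> : (\int[mu]_(x in [set x | (0 <= x)%R]) ((1 + a * `|x|) `^ (- al))%:E =
    \int[mu]_(x in `[0%R, +oo[) ((1 + a * x) `^ (- al))%:E)%E.
  rewrite -set_itvcy; apply: eq_integral => x.
  by rewrite inE/= in_itv/= andbT => x0; rewrite ger0_norm.
rewrite (@ge0_continuous_FTC2y _ _ F 0 0)//.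
- rewrite -EFinB -EFinM; congr EFin; rewrite /F mulr0 addr0 powR1.
  by field; rewrite ?subr_eq0 !gt_eqF.
- by move=> x _; exact: powR_ge0.
- apply: continuous_in_subspaceT => x; rewrite inE/= in_itv/= andbT => x0; exact: cw.
- rewrite -[X in _ --> X](mulr0 (- (a * (al - 1))^-1)); apply: cvgM; first exact: cvg_cst.
  apply/cvgrPdist_lt => e e0; near=> x; rewrite sub0r normrN ger0_norm ?powR_ge0//.
  have x0 : 0 <= x by near: x; exact: nbhs_pinfty_ge.
  rewrite /powR gt_eqF ?pos// -[ltRHS]lnK ?posrE// ltr_expR.
  rewrite -opprB mulNr ltrNl mulrC -ltr_pdivrMr ?subr_gt0//.
  rewrite -ltr_expR lnK ?posrE ?pos// -ltrBlDl -ltr_pdivrMl//.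
  by near: x; apply: nbhs_pinfty_gt; exact: num_real.
- by move=> x x0; have := dF x (ltW x0) => h.
- by apply: cvg_at_right_filter; exact: cF0.
- by move=> x; rewrite in_itv/= andbT => x0; rewrite derive1E; have := dF x (ltW x0) => h; exact: derive_val.
Unshelve. all: end_near. Qed.

End polynomial_weight.

Section symbol_L1.
Context (R : realType) (n : nat) (i0 : 'I_n) (rho : R).
Hypothesis rho0 : 0 < rho.
Local Notation lv := (lebesgue_vec R n).

Let n0 : 0 < n%:R :> R.
Proof. by rewrite ltr0n (leq_trans _ (ltn_ord i0)). Qed.

(** The exponent 1 + 1/n exceeds 1, so that every factor is integrable on the line, while the n
    factors together carry only n + 1 powers, the number of integrations by parts. *)
Definition poly_weight (y : 'cV[R]_n) : R :=
  \prod_(i < n) (1 + rho * `|y i 0|) `^ (- (1 + n%:R^-1)).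

Let base_gt0 (x : R) : 0 < 1 + rho * `|x|.
Proof. by rewrite ltr_pwDl// mulr_ge0// ltW. Qed.

Lemma poly_weight_ge0 y : 0 <= poly_weight y.
Proof. by apply: prodr_ge0 => i _; exact: powR_ge0. Qed.

Lemma integral_poly_weight :
  (\int[lv]_y (poly_weight y)%:E = ((2 * n%:R / rho) ^+ n)%:E)%E.
Proof.
have mw : measurable_fun setT (fun x : R => (1 + rho * `|x|) `^ (- (1 + n%:R^-1))).
  apply: (measurableT_comp (measurable_powR _)).
  by apply: measurable_funD => //; apply: measurable_funM => //; exact: measurable_normr.
rewrite /poly_weight (@ge0_integral_prod R n
  (fun _ x => (1 + rho * `|x|) `^ (- (1 + n%:R^-1))) (fun=> 2 * n%:R / rho))//.
- by rewrite prodr_const card_ord.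
- by move=> _ x; exact: powR_ge0.
- move=> _; rewrite integral_weight1// ?ltrDl ?invr_gt0//; congr EFin.
  by rewrite addrAC subrr add0r; field; rewrite !gt_eqF.
Qed.

(** The index j maximises |y_i|: each of the n factors is then at least the (1 + 1/n)-th inverse
    power of 1 + rho |y_j|. *)
Lemma poly_weight_inv y : exists j : 'I_n,
  1 <= poly_weight y * (1 + rho * `|y j 0|) ^+ n.+1.
Proof.
case: (@Order.TotalTheory.arg_maxP _ _ _ i0 xpredT (fun i => `|y i 0|)) => // j _ jmax.
exists j; set b := 1 + rho * _.
have b0 : 0 < b by exact: base_gt0.
have -> : b ^+ n.+1 = \prod_(i < n) b `^ (1 + n%:R^-1).
  rewrite prodr_const card_ord -[RHS]powR_mulrn ?powR_ge0// -powRrM -powR_mulrn ?(ltW b0)//.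
  by congr powR; rewrite -natr1; field; rewrite gt_eqF.
rewrite /poly_weight -big_split/=; elim/big_ind : _ => //.
  by move=> u v u1 v1; rewrite mulr_ege1.
move=> i _; rewrite powRN ler_pdivlMl ?powR_gt0// mulr1.
apply: ge0_ler_powR; rewrite ?nnegrE ?(ltW (base_gt0 _)) ?(ltW b0) ?addr_ge0 ?invr_ge0 ?(ltW n0)//.
by rewrite lerD2l ler_pM2l//; exact: jmax.
Qed.

Variables (K : R) (psi : 'cV[R]_n -> R[i]) (psi' : 'I_n -> 'cV[R]_n -> R[i]).
Hypothesis K0 : 0 <= K.
Hypothesis mpsi : cmeasurable psi.
Hypothesis dpsi : forall j, is_cpartial j psi (psi' j).
Hypothesis spsi' : forall j m, is_symbol j rho m 1 (K / rho) (psi' j).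
Hypothesis ipsi : lv.-integrable setT
  (EFin \o (fun xi => japanese rho xi ^+ (n + 2) * expR (- complex.Re (psi xi)))).
Let J : R := \int[lv]_xi (japanese rho xi ^+ (n + 2) * expR (- complex.Re (psi xi))).

(** The coordinate in which to integrate by parts is the largest one of y; it varies with y, and
    this is why symbol bounds are assumed for every j. Order 1 and n + 1 derivatives use up the
    weight of degree n + 2. *)
Lemma fourier_symbol_le C f y : (forall j, is_symbol j rho n.+1 1 C f) ->
  `|fourier (fun xi => f xi * cexp (- psi xi)) y| <=
  2 ^+ n.+1 * ibp_constant K n.+1 * C * J * poly_weight y.
Proof.
move=> sf; set F := `|_|.
have C0 : 0 <= C := is_symbol_ge0 rho0 (sf i0).
have J0 : 0 <= J.
  by apply: Rintegral_ge0 => xi _; rewrite mulr_ge0 ?expR_ge0// exprn_ge0// japanese_ge0.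
have ibp1 : 1 <= ibp_constant K n.+1.
  rewrite /ibp_constant; elim/big_ind : _ => // [u v u1 v1|k _]; first by rewrite mulr_ege1.
  by rewrite lerDl mulr_ge0// exprn_ge0.
have [j hj] := poly_weight_inv y.
set t := rho * `|y j 0| in hj *.
have t0 : 0 <= t by rewrite mulr_ge0// ltW.
set D := ibp_constant K n.+1 * C * J.
have h1 : F <= D.
  have s0 : is_symbol j rho 0 1 C f.
    by elim: n.+1 (sf j) => // m IH /(is_symbolS); exact: IH.
  have := normr_fourier_symbol rho0 mpsi ipsi y (leq_trans (leqnSn 1) (leq_addl n 2)) s0.
  move=> h; rewrite (le_trans h)// /D -mulrA ler_peMl// mulr_ge0//.
have h2 : t ^+ n.+1 * F <= D.
  have [yj|yj] := eqVneq (y j 0) 0.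
    rewrite /t yj normr0 mulr0 expr0n mul0r /D !mulr_ge0// (le_trans _ ibp1)//.
  apply: (symbol_decay rho0 mpsi (dpsi j) (spsi' j) ipsi _ (sf j) yj).
  by rewrite addn2 add1n.
(* The bound [h1] serves for t <= 1 and [h2] for t > 1; in either case 1 + t is at most 2 max (1,
   t). *)
have h3 : (1 + t) ^+ n.+1 * F <= 2 ^+ n.+1 * D.
  have [t1|t1] := leP t 1.
    rewrite ler_pM ?exprn_ge0 ?addr_ge0//; first exact: normr_ge0.
    by rewrite ler_pXn2r ?nnegrE ?addr_ge0// (_ : 2 = 1 + 1)// lerD2l.
  apply: (@le_trans _ _ ((2 * t) ^+ n.+1 * F)).
    rewrite ler_wpM2r ?normr_ge0// ler_pXn2r ?nnegrE ?addr_ge0// ?mulr_ge0//; last exact: ltW.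
    by rewrite mulrDl mul1r lerD2r ltW.
  by rewrite exprMn -mulrA ler_wpM2l// exprn_ge0.
have -> : 2 ^+ n.+1 * ibp_constant K n.+1 * C * J * poly_weight y =
  poly_weight y * (2 ^+ n.+1 * D) by rewrite /D; ring.
rewrite (le_trans _ (ler_wpM2l (poly_weight_ge0 y) h3))// mulrA.
by rewrite ler_peMl// normr_ge0.
Qed.

Lemma integral_fourier_symbol C f : (forall j, is_symbol j rho n.+1 1 C f) ->
  (\int[lv]_y `|fourier (fun xi => f xi * cexp (- psi xi)) y|%:E <=
   (2 ^+ n.+1 * ibp_constant K n.+1 * (2 * n%:R) ^+ n * C * (rho ^- n * J))%:E)%E.
Proof.
move=> sf.
have C0 : 0 <= C := is_symbol_ge0 rho0 (sf i0).
have J0 : 0 <= J.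
  by apply: Rintegral_ge0 => xi _; rewrite mulr_ge0 ?expR_ge0// exprn_ge0// japanese_ge0.
have ibp0 : 0 <= ibp_constant K n.+1.
  by apply: prodr_ge0 => k _; rewrite addr_ge0// mulr_ge0// exprn_ge0.
have mpw : measurable_fun setT poly_weight.
  apply: (@measurable_prod_coord R n (fun _ x => (1 + rho * `|x|) `^ (- (1 + n%:R^-1)))) => _.
  apply: (measurableT_comp (measurable_powR _)).
  by apply: measurable_funD => //; apply: measurable_funM => //; exact: measurable_normr.
have mf : measurable_fun setT (fourier (fun xi => f xi * cexp (- psi xi))).
  apply: measurable_fourier; apply: (cintegrable_symbol rho0 mpsi ipsi _ (sf i0)).
  by rewrite addn2.
apply: (@le_trans _ _ (\int[lv]_y ((2 ^+ n.+1 * ibp_constant K n.+1 * C * J)%:E *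
   (poly_weight y)%:E))%E).
  apply: ge0_le_integral => //.
  - by apply/measurable_EFinP; exact: measurableT_comp.
  - by apply/measurable_EFinP; apply: measurable_funM.
  - by move=> y _; rewrite lee_fin; exact: fourier_symbol_le.
rewrite ge0_integralZl//; last 3 first.
- by apply/measurable_EFinP.
- by move=> y _; rewrite lee_fin poly_weight_ge0.
- by rewrite lee_fin !mulr_ge0// exprn_ge0.
rewrite integral_poly_weight -EFinM lee_fin exprMn exprVn le_eqVlt; apply/orP; left.
by apply/eqP; ring.
Qed.

End symbol_L1.

(** * Small jumps *)

Section trigonometric_bounds.
Context (R : realType).
Implicit Types u v : R.

Lemma normrB_derive_le (f f' : R -> R) (u M : R) :
  (forall x : R, is_derive x 1 f (f' x)) ->
  (forall x : R, `|x| <= `|u| -> `|f' x| <= M) -> `|f u - f 0| <= M * `|u|.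
Proof.
move=> df bf.
have cf : continuous f.
  by move=> x; have := df x => h; apply: differentiable_continuous; apply/derivable1_diffP.
have [u0|u0|->] := ltgtP u 0; last by rewrite subrr !normr0 mulr0.
- have [c] := @MVT _ f f' u 0 u0 (fun x _ => df x) (continuous_subspaceT cf).
  rewrite in_itv/= => /andP[uc c0] h.
  rewrite distrC h normrM sub0r normrN ler_wpM2r// bf// !ltr0_norm// lerN2 ltW//.
- have [c] := @MVT _ f f' 0 u u0 (fun x _ => df x) (continuous_subspaceT cf).
  rewrite in_itv/= => /andP[c0 uc] h.
  by rewrite h normrM subr0 ler_wpM2r// bf// !gtr0_norm// ltW.
Qed.

Lemma normr_sin_le u : `|sin u| <= `|u|.
Proof.
have := @normrB_derive_le (@sin R) (@cos R) u 1 (@is_derive_sin R).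
rewrite sin0 subr0 mul1r; apply => x _.
by rewrite ler_norml cos_geN1 cos_le1.
Qed.

Lemma oneBcos_ge0 u : 0 <= 1 - cos u.
Proof. by rewrite subr_ge0 cos_le1. Qed.

Lemma is_derive_oneBcos u : is_derive u 1 (fun v : R => 1 - cos v) (sin u).
Proof. by apply: is_derive_eq; rewrite /GRing.scale/=; ring. Qed.

Lemma is_derive_idBsin u : is_derive u 1 (fun v : R => v - sin v) (1 - cos u).
Proof. by apply: is_derive_eq. Qed.

Lemma oneBcos_le u : 1 - cos u <= `|u|.
Proof.
rewrite -[leLHS](ger0_norm (oneBcos_ge0 u)).
have := @normrB_derive_le (fun v => 1 - cos v) (@sin R) u 1 is_derive_oneBcos.
rewrite cos0 subrr subr0 mul1r; apply => x _.
by rewrite ler_norml sin_geN1 sin_le1.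
Qed.

Lemma oneBcos_le_sqr u : 1 - cos u <= `|u| ^+ 2.
Proof.
rewrite -[leLHS](ger0_norm (oneBcos_ge0 u)).
have := @normrB_derive_le (fun v => 1 - cos v) (@sin R) u `|u| is_derive_oneBcos.
rewrite cos0 subrr subr0 expr2; apply => x.
exact: le_trans (normr_sin_le x).
Qed.

Lemma normr_idBsin_le u : `|u - sin u| <= `|u| ^+ 2.
Proof.
have := @normrB_derive_le (fun v => v - sin v) (fun v => 1 - cos v) u `|u| is_derive_idBsin.
rewrite sin0 !subr0 expr2; apply => x.
by move=> h; rewrite ger0_norm ?oneBcos_ge0//; exact: (le_trans (oneBcos_le x)).
Qed.

End trigonometric_bounds.

Section l1_norm.
Context (R : realType) (n : nat).
Implicit Types u v : 'cV[R]_n.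

Definition l1norm v : R := \sum_i `|v i 0|.

Lemma l1norm_ge0 v : 0 <= l1norm v.
Proof. exact: sumr_ge0. Qed.

Lemma coord_le_l1norm v j : `|v j 0| <= l1norm v.
Proof. by rewrite /l1norm (bigD1 j)//= lerDl sumr_ge0. Qed.

Lemma l1norm_shift v (t : R) j : l1norm (v + t *: delta_mx j 0) <= l1norm v + `|t|.
Proof.
rewrite /l1norm [leRHS](_ : _ = \sum_i (`|v i 0| + `|t| * (i == j)%:R)).
  apply: ler_sum => i _; rewrite !mxE eqxx andbT (le_trans (ler_normD _ _))//.
  by rewrite lerD2l normrM; case: (i == j); rewrite ?normr1 ?normr0.
rewrite big_split/=; congr (_ + _); rewrite (bigD1 j)//= eqxx mulr1 big1 ?addr0// => i ij.
by rewrite (negbTE ij) mulr0.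
Qed.

Lemma normr_dotv_l1 u v : `|dotv u v| <= enorm u * l1norm v.
Proof. exact: normr_dotv_enorm. Qed.

Lemma enorm_le_l1norm v : enorm v <= l1norm v.
Proof. exact: enorm_le_sum. Qed.

Lemma measurable_l1norm d (T : measurableType d) (f : T -> 'cV[R]_n) :
  measurable_fun setT f -> measurable_fun setT (fun x => l1norm (f x)).
Proof.
move=> mf; apply: measurable_sum => i; apply: (@measurableT_comp _ _ _ _ _ _ (@Num.norm R R)) => //.
exact: (measurableT_comp (@measurable_coord R n 1 i 0) mf).
Qed.

End l1_norm.

Section levy_symbol.
Context (R : realType) (n : nat) d (E : measurableType d).
Variables (m : {sigma_finite_measure set E -> \bar R}) (S : set E).
Variables (T : E -> 'cV[R]_n) (rho K : R).
Hypothesis rho0 : 0 < rho.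
Hypothesis mS : measurable S.
Hypothesis mT : measurable_fun setT T.
Hypothesis T1 : forall x j, S x -> rho * `|T x j 0| <= 1.
Let tau x := l1norm (T x).
Hypothesis itau : m.-integrable S (EFin \o (fun x => tau x ^+ 2)).
Hypothesis tauK : \int[m]_(x in S) tau x ^+ 2 <= K / rho ^+ 2.

Lemma tau_ge0 x : 0 <= tau x. Proof. exact: l1norm_ge0. Qed.

Lemma K_ge0 : 0 <= K.
Proof.
have : 0 <= K / rho ^+ 2.
  by apply: le_trans tauK; apply: Rintegral_ge0 => x _; rewrite sqr_ge0.
by rewrite pmulr_lge0// invr_gt0 exprn_gt0.
Qed.

Section one_coordinate.
Variable j : 'I_n.

Definition levy_integral (k : nat) (F : R -> R) (xi : 'cV[R]_n) : R :=
  \int[m]_(x in S) (T x j 0 ^+ k * F (dotv xi (T x))).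

(** Domination by the second moment, with a constant that stays bounded as xi moves along a bounded
    segment: this is what differentiation under the integral asks for. *)
Definition levy_dominated (k : nat) (F : R -> R) : Prop :=
  measurable_fun setT F /\ exists C, forall xi x, S x ->
    `|T x j 0 ^+ k * F (dotv xi (T x))| <= C * (1 + l1norm xi) ^+ 2 * tau x ^+ 2.

Let measurable_integrand k F : measurable_fun setT F ->
  measurable_fun setT (fun z : 'cV[R]_n * E => T z.2 j 0 ^+ k * F (dotv z.1 (T z.2))).
Proof.
move=> mF; apply: measurable_funM.
  apply: measurable_funX; apply: (measurableT_comp (@measurable_coord R n 1 j 0)).
  exact: (measurableT_comp mT measurable_snd).
apply: (measurableT_comp mF); apply: measurable_dotv => //.
exact: (measurableT_comp mT measurable_snd).
Qed.

Lemma levy_integrable k F xi : levy_dominated k F ->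
  m.-integrable S (EFin \o (fun x => T x j 0 ^+ k * F (dotv xi (T x)))).
Proof.
move=> [mF [C h]].
apply: (integrable_le_norm _ _ (h xi) (integrableZl mS (C * (1 + l1norm xi) ^+ 2) itau)) => //.
apply: measurable_funTS.
have mz : measurable_fun setT (fun x : E => (xi, x)) by exact: measurable_pair1.
exact: (measurableT_comp (measurable_integrand k mF) mz).
Qed.

Lemma measurable_levy_integral k F : levy_dominated k F ->
  measurable_fun setT (levy_integral k F).
Proof.
move=> dF; apply: (@measurable_Rintegral_param _ _ _ _ R m S
  (fun xi x => T x j 0 ^+ k * F (dotv xi (T x)))) => //.
  exact: measurable_integrand dF.1.
by move=> xi; exact: levy_integrable.
Qed.

Lemma normr_levy_integral k F xi (h : E -> R) : levy_dominated k F ->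
  m.-integrable S (EFin \o h) ->
  (forall x, S x -> `|T x j 0 ^+ k * F (dotv xi (T x))| <= h x) ->
  `|levy_integral k F xi| <= \int[m]_(x in S) h x.
Proof.
move=> dF ih Fh; have iF := levy_integrable xi dF.
rewrite (le_trans (le_normr_Rintegral _ iF))//.
by apply: le_Rintegral => //; exact: integrable_norm iF.
Qed.

Local Notation e := (delta_mx j 0 : 'cV[R]_n).

(** Differentiating <xi, T> along e_j brings down one factor T_j, hence the passage from k to k + 1.
    The bound is uniform on the open interval of radius 1 about u. *)
Lemma is_derive_levy_integral k F F' xi (u : R) :
  (forall v : R, is_derive v 1 F (F' v)) ->
  levy_dominated k F -> levy_dominated k.+1 F' ->
  is_derive u 1 (fun v => levy_integral k F (xi + v *: e))
    (levy_integral k.+1 F' (xi + u *: e)).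
Proof.
move=> dF domF domF'.
pose f (v : R) (x : E) := T x j 0 ^+ k * F (dotv (xi + v *: e) (T x)).
have df (v : R) x : is_derive v 1 (f^~ x) (T x j 0 ^+ k.+1 * F' (dotv (xi + v *: e) (T x))).
  have h1 : is_derive v 1 (fun v => dotv xi (T x) + v * T x j 0) (T x j 0).
    by apply: is_derive_eq; rewrite /GRing.scale/=; ring.
  have E1 w : dotv (xi + w *: e) (T x) = dotv xi (T x) + w * T x j 0.
    by rewrite dotvDl dotvZl dotv_delta.
  have h2 := @is_derive1_comp R F (fun v => dotv xi (T x) + v * T x j 0) v _ _ (dF _) h1.
  rewrite E1 /f; under eq_fun do rewrite E1.
  have h3 := is_deriveZ (T x j 0 ^+ k) h2.
  by apply: is_derive_eq h3 _; rewrite /GRing.scale/= exprSr; ring.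
have pd v x : partial1of2 f v x = T x j 0 ^+ k.+1 * F' (dotv (xi + v *: e) (T x)).
  by rewrite partial1of2E; have h := df v x; exact: derive_val.
have [_ [C hC]] := domF'.
pose G x := `|C| * (1 + (l1norm xi + (`|u| + 1))) ^+ 2 * tau x ^+ 2.
have Iu : u \in `](u - 1), (u + 1)[ by rewrite in_itv/= ltrBlDr !ltrDl ltr01.
have intf v : `](u - 1), (u + 1)[%classic v -> m.-integrable S (EFin \o f v).
  by move=> _; exact: levy_integrable.
have derf v x : `](u - 1), (u + 1)[%classic v -> S x -> derivable (f^~ x) v 1.
  by move=> _ _; have h := df v x; exact: ex_derive.
have G0 x : 0 <= G x by rewrite mulr_ge0 ?sqr_ge0// mulr_ge0 ?sqr_ge0.
have iG : m.-integrable S (EFin \o G).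
  exact: (integrableZl mS (`|C| * (1 + (l1norm xi + (`|u| + 1))) ^+ 2) itau).
have Gub v x : `](u - 1), (u + 1)[%classic v -> S x -> `|partial1of2 f v x| <= G x.
  move=> uv Sx; rewrite pd (le_trans (hC _ x Sx))// ler_wpM2r ?sqr_ge0//.
  apply: (@le_trans _ _ (`|C| * (1 + l1norm (xi + v *: e)) ^+ 2)).
    by rewrite ler_wpM2r ?ler_norm// sqr_ge0.
  rewrite ler_wpM2l// ler_pXn2r ?nnegrE ?addr_ge0 ?l1norm_ge0//.
  rewrite lerD2l (le_trans (l1norm_shift _ _ _))// lerD2l.
  move: uv; rewrite /= in_itv/= => /andP[uv vu].
  rewrite -[v](subrK u) addrC (le_trans (ler_normD _ _))// lerD2l.
  by rewrite ler_norml; apply/andP; split; [rewrite lerBrDr|rewrite lerBlDr]; lra.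
have h1 := derivable_under_integral mS Iu intf derf G0 iG Gub.
have h2 := differentiation_under_integral mS Iu intf derf G0 iG Gub.
apply: DeriveDef; first exact: h1.
rewrite -derive1E; etransitivity; first exact: h2.
by apply: eq_Rintegral => x _; rewrite pd.
Qed.

Lemma levy_integralN k F xi : levy_dominated k F ->
  levy_integral k (fun u => - F u) xi = - levy_integral k F xi.
Proof.
move=> dF; rewrite /levy_integral -[RHS]mulN1r -RintegralZl//.
  by apply: eq_Rintegral => x _; rewrite mulN1r mulrN.
exact: levy_integrable.
Qed.

Lemma normr_dotv_tau (xi : 'cV[R]_n) x : `|dotv xi (T x)| <= enorm xi * tau x.
Proof. exact: normr_dotv_l1. Qed.

(** The missing powers of T come from the vanishing of F at 0: together T_j^k and F have degree 2,
    which the second moment dominates. *)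
Lemma levy_dominated_small k (F : R -> R) : (k <= 2)%N -> measurable_fun setT F ->
  (forall u, `|F u| <= `|u| ^+ (2 - k)) -> levy_dominated k F.
Proof.
move=> k2 mF hF; split => //; exists 1 => xi x _; rewrite mul1r.
have e0 := enorm_ge0 xi; have t0 := tau_ge0 x.
apply: (@le_trans _ _ (tau x ^+ k * (enorm xi * tau x) ^+ (2 - k))).
  rewrite normrM normrX ler_pM ?exprn_ge0 ?normr_ge0//.
    by apply: lerXn2r; rewrite ?nnegrE ?normr_ge0//; exact: coord_le_l1norm.
  rewrite (le_trans (hF _))//; apply: lerXn2r; rewrite ?nnegrE ?normr_ge0 ?mulr_ge0//.
  exact: normr_dotv_tau.
rewrite exprMn mulrCA -exprD subnKC// ler_wpM2r ?sqr_ge0//.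
apply: (@le_trans _ _ ((1 + l1norm xi) ^+ (2 - k))).
  apply: lerXn2r; rewrite ?nnegrE ?addr_ge0 ?l1norm_ge0//.
  by rewrite (le_trans (enorm_le_l1norm _))// lerDr.
by rewrite ler_weXn2l ?leq_subr// lerDl l1norm_ge0.
Qed.

(** This is where smallness of the jumps enters: beyond the second power, each factor T_j gains 1 /
    rho. *)
Lemma coord_power_le k x : S x -> `|T x j 0| ^+ k.+2 <= rho ^- k * tau x ^+ 2.
Proof.
move=> Sx; rewrite -addn2 exprD ler_pM ?exprn_ge0 ?normr_ge0//; last first.
  by rewrite ler_pXn2r ?nnegrE ?tau_ge0 ?normr_ge0//; exact: coord_le_l1norm.
case: k => [|k]; first by rewrite !expr0 invr1.
rewrite -exprVn ler_pXn2r ?nnegrE ?normr_ge0 ?invr_ge0 ?(ltW rho0)//.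
by rewrite -[leRHS]mulr1 ler_pdivlMl// T1.
Qed.

Lemma levy_bounded_le k (F : R -> R) xi x : (forall u, `|F u| <= 1) -> S x ->
  `|T x j 0 ^+ k.+2 * F (dotv xi (T x))| <= rho ^- k * tau x ^+ 2.
Proof.
move=> F1 Sx; rewrite normrM normrX (le_trans _ (coord_power_le k Sx))//.
by rewrite ler_piMr ?exprn_ge0 ?normr_ge0.
Qed.

Lemma levy_dominated_bounded k (F : R -> R) : measurable_fun setT F ->
  (forall u, `|F u| <= 1) -> levy_dominated k.+2 F.
Proof.
move=> mF F1; split => //; exists (rho ^- k) => xi x Sx.
rewrite (le_trans (levy_bounded_le _ _ F1 Sx))// ler_wpM2r ?sqr_ge0//.
rewrite ler_peMr ?invr_ge0 ?exprn_ge0 ?(ltW rho0)//.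
by rewrite exprn_ege1// lerDl l1norm_ge0.
Qed.

Lemma levy_integral_bounded k (F : R -> R) xi : measurable_fun setT F ->
  (forall u, `|F u| <= 1) -> `|levy_integral k.+2 F xi| <= K / rho ^+ k.+2.
Proof.
move=> mF F1.
apply: (le_trans (@normr_levy_integral _ _ xi (fun x => rho ^- k * tau x ^+ 2)
  (levy_dominated_bounded k mF F1) _ _)).
- exact: (integrableZl mS (rho ^- k) itau).
- by move=> x Sx; exact: levy_bounded_le.
rewrite RintegralZl// (le_trans (ler_wpM2l _ tauK))//.
  by rewrite invr_ge0 exprn_ge0// ltW.
have -> : rho ^- k.+2 = rho ^- k * rho ^- 2 by rewrite -!exprVn -exprD addn2.
by rewrite [leLHS]mulrCA.
Qed.

Lemma levy_integral_linear (F : R -> R) xi : measurable_fun setT F ->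
  (forall u, `|F u| <= `|u|) -> `|levy_integral 1 F xi| <= K / rho * (enorm xi / rho).
Proof.
move=> mF F1.
apply: (le_trans (@normr_levy_integral _ _ xi (fun x => enorm xi * tau x ^+ 2)
  (@levy_dominated_small 1 F isT mF F1) _ _)).
- exact: (integrableZl mS (enorm xi) itau).
- move=> x Sx; rewrite expr1 normrM.
  apply: (@le_trans _ _ (tau x * (enorm xi * tau x))); last by rewrite mulrCA -expr2.
  rewrite ler_pM ?normr_ge0//; first exact: coord_le_l1norm.
  by rewrite (le_trans (F1 _))// normr_dotv_tau.
rewrite RintegralZl// (le_trans (ler_wpM2l (enorm_ge0 _) tauK))//.
by rewrite le_eqVlt; apply/orP; left; apply/eqP; field; rewrite gt_eqF.
Qed.

Let m_cos : measurable_fun setT (@cos R).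
Proof. by apply: continuous_measurable_fun; exact: continuous_cos. Qed.
Let m_sin : measurable_fun setT (@sin R).
Proof. by apply: continuous_measurable_fun; exact: continuous_sin. Qed.
Let m_oneBcos : measurable_fun setT (fun u : R => 1 - cos u).
Proof. exact: measurable_funB. Qed.
Let m_idBsin : measurable_fun setT (fun u : R => u - sin u).
Proof. exact: measurable_funB. Qed.
Let cos_b u : `|@cos R u| <= 1.
Proof. by rewrite ler_norml cos_geN1 cos_le1. Qed.
Let sin_b u : `|@sin R u| <= 1.
Proof. by rewrite ler_norml sin_geN1 sin_le1. Qed.

(** Integral of T_j^k e^(i <xi, T>). From k = 2 on it is dominated by the second moment, and
    differentiation just multiplies by i and raises k. *)
Definition levy_moment (k : nat) (xi : 'cV[R]_n) : R[i] :=
  levy_integral k cos xi +i* levy_integral k sin xi.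

(** Integral of - i T_j (e^(i <xi, T>) - 1): the derivative of [levy_psi] along e_j. *)
Definition levy_psi' (xi : 'cV[R]_n) : R[i] :=
  levy_integral 1 sin xi +i* levy_integral 1 (fun u => 1 - cos u) xi.

Lemma is_cpartial_moment k : is_cpartial j (levy_moment k.+2)
  (fun xi => 'i%C * levy_moment k.+3 xi).
Proof.
move=> xi u; split => /=.
  apply: (is_derive_eq (is_derive_levy_integral xi u (fun v => is_derive_cos v) _ _)).
  - exact: levy_dominated_bounded.
  - by apply: levy_dominated_bounded => [|v]; [exact: measurable_funN|rewrite normrN].
  - by rewrite levy_integralN ?mul0r ?sub0r ?mul1r//; exact: levy_dominated_bounded.
apply: (is_derive_eq (is_derive_levy_integral xi u (fun v => is_derive_sin v) _ _)).
- exact: levy_dominated_bounded.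
- exact: levy_dominated_bounded.
- by rewrite mul0r mul1r ?add0r ?addr0.
Qed.

Lemma is_cpartial_psi' : is_cpartial j levy_psi' (levy_moment 2).
Proof.
move=> xi u; split => /=.
  apply: (is_derive_levy_integral xi u (fun v => is_derive_sin v)).
  - by apply: levy_dominated_small => // v; exact: normr_sin_le.
  - exact: levy_dominated_bounded.
apply: (is_derive_levy_integral xi u (fun v => is_derive_oneBcos v)).
- apply: levy_dominated_small => // v; rewrite expr1 ger0_norm ?oneBcos_ge0//.
  exact: oneBcos_le.
- exact: levy_dominated_bounded.
Qed.

Lemma cmeasurable_moment k : cmeasurable (levy_moment k.+2).
Proof. by split; apply: measurable_levy_integral; exact: levy_dominated_bounded. Qed.

(** Every derivative is again a moment, with one more factor 1 / rho and no growth in xi; the 2 adds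
    the real and the imaginary part. *)
Lemma is_symbol_moment a k : is_symbol j rho a 0 (2 * K / rho ^+ k.+2) (levy_moment k.+2).
Proof.
have bnd k' xi : cmod (levy_moment k'.+2 xi) <= 2 * K / rho ^+ k'.+2 * japanese rho xi ^+ 0.
  rewrite expr0 mulr1 (le_trans (cmod_le_ReIm _))//= -mulrA mulrDl mul1r.
  by rewrite lerD// levy_integral_bounded.
elim: a k => [|a IH] k; split => //.
- exact: cmeasurable_moment.
- exact: is_cpartial_continuous (is_cpartial_moment k).
- exact: cmeasurable_moment.
- exact: is_cpartial_continuous (is_cpartial_moment k).
- exists (fun xi => 'i%C * levy_moment k.+3 xi); first exact: is_cpartial_moment.
  have := is_symbolZ 'i%C (IH k.+1); rewrite cmodi mul1r.
  apply: is_symbol_weaken; rewrite // le_eqVlt; apply/orP; left; apply/eqP.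
  by rewrite [in LHS]exprS; field; rewrite gt_eqF ?expf_neq0// gt_eqF.
Qed.

(** Only psi' itself grows, linearly because |sin u| and 1 - cos u are at most |u|; its derivative
    is the second moment, already of order 0. *)
Lemma is_symbol_psi' a : is_symbol j rho a 1 (2 * K / rho) levy_psi'.
Proof.
have mp : cmeasurable levy_psi'.
  split; apply: measurable_levy_integral; apply: levy_dominated_small => // v.
    exact: normr_sin_le.
  by rewrite expr1 ger0_norm ?oneBcos_ge0// oneBcos_le.
have cp := is_cpartial_continuous is_cpartial_psi'.
have bp xi : cmod (levy_psi' xi) <= 2 * K / rho * japanese rho xi ^+ 1.
  have h (F : R -> R) : measurable_fun setT F -> (forall u, `|F u| <= `|u|) ->
      `|levy_integral 1 F xi| <= K / rho * japanese rho xi.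
    move=> mF hF; rewrite (le_trans (levy_integral_linear xi mF hF))//.
    by rewrite ler_wpM2l ?lerDr// divr_ge0 ?K_ge0// ltW.
  have -> : 2 * K / rho * japanese rho xi ^+ 1 =
    K / rho * japanese rho xi + K / rho * japanese rho xi by ring.
  rewrite (le_trans (cmod_le_ReIm _))//= lerD// h// => v.
    exact: normr_sin_le.
  by rewrite ger0_norm ?oneBcos_ge0// oneBcos_le.
case: a => [|a]; split => //.
exists (levy_moment 2); first exact: is_cpartial_psi'.
apply: (@is_symbol_order _ _ _ _ rho0 _ 0) => //.
have := is_symbol_moment a 0; apply: is_symbol_weaken => //.
by rewrite le_eqVlt; apply/orP; left; apply/eqP; field; rewrite gt_eqF.
Qed.

(** Exponent of the jumps in [S], compensated on all of [S]: the integrand is 1 - e^(i theta) + i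
    theta with theta = <xi, T>. *)
Definition levy_psi (xi : 'cV[R]_n) : R[i] :=
  (\int[m]_(x in S) (1 - cos (dotv xi (T x)))) +i*
  (\int[m]_(x in S) (dotv xi (T x) - sin (dotv xi (T x)))).

Lemma levy_psiE xi : levy_psi xi =
  levy_integral 0 (fun u => 1 - cos u) xi +i* levy_integral 0 (fun u => u - sin u) xi.
Proof. by congr (_ +i* _); apply: eq_Rintegral => x _; rewrite expr0 mul1r. Qed.

Let dom_oneBcos : levy_dominated 0 (fun u => 1 - cos u).
Proof.
apply: levy_dominated_small => // v; rewrite subn0.
by rewrite ger0_norm ?oneBcos_ge0// oneBcos_le_sqr.
Qed.

Let dom_idBsin : levy_dominated 0 (fun u => u - sin u).
Proof. by apply: levy_dominated_small => // v; exact: normr_idBsin_le. Qed.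

Lemma cmeasurable_levy_psi : cmeasurable levy_psi.
Proof.
rewrite (_ : levy_psi = fun xi => levy_integral 0 (fun u => 1 - cos u) xi +i*
  levy_integral 0 (fun u => u - sin u) xi); last by apply/funext => xi; exact: levy_psiE.
by split; exact: measurable_levy_integral.
Qed.

Lemma is_cpartial_levy_psi : is_cpartial j levy_psi levy_psi'.
Proof.
rewrite (_ : levy_psi = fun xi => levy_integral 0 (fun u => 1 - cos u) xi +i*
  levy_integral 0 (fun u => u - sin u) xi); last by apply/funext => xi; exact: levy_psiE.
move=> xi u; split => /=.
  apply: (is_derive_levy_integral xi u (fun v => is_derive_oneBcos v)) => //.
  by apply: levy_dominated_small => // v; exact: normr_sin_le.
apply: (is_derive_levy_integral xi u (fun v => is_derive_idBsin v)) => //.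
apply: levy_dominated_small => // v; rewrite expr1 ger0_norm ?oneBcos_ge0//.
exact: oneBcos_le.
Qed.

End one_coordinate.

End levy_symbol.

(** * The exponential factor carrying the displacement c *)

Section exponential_symbol.
Context (R : realType) (n : nat) (j : 'I_n) (rho : R) (c : 'cV[R]_n).
Hypothesis rho0 : 0 < rho.
Hypothesis c1 : rho * `|c j 0| <= 1.
Local Notation e := (delta_mx j 0 : 'cV[R]_n).

Lemma cmeasurable_cis_dotv : cmeasurable (fun xi : 'cV[R]_n => cis (dotv xi c)).
Proof. by apply: cmeasurable_cis; exact: measurable_dotv. Qed.

Lemma is_cpartial_cis : is_cpartial j (fun xi => cis (dotv xi c))
  (fun xi => ('i * (c j 0)%:C)%C * cis (dotv xi c)).
Proof.
move=> xi u.
have h1 : is_derive u 1 (fun v : R => dotv (xi + v *: e) c) (c j 0).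
  under eq_fun do rewrite dotvDl dotvZl dotv_delta.
  by apply: is_derive_eq; rewrite /GRing.scale/=; ring.
split => /=.
  apply: (is_derive_eq (@is_derive1_comp R (@cos R) (fun v => dotv (xi + v *: e) c) u _ _ (is_derive_cos _) h1)).
  by ring.
apply: (is_derive_eq (@is_derive1_comp R (@sin R) (fun v => dotv (xi + v *: e) c) u _ _ (is_derive_sin _) h1)).
by ring.
Qed.

Lemma is_symbol_cis m (a : R[i]) :
  is_symbol j rho m 0 (cmod a) (fun xi => a * cis (dotv xi c)).
Proof.
have ma (z : R[i]) : cmeasurable (fun xi : 'cV[R]_n => z * cis (dotv xi c)).
  by apply: cmeasurableM; [exact: cmeasurable_cst|exact: cmeasurable_cis_dotv].
have da (z : R[i]) := is_cpartialZ z is_cpartial_cis.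
have ba (z : R[i]) xi : cmod (z * cis (dotv xi c)) <= cmod z * japanese rho xi ^+ 0.
  by rewrite cmodM cmod_cis.
elim: m a => [|m IH] a; split => //.
- exact: is_cpartial_continuous (da a).
- exact: is_cpartial_continuous (da a).
- exists (fun xi => a * (('i * (c j 0)%:C)%C * cis (dotv xi c))); first exact: da.
  under [X in is_symbol _ _ _ _ _ X]eq_fun do rewrite mulrA.
  have := IH (a * ('i * (c j 0)%:C)%C); apply: is_symbol_weaken => //.
  rewrite cmodM ler_wpM2l ?cmod_ge0// cmodM cmodi mul1r cmod_real.
  by rewrite -[leRHS]mulr1 ler_pdivlMl.
Qed.

(** The origin of the factor rho |c| of the estimate. The value is at most 2 |<xi, c>|, linear in
    xi, and the first derivative has size |c_j| = rho |c_j| / rho; the later ones gain 1 / rho each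
    because rho |c_j| <= 1. *)
Lemma is_symbol_cisB1 m :
  is_symbol j rho m 1 (2 * (rho * l1norm c)) (fun xi => cis (dotv xi c) - 1).
Proof.
have d1 : is_cpartial j (fun xi => cis (dotv xi c) - 1)
    (fun xi => ('i * (c j 0)%:C)%C * cis (dotv xi c)).
  have h : is_cpartial j (fun=> 1 : R[i]) (fun=> 0) by move=> xi u; split; exact: is_derive_cst.
  have := is_cpartialB is_cpartial_cis h.
  by rewrite [X in is_cpartial _ _ X](_ : _ =
    (fun xi => ('i * (c j 0)%:C)%C * cis (dotv xi c)))//; apply/funext => xi; rewrite subr0.
have m1 : cmeasurable (fun xi : 'cV[R]_n => cis (dotv xi c) - 1).
  by apply: cmeasurableB; [exact: cmeasurable_cis_dotv|exact: cmeasurable_cst].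
have c1' := is_cpartial_continuous d1.
have b1 xi : cmod (cis (dotv xi c) - 1) <= 2 * (rho * l1norm c) * japanese rho xi ^+ 1.
  have hd : `|dotv xi c| <= rho * l1norm c * japanese rho xi.
    rewrite (le_trans (normr_dotv_l1 _ _))// /japanese mulrDr mulr1.
    rewrite -[X in _ <= _ + X](_ : enorm xi * l1norm c = _); last by field; rewrite gt_eqF.
    by rewrite lerDr mulr_ge0 ?l1norm_ge0// ltW.
  rewrite (le_trans (cmod_le_ReIm _))//= expr1 subr0 -mulrA mulrDl !mul1r lerD//.
    by rewrite distrC ger0_norm ?oneBcos_ge0// (le_trans (oneBcos_le _)).
  by rewrite (le_trans (normr_sin_le _)).
case: m => [|m]; split => //.
exists (fun xi => ('i * (c j 0)%:C)%C * cis (dotv xi c)) => //.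
apply: (@is_symbol_order _ _ _ _ rho0 _ 0) => //.
apply: (is_symbol_weaken rho0 _ (is_symbol_cis m ('i * (c j 0)%:C)%C)).
rewrite cmodM cmodi mul1r cmod_real -[leRHS](_ : 2 * l1norm c = _); last by field; rewrite gt_eqF.
rewrite (le_trans (coord_le_l1norm c j))// mulrDl mul1r lerDl; exact: l1norm_ge0.
Qed.

End exponential_symbol.

(** * Large jumps *)

Section complex_power_limit.
Context (R : realType).
Implicit Types z w : R[i].

Lemma cmod_subX z w (B : R) N : cmod z <= B -> cmod w <= B -> 1 <= B ->
  cmod (z ^+ N - w ^+ N) <= N%:R * B ^+ N * cmod (z - w).
Proof.
move=> zB wB B1; have B0 : 0 <= B := le_trans ler01 B1.
elim: N => [|N IH]; first by rewrite !expr0 subrr mul0r mul0r ComplexField.Normc.normc0.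
have -> : z ^+ N.+1 - w ^+ N.+1 = z * (z ^+ N - w ^+ N) + (z - w) * w ^+ N.
  by rewrite !exprS; ring.
rewrite (le_trans (cmodD _ _))// !cmodM cmodX.
have -> : N.+1%:R * B ^+ N.+1 * cmod (z - w) =
    B * (N%:R * B ^+ N * cmod (z - w)) + cmod (z - w) * B ^+ N.+1.
  by rewrite -natr1 exprS; ring.
rewrite lerD//; first by rewrite ler_pM ?cmod_ge0.
rewrite ler_wpM2l ?cmod_ge0//.
apply: (@le_trans _ _ (B ^+ N)); last by rewrite ler_weXn2l.
by apply: lerXn2r; rewrite ?nnegrE ?cmod_ge0.
Qed.

Lemma expr_1Ddiv_le (x : R) N : 0 <= x -> (1 + x / N%:R) ^+ N <= expR x.
Proof.
case: N => [|N] x0; first by rewrite expr0 -expR0 ler_expR.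
have -> : expR x = expR (x / N.+1%:R) ^+ N.+1.
  by rewrite -expRM_natl mulrC divfK ?pnatr_eq0.
by apply: lerXn2r; rewrite ?nnegrE ?expR_ge0 ?expR_ge1Dx// addr_ge0// divr_ge0.
Qed.

Lemma cvg_cexp_quotient (f : R -> R) (l : R) (N_ : nat -> R) :
  (forall k, 0 < N_ k) -> N_ k @[k --> \oo] --> +oo ->
  f 0 = 0 -> is_derive (0 : R) 1 f l ->
  N_ k * f ((N_ k)^-1) @[k --> \oo] --> l.
Proof.
move=> N0 Noo f0 df.
have d : derivable f 0 1 by exact: ex_derive.
have h0 : h^-1 *: (f (h *: 1 + 0) - f 0) @[h --> 0^'] --> l.
  by rewrite -(@derive_val _ _ _ _ _ _ _ df); exact: d.
have c0 : (N_ k)^-1 @[k --> \oo] --> (0 : R).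
  by apply/gtr0_cvgV0 => //; exact: nearW.
have cn k : (N_ k)^-1 != 0 by rewrite invr_eq0 gt_eqF.
have := (cvgr_dnbhsP _ _ _).1 h0 _ (conj cn c0).
apply: cvg_trans; apply: near_eq_cvg; near=> k.
by rewrite /= invrK addr0 /GRing.scale/= mulr1 f0 subr0.
Unshelve. all: end_near. Qed.

End complex_power_limit.

Section compound_poisson.
Context (R : realType) (n : nat) d (E : measurableType d).
Variables (m : {sigma_finite_measure set E -> \bar R}) (L : set E).
Variables (T : E -> 'cV[R]_n).
Hypothesis mL : measurable L.
Hypothesis mT : measurable_fun setT T.
Hypothesis Loo : (m L < +oo)%E.
Local Notation lv := (lebesgue_vec R n).
Let lam : R := fine (m L).

Let lamE : m L = lam%:E.
Proof. by rewrite fineK// ge0_fin_numE. Qed.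

Let lam0 : 0 <= lam.
Proof. exact: fine_ge0. Qed.

Definition fourier_L1 (f : 'cV[R]_n -> R[i]) : \bar R :=
  (\int[lv]_y `|fourier f y|%:E)%E.

Definition jump_mean (xi : 'cV[R]_n) : R[i] :=
  (\int[m]_(x in L) cos (dotv xi (T x))) +i* (\int[m]_(x in L) sin (dotv xi (T x))).

Definition jump_psi (xi : 'cV[R]_n) : R[i] := lam%:C - jump_mean xi.

Let integrable_cst_L (C : R) : m.-integrable L (EFin \o cst C).
Proof.
apply/integrable_norm_lty => //; split; first exact: measurable_cst.
by rewrite (integral_cst m mL (`|C|%:E)); apply: lte_mul_pinfty; rewrite ?lee_fin.
Qed.

Lemma integrable_bounded_L (f : E -> R) (C : R) : measurable_fun setT f ->
  (forall x, `|f x| <= C) -> m.-integrable L (EFin \o f).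
Proof.
move=> mf fC; apply: (@integrable_le_norm _ _ _ _ _ _ (cst C)) => //.
  exact: measurable_funTS.
Qed.

Lemma normr_Rintegral_bounded_L (f : E -> R) (C : R) : measurable_fun setT f ->
  (forall x, `|f x| <= C) -> `|\int[m]_(x in L) f x| <= C * lam.
Proof.
move=> mf fC; have fi := integrable_bounded_L mf fC.
rewrite (le_trans (le_normr_Rintegral _ fi))//.
have -> : C * lam = \int[m]_(x in L) (cst C x) by rewrite Rintegral_cst.
apply: le_Rintegral => //; exact: integrable_norm fi.
Qed.

Let m_trig (F : R -> R) xi : continuous F -> measurable_fun setT (fun x => F (dotv xi (T x))).
Proof.
move=> cF; apply: (measurableT_comp (continuous_measurable_fun cF)).
exact: measurable_dotv.
Qed.

Let cos_b u : `|@cos R u| <= 1.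
Proof. by rewrite ler_norml cos_geN1 cos_le1. Qed.
Let sin_b u : `|@sin R u| <= 1.
Proof. by rewrite ler_norml sin_geN1 sin_le1. Qed.

Let int_trig (F : R -> R) xi : continuous F -> (forall u, `|F u| <= 1) ->
  m.-integrable L (EFin \o (fun x => F (dotv xi (T x)))).
Proof. by move=> cF F1; apply: (@integrable_bounded_L _ 1) => //; exact: m_trig. Qed.

Lemma cmeasurable_jump_mean : cmeasurable jump_mean.
Proof.
have h (F : R -> R) : continuous F -> (forall u, `|F u| <= 1) ->
    measurable_fun setT (fun xi => \int[m]_(x in L) F (dotv xi (T x))).
  move=> cF F1; apply: (@measurable_Rintegral_param _ _ _ _ R m L
    (fun xi x => F (dotv xi (T x)))) => //; last by move=> xi; exact: int_trig.
  apply: (measurableT_comp (continuous_measurable_fun cF)); apply: measurable_dotv => //.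
  exact: (measurableT_comp mT measurable_snd).
by split; apply: h => //; [exact: continuous_cos|exact: continuous_sin].
Qed.

Lemma cmod_jump_mean xi : cmod (jump_mean xi) <= 2 * lam.
Proof.
rewrite (le_trans (cmod_le_ReIm _))//= mulrDl lerD// normr_Rintegral_bounded_L//.
  by apply: m_trig; exact: continuous_cos.
by apply: m_trig; exact: continuous_sin.
Qed.

Lemma cmod_jump_psi xi : cmod (jump_psi xi) <= 3 * lam.
Proof.
rewrite (le_trans (cmodB _ _))// cmod_real ger0_norm//.
by have := cmod_jump_mean xi; lra.
Qed.

Lemma cintegrable_jump_mean g : cintegrable g ->
  cintegrable (fun xi => jump_mean xi * g xi).
Proof.
move=> ig; apply: cintegrableMbounded cmod_jump_mean ig.
exact: cmeasurable_jump_mean.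
Qed.

(** The factor e^(i <xi, T x>) shifts the argument y to y - T x, so that multiplication by
    [jump_mean] amounts to averaging translates over the jumps. *)
Lemma fourier_jump_mean g y : cintegrable g ->
  fourier (fun xi => jump_mean xi * g xi) y =
  \int[m]_(x in L) fourier g (y - T x).
Proof.
move=> ig; have [mg gi] := ig.
pose f (xi : 'cV[R]_n) (x : E) := complex.Re (cis (- dotv xi (y - T x)) * g xi).
have fE xi x : f xi x = complex.Re (cis (- dotv xi y) * g xi) * cos (dotv xi (T x)) -
    complex.Im (cis (- dotv xi y) * g xi) * sin (dotv xi (T x)).
  rewrite /f dotvBr opprB addrC cisD -mulrA [X in complex.Re X]mulrCA mulrA -mulrA.
  by case: (cis (- dotv xi y) * g xi) => a b; rewrite cReM /=; ring.
have mf : measurable_fun setT (fun z : 'cV[R]_n * E => f z.1 z.2).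
  apply: (cmeasurableM _ (cmeasurable_comp mg measurable_fst)).1.
  apply: cmeasurable_cis; apply: measurable_funN; apply: measurable_dotv => //.
  apply: (measurable_fun_coordP) => i j.
  under eq_fun do rewrite !mxE.
  apply: measurable_funB => //; apply: (measurableT_comp (@measurable_coord R n 1 i j)).
  exact: (measurableT_comp mT measurable_snd).
have fb xi x : `|f xi x| <= cmod (g xi).
  by rewrite (le_trans (normr_Re_cmod _))// cmodM cmod_cis mul1r.
have if1 xi : m.-integrable L (EFin \o f xi).
  apply: (@integrable_bounded_L _ (cmod (g xi))) => //.
  exact: (measurableT_comp mf (measurable_pair1 xi)).
have [] // := @Rfubini _ _ _ _ R lv m setT L f.
- apply: (@le_lt_trans _ _ (\int[lv]_xi ((cmod (g xi))%:E * lam%:E))%E).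
    have eI xi : (\int[m]_(x in L) `|f xi x|%:E = (\int[m]_(x in L) `|f xi x|)%:E)%E.
      by rewrite EFin_Rintegral//; exact: integrable_norm (if1 xi).
    apply: ge0_le_integral => //.
    + by move=> xi _; exact: integral_ge0.
    + under eq_fun do rewrite eI.
      apply/measurable_EFinP.
      apply: (@measurable_Rintegral_param _ _ _ _ R m L (fun xi x => `|f xi x|)) => //.
        exact: measurableT_comp.
      by move=> xi; exact: integrable_norm (if1 xi).
    + apply: emeasurable_funM => //; apply/measurable_EFinP; exact: measurable_cmod.
    + move=> xi _; rewrite -lamE -[leRHS](integral_cst m mL) .
      apply: ge0_le_integral => //.
      * by apply/measurable_EFinP; apply: measurableT_comp => //; apply: measurable_funTS; exact: (measurableT_comp mf (measurable_pair1 xi)).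
      * by move=> x _; rewrite lee_fin.
  rewrite ge0_integralZr//; last 2 first.
  + by apply/measurable_EFinP; exact: measurable_cmod.
  + by move=> xi _; rewrite lee_fin cmod_ge0.
  apply: lte_mul_pinfty; rewrite ?ltry//.
    by apply: integral_ge0 => xi _; rewrite lee_fin cmod_ge0.
  rewrite -EFin_Rintegral//; exact: ltry.
- by move=> x Lx; exact: integrable_fourier.
move=> _ _ <-; apply: eq_Rintegral => xi _.
transitivity (\int[m]_(x in L) (complex.Re (cis (- dotv xi y) * g xi) * cos (dotv xi (T x)) -
    complex.Im (cis (- dotv xi y) * g xi) * sin (dotv xi (T x)))); last first.
  by apply: eq_Rintegral => x _; rewrite fE.
rewrite RintegralB//; last 2 first.
- by apply: (integrableZl mL _ (int_trig xi _ cos_b)); exact: continuous_cos.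
- by apply: (integrableZl mL _ (int_trig xi _ sin_b)); exact: continuous_sin.
rewrite !RintegralZl//; last 2 first.
- by apply: int_trig => //; exact: continuous_sin.
- by apply: int_trig => //; exact: continuous_cos.
by rewrite mulrCA; case: (cis (- dotv xi y) * g xi) => a b; rewrite cReM /=; ring.
Qed.

(** Translations preserve the L1 norm, so the average costs at most the total mass of [L]. *)
Lemma fourier_L1_jump_mean g : cintegrable g ->
  (fourier_L1 (fun xi => (jump_mean xi * g xi)%R) <= lam%:E * fourier_L1 g)%E.
Proof.
move=> ig; have mFg := measurable_fourier ig.
have mF : measurable_fun setT (fun z : 'cV[R]_n * E => fourier g (z.1 - T z.2)).
  apply: (measurableT_comp mFg); apply: (measurable_fun_coordP) => i j.
  under eq_fun do rewrite !mxE.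
  apply: measurable_funB.
    exact: (measurableT_comp (@measurable_coord R n 1 i j) measurable_fst).
  apply: (measurableT_comp (@measurable_coord R n 1 i j)).
  exact: (measurableT_comp mT measurable_snd).
pose h (z : 'cV[R]_n * E) := (`|fourier g (z.1 - T z.2)| * \1_L z.2)%:E.
have mh : measurable_fun setT h.
  apply/measurable_EFinP; apply: measurable_funM; first exact: measurableT_comp.
  exact: (measurableT_comp (measurable_indic mL)).
have h0 z : (0 <= h z)%E by rewrite lee_fin mulr_ge0.
have hE y : (\int[m]_x h (y, x) = \int[m]_(x in L) `|fourier g (y - T x)|%:E)%E.
  rewrite [RHS]integral_mkcond; apply: eq_integral => x _.
  by rewrite /h /= indicE patchE; case: (x \in L); rewrite ?mulr1 ?mulr0.
apply: (@le_trans _ _ (\int[lv]_y \int[m]_x h (y, x))%E).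
  apply: ge0_le_integral => //.
  - by apply/measurable_EFinP; apply: measurableT_comp => //; apply: measurable_fourier; exact: cintegrable_jump_mean.
  - exact: (measurable_fun_fubini_tonelli_F h).
  - move=> y _; rewrite fourier_jump_mean// hE.
    have iF : m.-integrable L (EFin \o (fun x => fourier g (y - T x))).
      apply: (@integrable_bounded_L _ (\int[lv]_xi cmod (g xi))).
        exact: (measurableT_comp mF (measurable_pair1 y)).
      by move=> x; exact: normr_fourier.
    rewrite -EFin_Rintegral//; last exact: integrable_norm iF.
    by rewrite lee_fin le_normr_Rintegral.
rewrite (fubini_tonelli h)//.
have -> : (\int[m]_x \int[lv]_y h (y, x) = \int[m]_x (fourier_L1 g * (\1_L x)%:E))%E.
  apply: eq_integral => x _; rewrite /h /=.
  under eq_integral do rewrite EFinM.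
  have mg : measurable_fun setT (fun y : 'cV[R]_n => `|fourier g (y - T x)|%:E).
    apply/measurable_EFinP; apply: measurableT_comp => //.
    by apply: (measurableT_comp mFg); exact: measurable_shiftv.
  rewrite (ge0_integralZr lv measurableT mg); last 2 first.
  - by move=> y _; rewrite lee_fin.
  - by rewrite lee_fin.
  have mg0 : measurable_fun setT (fun y : 'cV[R]_n => `|fourier g y|%:E).
    by apply/measurable_EFinP; exact: measurableT_comp.
  have g0 (y : 'cV[R]_n) : (0 <= `|fourier g y|%:E)%E by rewrite lee_fin.
  by rewrite /fourier_L1 -(ge0_integral_shiftv (- T x) mg0 g0).
rewrite ge0_integralZl//; last 2 first.
- by apply/measurable_EFinP; exact: measurable_indic.
- by apply: integral_ge0 => y _; rewrite lee_fin.
have -> : (\int[m]_x (\1_L x)%:E = lam%:E)%E.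
  by rewrite integral_indic// setIT; exact: lamE.
by rewrite muleC.
Qed.

Lemma fourier_lincomb (a b : R) (f g : 'cV[R]_n -> R[i]) y : cintegrable f -> cintegrable g ->
  fourier (fun xi => a%:C * f xi + b%:C * g xi) y = a * fourier f y + b * fourier g y.
Proof.
move=> cf cg; rewrite /fourier -!RintegralZl//; try exact: integrable_fourier.
rewrite -RintegralD//; last 2 first.
- exact: (integrableZl measurableT _ (integrable_fourier y cf)).
- exact: (integrableZl measurableT _ (integrable_fourier y cg)).
apply: eq_Rintegral => xi _; case: (cis _) => u v; case: (f xi) => p q; case: (g xi) => r s /=.
by ring.
Qed.

Definition jump_factor (a : R) (xi : 'cV[R]_n) : R[i] := 1 - a%:C * jump_psi xi.

Lemma cmeasurable_jump_factor a : cmeasurable (jump_factor a).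
Proof.
apply: cmeasurableB; first exact: cmeasurable_cst.
apply: cmeasurableM; first exact: cmeasurable_cst.
by apply: cmeasurableB; [exact: cmeasurable_cst|exact: cmeasurable_jump_mean].
Qed.

Lemma cmod_jump_factor a xi : 0 <= a -> cmod (jump_factor a xi) <= 1 + a * (3 * lam).
Proof.
move=> a0; rewrite (le_trans (cmodB _ _))// ComplexField.Normc.normc1 lerD2l.
by rewrite cmodM cmod_real ger0_norm// ler_wpM2l// cmod_jump_psi.
Qed.

Lemma cintegrable_jump_factor a g : 0 <= a -> cintegrable g ->
  cintegrable (fun xi => jump_factor a xi * g xi).
Proof.
move=> a0; apply: (@cintegrableMbounded _ _ _ _ (1 + a * (3 * lam))).
  exact: cmeasurable_jump_factor.
by move=> xi; exact: cmod_jump_factor.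
Qed.

(** The factor equals (1 - a lam) + a [jump_mean]. Both coefficients are nonnegative, and the two
    contributions 1 - a lam and a lam add up to 1. *)
Lemma fourier_L1_jump_factor a g : 0 <= a -> a * lam <= 1 -> cintegrable g ->
  (fourier_L1 (fun xi => (jump_factor a xi * g xi)%R) <= fourier_L1 g)%E.
Proof.
move=> a0 alam ig; have ib := cintegrable_jump_mean ig.
have b0 : 0 <= 1 - a * lam by rewrite subr_ge0.
have mF f : cintegrable f -> measurable_fun setT (fun y => `|fourier f y|%:E).
  by move=> cf; apply/measurable_EFinP; apply: measurableT_comp => //; exact: measurable_fourier.
apply: (@le_trans _ _ (\int[lv]_y ((1 - a * lam)%:E * `|fourier g y|%:E +
    a%:E * `|fourier (fun xi => jump_mean xi * g xi)%R y|%:E))%E).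
  apply: ge0_le_integral => //.
  - by apply: mF; exact: cintegrable_jump_factor.
  - by apply: emeasurable_funD; apply: emeasurable_funM => //; exact: mF.
  - move=> y _.
    have -> : fourier (fun xi => jump_factor a xi * g xi) y =
        (1 - a * lam) * fourier g y + a * fourier (fun xi => jump_mean xi * g xi) y.
      rewrite -fourier_lincomb//; congr fourier; apply/funext => xi.
      rewrite /jump_factor /jump_psi rmorphB rmorphM /= rmorph1; ring.
    rewrite -!EFinM -EFinD lee_fin (le_trans (ler_normD _ _))// !normrM.
    by rewrite (ger0_norm a0) (ger0_norm b0).
rewrite ge0_integralD//; last 4 first.
- by move=> y _; rewrite -EFinM lee_fin mulr_ge0.
- by apply: emeasurable_funM => //; exact: mF.
- by move=> y _; rewrite -EFinM lee_fin mulr_ge0.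
- by apply: emeasurable_funM => //; exact: mF.
rewrite !ge0_integralZl//; try (by rewrite lee_fin); try exact: mF.
apply: (@le_trans _ _ ((1 - a * lam)%:E * fourier_L1 g + a%:E * (lam%:E * fourier_L1 g))%E).
  by rewrite leeD2l// lee_wpmul2l ?lee_fin// fourier_L1_jump_mean.
rewrite muleA -EFinM -ge0_muleDl ?lee_fin ?mulr_ge0// -EFinD subrK mul1e//.
Qed.

Lemma fourier_L1_jump_factorX a g N : 0 <= a -> a * lam <= 1 -> cintegrable g ->
  cintegrable (fun xi => jump_factor a xi ^+ N * g xi) /\
  (fourier_L1 (fun xi => (jump_factor a xi ^+ N * g xi)%R) <= fourier_L1 g)%E.
Proof.
move=> a0 alam ig; elim: N => [|N [IH1 IH2]].
  by rewrite (_ : (fun xi => _) = g)//; apply/funext => xi; rewrite expr0 mul1r.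
rewrite (_ : (fun xi => _) = (fun xi => jump_factor a xi * (jump_factor a xi ^+ N * g xi))).
  split; first exact: cintegrable_jump_factor.
  exact: le_trans (fourier_L1_jump_factor a0 alam IH1) IH2.
by apply/funext => xi; rewrite exprS mulrA.
Qed.

(** The shift by [Num.bound lam] ensures [a_ k * lam <= 1] for every k, and not only eventually. *)
Let N_ k := (Num.bound lam + k).+1.
Let a_ k : R := (N_ k)%:R^-1.

Let N_gt0 k : 0 < (N_ k)%:R :> R. Proof. by []. Qed.
Let a_ge0 k : 0 <= a_ k. Proof. by rewrite invr_ge0. Qed.

Let a_lam k : a_ k * lam <= 1.
Proof.
rewrite ler_pdivrMl// mulr1 (le_trans (ltW (archi_boundP lam0)))// ler_nat.
by rewrite (leq_trans (leq_addr k _)).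
Qed.

Let N_oo : (N_ k)%:R @[k --> \oo] --> (+oo : set_system R).
Proof.
apply/cvgryPge => A; near=> k; apply: (@le_trans _ _ k%:R).
  by near: k; exact: nbhs_infty_ger.
by rewrite ler_nat (leq_trans (leq_addl _ _) (leqnSn _)).
Unshelve. all: end_near. Qed.

Lemma cvg_cexp_mul (z : R[i]) :
  ((N_ k)%:R * complex.Re (cexp ((a_ k)%:C * z) - 1) @[k --> \oo] --> complex.Re z) /\
  ((N_ k)%:R * complex.Im (cexp ((a_ k)%:C * z) - 1) @[k --> \oo] --> complex.Im z).
Proof.
case: z => u v /=.
have dl w : is_derive (0 : R) 1 (fun h : R => h * w) w.
  by apply: is_derive_eq; rewrite /GRing.scale/=; ring.
have du : is_derive (0 : R) 1 (fun h : R => expR (h * u)) u.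
  apply: is_derive_eq (@is_derive1_comp R (@expR R) (fun h => h * u) 0 _ _ (is_derive_expR _) (dl u)) _.
  by rewrite mul0r expR0 mul1r.
have dc : is_derive (0 : R) 1 (fun h : R => cos (h * v)) 0.
  apply: is_derive_eq (@is_derive1_comp R (@cos R) (fun h => h * v) 0 _ _ (is_derive_cos _) (dl v)) _.
  by rewrite mul0r sin0 oppr0 mul0r.
have ds : is_derive (0 : R) 1 (fun h : R => sin (h * v)) v.
  apply: is_derive_eq (@is_derive1_comp R (@sin R) (fun h => h * v) 0 _ _ (is_derive_sin _) (dl v)) _.
  by rewrite mul0r cos0 mul1r.
split.
  have h : is_derive (0 : R) 1 (fun h : R => expR (h * u) * cos (h * v) - 1) u.
    apply: is_derive_eq (is_deriveB (is_deriveM du dc) (is_derive_cst (1 : R) (0 : R) 1)) _.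
    by rewrite !mul0r scaler0 add0r subr0 cos0 scale1r.
  have := cvg_cexp_quotient N_gt0 N_oo _ h; rewrite mul0r mul0r expR0 cos0 mul1r subrr.
  move=> /(_ erefl); apply: cvg_trans; apply: near_eq_cvg; near=> k.
  by rewrite !mul0r !(subr0, addr0).
have h : is_derive (0 : R) 1 (fun h : R => expR (h * u) * sin (h * v)) v.
  apply: is_derive_eq (is_deriveM du ds) _.
  by rewrite !mul0r sin0 expR0 scale0r addr0 scale1r.
have := cvg_cexp_quotient N_gt0 N_oo _ h; rewrite mul0r mul0r sin0 mulr0.
move=> /(_ erefl); apply: cvg_trans; apply: near_eq_cvg; near=> k.
by rewrite !mul0r !(subr0, addr0).
Unshelve. all: end_near. Qed.

Lemma jump_psi_Re_ge0 xi : 0 <= complex.Re (jump_psi xi).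
Proof.
rewrite /jump_psi !ReImE /= subr_ge0 (le_trans (ler_norm _))//.
rewrite -[leRHS]mul1r normr_Rintegral_bounded_L//.
by apply: m_trig; exact: continuous_cos.
Qed.

(** Write e^(- psi) as the N-th power of e^(- psi / N). By [cmod_subX] the two N-th powers differ by
    at most a constant times N |1 - psi / N - e^(- psi / N)|, which tends to 0 because N (e^(- psi /
    N) - 1) tends to - psi. *)
Lemma cvg_jump_factorX xi :
  cmod (jump_factor (a_ k) xi ^+ N_ k - cexp (- jump_psi xi)) @[k --> \oo] --> 0.
Proof.
pose C := 3 * lam.
have C0 : 0 <= C by rewrite mulr_ge0.
have [c1 c2] := cvg_cexp_mul (- jump_psi xi).
pose b k := cexp ((a_ k)%:C * - jump_psi xi).
have bX k : cexp (- jump_psi xi) = b k ^+ N_ k.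
  rewrite /b -cexpMn; congr cexp.
  rewrite mulrA -(rmorph_nat (real_complex R)) -rmorphM /= mulfV ?mul1r ?gt_eqF//.
have lim0 : expR C * (`|(N_ k)%:R * complex.Re (b k - 1) - complex.Re (- jump_psi xi)| +
   `|(N_ k)%:R * complex.Im (b k - 1) - complex.Im (- jump_psi xi)|) @[k --> \oo] --> 0.
  rewrite [X in _ --> X](_ : 0 = expR C * (0 + 0)); last by rewrite addr0 mulr0.
  apply: cvgM; first exact: cvg_cst.
  by apply: cvgD; apply/norm_cvg0P; apply/subr_cvg0.
apply: (@cvg0_norm_le _ _ _ _ _ _ _ lim0) => k.
rewrite ger0_norm ?cmod_ge0// (bX k).
have B1 : 1 <= 1 + C / (N_ k)%:R by rewrite lerDl divr_ge0.
apply: (le_trans (cmod_subX (N_ k) _ _ B1)).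
- by rewrite mulrC; exact: cmod_jump_factor.
- rewrite (le_trans _ B1)// cmod_cexp -expR0 ler_expR.
  rewrite !ReImE /= mul0r subr0 mulrN oppr_le0 mulr_ge0//; exact: jump_psi_Re_ge0.
rewrite mulrAC mulrC ler_pM//.
- by rewrite exprn_ge0// (le_trans ler01).
- by rewrite mulr_ge0 ?cmod_ge0.
- exact: expr_1Ddiv_le.
rewrite -[X in X * _](ger0_norm (ltW (N_gt0 k))) -cmod_real -cmodM.
have -> : (N_ k)%:R%:C * (jump_factor (a_ k) xi - b k) =
    - ((N_ k)%:R%:C * (b k - 1) + jump_psi xi).
  have NaC : (N_ k)%:R%:C * (a_ k)%:C = 1 :> R[i] by rewrite -rmorphM /= mulfV// gt_eqF.
  by rewrite /jump_factor -[X in - (_ + X)]mul1r -NaC; ring.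
rewrite cmodN (le_trans (cmod_le_ReIm _))//; move: (b k - 1) (jump_psi xi) => [u v] [p q] /=.
by rewrite !mul0r subr0 addr0 !opprK.
Qed.

(* [cexp (- psi)] is the limit of [(1 - psi / N) ^ N], and for [N >= lam] each
   factor acts on inverse Fourier transforms as an average of translations. *)
Lemma fourier_L1_jump_psi g : cintegrable g ->
  (fourier_L1 (fun xi => (cexp (- jump_psi xi) * g xi)%R) <= fourier_L1 g)%E.
Proof.
move=> ig.
pose f k xi := jump_factor (a_ k) xi ^+ N_ k * g xi.
have fX k := fourier_L1_jump_factorX (N_ k) (a_ge0 k) (a_lam k) ig.
have bnd k xi : cmod (f k xi) <= expR (3 * lam) * cmod (g xi).
  rewrite cmodM ler_wpM2r ?cmod_ge0// cmodX (le_trans _ (expr_1Ddiv_le (N_ k) _)) ?mulr_ge0//.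
  apply: lerXn2r; rewrite ?nnegrE ?cmod_ge0 ?addr_ge0 ?mulr_ge0//.
  by rewrite [X in 1 + X]mulrC; exact: cmod_jump_factor.
have cv y : fourier (f k) y @[k --> \oo] --> fourier (fun xi => cexp (- jump_psi xi) * g xi) y.
  apply: (@Rdominated_cvg _ _ R lv setT _ _ (fun xi => expR (3 * lam) * cmod (g xi))) => //.
  - by move=> k; apply: (cmeasurable_fourier y _).1; exact: (fX k).1.1.
  - move=> xi _; apply/subr_cvg0.
    have h : cmod (jump_factor (a_ k) xi ^+ N_ k - cexp (- jump_psi xi)) * cmod (g xi)
        @[k --> \oo] --> 0.
      rewrite -[X in _ --> X](mul0r (cmod (g xi))); apply: cvgM; last exact: cvg_cst.
      exact: cvg_jump_factorX.
    apply: (@cvg0_norm_le _ _ _ _ _ _ _ h) => k.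
    rewrite -cReN -cReD (le_trans (normr_Re_cmod _))// -mulrBr -mulrBl.
    by rewrite !cmodM cmod_cis mul1r.
  - exact: (integrableZl measurableT _ ig.2).
  - by move=> k xi _; rewrite (le_trans (normr_Re_cmod _))// cmodM cmod_cis mul1r.
have mf k : measurable_fun setT (fun y => `|fourier (f k) y|%:E).
  apply/measurable_EFinP; apply: measurableT_comp => //; apply: measurable_fourier.
  exact: (fX k).1.
have f0 k y : [set: 'cV[R]_n] y -> (0 <= `|fourier (f k) y|%:E)%E by rewrite lee_fin.
(* The inverse transforms converge pointwise only, so Fatou's lemma carries the uniform L1 bound to
   the limit. *)
have := @fatou _ _ R lv setT measurableT (fun k y => `|fourier (f k) y|%:E) mf f0.
rewrite (_ : (\int[lv]_y _)%E = fourier_L1 (fun xi => cexp (- jump_psi xi) * g xi)); last first.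
  apply: eq_integral => y _.
  have h : `|fourier (f k) y|%:E @[k --> \oo] -->
      `|fourier (fun xi => cexp (- jump_psi xi) * g xi) y|%:E.
    by apply: cvg_EFin; [exact: nearW|apply: cvg_norm; exact: cv].
  by rewrite (cvg_limn_einf_sup h).1.
move=> h; apply: (le_trans h).
rewrite limn_einf_lim; apply: lime_le; first exact: is_cvg_einfs.
apply: nearW => k; apply: (@le_trans _ _ (fourier_L1 (f k))); last exact: (fX k).2.
by apply: ereal_inf_lbound; exists k => /=.
Qed.

End compound_poisson.

(** * Characteristic function of the Ornstein-Uhlenbeck process *)

Section matrix_limit.
Context (R : realType) (m n : nat).

Lemma cvg_mx_coordP (I : Type) (F : set_system I) (FF : Filter F)
    (f : I -> 'M[R]_(m, n)) (l : 'M[R]_(m, n)) :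
  (forall i j, f x i j @[x --> F] --> l i j) -> f x @[x --> F] --> l.
Proof.
move=> fl A [P lP sPA]; apply: (@filterS _ F _ [set x | forall i j, P i j (f x i j)]).
  by move=> x Px; exact: sPA.
apply: filter_forall => i; apply: filter_forall => j; exact: (fl i j _ (lP i j)).
Qed.

Lemma cvg_mx_coord (I : Type) (F : set_system I)
    (f : I -> 'M[R]_(m, n)) (l : 'M[R]_(m, n)) i j :
  f x @[x --> F] --> l -> f x i j @[x --> F] --> l i j.
Proof.
move=> fl.
exact: (@cvg_comp _ _ _ f (fun N : 'M[R]_(m, n) => N i j) F _ _ fl (@coord_continuous R m n i j l)).
Qed.

End matrix_limit.

Lemma cvg_sumr (R : realType) (I T : Type) (r : seq I) (F : set_system T)
    (FF : Filter F) (f : I -> T -> R) (l : I -> R) :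
  (forall i, f i x @[x --> F] --> l i) ->
  \sum_(i <- r) f i x @[x --> F] --> \sum_(i <- r) l i.
Proof.
move=> fl; elim: r => [|i r IH].
  by under eq_fun do rewrite big_nil; rewrite big_nil; exact: cvg_cst.
by under eq_fun do rewrite big_cons; rewrite big_cons; exact: cvgD.
Qed.

(** * Entries of the matrix exponential as power series *)

Section matrix_exponential.
Context (R : realType) (n : nat) (M : 'M[R]_n).

Lemma cvg_pseries_dominated (c : nat -> R) (D b K : R) :
  (forall k, `|c k| <= D * b ^+ k / k`!%:R) -> cvgn (pseries c K).
Proof.
move=> cD; apply: normed_cvg.
apply: (@series_le_cvg R _ (fun k => D * exp_coeff (b * `|K|) k)) => [k|k|k|].
- exact: normr_ge0.
- have D0 := le_trans (normr_ge0 _) (cD k).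
  have -> : D * exp_coeff (b * `|K|) k = D * b ^+ k / k`!%:R * `|K| ^+ k.
    by rewrite /exp_coeff /= exprMn; ring.
  by rewrite mulr_ge0 ?exprn_ge0.
- rewrite /= normrM normrX (le_trans (ler_wpM2r _ (cD k))) ?exprn_ge0//.
  by rewrite /exp_coeff /= exprMn le_eqVlt; apply/orP; left; apply/eqP; ring.
- apply: is_cvg_seriesZ; exact: is_cvg_series_exp_coeff.
Qed.

Let a : R := \sum_i \sum_j `|M i j|.

Let a0 : 0 <= a.
Proof. by apply: sumr_ge0 => i _; exact: sumr_ge0. Qed.

Lemma normr_mxX k i j : `|(M ^+ k) i j| <= a ^+ k.
Proof.
elim: k i => [|k IH] i; first by rewrite !expr0 mxE; case: (i == j); rewrite ?normr1 ?normr0.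
rewrite exprS [(M * _) i j]mxE (le_trans (ler_norm_sum _ _ _))// exprS.
apply: (@le_trans _ _ (\sum_l `|M i l| * a ^+ k)).
  by apply: ler_sum => l _; rewrite normrM ler_wpM2l.
rewrite -mulr_suml ler_wpM2r ?exprn_ge0//.
by rewrite /a [leRHS](bigD1 i)//= lerDl sumr_ge0// => l _; exact: sumr_ge0.
Qed.

(** Coefficients in s of the (i, j) entry of the p-th derivative of e^(sM); the parameter p makes
    the family closed under [pseries_diffs]. *)
Definition mexp_coef p i j k : R := (M ^+ (k + p)) i j / k`!%:R.

Lemma pseries_diffs_mexp p i j : pseries_diffs (mexp_coef p i j) = mexp_coef p.+1 i j.
Proof.
apply/funext => k; rewrite /pseries_diffs /mexp_coef addSnnS factS natrM invfM.
by rewrite mulrCA [X in _ * X]mulrA mulfV ?pnatr_eq0// mul1r.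
Qed.

Lemma cvg_pseries_mexp p i j K : cvgn (pseries (mexp_coef p i j) K).
Proof.
apply: (@cvg_pseries_dominated _ (a ^+ p) a) => k.
rewrite /mexp_coef normrM normfV normr_nat ler_wpM2r ?invr_ge0//.
by rewrite -exprD addnC normr_mxX.
Qed.

Lemma scalemxX (s : R) k : (s *: M) ^+ k = s ^+ k *: M ^+ k.
Proof.
elim: k => [|k IH]; first by rewrite !expr0 scale1r.
rewrite !exprS IH.
by rewrite /GRing.mul/= -scalemxAl -scalemxAr scalerA.
Qed.

Lemma mexpE s i j : mexp (s *: M) i j = limn (pseries (mexp_coef 0 i j) s).
Proof.
have h : series (fun k => (k`!%:R)^-1 *: (s *: M) ^+ k) @ \oo -->
    \matrix_(i, j) limn (pseries (mexp_coef 0 i j) s).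
  apply: cvg_mx_coordP => i' j'; rewrite mxE.
  rewrite (_ : (fun N => _) = pseries (mexp_coef 0 i' j') s).
    exact: cvg_pseries_mexp.
  apply/funext => N; rewrite /series /= summxE; apply: eq_bigr => k _.
  by rewrite /= scalemxX 2!mxE /mexp_coef addn0; ring.
have h1 := @cvg_mx_coord R n n nat \oo _ _ i j h; rewrite mxE in h1.
have h2 := @cvg_mx_coord R n n nat \oo _ _ i j (cvgP _ h).
exact: (etrans (esym (cvg_lim (@Rhausdorff R) h2)) (cvg_lim (@Rhausdorff R) h1)).
Qed.

(** The series converge for all s, so they may be differentiated term by term; the resulting shift
    of the powers of M is a left multiplication by M. *)
Lemma is_derive_mexp (s : R) i j :
  is_derive s 1 (fun u : R => mexp (u *: M) i j) ((M *m mexp (s *: M)) i j).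
Proof.
under eq_fun do rewrite mexpE.
have h := @pseries_snd_diffs R (mexp_coef 0 i j) (`|s| + 1) s.
rewrite !pseries_diffs_mexp in h.
apply: (is_derive_eq (h _ _ _ _)); try exact: cvg_pseries_mexp.
  by rewrite [ltRHS]ger0_norm ?ltrDl ?addr_ge0.
apply: cvg_lim => //.
rewrite mxE (_ : pseries _ _ = fun N => \sum_l M i l * pseries (mexp_coef 0 l j) s N).
  apply: cvg_sumr => l; apply: cvgM; first exact: cvg_cst.
  by rewrite mexpE; exact: cvg_pseries_mexp.
apply/funext => N; under [RHS]eq_bigr do rewrite mulr_sumr.
rewrite exchange_big /=; apply: eq_bigr => k _.
rewrite /= /mexp_coef addn1 exprS [(M * _) i j]mxE !mulr_suml.
by apply: eq_bigr => l _; rewrite addn0 !mulrA.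
Qed.

Lemma mexp0 : mexp (0 *: M) = 1%:M.
Proof.
apply/matrixP => i j; rewrite mexpE; apply: cvg_lim => //.
apply: (@cvg_near_cst _ _ _ _ _ _); exists 1%N => // N /= N1.
rewrite /pseries /series /= big_ltn// /mexp_coef addn0 !expr0 fact0 divr1 mulr1.
rewrite big_nat_cond big1 ?addr0// => k /andP[/andP[k1 _] _].
by rewrite expr0n gtn_eqF// mulr0.
Qed.

End matrix_exponential.

Lemma trmx_mexp (R : realType) n (M : 'M[R]_n) (s : R) :
  (mexp (s *: M))^T = mexp (s *: M^T).
Proof.
have trX k : (M^T) ^+ k = (M ^+ k)^T.
  elim: k => [|k IH]; first by rewrite !expr0 trmx1.
  by rewrite exprSr exprS IH /GRing.mul/= trmx_mul.
apply/matrixP => i j; rewrite mxE !mexpE; congr (limn (pseries _ s)).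
by apply/funext => k; rewrite /mexp_coef trX mxE.
Qed.

(** * Characteristic function of a sum of independent variables *)

Section decoupling.
Context (R : realType) d (Omega : measurableType d) (P : probability Omega R).
Context d' (T : measurableType d') (Y : Omega -> T).
Hypothesis mY : measurable_fun setT Y.

Lemma integrable_bounded_prob (f : Omega -> R) (C : R) : measurable_fun setT f ->
  (forall w, `|f w| <= C) -> P.-integrable setT (EFin \o f).
Proof.
move=> mf fC; apply: (@integrable_le_norm _ _ _ _ _ _ (cst C)) => //.
exact: finite_measure_integrable_cst.
Qed.

Lemma Rintegral_cst_prob (C : R) : \int[P]_w C = C.
Proof. by rewrite /Rintegral integral_cst//= probability_setT mule1. Qed.

(** With W taken as a density, the law of Y becomes c times its original law; this extends the
    product formula from events of Y to functions of Y. *)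
Lemma ge0_integral_decoupled (W : Omega -> R) (c : R) : measurable_fun setT W ->
  (forall w, 0 <= W w) -> 0 <= c ->
  (forall E, measurable E ->
     (\int[P]_(w in Y @^-1` E) (W w)%:E = c%:E * P (Y @^-1` E))%E) ->
  forall h : T -> R, measurable_fun setT h -> (forall y, 0 <= h y) ->
  (\int[P]_w (W w * h (Y w))%:E = c%:E * \int[P]_w (h (Y w))%:E)%E.
Proof.
move=> mW W0 c0 hE h mh h0.
pose law := measure_function_pushforward__canonical__measure_function_Measure P mY.
pose dens := density_measure P mW W0.
pose dlaw := measure_function_pushforward__canonical__measure_function_Measure dens mY.
have mhE : measurable_fun setT (fun y => (h y)%:E) by exact/measurable_EFinP.
have h1 : (\int[dlaw]_y (h y)%:E = \int[law]_y ((h y)%:E * c%:E))%E.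
  apply: (@integral_density _ _ _ law dlaw (cst c)) => // E mE.
  exact: (etrans (hE E mE) (esym (integral_cst law mE c%:E))).
have h2 : (\int[dlaw]_y (h y)%:E = \int[dens]_w (h (Y w))%:E)%E.
  rewrite ge0_integral_pushforward// => y _; by rewrite lee_fin.
have h3 : (\int[dens]_w (h (Y w))%:E = \int[P]_w ((h (Y w))%:E * (W w)%:E))%E.
  by apply: (@integral_density _ _ _ P dens W) => //; exact: (measurableT_comp mhE mY).
have h4 : (\int[law]_y ((h y)%:E * c%:E) = \int[P]_w ((h (Y w))%:E * c%:E))%E.
  rewrite ge0_integral_pushforward ?preimage_setT//; first exact: emeasurable_funM.
  by move=> y _; rewrite -EFinM lee_fin mulr_ge0.
rewrite -ge0_integralZl//; last 2 first.
- exact: (measurableT_comp mhE mY).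
- by move=> w _; rewrite lee_fin.
transitivity (\int[P]_w ((h (Y w))%:E * (W w)%:E))%E.
  by apply: eq_integral => w _; rewrite -EFinM mulrC.
by rewrite -h3 -h2 h1 h4; apply: eq_integral => w _; rewrite muleC.
Qed.

(** Reduction to the nonnegative function [h + C]; the hypothesis for the whole space identifies c
    as the integral of W and accounts for the added constant. *)
Lemma Rintegral_decoupled (W : Omega -> R) (c D : R) : measurable_fun setT W ->
  (forall w, 0 <= W w <= D) -> 0 <= c ->
  (forall E, measurable E ->
     (\int[P]_(w in Y @^-1` E) (W w)%:E = c%:E * P (Y @^-1` E))%E) ->
  forall (h : T -> R) (C : R), measurable_fun setT h -> (forall y, `|h y| <= C) ->
  \int[P]_w (W w * h (Y w)) = c * \int[P]_w h (Y w).
Proof.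
move=> mW WD c0 hE h C mh hC.
have W0 w : 0 <= W w by case/andP: (WD w).
have hC0 y : 0 <= h y + C.
  by rewrite -lerBlDr sub0r; have := hC y; rewrite ler_norml => /andP[].
have mhY : measurable_fun setT (fun w => h (Y w)) by exact: measurableT_comp.
have iW : P.-integrable setT (EFin \o W).
  apply: (integrable_bounded_prob mW (C := D)) => w; rewrite ger0_norm//.
  by case/andP: (WD w).
have ih : P.-integrable setT (EFin \o (fun w => h (Y w))).
  exact: (integrable_bounded_prob mhY (C := C)).
have iWh : P.-integrable setT (EFin \o (fun w => W w * h (Y w))).
  apply: (integrable_bounded_prob _ (C := D * C)); first exact: measurable_funM.
  by move=> w; rewrite normrM ler_pM// ger0_norm//; case/andP: (WD w).
have ic (k : R) : P.-integrable setT (EFin \o cst k) by exact: finite_measure_integrable_cst.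
have e1 : \int[P]_w (W w * (h (Y w) + C)) = c * \int[P]_w (h (Y w) + C).
  rewrite /Rintegral (@ge0_integral_decoupled W c mW W0 c0 hE (fun y => h y + C))//; last first.
    exact: measurable_funD.
  rewrite fineM//; apply: integrable_fin_num => //.
  by have := integrableD measurableT ih (ic C).
have e2 : \int[P]_w W w = c.
  have := hE setT measurableT; rewrite preimage_setT probability_setT mule1.
  by rewrite /Rintegral => ->.
have ecst := Rintegral_cst_prob C.
move: e1; rewrite [X in _ = c * X](RintegralD measurableT ih (ic C)) ecst.
under eq_Rintegral do rewrite mulrDr.
rewrite RintegralD//; last first.
  by apply: (integrable_bounded_prob _ (C := D * `|C|)); [exact: measurable_funM|move=> w; rewrite normrM ler_wpM2r// ger0_norm//; case/andP: (WD w)].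
rewrite RintegralZr// e2 mulrDr; exact: addIr.
Qed.

End decoupling.

Section independence.
Context (R : realType) d (Omega : measurableType d) (P : probability Omega R).
Context d' (T : measurableType d') (N : nat) (Y : nat -> Omega -> T).
Hypothesis mY : forall i, measurable_fun setT (Y i).
Hypothesis indepY : forall E : nat -> set T, (forall i, measurable (E i)) ->
  P (\bigcap_(i in `I_N) (Y i @^-1` E i)) = (\prod_(i < N) P (Y i @^-1` E i))%E.
Variable theta : nat -> T -> R.
Hypothesis mtheta : forall i, measurable_fun setT (theta i).

Definition charval i : R[i] :=
  (\int[P]_w cos (theta i (Y i w))) +i* (\int[P]_w sin (theta i (Y i w))).

Let pr i (E : set T) : R := fine (P (Y i @^-1` E)).

Let J j (E : nat -> set T) w : R := \prod_(j <= i < N) \1_(E i) (Y i w).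

Let Sum j w : R := \sum_(i < j) theta i (Y i w).

Let mSum j : measurable_fun setT (Sum j).
Proof. by apply: measurable_sum => i; exact: measurableT_comp. Qed.

Let mJ j E : (forall i, measurable (E i)) -> measurable_fun setT (J j E).
Proof.
move=> mE; apply: measurable_prod => i _.
exact: (measurableT_comp (measurable_indic (mE i)) (mY i)).
Qed.

Let J01 j E w : 0 <= J j E w <= 1.
Proof.
rewrite /J; elim/big_rec : _ => [|i x _ /andP[x0 x1]]; first by rewrite ler01 lexx.
by rewrite indicE; case: (_ \in _); rewrite ?mul1r ?mul0r ?x0 ?x1 ?lexx ?ler01.
Qed.

Let prK i E : measurable E -> P (Y i @^-1` E) = (pr i E)%:E.
Proof.
move=> mE; rewrite /pr fineK// fin_num_measure// -[X in measurable X]setTI.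
exact: mY.
Qed.

Let integral_J0 E : (forall i, measurable (E i)) ->
  \int[P]_w J 0 E w = \prod_(0 <= i < N) pr i (E i).
Proof.
move=> mE.
have mI : measurable (\bigcap_(i in `I_N) (Y i @^-1` E i)).
  apply: fin_bigcap_measurable => // i _; rewrite -[X in measurable X]setTI; exact: mY.
have -> : J 0 E = \1_(\bigcap_(i in `I_N) (Y i @^-1` E i)).
  apply/funext => w; rewrite /J indicE.
  have [wI|wI] := boolP (w \in _).
    rewrite big_nat_cond big1// => i /andP[/andP[_ iN] _].
    by rewrite indicE mem_set//; move/set_mem : wI; exact.
  have [i hi] : exists i, ~ (`I_N i -> (Y i @^-1` E i) w).
    apply/existsNP => h; move/negP : wI; apply; apply/mem_set => i iN; exact: h.
  move/not_implyP : hi => [/= iN nE]; rewrite big_mkord; apply/eqP/prodf_eq0.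
  by exists (Ordinal iN) => //=; rewrite indicE memNset.
rewrite /Rintegral integral_indic// setIT.
rewrite [X in fine X](_ : _ = (\prod_(i < N) P (Y i @^-1` E i))%E); last exact: indepY.
rewrite (eq_bigr (fun i : 'I_N => (pr i (E i))%:E)); last by move=> i _; exact: prK.
by rewrite prodEFin /= big_mkord.
Qed.

(** Independence is given for events, so the variables are converted one at a time: the first j
    already appear in a phase, the others still through events. The term [1 + cos] is nonnegative
    and can act as the density W of the decoupling lemmas. *)
Lemma integral_cos_independent j (E : nat -> set T) (al : R) : (j <= N)%N ->
  (forall i, measurable (E i)) ->
  \int[P]_w ((1 + cos (al + Sum j w)) * J j E w) =
  (1 + complex.Re (cis al * \prod_(i < j) charval i)) * \prod_(j <= i < N) pr i (E i).
Proof.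
elim: j E al => [|j IH] E al jN mE.
  rewrite big_ord0 mulr1 /= -integral_J0// -RintegralZl//; last first.
    apply: (integrable_bounded_prob _ (C := 1)); first exact: mJ.
    by move=> w; rewrite ger0_norm; have /andP[] := J01 0 E w.
  by apply: eq_Rintegral => w _; rewrite /Sum big_ord0 addr0.
pose W a w := (1 + cos (a + Sum j w)) * J j.+1 E w.
have mW a : measurable_fun setT (W a).
  apply: measurable_funM; last exact: mJ.
  apply: measurable_funD => //; apply: measurableT_comp; last exact: measurable_funD.
  by apply: continuous_measurable_fun; exact: continuous_cos.
have W02 a w : 0 <= W a w <= 2.
  have /andP[J0 J1] := J01 j.+1 E w.
  have c0 : 0 <= 1 + cos (a + Sum j w) by rewrite -lerBlDl sub0r cos_geN1.
  rewrite mulr_ge0//= -[leRHS]mulr1 ler_pM//.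
  by rewrite (_ : 2 = 1 + 1)// lerD2l cos_le1.
pose pi' := \prod_(j.+1 <= i < N) pr i (E i).
pose c a := (1 + complex.Re (cis a * \prod_(i < j) charval i)) * pi'.
(* The induction hypothesis with the j-th event replaced by an arbitrary F says exactly that [W a]
   decouples from [Y j]. *)
have hE a F : measurable F ->
    (\int[P]_(w in Y j @^-1` F) (W a w)%:E = (c a)%:E * P (Y j @^-1` F))%E.
  move=> mF; pose E' i := if i == j then F else E i.
  have mE' i : measurable (E' i) by rewrite /E'; case: ifP.
  have mYF : measurable (Y j @^-1` F) by rewrite -[X in measurable X]setTI; exact: mY.
  have := IH E' a (ltnW jN) mE'; rewrite big_ltn// {2}/E' eqxx.
  have -> : \prod_(j.+1 <= i < N) pr i (E' i) = pi'.
    by apply: eq_big_nat => i /andP[ji _]; rewrite /E' gtn_eqF.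
  have JE w : J j E' w = J j.+1 E w * \1_(Y j @^-1` F) w.
    rewrite /J big_ltn// mulrC; congr (_ * _).
      by apply: eq_big_nat => i /andP[ji _]; rewrite /E' gtn_eqF.
    by rewrite /E' eqxx !indicE.
  under eq_Rintegral do rewrite JE mulrA.
  move=> h; rewrite prK// -EFinM /c -mulrA [pi' * _]mulrC -h EFin_Rintegral//; last first.
    apply: (integrable_bounded_prob _ (C := 2)).
      by apply: (measurable_funM (mW a)); exact: measurable_indic.
    move=> w; have /andP[w0 w1] := W02 a w.
    rewrite normrM -[leRHS]mulr1 ler_pM// ?(ger0_norm w0)//.
    by rewrite ger0_norm ?indicE; case: (_ \in _).
  rewrite [LHS]integral_mkcond; apply: eq_integral => w _; rewrite patchE indicE /W.
  by case: (_ \in _); rewrite ?mulr1 ?mulr0.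
have iWh a (h : T -> R) C : measurable_fun setT h -> (forall y, `|h y| <= C) ->
    P.-integrable setT (EFin \o (fun w => W a w * h (Y j w))).
  move=> mh hC; apply: (integrable_bounded_prob _ (C := 2 * C)).
    by apply: measurable_funM => //; exact: measurableT_comp.
  by move=> w; rewrite normrM ler_pM//; have /andP[w0 w1] := W02 a w; rewrite ger0_norm.
have c0 a : 0 <= c a.
  have := hE a setT measurableT; rewrite preimage_setT probability_setT mule1 => h.
  rewrite -lee_fin -h; apply: integral_ge0 => w _; rewrite lee_fin.
  by have /andP[] := W02 a w.
have dec a (h : T -> R) C := @Rintegral_decoupled _ _ _ P _ _ (Y j) (mY j) (W a) (c a) 2
  (mW a) (W02 a) (c0 a) (hE a) h C.
pose hc y := cos (theta j y); pose hs y := sin (theta j y).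
pose h3 y := 2^-1 * (1 - hc y - hs y).
have mhc : measurable_fun setT hc.
  by apply: (measurableT_comp _ (mtheta j)); apply: continuous_measurable_fun; exact: continuous_cos.
have mhs : measurable_fun setT hs.
  by apply: (measurableT_comp _ (mtheta j)); apply: continuous_measurable_fun; exact: continuous_sin.
have mh3 : measurable_fun setT h3.
  by apply: measurable_funM => //; apply: measurable_funB => //; exact: measurable_funB.
have hcb y : `|hc y| <= 1 by rewrite ler_norml cos_geN1 cos_le1.
have hsb y : `|hs y| <= 1 by rewrite ler_norml sin_geN1 sin_le1.
have h3b y : `|h3 y| <= 2^-1 * 3.
  rewrite normrM ger0_norm// ler_wpM2l//.
  rewrite (le_trans (ler_normB _ _))// (_ : 3 = 1 + 1 + 1) ?lerD//; last by ring.
  by rewrite (le_trans (ler_normB _ _))// normr1 lerD.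
transitivity (\int[P]_w (W al w * hc (Y j w) + W (al + pi / 2) w * hs (Y j w) +
   (W 0 w * h3 (Y j w) + W pi w * h3 (Y j w)))).
  apply: eq_Rintegral => w _.
  have -> : Sum j.+1 w = Sum j w + theta j (Y j w) by rewrite /Sum big_ord_recr.
  have q1 : cos (al + pi / 2 + Sum j w) = - sin (al + Sum j w) by rewrite addrAC cosDpihalf.
  have q2 : cos (pi + Sum j w) = - cos (Sum j w) by rewrite addrC cosDpi.
  have q3 : cos (al + (Sum j w + theta j (Y j w))) =
      cos (al + Sum j w) * cos (theta j (Y j w)) - sin (al + Sum j w) * sin (theta j (Y j w)).
    by rewrite (addrA al (Sum j w)) (cosD (al + Sum j w)).
  by rewrite q3 /W /h3 /hc /hs add0r q1 q2; field.
have i1 := iWh al hc 1 mhc hcb.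
have i2 := iWh (al + pi / 2) hs 1 mhs hsb.
have i3 := iWh 0 h3 _ mh3 h3b.
have i4 := iWh pi h3 _ mh3 h3b.
rewrite (RintegralD measurableT (integrableD measurableT i1 i2) (integrableD measurableT i3 i4)).
rewrite (RintegralD measurableT i1 i2) (RintegralD measurableT i3 i4).
rewrite (dec _ _ _ mhc hcb) (dec _ _ _ mhs hsb) !(dec _ _ _ mh3 h3b).
have ic : P.-integrable setT (EFin \o (fun w => hc (Y j w))).
  by apply: (integrable_bounded_prob _ (C := 1)) => //; exact: measurableT_comp.
have is_ : P.-integrable setT (EFin \o (fun w => hs (Y j w))).
  by apply: (integrable_bounded_prob _ (C := 1)) => //; exact: measurableT_comp.
have i1' : P.-integrable setT (EFin \o cst (1 : R)) by exact: finite_measure_integrable_cst.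
have -> : \int[P]_w h3 (Y j w) =
    2^-1 * (1 - complex.Re (charval j) - complex.Im (charval j)).
  rewrite RintegralZl//; last exact: (integrableB _ (integrableB _ i1' ic) is_).
  congr (_ * _).
  rewrite (RintegralB measurableT (integrableB measurableT i1' ic) is_).
  rewrite (RintegralB measurableT i1' ic); congr (_ - _ - _).
  exact: Rintegral_cst_prob.
rewrite big_ord_recr /= -/pi' /c !cReM cImM /= cosDpihalf sinDpihalf cos0 sin0 cospi sinpi.
by rewrite -/(charval j) /=; field.
Qed.

Lemma integral_cos_sum (al : R) :
  \int[P]_w cos (al + \sum_(i < N) theta i (Y i w)) =
  complex.Re (cis al * \prod_(i < N) charval i).
Proof.
have := @integral_cos_independent N (fun=> setT) al (leqnn N) (fun=> measurableT).
rewrite big_geq// mulr1.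
under eq_Rintegral do rewrite /J big_geq// mulr1.
rewrite RintegralD//; last 2 first.
- exact: finite_measure_integrable_cst.
- apply: integrable_cos_prob; apply: measurable_funD => //; exact: mSum.
rewrite (_ : \int[P]_w 1 = 1); last exact: Rintegral_cst_prob.
by move/addrI.
Qed.

End independence.

(** * Riemann sums and cadlag paths *)

Section step_functions.
Context (R : realType) (t : R).
Hypothesis t0 : 0 < t.
Local Notation mu := (@lebesgue_measure R).

Definition mesh_point N k : R := k%:R * t / N.+1%:R.

Local Notation I N k := `[mesh_point N k, mesh_point N k.+1[%classic.

Definition mesh_index N (s : R) : nat := Num.truncn (s * N.+1%:R / t).

Lemma mesh_point0 N : mesh_point N 0 = 0.
Proof. by rewrite /mesh_point !mul0r. Qed.

Lemma mesh_pointN N : mesh_point N N.+1 = t.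
Proof. by rewrite /mesh_point mulrC mulKf ?pnatr_eq0. Qed.

Lemma mesh_pointS N k : mesh_point N k.+1 - mesh_point N k = t / N.+1%:R.
Proof. by rewrite /mesh_point -natr1; field; rewrite addr_eq0 gt_eqF ?ltr_wpDl. Qed.

Lemma mesh_point_lt N k : mesh_point N k < mesh_point N k.+1.
Proof. by rewrite -subr_gt0 mesh_pointS divr_gt0. Qed.

Lemma mesh_point_ge0 N k : 0 <= mesh_point N k.
Proof. by rewrite divr_ge0// mulr_ge0// ltW. Qed.

Lemma mesh_point_le N k : (k <= N.+1)%N -> mesh_point N k <= t.
Proof.
move=> kN; rewrite ler_pdivrMr// mulrC ler_pM2l// ler_nat//.
Qed.

Lemma mem_mesh N k s : 0 <= s -> I N k s <-> mesh_index N s = k.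
Proof.
move=> s0; have x0 : 0 <= s * N.+1%:R / t by rewrite divr_ge0 ?mulr_ge0// ltW.
have e1 : (mesh_point N k <= s) = (k%:R <= s * N.+1%:R / t).
  by rewrite ler_pdivrMr// ler_pdivlMr.
have e2 : (s < mesh_point N k.+1) = (s * N.+1%:R / t < k.+1%:R).
  by rewrite ltr_pdivlMr// ltr_pdivrMr.
rewrite /= in_itv/= e1 e2; split=> [|<-]; first exact: truncn_def.
exact: truncn_itv.
Qed.

Lemma mesh_index_lt N s : 0 <= s -> s < t -> (mesh_index N s < N.+1)%N.
Proof.
move=> s0 st; rewrite truncn_lt_nat ?divr_ge0 ?mulr_ge0 ?(ltW t0)//.
by rewrite ltr_pdivrMr// mulrC ltr_pM2l.
Qed.

Lemma mesh_index_itv N s : 0 <= s ->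
  mesh_point N (mesh_index N s) <= s < mesh_point N (mesh_index N s).+1.
Proof. by move=> s0; have := (mem_mesh N (mesh_index N s) s0).2 erefl; rewrite /= in_itv. Qed.

Definition step_sum N (F : nat -> R -> R) (s : R) : R :=
  \sum_(k < N.+1) F k s * \1_(I N k) s.

Lemma step_sumE N F s : 0 <= s -> s < t -> step_sum N F s = F (mesh_index N s) s.
Proof.
move=> s0 st; have kN := mesh_index_lt N s0 st.
rewrite /step_sum (bigD1 (Ordinal kN))//= indicE mem_set; last exact/mem_mesh.
rewrite mulr1 big1 ?addr0// => i /eqP ik.
rewrite indicE memNset ?mulr0//; apply: contra_not ik => /(mem_mesh _ _ s0) ik.
exact: val_inj.
Qed.

Lemma Rintegral_step_sum N F :
  (forall k, (k < N.+1)%N -> mu.-integrable `[0, t[ (EFin \o F k)) ->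
  mu.-integrable `[0, t[ (EFin \o step_sum N F) /\
  \int[mu]_(s in `[0, t[) step_sum N F s = \sum_(k < N.+1) \int[mu]_(s in I N k) F k s.
Proof.
move=> iF.
have IS k : (k < N.+1)%N -> I N k `<=` `[0, t[.
  move=> kN; apply: subset_itv; rewrite bnd_simp ?mesh_point_ge0//; exact: mesh_point_le.
have iFI k : (k < N.+1)%N ->
    mu.-integrable `[0, t[ (EFin \o (fun s => F k s * \1_(I N k) s)) /\
    \int[mu]_(s in `[0, t[) (F k s * \1_(I N k) s) = \int[mu]_(s in I N k) F k s.
  move=> kN; split.
    apply: (integrable_le_norm _ _ _ (integrable_norm (iF k kN))) => //.
      apply: measurable_funM; first exact: integrable_measurable (iF k kN).
      by apply: measurable_funTS; exact: measurable_indic.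
    move=> s _; rewrite normrM ler_piMr// ger0_norm indicE; by case: (_ \in _).
  rewrite -[in RHS](setIidl (IS k kN)) Rintegral_mkcondl.
  by apply: eq_Rintegral => s _; rewrite patchE indicE; case: (_ \in _); rewrite ?mulr1 ?mulr0.
rewrite /step_sum; elim: N.+1 {IS iF} iFI => [|m IH] iFI.
  have e0 : (fun s => \sum_(k < 0) F k s * \1_(I N k) s) = cst 0.
    by apply/funext => s; rewrite big_ord0.
  rewrite e0; split; last by rewrite big_ord0 Rintegral_cst// mul0r.
  exact: integrable0.
have [iI eI] := IH (fun k km => iFI k (leqW km)); have [im em] := iFI m (leqnn _).
have eS : (fun s => \sum_(k < m.+1) F k s * \1_(I N k) s) =
    (fun s => \sum_(k < m) F k s * \1_(I N k) s + F m s * \1_(I N m) s).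
  by apply/funext => s; rewrite big_ord_recr.
rewrite eS; split; first exact: (integrableD _ iI im).
by rewrite RintegralD// eI em big_ord_recr.
Qed.

Lemma cvg_mesh_width : t / N.+1%:R @[N --> \oo] --> 0.
Proof. by rewrite -[X in _ --> X](mulr0 t); apply: cvgM; [exact: cvg_cst|exact: cvg_harmonic]. Qed.

Lemma cvg_mesh_lo s : 0 <= s -> mesh_point N (mesh_index N s) @[N --> \oo] --> s.
Proof.
move=> s0; apply/subr_cvg0; apply: (@cvg0_norm_le _ _ _ _ _ _ _ cvg_mesh_width) => N.
have /andP[h1 h2] := mesh_index_itv N s0.
by rewrite distrC ger0_norm ?subr_ge0// -(mesh_pointS N (mesh_index N s)) lerD2r ltW.
Qed.

(** The right end of the cell containing s tends to s from strictly above, where right continuity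
    applies. *)
Lemma cvg_mesh_hi (f : R -> R) s : 0 <= s -> f u @[u --> s^'+] --> f s ->
  f (mesh_point N (mesh_index N s).+1) @[N --> \oo] --> f s.
Proof.
move=> s0 fs A /fs sA.
have hi : mesh_point N (mesh_index N s).+1 @[N --> \oo] --> s.
  apply/subr_cvg0; apply: (@cvg0_norm_le _ _ _ _ _ _ _ cvg_mesh_width) => N.
  have /andP[h1 h2] := mesh_index_itv N s0.
  by rewrite ger0_norm ?subr_ge0 ?(ltW h2)// -(mesh_pointS N (mesh_index N s)) lerD2l lerN2.
apply: (@filterS _ \oo _ _ _ _ (hi _ sA)) => N /=; apply.
by have /andP[] := mesh_index_itv N s0.
Qed.

End step_functions.

Section cadlag_functions.
Context (R : realType) (n : nat) (f : R -> 'cV[R]_n).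
Hypothesis cf : cadlag f.
Local Notation mu := (@lebesgue_measure R).

Lemma cadlag_right (i : 'I_n) s : 0 <= s -> f u i 0 @[u --> s^'+] --> f s i 0.
Proof.
move=> s0; have := cf.1 s s0.
exact: (@cvg_mx_coord R n 1 _ (s^'+) f (f s) i 0).
Qed.

(** Right continuity bounds f to the right of each point and the left limit bounds it to the left;
    compactness of [0, t] turns these local bounds into a global one. *)
Lemma cadlag_bounded t : exists2 M : R, 0 <= M &
  forall (s : R) i, 0 <= s <= t -> `|f s i 0| <= M.
Proof.
have right s0 : 0 <= s0 -> \forall s \near s0^'+, forall i, `|f s i 0| <= \sum_i (`|f s0 i 0| + 1).
  move=> s00; apply: filter_forall => i.
  have /cvgrPdist_lt /(_ 1 ltr01) := @cadlag_right i s0 s00.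
  apply: filterS => s hs; rewrite (bigD1 i)//= ler_wpDr//.
    by apply: sumr_ge0 => j _; rewrite addr_ge0.
  rewrite -[f s i 0](subrKC (f s0 i 0)) (le_trans (ler_normD _ _))// lerD2l ltW//.
  by rewrite distrC.
have left s0 : 0 < s0 -> exists K, \forall s \near s0^'-, forall i, `|f s i 0| <= K.
  move=> s00; have /cvg_ex[l fl] := cf.2 s0 s00.
  exists (\sum_i (`|l i 0| + 1)); apply: filter_forall => i.
  have /cvgrPdist_lt /(_ 1 ltr01) := @cvg_mx_coord R n 1 _ (s0^'-) f l i 0 fl.
  apply: filterS => s hs; rewrite (bigD1 i)//= ler_wpDr//.
    by apply: sumr_ge0 => j _; rewrite addr_ge0.
  rewrite -[f s i 0](subrKC (l i 0)) (le_trans (ler_normD _ _))// lerD2l ltW//.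
  by rewrite distrC.
have loc (s0 : R) : 0 <= s0 -> exists K, \forall s \near s0, 0 <= s -> forall i, `|f s i 0| <= K.
  move=> s00; have [K hK] : exists K, \forall s \near s0, s < s0 -> 0 <= s -> forall i, `|f s i 0| <= K.
    move: s00; rewrite le_eqVlt => /predU1P[<-|s00].
      by exists 0; exists 1 => //= s _ s0' s0''; have := lt_le_trans s0' s0''; rewrite ltxx.
    have [K hK] := left s0 s00; exists K; apply: (@filterS _ (nbhs s0) _ _ _ _ hK) => s /= h sl _.
    exact: h.
  have hR : \forall s \near s0, s0 < s -> forall i, `|f s i 0| <= \sum_i (`|f s0 i 0| + 1).
    exact: right s0 s00.
  exists (Num.max K (\sum_i (`|f s0 i 0| + 1))); move: hK hR; apply: filterS2 => s h1 h2 s00' i.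
  rewrite le_max; have [ss|ss|->] := ltgtP s s0.
  - by rewrite h1.
  - by rewrite h2 ?orbT.
  - apply/orP; right; rewrite (bigD1 i)//= -addrA lerDl addr_ge0//.
    by apply: sumr_ge0 => j _; rewrite addr_ge0.
have [M [_ h]] : \forall M \near (+oo : set_system R), `[0, t]%classic `<=`
    (fun s => 0 <= s -> forall i, `|f s i 0| <= M).
  have /compact_near_coveringP := @segment_compact R 0 t.
  apply => s0; rewrite /= in_itv/= => /andP[s00 s0t].
  have [K hK] := loc s0 s00.
  exists ((fun s => 0 <= s -> forall i, `|f s i 0| <= K), [set M | K <= M]).
    by split; [exact: hK|apply: nbhs_pinfty_ge; exact: num_real].
  by move=> [s M] /= [h1 h2] s00' i; exact: le_trans (h1 s00' i) h2.
exists (Num.max 0 (M + 1)) => [|s i /andP[s0 st]]; first by rewrite le_max lexx.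
have Mlt : M < M + 1 by rewrite ltrDl.
by rewrite le_max (h _ Mlt s _ s0 i) ?orbT//= in_itv/= s0 st.
Qed.

(** Pointwise limit of the step functions that take on each cell the value at its right end. *)
Lemma measurable_cadlag t i : 0 < t ->
  measurable_fun (`[0, t[%classic : set (measurableTypeR R)) (fun s => f s i 0).
Proof.
move=> t0.
apply: (@measurable_fun_cvg _ _ _ _ (fun N => step_sum t N (fun k _ => f (mesh_point t N k.+1) i 0))).
  move=> N; apply: measurable_funTS; apply: measurable_sum => k.
  by apply: measurable_funM => //; exact: measurable_indic.
move=> s; rewrite /= in_itv/= => /andP[s0 st].
under eq_fun do rewrite step_sumE//.
by apply: (@cvg_mesh_hi _ _ t0 (fun u => f u i 0)) => //; exact: cadlag_right.
Qed.

End cadlag_functions.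

Lemma is_derive_sumr (R : realType) (I : Type) (r : seq I) (f df : I -> R -> R) (x : R) :
  (forall i, is_derive x 1 (f i) (df i x)) ->
  is_derive x 1 (fun y : R => \sum_(i <- r) f i y) (\sum_(i <- r) df i x).
Proof.
move=> h; elim: r => [|i r IH].
  by under eq_fun do rewrite big_nil; rewrite big_nil; exact: is_derive_cst.
under eq_fun do rewrite big_cons; rewrite big_cons; exact: is_deriveD.
Qed.

Section eta.
Context (R : realType) (n : nat) (M : 'M[R]_n) (t : R) (xi : 'cV[R]_n).

(** Solution of the backward equation eta' = - M eta with eta t = xi. It is used with M = A^T, so
    that pairing it with the path cancels the drift A X. *)
Definition eta (s : R) : 'cV[R]_n := mexp ((t - s) *: M) *m xi.

Lemma is_derive_eta i (s : R) :
  is_derive s 1 (fun u : R => eta u i 0) (- (M *m eta s) i 0).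
Proof.
rewrite /eta; under eq_fun do rewrite mxE.
have -> : - (M *m (mexp ((t - s) *: M) *m xi)) i 0 =
    \sum_j (- (M *m mexp ((t - s) *: M)) i j * xi j 0).
  by rewrite mulmxA mxE -sumrN; apply: eq_bigr => j _; rewrite mulNr.
apply: (@is_derive_sumr R _ _ (fun j u => mexp ((t - u) *: M) i j * xi j 0)
  (fun j u => - (M *m mexp ((t - u) *: M)) i j * xi j 0)) => j.
have h1 : is_derive s 1 (fun u : R => t - u) (-1).
  by apply: is_derive_eq; rewrite /GRing.scale/=; ring.
have h2 := @is_derive1_comp R (fun u => mexp (u *: M) i j) (fun u => t - u) s _ _
  (is_derive_mexp M (t - s) i j) h1.
have h3 := is_deriveM h2 (is_derive_cst (xi j 0) s (1 : R)).
apply: (is_derive_eq h3); rewrite /GRing.scale/=; ring.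
Qed.

Lemma eta_end : eta t = xi.
Proof. by rewrite /eta subrr mexp0 mul1mx. Qed.

Lemma is_derive_dotv_eta (s : R) v :
  is_derive s 1 (fun u : R => dotv (eta u) v) (- dotv (M *m eta s) v).
Proof.
have -> : - dotv (M *m eta s) v = \sum_i (- (M *m eta s) i 0 * v i 0).
  by rewrite -sumrN; apply: eq_bigr => i _; rewrite mulNr.
apply: (@is_derive_sumr R _ _ (fun i u => eta u i 0 * v i 0)
  (fun i u => - (M *m eta u) i 0 * v i 0)) => i.
have h3 := is_deriveM (is_derive_eta i s) (is_derive_cst (v i 0) s (1 : R)).
apply: (is_derive_eq h3); rewrite /GRing.scale/=; ring.
Qed.

Lemma continuous_eta i : continuous (fun s => eta s i 0).
Proof.
move=> s; have h := is_derive_eta i s.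
by apply: differentiable_continuous; apply/derivable1_diffP.
Qed.

End eta.

Lemma continuous_mulmx_coord (R : realType) m n (B : 'M[R]_(m, n)) (f : R -> 'cV[R]_n) :
  (forall i, continuous (fun s => f s i 0)) ->
  forall i, continuous (fun s => (B *m f s) i 0).
Proof.
move=> cf i.
rewrite (_ : (fun s => _) = fun s => \sum_j B i j * f s j 0); last first.
  by apply/funext => s; rewrite mxE.
by move=> s; apply: cvg_sumr => j; apply: cvgM; [exact: cvg_cst|exact: cf].
Qed.

Lemma continuous_dotv (R : realType) n (f : R -> 'cV[R]_n) v :
  (forall i, continuous (fun s => f s i 0)) -> continuous (fun s => dotv (f s) v).
Proof.
by move=> cf s; apply: cvg_sumr => i; apply: cvgM; [exact: cf|exact: cvg_cst].
Qed.

Lemma cadlag_continuous (R : realType) n (f : R -> 'cV[R]_n) :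
  (forall i, continuous (fun s => f s i 0)) -> cadlag f.
Proof.
move=> cf; split => s _.
  by apply: cvg_mx_coordP => i j; rewrite (ord1 j); apply: cvg_at_right_filter; exact: cf.
apply/cvg_ex; exists (f s).
by apply: cvg_mx_coordP => i j; rewrite (ord1 j); apply: cvg_at_left_filter; exact: cf.
Qed.

Lemma normr_dotv_bound (R : realType) n (u v : 'cV[R]_n) (K L : R) :
  (forall i, `|u i 0| <= K) -> (forall i, `|v i 0| <= L) -> `|dotv u v| <= n%:R * (K * L).
Proof.
move=> uK vL; rewrite (le_trans (normr_dotv _ _))//.
rewrite (_ : n%:R * (K * L) = \sum_(i < n) K * L); last first.
  by rewrite sumr_const card_ord mulr_natl.
by apply: ler_sum => i _; rewrite ler_pM.
Qed.

Lemma Rintegral_sumr d (T : measurableType d) (R : realType)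
    (m : {measure set T -> \bar R}) (D : set T) (I : Type) (r : seq I) (f : I -> T -> R) :
  measurable D -> (forall i, m.-integrable D (EFin \o f i)) ->
  \int[m]_(x in D) (\sum_(i <- r) f i x) = \sum_(i <- r) \int[m]_(x in D) f i x.
Proof.
move=> mD fi.
suff : m.-integrable D (EFin \o (fun x => \sum_(i <- r) f i x)) /\
  \int[m]_(x in D) (\sum_(i <- r) f i x) = \sum_(i <- r) \int[m]_(x in D) f i x by case.
elim: r => [|i r [IH1 IH2]].
  have e0 : (fun x => \sum_(i <- [::]) f i x) = cst 0 by apply/funext => x; rewrite big_nil.
  by rewrite e0 big_nil Rintegral_cst// mul0r; split=> //; exact: integrable0.
have eS : (fun x => \sum_(j <- i :: r) f j x) = (fun x => f i x + \sum_(j <- r) f j x).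
  by apply/funext => x; rewrite big_cons.
rewrite eS; split; first exact: (integrableD _ (fi i) IH1).
by rewrite RintegralD// IH2 big_cons.
Qed.

Section bounded_interval_integrals.
Context (R : realType).
Local Notation mu := (@lebesgue_measure R).

Lemma integrable_bounded_itv (D : set (measurableTypeR R)) (f : R -> R) (b C : R) :
  measurable D -> D `<=` `[0, b] -> measurable_fun D f ->
  (forall s, D s -> `|f s| <= C) -> mu.-integrable D (EFin \o f).
Proof.
move=> mD Db mf fC; apply: (@integrable_le_norm _ _ _ _ _ _ (cst C)) => //.
apply/integrable_norm_lty => //; split; first exact: measurable_cst.
rewrite (integral_cst _ mD (`|C|%:E)); apply: lte_mul_pinfty => //.
apply: (@le_lt_trans _ _ (mu `[0, b]%classic)).
  by apply: le_measure; rewrite ?inE.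
by rewrite lebesgue_measure_itv/=; case: ifP => _; rewrite ?ltry// -EFinB ltry.
Qed.

Lemma Rintegral_itv_diff (f : R -> R) (a b : R) : 0 <= a -> a <= b ->
  mu.-integrable `[0, b] (EFin \o f) ->
  \int[mu]_(s in `[0, b]) f s - \int[mu]_(s in `[0, a]) f s =
  \int[mu]_(s in `[a, b[) f s.
Proof.
move=> a0 ab fi.
have sub (i : interval R) : [set` i] `<=` `[0, b] -> mu.-integrable [set` i] (EFin \o f).
  by move=> ib; apply: (integrableS _ _ _ fi).
rewrite (@Rintegral_itvB _ f (BLeft 0) (BRight b) a)// ?bnd_simp//.
rewrite Rintegral_itv_obnd_cbnd; last by apply: sub; apply: subset_itv; rewrite bnd_simp.
rewrite -Rintegral_itv_bndo_bndc//.
by apply: sub; apply: subset_itv; rewrite bnd_simp.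
Qed.

End bounded_interval_integrals.

(** * Integration by parts along a path of the equation *)

Section pathwise_limit.
Context (R : realType) (n d : nat) (A : 'M[R]_n) (B : 'M[R]_(n, d)).
Variables (f : R -> 'cV[R]_n) (z : R -> 'cV[R]_d) (x xi : 'cV[R]_n) (t : R).
Hypothesis t0 : 0 < t.
Hypothesis cf : cadlag f.
Hypothesis sde : forall s, 0 <= s ->
  f s = x + vintegral `[0, s] (fun u => A *m f u) + B *m z s.
Local Notation mu := (@lebesgue_measure R).
Local Notation eta := (eta A^T t xi).
Local Notation kappa := (fun s => A^T *m eta s).
Local Notation pt := (mesh_point t).

Let ceta i : continuous (fun s => eta s i 0). Proof. exact: continuous_eta. Qed.
Let ckappa i : continuous (fun s => kappa s i 0). Proof. exact: continuous_mulmx_coord. Qed.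

Let mf i : measurable_fun (`[0, t]%classic : set (measurableTypeR R)) (fun s => f s i 0).
Proof.
have := @measurable_cadlag _ _ f cf (t + 1) i (addr_gt0 t0 ltr01).
apply: measurable_funS => //; apply: subset_itv; rewrite bnd_simp//.
by rewrite ltrDl.
Qed.

Let mdotf v : measurable_fun (`[0, t]%classic : set (measurableTypeR R)) (fun s => dotv v (f s)).
Proof. by apply: measurable_sum => i; apply: measurable_funM. Qed.

Let bounded_path : exists2 C, 0 <= C & forall u s, 0 <= u <= t -> 0 <= s <= t ->
  `|dotv (kappa u) (f s)| <= C.
Proof.
have [M M0 hM] := cadlag_bounded cf t.
have [K K0 hK] := cadlag_bounded (cadlag_continuous ckappa) t.
exists (n%:R * (K * M)); first by rewrite !mulr_ge0.
by move=> u s ut st; apply: normr_dotv_bound => i; [exact: hK|exact: hM].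
Qed.

Let integrable_dotf v : mu.-integrable `[0, t] (EFin \o (fun s => dotv v (f s))).
Proof.
have [M M0 hM] := cadlag_bounded cf t.
apply: (@integrable_bounded_itv _ _ _ t (n%:R * ((\sum_i `|v i 0|) * M))) => // s.
rewrite /= in_itv/= => st; apply: normr_dotv_bound => i; last exact: hM.
by rewrite (bigD1 i)//= lerDl sumr_ge0.
Qed.

Let integrable_sub (D D' : set (measurableTypeR R)) h : measurable D -> measurable D' -> D' `<=` D ->
  mu.-integrable D (EFin \o h) -> mu.-integrable D' (EFin \o h).
Proof. by move=> mD mD' sD; exact: integrableS. Qed.

Lemma dotv_vintegral v s : 0 <= s <= t ->
  dotv v (vintegral `[0, s] (fun u => A *m f u)) =
  \int[mu]_(u in `[0, s]) dotv (A^T *m v) (f u).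
Proof.
move=> /andP[s0 st].
have sub : `[0, s]%classic `<=` (`[0, t]%classic : set R) by apply: subset_itv; rewrite bnd_simp.
have is_ w : mu.-integrable `[0, s] (EFin \o (fun s => dotv w (f s))).
  exact: (integrable_sub _ _ sub (integrable_dotf w)).
have Ei i u : (A *m f u) i 0 = dotv (A^T *m delta_mx i 0) (f u).
  by rewrite dotv_mulmxl dotv_delta.
rewrite /dotv; under eq_bigr => i _.
  rewrite mxE; under eq_Rintegral do rewrite Ei.
  rewrite -RintegralZl//; over.
rewrite -Rintegral_sumr//; last by move=> i; exact: (integrableZl _ (v i 0) (is_ _)).
apply: eq_Rintegral => u _; rewrite -[RHS]/(dotv _ _) dotv_mulmxl.
by apply: eq_bigr => i _; rewrite Ei.
Qed.

Let g N k s := dotv (kappa s) (f (pt N k.+1)) - dotv (kappa (pt N k)) (f s).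

Let integrable_kappa v a b : mu.-integrable `[a, b] (EFin \o (fun s => dotv (kappa s) v)).
Proof. by apply: integrable_continuous_itv; exact: continuous_dotv. Qed.

(** The equation expresses B (z_(k+1) - z_k) through f and the integral of A f; moving eta from p_k
    to p_(k+1) produces a telescoping difference, and what remains is the integral of [g]. *)
Let term N k : (k < N.+1)%N ->
  dotv (B^T *m eta (pt N k)) (z (pt N k.+1) - z (pt N k)) =
  dotv (eta (pt N k.+1)) (f (pt N k.+1)) - dotv (eta (pt N k)) (f (pt N k)) +
  \int[mu]_(s in `[pt N k, pt N k.+1[) g N k s.
Proof.
move=> kN.
have p0 := mesh_point_ge0 t0 N k; have pS := mesh_point_lt t0 N k.
have pt' := mesh_point_le t0 kN.
have pS0 := ltW (le_lt_trans p0 pS).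
have e1 : B *m (z (pt N k.+1) - z (pt N k)) = (f (pt N k.+1) - f (pt N k)) -
    (vintegral `[0, pt N k.+1] (fun u => A *m f u) - vintegral `[0, pt N k] (fun u => A *m f u)).
  rewrite (sde pS0) (sde p0) mulmxBr.
  move: (B *m _) (B *m _) (vintegral _ _) (vintegral _ _) => b1 b0 v1 v0.
  by apply/colP => i; rewrite !mxE; ring.
rewrite dotv_mulmxl e1 2!dotvBr [dotv _ (_ - vintegral _ _)]dotvBr.
rewrite !dotv_vintegral ?p0 ?pS0 ?(le_trans (ltW pS))//.
rewrite Rintegral_itv_diff ?(ltW pS)//; last first.
  apply: integrable_sub (integrable_dotf _) => //.
  by apply: subset_itv; rewrite bnd_simp.
have FTC : \int[mu]_(s in `[pt N k, pt N k.+1[) dotv (kappa s) (f (pt N k.+1)) =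
    - (dotv (eta (pt N k.+1)) (f (pt N k.+1)) - dotv (eta (pt N k)) (f (pt N k.+1))).
  rewrite Rintegral_itv_bndo_bndc; last first.
    apply: (integrable_sub _ _ _ (integrable_kappa _ (pt N k) (pt N k.+1))) => //.
    by apply: subset_itv; rewrite bnd_simp.
  have dF (s : R) : is_derive s 1 (fun s => - dotv (eta s) (f (pt N k.+1)))
      (dotv (kappa s) (f (pt N k.+1))).
    have h := is_derive_dotv_eta A^T t xi s (f (pt N k.+1)).
    by apply: is_derive_eq; rewrite opprK.
  rewrite (@RFTC2 R _ _ _ _ pS (@continuous_dotv R n _ _ ckappa) dF); ring.
rewrite RintegralB//; last 2 first.
- apply: (integrable_sub _ _ _ (integrable_kappa _ (pt N k) (pt N k.+1))) => //.
  by apply: subset_itv; rewrite bnd_simp.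
- apply: integrable_sub (integrable_dotf _) => //.
  by apply: subset_itv; rewrite bnd_simp.
rewrite FTC; ring.
Qed.

(** The sums discretise the integral of <B^T eta, dz>, but no stochastic integral is formed: they
    telescope up to the integral of a step function that tends to 0 pointwise, by right continuity
    of f and continuity of kappa, while staying bounded. *)
Lemma pathwise_cvg :
  \sum_(k < N.+1) dotv (B^T *m eta (pt N k)) (z (pt N k.+1) - z (pt N k))
    @[N --> \oo] --> dotv xi (f t) - dotv (eta 0) (f 0).
Proof.
have [C C0 hC] := bounded_path.
have ig N k : (k < N.+1)%N -> mu.-integrable `[0, t[ (EFin \o g N k).
  move=> _; have s0 : `[0, t[%classic `<=` (`[0, t]%classic : set R).
    by apply: subset_itv; rewrite bnd_simp.
  have i1 := integrable_sub (measurable_itv _) (measurable_itv _) s0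
    (integrable_kappa (f (pt N k.+1)) 0 t).
  have i2 := integrable_sub (measurable_itv _) (measurable_itv _) s0
    (integrable_dotf (kappa (pt N k))).
  exact: (integrableB _ i1 i2).
have E1 N : \sum_(k < N.+1) dotv (B^T *m eta (pt N k)) (z (pt N k.+1) - z (pt N k)) =
    dotv xi (f t) - dotv (eta 0) (f 0) +
    \int[mu]_(s in `[0, t[) step_sum t N (g N) s.
  rewrite (Rintegral_step_sum t0 (ig N)).2.
  rewrite (eq_bigr (fun k : 'I_N.+1 => (dotv (eta (pt N k.+1)) (f (pt N k.+1)) -
     dotv (eta (pt N k)) (f (pt N k))) + \int[mu]_(s in `[pt N k, pt N k.+1[) g N k s)); last first.
    by move=> k _; exact: term.
  rewrite big_split/=; congr (_ + _).
  rewrite -(big_mkord xpredT (fun k => dotv (eta (pt N k.+1)) (f (pt N k.+1)) -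
     dotv (eta (pt N k)) (f (pt N k)))) telescope_sumr//.
  by rewrite mesh_pointN// mesh_point0 eta_end.
suff h : \int[mu]_(s in `[0, t[) step_sum t N (g N) s @[N --> \oo] --> 0.
  have h2 : dotv xi (f t) - dotv (eta 0) (f 0) + \int[mu]_(s in `[0, t[) step_sum t N (g N) s
      @[N --> \oo] --> dotv xi (f t) - dotv (eta 0) (f 0) + 0.
    by apply: cvgD h; exact: cvg_cst.
  rewrite addr0 in h2; apply: cvg_trans h2; apply: near_eq_cvg; near=> N.
  by rewrite E1.
rewrite [X in _ --> X](_ : 0 = \int[mu]_(s in `[0, t[) (0 : R)); last first.
  by rewrite Rintegral_cst// mul0r.
apply: (@Rdominated_cvg _ _ R mu _ _ (fun=> 0) (cst (C + C))) => //.
- by move=> N; exact: integrable_measurable (Rintegral_step_sum t0 (ig N)).1.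
- move=> s; rewrite /= in_itv/= => /andP[s0 st].
  under eq_fun do rewrite step_sumE//.
  have h1 : dotv (kappa s) (f (pt N (mesh_index t N s).+1)) @[N --> \oo] --> dotv (kappa s) (f s).
    apply: cvg_sumr => i; apply: cvgM; first exact: cvg_cst.
    by apply: (@cvg_mesh_hi _ _ t0 (fun u => f u i 0)) => //; exact: cadlag_right.
  have h2 : dotv (kappa (pt N (mesh_index t N s))) (f s) @[N --> \oo] --> dotv (kappa s) (f s).
    exact: (@cvg_comp _ _ _ _ (fun u => dotv (kappa u) (f s)) _ _ _ (cvg_mesh_lo t0 s0)
      (@continuous_dotv R n _ (f s) ckappa s)).
  have h3 : dotv (kappa s) (f (pt N (mesh_index t N s).+1)) -
      dotv (kappa (pt N (mesh_index t N s))) (f s) @[N --> \oo] -->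
      dotv (kappa s) (f s) - dotv (kappa s) (f s) by exact: cvgB.
  rewrite subrr in h3; apply: cvg_trans h3; apply: near_eq_cvg; near=> N.
  by [].
- have := integrable_bounded_itv (D := `[0, t[%classic) (b := t) (f := cst (C + C)) (C := C + C).
  apply => //; first by apply: subset_itv; rewrite bnd_simp.
  by move=> s _; rewrite ger0_norm ?addr_ge0.
- move=> N s; rewrite /= in_itv/= => /andP[s0 st].
  have kN := mesh_index_lt t0 N s0 st.
  rewrite step_sumE// (le_trans (ler_normB _ _))// lerD// hC//.
  + by rewrite s0 ltW.
  + by rewrite mesh_point_ge0// mesh_point_le.
  + by rewrite mesh_point_ge0// mesh_point_le// ltnW.
  + by rewrite s0 ltW.
Unshelve. all: end_near. Qed.

End pathwise_limit.

Lemma Rdominated_cvg_ae d (T : measurableType d) (R : realType)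
    (mu : {measure set T -> \bar R}) D (f_ : nat -> T -> R) (f g : T -> R) : measurable D ->
  (forall n, measurable_fun D (f_ n)) -> measurable_fun D f ->
  {ae mu, forall x, D x -> f_ n x @[n --> \oo] --> f x} ->
  mu.-integrable D (EFin \o g) ->
  (forall n x, D x -> `|f_ n x| <= g x) ->
  (\int[mu]_(x in D) f_ n x) @[n --> \oo] --> \int[mu]_(x in D) f x.
Proof.
move=> mD mf_ mf cf ig fg.
have mE n : measurable_fun D (fun x => (f_ n x)%:E) by exact/measurable_EFinP.
have mfE : measurable_fun D (EFin \o f) by exact/measurable_EFinP.
have cE : {ae mu, forall x, D x -> (f_ n x)%:E @[n --> \oo] --> (EFin \o f) x}.
  apply: filterS cf => x cx Dx; apply: cvg_EFin; first exact: nearW.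
  exact: cx.
have bE : {ae mu, forall x n, D x -> (`|(f_ n x)%:E| <= (EFin \o g) x)%E}.
  by apply: aeW => x n Dx; rewrite lee_fin fg.
have [if_ _ h] := @dominated_convergence _ _ R mu D mD (fun n x => (f_ n x)%:E)
  (EFin \o f) (EFin \o g) mE mfE cE ig bE.
by apply: fine_cvg; rewrite fineK//; exact: integrable_fin_num.
Qed.

(** * Bounds and continuity from the Levy-Khintchine formula *)

Section levy_khintchine_bounds.
Context (R : realType) (d : nat) (nu : {measure set 'cV[R]_d -> \bar R}).
Hypothesis hnu : levy_measure nu.

Lemma measurable_setC0 : measurable (~` [set (0 : 'cV[R]_d)]).
Proof.
apply: measurableC.
have := @measurable_coord_box R d (fun=> [set 0]) (fun=> measurable_set1 _).
rewrite (_ : [set y | _] = [set 0])//; apply/seteqP; split => y /=.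
  by move=> h; apply/colP => i; rewrite mxE h.
by move=> -> i; rewrite mxE.
Qed.

Definition levy_weight (z : 'cV[R]_d) : R := Num.min 1 (enorm z ^+ 2).

Lemma levy_weight_ge0 z : 0 <= levy_weight z.
Proof. by rewrite /levy_weight le_min ler01 sqr_ge0. Qed.

Lemma measurable_levy_weight : measurable_fun setT levy_weight.
Proof.
apply: measurable_minr => //; apply: measurable_funX; exact: measurable_enorm.
Qed.

Lemma integrable_levy_weight :
  nu.-integrable (~` [set (0 : 'cV[R]_d)]) (EFin \o levy_weight).
Proof.
have [_ _ h] := hnu; apply: ge0_integrable_lty => //; first exact: measurable_setC0.
  by apply: measurable_funTS; exact: measurable_levy_weight.
by move=> z _; exact: levy_weight_ge0.
Qed.

(** The 2 bounds the integrands for |z| >= 1; the square comes from |<xi, z>| <= d M |z| when |z| <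
    1. *)
Definition levy_const (M : R) : R := 2 + (d%:R * M) ^+ 2.

Lemma normr_dotv_le_enorm (xi z : 'cV[R]_d) M : (forall i, `|xi i 0| <= M) ->
  `|dotv xi z| <= d%:R * M * enorm z.
Proof.
move=> xM; rewrite -mulrA; apply: normr_dotv_bound => // i; exact: coord_le_enorm.
Qed.

Lemma levy_integrand_le (F : R -> R) (xi z : 'cV[R]_d) M : (forall i, `|xi i 0| <= M) ->
  (forall u, `|F u| <= 2) -> (enorm z < 1 -> `|F (dotv xi z)| <= `|dotv xi z| ^+ 2) ->
  `|F (dotv xi z)| <= levy_const M * levy_weight z.
Proof.
move=> xM F2 Fu; have [z1|z1] := ltP (enorm z) 1.
  have -> : levy_weight z = enorm z ^+ 2.
    by apply/min_idPr; rewrite expr_le1 ?enorm_ge0// ltW.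
  rewrite (le_trans (Fu z1))//.
  apply: (@le_trans _ _ ((d%:R * M) ^+ 2 * enorm z ^+ 2)).
    rewrite -exprMn; apply: lerXn2r; rewrite ?nnegrE//; last exact: normr_dotv_le_enorm.
    exact: le_trans (normr_dotv_le_enorm z xM).
  by rewrite ler_wpM2r ?sqr_ge0// lerDr.
have -> : levy_weight z = 1 by apply/min_idPl; rewrite exprn_ege1.
by rewrite mulr1 (le_trans (F2 _))// lerDl sqr_ge0.
Qed.

Definition levy_re (xi z : 'cV[R]_d) : R := 1 - cos (dotv xi z).

Definition levy_im (xi z : 'cV[R]_d) : R :=
  dotv xi z * \1_[set y : 'cV[R]_d | enorm y < 1] z - sin (dotv xi z).

Lemma normr_levy_re (xi : 'cV[R]_d) z M : (forall i, `|xi i 0| <= M) ->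
  `|levy_re xi z| <= levy_const M * levy_weight z.
Proof.
move=> xM; apply: (@levy_integrand_le (fun u => 1 - cos u)) => // u.
  by rewrite (le_trans (ler_normB _ _))// normr1 lerD2l ler_norml cos_geN1 cos_le1.
by rewrite ger0_norm ?oneBcos_ge0// oneBcos_le_sqr.
Qed.

Lemma normr_levy_im (xi : 'cV[R]_d) z M : (forall i, `|xi i 0| <= M) ->
  `|levy_im xi z| <= levy_const M * levy_weight z.
Proof.
move=> xM; rewrite /levy_im indicE; have [z1|z1] := ltP (enorm z) 1.
  rewrite mem_set// mulr1.
  have -> : levy_weight z = enorm z ^+ 2.
    by apply/min_idPr; rewrite expr_le1 ?enorm_ge0// ltW.
  rewrite (le_trans (normr_idBsin_le _))//.
  apply: (@le_trans _ _ ((d%:R * M) ^+ 2 * enorm z ^+ 2)).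
    rewrite -exprMn; apply: lerXn2r; rewrite ?nnegrE//; last exact: normr_dotv_le_enorm.
    exact: le_trans (normr_dotv_le_enorm z xM).
  by rewrite ler_wpM2r ?sqr_ge0// lerDr.
rewrite memNset/=; last by apply/negP; rewrite -leNgt.
have -> : levy_weight z = 1 by apply/min_idPl; rewrite exprn_ege1.
rewrite mulr0 sub0r normrN mulr1 (@le_trans _ _ 1)//.
  by rewrite ler_norml sin_geN1 sin_le1.
by rewrite /levy_const (_ : 2 = 1 + 1)// -addrA lerDl addr_ge0// sqr_ge0.
Qed.

Lemma measurable_levy_re xi : measurable_fun setT (levy_re xi).
Proof.
apply: measurable_funB => //.
apply: (measurableT_comp (continuous_measurable_fun (@continuous_cos R))).
exact: measurable_dotv.
Qed.

Lemma measurable_unit_ball : measurable [set y : 'cV[R]_d | enorm y < 1].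
Proof.
have := @measurable_enorm R d measurableT `]-oo, 1[%classic (measurable_itv _).
rewrite setTI (_ : _ @^-1` _ = [set y : 'cV[R]_d | enorm y < 1])//.
Qed.

Lemma measurable_levy_im xi : measurable_fun setT (levy_im xi).
Proof.
have m1 : measurable_fun setT (dotv xi) by exact: measurable_dotv.
apply: measurable_funB.
  apply: measurable_funM => //.
  exact: (measurable_indic measurable_unit_ball).
exact: (measurableT_comp (continuous_measurable_fun (@continuous_sin R)) m1).
Qed.

Lemma levy_khintchineE Phi b : levy_khintchine Phi 0 b nu ->
  forall xi, complex.Re (Phi xi) = \int[nu]_(z in ~` [set 0]) levy_re xi z /\
    complex.Im (Phi xi) = dotv b xi + \int[nu]_(z in ~` [set 0]) levy_im xi z.
Proof.
have Ei (z : R) : cexp ('i%C * z%:C) = cis z.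
  have e1 : complex.Re ('i%C * z%:C) = 0 by rewrite cReM /= mul0r mulr0 subrr.
  have e2 : complex.Im ('i%C * z%:C) = z by rewrite cImM /= mul0r mul1r add0r.
  by rewrite cexpE e1 e2 expR0 mul1r.
case=> _ _ h xi; rewrite h mul0mx dotv0l mulr0 /cintegral; split.
  rewrite !ReImE /= !(mul0r, mulr0, subrr, oppr0, add0r).
  apply: eq_Rintegral => z _.
  by rewrite !(mul0r, mul1r, mulr0, subr0, addr0, add0r, oppr0) expR0 mul1r.
rewrite !ReImE /= !(mul0r, mul1r, mulr0, subrr, addr0, add0r).
congr (_ + _); apply: eq_Rintegral => z _; rewrite /levy_im.
by rewrite !(mul0r, mul1r, mulr0, subr0, addr0, add0r, oppr0, sub0r) expR0 mul1r addrC.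
Qed.

Lemma integrable_levy_re xi : nu.-integrable (~` [set (0 : 'cV[R]_d)]) (EFin \o levy_re xi).
Proof.
apply: (integrable_le_norm measurable_setC0 _ _ (integrableZl measurable_setC0
  (levy_const (l1norm xi)) integrable_levy_weight)).
  by apply: measurable_funTS; exact: measurable_levy_re.
by move=> z _; apply: normr_levy_re => i; exact: coord_le_l1norm.
Qed.

Lemma integrable_levy_im xi : nu.-integrable (~` [set (0 : 'cV[R]_d)]) (EFin \o levy_im xi).
Proof.
apply: (integrable_le_norm measurable_setC0 _ _ (integrableZl measurable_setC0
  (levy_const (l1norm xi)) integrable_levy_weight)).
  by apply: measurable_funTS; exact: measurable_levy_im.
by move=> z _; apply: normr_levy_im => i; exact: coord_le_l1norm.
Qed.

(** Sequential continuity of Phi by dominated convergence: the common bound M on the coordinates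
    provides the dominating multiple of [levy_weight]. *)
Lemma cvg_levy_khintchine Phi b (u_ : nat -> 'cV[R]_d) (u : 'cV[R]_d) M :
  levy_khintchine Phi 0 b nu ->
  (forall N i, `|u_ N i 0| <= M) -> (forall i, u_ N i 0 @[N --> \oo] --> u i 0) ->
  (complex.Re (Phi (u_ N)) @[N --> \oo] --> complex.Re (Phi u)) /\
  (complex.Im (Phi (u_ N)) @[N --> \oo] --> complex.Im (Phi u)).
Proof.
move=> LK uM cu.
have iw := integrableZl measurable_setC0 (levy_const M) integrable_levy_weight.
have cd z : dotv (u_ N) z @[N --> \oo] --> dotv u z.
  by apply: cvg_sumr => i; apply: cvgM; [exact: cu|exact: cvg_cst].
have cs z : sin (dotv (u_ N) z) @[N --> \oo] --> sin (dotv u z).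
  exact: (@cvg_comp _ _ _ _ (@sin R) _ _ _ (cd z) (@continuous_sin R _)).
split.
  rewrite (levy_khintchineE LK u).1; under eq_fun do rewrite (levy_khintchineE LK _).1.
  apply: (Rdominated_cvg (g := fun z => levy_const M * levy_weight z)) => //.
  - exact: measurable_setC0.
  - by move=> N; apply: measurable_funTS; exact: measurable_levy_re.
  - move=> z _; apply: cvgB; first exact: cvg_cst.
    exact: (@cvg_comp _ _ _ _ (@cos R) _ _ _ (cd z) (@continuous_cos R _)).
  - by move=> N z _; exact: normr_levy_re.
rewrite (levy_khintchineE LK u).2; under eq_fun do rewrite (levy_khintchineE LK _).2.
apply: cvgD.
  by apply: cvg_sumr => i; apply: cvgM; [exact: cvg_cst|exact: cu].
apply: (Rdominated_cvg (g := fun z => levy_const M * levy_weight z)) => //.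
- exact: measurable_setC0.
- by move=> N; apply: measurable_funTS; exact: measurable_levy_im.
- by move=> z _; apply: cvgB => //; apply: cvgM => //; exact: cvg_cst.
- by move=> N z _; exact: normr_levy_im.
Qed.

Lemma levy_khintchine_bounded Phi b M : levy_khintchine Phi 0 b nu ->
  exists C, forall u : 'cV[R]_d, (forall i, `|u i 0| <= M) ->
    `|complex.Re (Phi u)| <= C /\ `|complex.Im (Phi u)| <= C.
Proof.
move=> LK.
have iw := integrableZl measurable_setC0 (levy_const M) integrable_levy_weight.
pose W := \int[nu]_(z in ~` [set 0]) (levy_const M * levy_weight z).
exists (W + d%:R * (l1norm b * M)) => u uM.
have dn : 0 <= d%:R * (l1norm b * `|M|) by rewrite !mulr_ge0// l1norm_ge0.
have bM : `|dotv b u| <= d%:R * (l1norm b * M).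
  by apply: normr_dotv_bound => // i; exact: coord_le_l1norm.
have le h : nu.-integrable (~` [set (0 : 'cV[R]_d)]) (EFin \o h) ->
    (forall z, `|h z| <= levy_const M * levy_weight z) ->
    `|\int[nu]_(z in ~` [set 0]) h z| <= W.
  move=> ih hW; rewrite (le_trans (le_normr_Rintegral measurable_setC0 ih))//.
  apply: le_Rintegral => //; first exact: measurable_setC0.
  exact: integrable_norm ih.
split.
  rewrite (levy_khintchineE LK u).1 ler_wpDr//; first exact: le_trans bM.
  by apply: le => [|z]; [exact: integrable_levy_re|exact: normr_levy_re].
rewrite (levy_khintchineE LK u).2 addrC (le_trans (ler_normD _ _))// lerD//.
by apply: le => [|z]; [exact: integrable_levy_im|exact: normr_levy_im].
Qed.

End levy_khintchine_bounds.

(** * Limit of the Riemann sums in law *)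

Section ou_charfun.
Context (R : realType) (n d : nat) (A : 'M[R]_n) (B : 'M[R]_(n, d)).
Context (dO : measure_display) (Omega : measurableType dO) (P : probability Omega R).
Variables (Z : R -> Omega -> 'cV[R]_d) (Phi : 'cV[R]_d -> R[i]) (b : 'cV[R]_d).
Variables (nu : {measure set 'cV[R]_d -> \bar R}) (x : 'cV[R]_n) (X : R -> Omega -> 'cV[R]_n).
Hypothesis hZ : levy_process P Z.
Hypothesis hPhi : char_exponent P Z Phi.
Hypothesis hLK : levy_khintchine Phi 0 b nu.
Hypothesis hX : ou_process P A B Z x X.
Local Notation mu := (@lebesgue_measure R).

Let hnu : levy_measure nu. Proof. by case: hLK. Qed.

Definition ou_line (xi : 'cV[R]_n) (s : R) : 'cV[R]_d := B^T *m (mexp (s *: A^T) *m xi).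

Lemma continuous_ou_line xi i : continuous (fun s => ou_line xi s i 0).
Proof.
apply: continuous_mulmx_coord => {}i.
rewrite (_ : (fun s => _) = fun s => \sum_j mexp (s *: A^T) i j * xi j 0); last first.
  by apply/funext => s; rewrite mxE.
move=> s; apply: cvg_sumr => j; apply: cvgM; last exact: cvg_cst.
have h := is_derive_mexp A^T s i j.
by apply: differentiable_continuous; apply/derivable1_diffP.
Qed.

Definition ou_psi (t : R) (xi : 'cV[R]_n) : R[i] :=
  (\int[mu]_(s in `[0, t[) complex.Re (Phi (ou_line xi s))) +i*
  (\int[mu]_(s in `[0, t[) complex.Im (Phi (ou_line xi s))).

(** Stationarity compares the increment with Z h - Z 0, and Z 0 vanishes almost surely. *)
Let increment_law (s h : R) (u : 'cV[R]_d) (F : R -> R) : 0 <= s -> 0 <= h ->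
  continuous F -> (forall v, `|F v| <= 1) ->
  \int[P]_w F (dotv u (Z (s + h) w - Z s w)) = \int[P]_w F (dotv u (Z h w)).
Proof.
move=> s0 h0 cF F1.
have mZ r : 0 <= r -> measurable_fun setT (Z r).
  by move=> r0; exact: (levy_measurable hZ r0).
have mD r r' : 0 <= r -> 0 <= r' -> measurable_fun setT (fun w => Z r w - Z r' w).
  move=> r0 r'0; apply: measurable_fun_coordP => i j; under eq_fun do rewrite !mxE.
  by apply: measurable_funB; apply: (measurableT_comp (@measurable_coord R d 1 i j)); exact: mZ.
have m1 := mD (s + h) s (addr_ge0 s0 h0) s0; have m2 := mD h 0 h0 (lexx 0).
have mg : measurable_fun setT (fun v => F (dotv u v)).
  by apply: (measurableT_comp (continuous_measurable_fun cF)); exact: measurable_dotv.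
have mgE : measurable_fun setT (fun v => (F (dotv u v))%:E) by exact/measurable_EFinP.
have ig (Y : Omega -> 'cV[R]_d) : measurable_fun setT Y ->
    P.-integrable setT (EFin \o (fun w => F (dotv u (Y w)))).
  move=> mY; apply: (integrable_bounded_prob _ (C := 1)) => //.
  exact: (measurableT_comp mg mY).
transitivity (\int[P]_w F (dotv u (Z h w - Z 0 w))).
  have push (Y : Omega -> 'cV[R]_d) (mY : measurable_fun setT Y) :
      (\int[P]_w (F (dotv u (Y w)))%:E = \int[pushforward P Y]_v (F (dotv u v))%:E)%E.
    by rewrite (integral_pushforward mY mgE)// preimage_setT//; exact: ig.
  rewrite /Rintegral !push//; congr fine; apply: eq_measure_integral => E mE _.
  exact: levy_stationary hZ _ _ _ s0 h0 mE.
rewrite /Rintegral; congr fine; apply: ae_eq_integral => //.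
- by apply/measurable_EFinP; exact: (measurableT_comp mg m2).
- by apply/measurable_EFinP; apply: (measurableT_comp mg); exact: mZ.
- by apply: filterS (levy_start hZ) => w -> _; rewrite subr0.
Qed.

Lemma charfun_increment (s h : R) (u : 'cV[R]_d) : 0 <= s -> 0 <= h ->
  (\int[P]_w cos (dotv u (Z (s + h) w - Z s w))) +i*
  (\int[P]_w sin (dotv u (Z (s + h) w - Z s w))) = cexp (- (h%:C * Phi u)).
Proof.
move=> s0 h0; rewrite -hPhi//.
have Ei (z : R) : cexp ('i%C * z%:C) = cis z.
  have e1 : complex.Re ('i%C * z%:C) = 0 by rewrite cReM /= mul0r mulr0 subrr.
  have e2 : complex.Im ('i%C * z%:C) = z by rewrite cImM /= mul0r mul1r add0r.
  by rewrite cexpE e1 e2 expR0 mul1r.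
rewrite increment_law//; last 2 first.
- exact: continuous_cos.
- by move=> v; rewrite ler_norml cos_geN1 cos_le1.
rewrite increment_law//; last 2 first.
- exact: continuous_sin.
- by move=> v; rewrite ler_norml sin_geN1 sin_le1.
by rewrite /cintegral; congr (_ +i* _); apply: eq_Rintegral => w _; rewrite Ei.
Qed.

Section fixed_time.
Variables (t : R) (xi : 'cV[R]_n).
Hypothesis t0 : 0 < t.
Local Notation pt := (mesh_point t).
Local Notation et := (eta A^T t xi).

(** Independence of the increments makes the characteristic function a product, and each factor is
    evaluated by [charfun_increment]. *)
Lemma mesh_integral_sums (al : R) N :
  \int[P]_w cos (al + \sum_(k < N.+1)
      dotv (B^T *m et (pt N k)) (Z (pt N k.+1) w - Z (pt N k) w)) =
  complex.Re (cis al * cexp (- \sum_(k < N.+1) (t / N.+1%:R)%:C * Phi (ou_line xi (pt N k.+1)))).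
Proof.
have h0 : 0 <= t / N.+1%:R by rewrite divr_ge0// ltW.
pose Y k w := Z (pt N k.+1) w - Z (pt N k) w.
have mY k : measurable_fun setT (Y k).
  have m1 := levy_measurable hZ (mesh_point_ge0 t0 N k.+1).
  have m2 := levy_measurable hZ (mesh_point_ge0 t0 N k).
  apply: measurable_fun_coordP => i j; rewrite /Y.
  under eq_fun do rewrite !mxE.
  by apply: measurable_funB; [exact: (measurableT_comp (@measurable_coord R d 1 i j) m1)|
    exact: (measurableT_comp (@measurable_coord R d 1 i j) m2)].
pose theta k y := dotv (B^T *m et (pt N k)) y.
have mtheta k : measurable_fun setT (theta k) by exact: measurable_dotv.
have indepY (E : nat -> set 'cV[R]_d) : (forall i, measurable (E i)) ->
    P (\bigcap_(i in `I_N.+1) (Y i @^-1` E i)) = (\prod_(i < N.+1) P (Y i @^-1` E i))%E.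
  move=> mE; apply: (@levy_independent _ _ _ _ P Z hZ N.+1 (pt N) E _ _ mE).
    by rewrite mesh_point0.
  by move=> i; exact: ltW (mesh_point_lt t0 N i).
have := @integral_cos_sum R _ Omega P _ _ N.+1 Y mY indepY theta mtheta al.
rewrite /theta /Y => ->; congr (complex.Re (_ * _)).
have -> : \sum_(k < N.+1) (t / N.+1%:R)%:C * Phi (ou_line xi (pt N k.+1)) =
    \sum_(k < N.+1) (t / N.+1%:R)%:C * Phi (B^T *m et (pt N k)).
  (* Time reversal: [eta] at the mesh point p_k involves t - p_k = p_(N+1-k), so the reversed sum
     runs over p_1, ..., p_(N+1). *)
  rewrite (reindex_inj rev_ord_inj)/=; apply: eq_bigr => k _.
  apply: f_equal; apply: f_equal.
  have -> : pt N (N.+1 - k.+1).+1 = t - pt N k.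
    have kN : (k <= N)%N by rewrite -ltnS.
    rewrite subSS -subSn// /mesh_point natrB ?leqW//.
    by field; rewrite ?addr_eq0 gt_eqF ?ltr_wpDl.
  by [].
rewrite (big_morph (fun z => cexp (- z)) (op1 := *%R) (op2 := +%R) (id1 := 1) (id2 := 0)).
- apply: eq_bigr => k _; rewrite /charval /theta /Y.
  have -> : pt N k.+1 = pt N k + t / N.+1%:R by rewrite -(mesh_pointS t N k) subrKC.
  by rewrite charfun_increment// mesh_point_ge0.
- by move=> z w; rewrite opprD cexpD.
- by rewrite oppr0 cexp0.
Qed.

Lemma cvg_mesh_sum (F : R -> R) (C : R) :
  (forall s, 0 <= s < t -> F (pt N (mesh_index t N s).+1) @[N --> \oo] --> F s) ->
  (forall s, 0 <= s <= t -> `|F s| <= C) ->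
  \sum_(k < N.+1) (t / N.+1%:R) * F (pt N k.+1) @[N --> \oo] -->
  \int[mu]_(s in `[0, t[) F s.
Proof.
move=> cF FC.
have ic (c : R) : mu.-integrable `[0, t[ (EFin \o cst c).
  apply: (@integrable_bounded_itv _ _ _ t `|c|) => //.
  by apply: subset_itv; rewrite bnd_simp.
pose S N := step_sum t N (fun k _ => F (pt N k.+1)).
have ES N : \sum_(k < N.+1) (t / N.+1%:R) * F (pt N k.+1) = \int[mu]_(s in `[0, t[) S N s.
  rewrite (Rintegral_step_sum t0 (fun k _ => ic (F (pt N k.+1)))).2; apply: eq_bigr => k _.
  transitivity (F (pt N k.+1) * fine (mu `[pt N k, pt N k.+1[%classic)).
    by rewrite lebesgue_measure_itv/= lte_fin mesh_point_lt//= mesh_pointS mulrC.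
  by rewrite -Rintegral_cst.
under eq_fun do rewrite ES.
apply: (@Rdominated_cvg _ _ R mu _ _ _ (cst C)) => //.
- move=> N; exact: integrable_measurable (Rintegral_step_sum t0 (fun k _ => ic (F (pt N k.+1)))).1.
- move=> s; rewrite /= in_itv/= => /andP[s0 st].
  by under eq_fun do rewrite /S step_sumE//; apply: cF; rewrite s0.
- move=> N s; rewrite /= in_itv/= => /andP[s0 st]; rewrite /S step_sumE// FC//.
  by rewrite mesh_point_ge0// mesh_point_le// mesh_index_lt.
Qed.

Lemma cvg_mesh_exponent :
  (complex.Re (\sum_(k < N.+1) (t / N.+1%:R)%:C * Phi (ou_line xi (pt N k.+1)))
     @[N --> \oo] --> complex.Re (ou_psi t xi)) /\
  (complex.Im (\sum_(k < N.+1) (t / N.+1%:R)%:C * Phi (ou_line xi (pt N k.+1)))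
     @[N --> \oo] --> complex.Im (ou_psi t xi)).
Proof.
have cl := @continuous_ou_line xi.
have [M M0 hM] := cadlag_bounded (cadlag_continuous cl) t.
have [C hC] := levy_khintchine_bounded hnu M hLK.
have cvg s : 0 <= s < t ->
    (complex.Re (Phi (ou_line xi (pt N (mesh_index t N s).+1))) @[N --> \oo] --> complex.Re (Phi (ou_line xi s))) /\
    (complex.Im (Phi (ou_line xi (pt N (mesh_index t N s).+1))) @[N --> \oo] --> complex.Im (Phi (ou_line xi s))).
  move=> /andP[s0 st].
  apply: (cvg_levy_khintchine hnu (u_ := fun N => ou_line xi (pt N (mesh_index t N s).+1)) (M := M) hLK).
    by move=> N i; apply: hM; rewrite mesh_point_ge0// mesh_point_le// mesh_index_lt.
  move=> i; apply: (@cvg_mesh_hi _ _ t0 (fun u => ou_line xi u i 0)) => //.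
  by apply: cvg_at_right_filter; exact: cl.
have hCs s : 0 <= s <= t -> forall i, `|ou_line xi s i 0| <= M by move=> st i; exact: hM.
split.
  have ReS N : complex.Re (\sum_(k < N.+1) (t / N.+1%:R)%:C * Phi (ou_line xi (pt N k.+1))) =
      \sum_(k < N.+1) (t / N.+1%:R) * complex.Re (Phi (ou_line xi (pt N k.+1))).
    rewrite (big_morph (@complex.Re R) (@cReD R) (erefl _)).
    by apply: eq_bigr => k _; rewrite cReM /= mul0r subr0.
  under eq_fun do rewrite ReS.
  apply: (@cvg_mesh_sum (fun s => complex.Re (Phi (ou_line xi s))) C) => s st.
    exact: (cvg s st).1.
  exact: (hC _ (hCs s st)).1.
have ImS N : complex.Im (\sum_(k < N.+1) (t / N.+1%:R)%:C * Phi (ou_line xi (pt N k.+1))) =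
    \sum_(k < N.+1) (t / N.+1%:R) * complex.Im (Phi (ou_line xi (pt N k.+1))).
  rewrite (big_morph (@complex.Im R) (@cImD R) (erefl _)).
  by apply: eq_bigr => k _; rewrite cImM /= mul0r addr0.
under eq_fun do rewrite ImS.
apply: (@cvg_mesh_sum (fun s => complex.Im (Phi (ou_line xi s))) C) => s st.
  exact: (cvg s st).2.
exact: (hC _ (hCs s st)).2.
Qed.

(** The same expectations have two limits: along paths the sums converge to <xi, X_t> - <eta 0, x>,
    and by independence they are exponentials of Riemann sums converging to [ou_psi t xi]. *)
Lemma ou_charfun (al : R) :
  \int[P]_w cos (al + dotv xi (X t w)) =
  complex.Re (cis al * (cis (dotv xi (mexp (t *: A) *m x)) * cexp (- ou_psi t xi))).
Proof.
pose c := dotv xi (mexp (t *: A) *m x).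
rewrite mulrA -cisD -/c.
have Ec : dotv (et 0) x = c by rewrite /c -dotv_mulmxl trmx_mexp /eta subr0.
pose S N w := \sum_(k < N.+1) dotv (B^T *m et (pt N k)) (Z (pt N k.+1) w - Z (pt N k) w).
have mZ r : 0 <= r -> measurable_fun setT (Z r).
  by move=> r0; exact: (levy_measurable hZ r0).
have mS N : measurable_fun setT (S N).
  apply: measurable_sum => k; apply: measurable_dotv => //.
  apply: measurable_fun_coordP => i j; under eq_fun do rewrite !mxE.
  by apply: measurable_funB; apply: (measurableT_comp (@measurable_coord R d 1 i j));
    apply: mZ; exact: mesh_point_ge0.
have m_cos (f : Omega -> R) : measurable_fun setT f -> measurable_fun setT (fun w => cos (al + c + f w)).
  move=> mf; apply: (measurableT_comp (continuous_measurable_fun (@continuous_cos R))).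
  exact: measurable_funD.
have lim1 : \int[P]_w cos (al + c + S N w) @[N --> \oo] -->
    \int[P]_w cos (al + c + (dotv xi (X t w) - c)).
  apply: (Rdominated_cvg_ae (g := cst 1)) => //.
  - by move=> N; exact: m_cos.
  - apply: m_cos; apply: measurable_funB => //; apply: measurable_dotv => //.
    exact: (ou_measurable hX (ltW t0)).
  - apply: filterS3 (levy_start hZ) (ou_cadlag hX) (ou_sde hX) => w Z0 cX sdeX _.
    have X0 : X 0 w = x.
      rewrite (sdeX 0 (lexx 0)) Z0 mulmx0 addr0 [vintegral _ _](_ : _ = 0) ?addr0//.
      by apply/colP => i; rewrite !mxE set_itv1 Rintegral_set1.
    have h := @pathwise_cvg R n d A B (X^~ w) (Z^~ w) x xi t t0 cX sdeX.
    rewrite X0 Ec in h.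
    apply: (@cvg_comp _ _ _ (fun N => al + c + S N w) (@cos R) _ _ _ _ (@continuous_cos R _)).
    by apply: cvgD; [exact: cvg_cst|exact: h].
  - exact: finite_measure_integrable_cst.
  - by move=> N w _; rewrite ler_norml cos_geN1 cos_le1.
have [c1 c2] := cvg_mesh_exponent.
set Sg := fun N => \sum_(k < N.+1) (t / N.+1%:R)%:C * Phi (ou_line xi (pt N k.+1)) in c1 c2.
have Re_cc a z : complex.Re (cis a * cexp (- z)) = expR (- complex.Re z) * cos (a - complex.Im z).
  by rewrite cexpE mulrCA -cisD cReM /= mul0r subr0 cReN cImN.
have lim2 : \int[P]_w cos (al + c + S N w) @[N --> \oo] -->
    complex.Re (cis (al + c) * cexp (- ou_psi t xi)).
  rewrite Re_cc.
  have h3 : expR (- complex.Re (Sg N)) * cos (al + c - complex.Im (Sg N)) @[N --> \oo] -->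
      expR (- complex.Re (ou_psi t xi)) * cos (al + c - complex.Im (ou_psi t xi)).
    apply: cvgM.
      apply: (@cvg_comp _ _ _ _ (@expR R) _ _ _ _ (@continuous_expR R _)).
      exact: cvgN.
    apply: (@cvg_comp _ _ _ _ (@cos R) _ _ _ _ (@continuous_cos R _)).
    by apply: cvgB => //; exact: cvg_cst.
  apply: cvg_trans h3; apply: near_eq_cvg; near=> N.
  by rewrite -Re_cc -mesh_integral_sums.
transitivity (\int[P]_w cos (al + c + (dotv xi (X t w) - c))).
  by apply: eq_Rintegral => w _; congr cos; ring.
exact: (etrans (esym (cvg_lim (@Rhausdorff R) lim1)) (cvg_lim (@Rhausdorff R) lim2)).
Unshelve. all: end_near. Qed.

End fixed_time.

End ou_charfun.

(** * Jump rates *)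

Section trigonometric_lower_bounds.
Context (R : realType).

(** On ]0, 1/2] one has cos c >= 1 - c^2 >= 3/4, hence sin y >= (3/4) y by the mean value theorem; a
    second application gives the claim. *)
Lemma oneBcos_ge (x : R) : `|x| <= 2^-1 -> 3 / 8 * x ^+ 2 <= 1 - cos x.
Proof.
wlog x0 : x / 0 <= x.
  move=> h xle; have [x0|x0] := leP 0 x; first exact: h.
  by have := h (- x); rewrite cosN sqrrN normrN; apply=> //; rewrite oppr_ge0 ltW.
rewrite ger0_norm// => x1; move: x0; rewrite le_eqVlt => /predU1P[<-|x0].
  by rewrite expr0n mulr0 cos0 subrr.
have sin_ge (y : R) : 0 < y -> y <= 2^-1 -> 3 / 4 * y <= sin y.
  move=> y0 y1.
  have [c] := @MVT R (@sin R) (@cos R) 0 y y0 (fun x _ => is_derive_sin x)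
    (continuous_subspaceT (@continuous_sin R)).
  rewrite in_itv/= sin0 !subr0 => /andP[c0 cy] ->; rewrite ler_wpM2r ?(ltW y0)//.
  have := oneBcos_le_sqr c; have : `|c| ^+ 2 <= (2^-1) ^+ 2.
    by apply: lerXn2r; rewrite ?nnegrE// ger0_norm ltW// (lt_le_trans cy).
  by lra.
pose F (y : R) := (1 - cos y) - 3 / 8 * y ^+ 2.
have dF (y : R) : is_derive y 1 F (sin y - 3 / 4 * y).
  by apply: is_derive_eq; rewrite /GRing.scale/=; field.
have cF : continuous F.
  by move=> y; have h := dF y; apply: differentiable_continuous; apply/derivable1_diffP.
have [c] := @MVT R F _ 0 x x0 (fun y _ => dF y) (continuous_subspaceT cF).
rewrite in_itv/= => /andP[c0 cx]; rewrite {2}/F cos0 expr0n mulr0 !subrr !subr0 => h.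
rewrite -subr_ge0 -/(F x) h mulr_ge0 ?(ltW x0)// subr_ge0 sin_ge//.
exact: le_trans (ltW cx) x1.
Qed.

(** The integral equals 2 r - sin (2 r v) / v, and the last term is at most 1 / |v| < r in absolute
    value. *)
Lemma average_oneBcos_ge (r v : R) : 0 < r -> 1 < r * `|v| ->
  r <= \int[@lebesgue_measure R]_(u in `[0, 2 * r]) (1 - cos (u * v)).
Proof.
move=> r0 rv.
have v0 : v != 0 by apply/eqP => v0; move: rv; rewrite v0 normr0 mulr0 ltr10.
pose F (u : R) := u - sin (u * v) / v.
have dF (u : R) : is_derive u 1 F (1 - cos (u * v)).
  have h1 : is_derive u 1 (fun u : R => u * v) v.
    by apply: is_derive_eq; rewrite /GRing.scale/=; ring.
  have h2 := @is_derive1_comp R (@sin R) (fun u => u * v) u _ _ (is_derive_sin _) h1.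
  have h3 := is_deriveB (is_derive_id u (1 : R)) (is_deriveM h2 (is_derive_cst v^-1 u (1 : R))).
  by apply: (is_derive_eq h3); rewrite /GRing.scale/=; field.
have cf : continuous (fun u : R => 1 - cos (u * v)).
  move=> u; apply: cvgB; first exact: cvg_cst.
  apply: (@cvg_comp _ _ _ _ (@cos R) _ _ _ _ (@continuous_cos R _)).
  by apply: cvgM; [exact: cvg_id|exact: cvg_cst].
have r2 : 0 < 2 * r by rewrite mulr_gt0.
rewrite (@RFTC2 R F _ _ _ r2 cf dF) /F mul0r sin0 mul0r subrr subr0.
have : `|sin (2 * r * v) / v| <= r.
  rewrite normrM normfV ler_pdivrMr ?normr_gt0//.
  by rewrite (le_trans _ (ltW rv))// ler_norml sin_geN1 sin_le1.
by rewrite ler_norml => /andP[_]; lra.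
Qed.

End trigonometric_lower_bounds.

Section jump_bounds.
Context (R : realType) (n : nat) d (E : measurableType d).
Variables (m : {sigma_finite_measure set E -> \bar R}) (D : set E) (T : E -> 'cV[R]_n).
Hypothesis mD : measurable D.
Hypothesis mT : measurable_fun setT T.
Local Notation mu := (@lebesgue_measure R).

Let mTj j : measurable_fun setT (fun x => T x j 0).
Proof. exact: (measurableT_comp (@measurable_coord R n 1 j 0) mT). Qed.

Definition exponent_on (xi : 'cV[R]_n) : \bar R :=
  (\int[m]_(x in D) (1 - cos (dotv xi (T x)))%:E)%E.

Definition axis (j : 'I_n) (u : R) : 'cV[R]_n := u *: delta_mx j 0.

Lemma dotv_axis j u v : dotv (axis j u) v = u * v j 0.
Proof. by rewrite dotvZl dotv_delta. Qed.

Lemma measurable_oneBcos xi : measurable_fun setT (fun x => 1 - cos (dotv xi (T x))).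
Proof.
apply: measurable_funB => //.
apply: (measurableT_comp (continuous_measurable_fun (@continuous_cos R))).
exact: measurable_dotv.
Qed.

Lemma measurable_jump_le j (r : R) : measurable [set x | r * `|T x j 0| <= 1].
Proof.
have := @measurable_funM _ _ _ setT (cst r) (fun x => `|T x j 0|)
  (measurable_cst _) (measurableT_comp (@normr_measurable R setT) (mTj j)).
move=> /(_ measurableT `]-oo, 1]%classic (measurable_itv _)); rewrite setTI.
by rewrite (_ : _ @^-1` _ = [set x | r * `|T x j 0| <= 1]).
Qed.

Lemma measurable_jump_gt j (r : R) : measurable [set x | 1 < r * `|T x j 0|].
Proof.
rewrite (_ : [set x | _] = ~` [set x | r * `|T x j 0| <= 1]).
  exact/measurableC/measurable_jump_le.
by apply/seteqP; split => x /=; rewrite ltNge => /negP.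
Qed.

Variables (j : 'I_n) (r M : R).
Hypothesis r0 : 0 < r.
Hypothesis M0 : 0 <= M.
Hypothesis expM : forall u, 0 <= u <= 2 * r -> (exponent_on (axis j u) <= M%:E)%E.

Lemma small_jumps :
  (\int[m]_(x in D `&` [set x | (r * `|T x j 0| <= 1)%R]) ((r * T x j 0) ^+ 2)%:E <= (11 * M)%:E)%E.
Proof.
have mS := measurable_jump_le j r.
have mDS : measurable (D `&` [set x | r * `|T x j 0| <= 1]) by exact: measurableI.
have r2 : 0 <= r / 2 <= 2 * r by apply/andP; split; have := r0; lra.
(* At frequency r / 2 the phase is at most 1/2, and [oneBcos_ge] gives (r T_j)^2 <= (32/3) (1 -
   cos); 11 is an integer above 32/3. *)
apply: (@le_trans _ _ ((32 / 3)%:E * exponent_on (axis j (r / 2)))%E); last first.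
  apply: (@le_trans _ _ ((32 / 3)%:E * M%:E)%E).
    by rewrite lee_pmul2l ?expM// lte_fin; lra.
  by rewrite -EFinM lee_fin ler_wpM2r//; lra.
rewrite /exponent_on -ge0_integralZl//; [|by apply/measurable_EFinP; apply: measurable_funTS; exact: measurable_oneBcos].
apply: (@le_trans _ _ (\int[m]_(x in D `&` [set x | (r * `|T x j 0| <= 1)%R])
   ((32 / 3)%:E * (1 - cos (dotv (axis j (r / 2)) (T x)))%:E))%E).
  apply: ge0_le_integral => //.
  - by move=> x _; rewrite lee_fin sqr_ge0.
  - apply/measurable_EFinP; apply: measurable_funTS; apply: measurable_funX.
    exact: measurable_funM.
  - apply: emeasurable_funM => //; apply/measurable_EFinP; apply: measurable_funTS.
    exact: measurable_oneBcos.
  - move=> x [_ /= hx]; rewrite -EFinM lee_fin dotv_axis.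
    have h : `|r / 2 * T x j 0| <= 2^-1.
      by rewrite normrM ger0_norm; have := r0; lra.
    have := oneBcos_ge h.
    have -> : (r / 2 * T x j 0) ^+ 2 = (r * T x j 0) ^+ 2 / 4 by rewrite !expr2; field.
    by lra.
apply: ge0_subset_integral => //.
- apply: emeasurable_funM => //; apply/measurable_EFinP; apply: measurable_funTS.
  exact: measurable_oneBcos.
Qed.

(* Averaging the exponent over [0 <= u <= 2 r] bounds it below by [1/2] at each
   jump with [r * |T_j| > 1]. *)
Lemma large_jumps : (m (D `&` [set x | (1 < r * `|T x j 0|)%R]) <= (2 * M)%:E)%E.
Proof.
pose I := `[0, 2 * r]%classic : set (measurableTypeR R).
pose h (z : measurableTypeR R * E) := ((1 - cos (z.1 * T z.2 j 0)) * (\1_I z.1 * \1_D z.2))%:E.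
have mI : measurable I by exact: measurable_itv.
have mh : measurable_fun setT h.
  apply/measurable_EFinP; apply: measurable_funM.
    apply: measurable_funB => //.
    apply: (measurableT_comp (continuous_measurable_fun (@continuous_cos R))).
    apply: measurable_funM; first exact: measurable_fst.
    exact: (measurableT_comp (mTj j) measurable_snd).
  apply: measurable_funM; first exact: (measurableT_comp (measurable_indic mI)).
  exact: (measurableT_comp (measurable_indic mD)).
have h0 z : (0 <= h z)%E by rewrite lee_fin !mulr_ge0 ?oneBcos_ge0.
have hu u : (\int[m]_x h (u, x) = (\1_I u)%:E * exponent_on (axis j u))%E.
  rewrite /exponent_on [X in (_ * X)%E]integral_mkcond -ge0_integralZl//; last 2 first.
  - apply/(measurable_restrictT _ _).1 => //; apply/measurable_EFinP; apply: measurable_funTS.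
    exact: measurable_oneBcos.
  - by move=> x _; apply: erestrict_ge0 => y _; rewrite lee_fin oneBcos_ge0.
  apply: eq_integral => x _; rewrite /h /= patchE dotv_axis [\1_D x]indicE.
  by case: (x \in D); rewrite ?mulr1 ?mulr0 ?mule0// -EFinM mulrC.
have hx x : (\int[mu]_u h (u, x) = (\1_D x)%:E *
    (\int[mu]_(u in `[0, 2 * r]) (1 - cos (u * T x j 0)))%:E)%E.
  rewrite EFin_Rintegral//; last first.
    apply: integrable_continuous_itv => u; apply: cvgB; first exact: cvg_cst.
    apply: (@cvg_comp _ _ _ _ (@cos R) _ _ _ _ (@continuous_cos R _)).
    by apply: cvgM; [exact: cvg_id|exact: cvg_cst].
  rewrite [X in (_ * X)%E]integral_mkcond -ge0_integralZl//; last 2 first.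
  - apply/(measurable_restrictT _ _).1 => //; apply/measurable_EFinP; apply: measurable_funTS.
    apply: measurable_funB => //.
    apply: (measurableT_comp (continuous_measurable_fun (@continuous_cos R))).
    exact: measurable_funM.
  - by move=> u _; apply: erestrict_ge0 => y _; rewrite lee_fin oneBcos_ge0.
  apply: eq_integral => u _; rewrite /h /= patchE [\1_I u]indicE -/I.
  by case: (u \in I); rewrite ?mul1r ?mul0r ?mulr0 ?mule0// -EFinM mulrC.
have muI : (\int[mu]_u (\1_I u)%:E = (2 * r)%:E)%E.
  rewrite integral_indic//; apply: (etrans (congr1 mu (setIT I))).
  apply: (etrans (lebesgue_measure_itv `[0, 2 * r])).
  by rewrite /= lte_fin mulr_gt0// -EFinB subr0.
have upper : (\int[mu]_u \int[m]_x h (u, x) <= (2 * r * M)%:E)%E.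
  have -> : (2 * r * M)%:E = (\int[mu]_u ((\1_I u)%:E * M%:E))%E.
    rewrite ge0_integralZr//; last exact/measurable_EFinP/measurable_indic.
    by rewrite muI -EFinM.
  apply: ge0_le_integral => //.
  - by move=> u _; exact: integral_ge0.
  - exact: (measurable_fun_fubini_tonelli_F h).
  - by apply: emeasurable_funM => //; exact/measurable_EFinP/measurable_indic.
  - move=> u _; rewrite hu indicE; have [uI|uI] := boolP (u \in I); last by rewrite !mul0e.
    by rewrite !mul1e expM//; move/set_mem : uI; rewrite /I /= in_itv.
have mL := measurable_jump_gt j r.
have mDL : measurable (D `&` [set x | 1 < r * `|T x j 0|]) by exact: measurableI.
have lower : (r%:E * m (D `&` [set x | (1 < r * `|T x j 0|)%R]) <= \int[m]_x \int[mu]_u h (u, x))%E.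
  rewrite -(integral_cst m mDL r%:E) [leLHS]integral_mkcond.
  apply: ge0_le_integral => //.
  - by move=> x _; apply: erestrict_ge0 => y _; rewrite lee_fin ltW.
  - by apply/(measurable_restrictT _ _).1 => //; exact: measurable_cst.
  - exact: (measurable_fun_fubini_tonelli_G h).
  - move=> x _; rewrite hx patchE; case: ifPn => [/set_mem [Dx /= rT]|_].
      by rewrite indicE mem_set// mul1e lee_fin average_oneBcos_ge.
    rewrite mule_ge0// lee_fin; apply: Rintegral_ge0 => u _; exact: oneBcos_ge0.
rewrite -(@lee_pmul2l _ r%:E) ?lte_fin//.
apply: (le_trans lower); rewrite -(fubini_tonelli h)//.
by apply: (le_trans upper); rewrite -EFinM lee_fin; lra.
Qed.

End jump_bounds.

Section jump_sums.
Context (R : realType) (n : nat) d (E : measurableType d).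
Variables (m : {sigma_finite_measure set E -> \bar R}) (D : set E) (T : E -> 'cV[R]_n).
Hypothesis mD : measurable D.
Hypothesis mT : measurable_fun setT T.
Variables (r M : R).
Hypothesis r0 : 0 < r.
Hypothesis M0 : 0 <= M.
Hypothesis expM : forall (j : 'I_n) u, 0 <= u <= 2 * r -> (exponent_on m D T (axis j u) <= M%:E)%E.

Let mTj j : measurable_fun setT (fun x => T x j 0).
Proof. exact: (measurableT_comp (@measurable_coord R n 1 j 0) mT). Qed.

Definition small_set := [set x | forall j, r * `|T x j 0| <= 1].

Lemma measurable_small_set : measurable small_set.
Proof.
rewrite (_ : small_set = \bigcap_(j in [set: 'I_n]) [set x | r * `|T x j 0| <= 1]); last first.
  by apply/seteqP; split => x /= h j; [move=> _|]; exact: h.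
by apply: fin_bigcap_measurable => // j _; exact: measurable_jump_le.
Qed.

Lemma sqr_l1norm_le (v : 'cV[R]_n) : l1norm v ^+ 2 <= n%:R * \sum_j v j 0 ^+ 2.
Proof.
rewrite expr2 /l1norm mulr_suml.
apply: (@le_trans _ _ (\sum_i \sum_j (v i 0 ^+ 2 + v j 0 ^+ 2) / 2)).
  apply: ler_sum => i _; rewrite mulr_sumr; apply: ler_sum => j _.
  have := sqr_ge0 (`|v i 0| - `|v j 0|).
  by rewrite -(real_normK (num_real (v i 0))) -(real_normK (num_real (v j 0))); lra.
under eq_bigr do rewrite -mulr_suml big_split/= sumr_const card_ord.
rewrite -mulr_suml big_split/= sumr_const card_ord sumrMnl mulr_natl.
have e (a : R) : (a + a) / 2 = a by field.
by rewrite e.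
Qed.

(** One factor n comes from Cauchy-Schwarz, the other from summing [small_jumps] over the
    coordinates. *)
Lemma integral_small_jumps :
  (\int[m]_(x in D `&` small_set) (l1norm (T x) ^+ 2)%:E <= (11 * n%:R ^+ 2 * M / r ^+ 2)%:E)%E.
Proof.
have mDS := measurableI _ _ mD measurable_small_set.
have mj j : measurable_fun (D `&` small_set) (fun x => ((r * T x j 0) ^+ 2)%:E).
  apply/measurable_EFinP; apply: measurable_funTS; apply: measurable_funX.
  exact: measurable_funM.
have r20 : 0 <= n%:R / r ^+ 2 by rewrite divr_ge0 ?sqr_ge0.
apply: (@le_trans _ _ (\int[m]_(x in D `&` small_set)
  ((n%:R / r ^+ 2)%:E * \sum_j ((r * T x j 0) ^+ 2)%:E))%E).
  apply: ge0_le_integral => //.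
  - by move=> x _; rewrite lee_fin sqr_ge0.
  - apply/measurable_EFinP; apply: measurable_funTS; apply: measurable_funX.
    exact: measurable_l1norm.
  - by apply: emeasurable_funM => //; apply: emeasurable_sum => j.
  - move=> x _; rewrite sumEFin -EFinM lee_fin (le_trans (sqr_l1norm_le _))//.
    under [X in _ <= _ * X]eq_bigr do rewrite exprMn.
    rewrite -mulr_sumr mulrA mulfVK// sqrf_eq0; exact: lt0r_neq0.
rewrite ge0_integralZl//; last 2 first.
- by apply: emeasurable_sum => j.
- by move=> x _; apply: sume_ge0 => j _; rewrite lee_fin sqr_ge0.
rewrite ge0_integral_sum//; last by move=> j x _; rewrite lee_fin sqr_ge0.
apply: (@le_trans _ _ ((n%:R / r ^+ 2)%:E * \sum_(j < n) (11 * M)%:E)%E).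
  rewrite lee_wpmul2l ?lee_fin//; apply: lee_sum => j _.
  apply: le_trans (small_jumps mD mT r0 M0 (expM j)); apply: ge0_subset_integral => //.
  - by apply: measurableI => //; exact: measurable_jump_le.
  - apply/measurable_EFinP; apply: measurable_funTS; apply: measurable_funX.
    exact: measurable_funM.
  - by move=> x _; rewrite lee_fin sqr_ge0.
  - by move=> x [Dx Sx]; split=> //=; exact: Sx.
rewrite sumEFin sumr_const card_ord -EFinM lee_fin -mulr_natr expr2.
by rewrite le_eqVlt; apply/orP; left; apply/eqP; ring.
Qed.

Lemma measure_large_jumps : (m (D `\` small_set) <= (2 * n%:R * M)%:E)%E.
Proof.
have mDL : measurable (D `\` small_set) by apply: measurableD => //; exact: measurable_small_set.
pose L j := D `&` [set x | 1 < r * `|T x j 0|].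
have mL j : measurable (L j) by apply: measurableI => //; exact: measurable_jump_gt.
rewrite -[X in m X]setIT -integral_indic//.
apply: (@le_trans _ _ (\int[m]_x (\sum_j (\1_(L j) x)%:E))%E).
  apply: ge0_le_integral => //.
  - exact/measurable_EFinP/measurable_indic.
  - by apply: emeasurable_sum => j; exact/measurable_EFinP/measurable_indic.
  - move=> x _; rewrite indicE; case: (boolP (x \in _)) => [/set_mem[Dx]|_]; last first.
      by apply: sume_ge0.
    move=> /existsNP[j /negP]; rewrite -ltNge => xj.
    rewrite (bigD1 j)//= indicE mem_set//.
    by rewrite leeDl// sume_ge0.
rewrite ge0_integral_sum//; last by move=> j; exact/measurable_EFinP/measurable_indic.
apply: (@le_trans _ _ (\sum_(j < n) (2 * M)%:E)%E).
  apply: lee_sum => j _; rewrite integral_indic// setIT; exact: (large_jumps mD mT r0 M0 (expM j)).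
rewrite sumEFin sumr_const card_ord lee_fin -mulr_natr.
by rewrite le_eqVlt; apply/orP; left; apply/eqP; ring.
Qed.

(** For |xi| <= 1 / (k + 1) the integrand is at most [f k], which does not depend on xi and tends to
    0 under the integrable bound [G] (second moment of the small jumps plus twice the indicator of
    the large ones). The value 1/2 stands for any constant below 1, the level at which the rate is
    read off. *)
Lemma exponent_on_small : exists2 r1, 0 < r1 & forall xi : 'cV[R]_n, enorm xi <= r1 ->
  (exponent_on m D T xi <= (2^-1)%:E)%E.
Proof.
have mS := measurable_small_set.
have ml1 : measurable_fun setT (fun x => l1norm (T x)) by exact: measurable_l1norm.
pose G x := l1norm (T x) ^+ 2 * \1_small_set x + 2 * \1_(~` small_set) x.
have G0 x : 0 <= G x by rewrite addr_ge0// mulr_ge0// sqr_ge0.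
have mG1 : measurable_fun setT (fun x => l1norm (T x) ^+ 2 * \1_small_set x).
  by apply: measurable_funM; [exact: measurable_funX|exact: measurable_indic].
have mG2 : measurable_fun setT (fun x => 2 * \1_(~` small_set) x : R).
  by apply: measurable_funM => //; apply: measurable_indic; exact: measurableC.
have iG : m.-integrable D (EFin \o G).
  apply: ge0_integrable_lty => //.
    by apply: measurable_funTS; exact: measurable_funD.
  rewrite (eq_integral (fun x => ((l1norm (T x) ^+ 2 * \1_small_set x)%:E +
    (2 * \1_(~` small_set) x)%:E)%E))//.
  rewrite ge0_integralD//; last 3 first.
  - by move=> x _; rewrite lee_fin mulr_ge0// sqr_ge0.
  - by apply/measurable_EFinP; exact: measurable_funTS.
  - by apply/measurable_EFinP; exact: measurable_funTS.
  apply: lte_add_pinfty.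
    apply: le_lt_trans (ltry (11 * n%:R ^+ 2 * M / r ^+ 2)).
    apply: le_trans integral_small_jumps; rewrite [leRHS]integral_mkcondr.
    apply: ge0_le_integral => //.
    - by move=> x _; rewrite lee_fin mulr_ge0// sqr_ge0.
    - by apply/measurable_EFinP; exact: measurable_funTS.
    - apply/(measurable_restrict _ _ _).1 => //; apply/measurable_EFinP.
      by apply: measurable_funTS; exact: measurable_funX.
    - move=> x _; rewrite patchE indicE; case: ifP => _; by rewrite ?mulr1 ?mulr0.
  under eq_integral do rewrite EFinM.
  rewrite ge0_integralZl//; last first.
    by apply/measurable_EFinP; apply: measurable_funTS; apply: measurable_indic; exact: measurableC.
  rewrite integral_indic//; last exact: measurableC.
  apply: lte_mul_pinfty => //; apply: le_lt_trans (ltry (2 * n%:R * M)).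
  by rewrite setIC -setDE; exact: measure_large_jumps.
pose f k x := Num.min 2 ((k.+1%:R^-1 * l1norm (T x)) ^+ 2).
have f0 k x : 0 <= f k x by rewrite le_min sqr_ge0 andbT.
have mf k : measurable_fun D (f k).
  apply: measurable_funTS; apply: measurable_minr => //.
  by apply: measurable_funX; exact: measurable_funM.
have fG k x : `|f k x| <= G x.
  rewrite ger0_norm// /f /G !indicE in_setC; case: (x \in _) => /=.
    rewrite mulr1 mulr0 addr0 ge_min; apply/orP; right.
    by rewrite exprMn ler_piMl ?sqr_ge0// exprn_ile1// ?invr_ge0// invf_le1// ler1n.
  by rewrite mulr0 mulr1 add0r ge_min lexx.
have cf : (\int[m]_(x in D) f k x) @[k --> \oo] --> \int[m]_(x in D) (0 : R).
  apply: (Rdominated_cvg mD mf _ iG) => // x Dx.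
  have h1 : (k.+1%:R^-1 * l1norm (T x)) ^+ 2 @[k --> \oo] --> (0 : R).
    rewrite [X in _ --> X](_ : 0 = (0 * l1norm (T x)) * (0 * l1norm (T x))); last by rewrite !mul0r.
    have h : k.+1%:R^-1 * l1norm (T x) @[k --> \oo] --> 0 * l1norm (T x).
      by apply: cvgM; [exact: cvg_harmonic|exact: cvg_cst].
    exact: (cvgM h h).
  apply: (squeeze_cvgr _ (cvg_cst _) h1).
  by near=> k; rewrite f0 /f ge_min lexx orbT.
rewrite (_ : \int[m]_(x in D) 0 = 0) in cf; last by rewrite /Rintegral integral0_eq.
have [k _ /(_ k (leqnn k)) /= fk] := cvgr_lt _ cf (2^-1) ltac:(by rewrite invr_gt0).
exists k.+1%:R^-1 => [|xi xik]; first by rewrite invr_gt0.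
have if_ : m.-integrable D (EFin \o f k) by apply: integrable_le_norm iG.
apply: (@le_trans _ _ (\int[m]_(x in D) (f k x)%:E)%E); last first.
  by rewrite -EFin_Rintegral// lee_fin ltW.
apply: ge0_le_integral => //.
- by apply/measurable_EFinP; apply: measurable_funTS; exact: measurable_oneBcos.
- exact/measurable_EFinP.
move=> x _; rewrite lee_fin /f le_min; apply/andP; split.
  by rewrite lerBlDl -lerBlDr; have := cos_geN1 (dotv xi (T x)); lra.
apply: (@le_trans _ _ (`|dotv xi (T x)| ^+ 2)).
  exact: oneBcos_le_sqr.
apply: lerXn2r; rewrite ?nnegrE//; first by rewrite mulr_ge0 ?l1norm_ge0// invr_ge0.
by rewrite (le_trans (normr_dotv_l1 _ _))// ler_wpM2r// l1norm_ge0.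
Unshelve. all: by end_near.
Qed.

End jump_sums.

(** * The exponent of the Ornstein-Uhlenbeck process *)

Section sigma_finite_copy.
Context d (T : measurableType d) (R : realType) (nu : {measure set T -> \bar R}).
Hypothesis nu_sigma : sigma_finite setT nu.

(** The same function under a name indexed by the proof of sigma-finiteness, to which the
    sigma-finite structure required by product measures can be attached. *)
Definition sigma_finite_copy of sigma_finite setT nu : set T -> \bar R := nu.
Local Notation nuS := (sigma_finite_copy nu_sigma).
HB.instance Definition _ := Measure.copy nuS nu.
HB.instance Definition _ := @Measure_isSigmaFinite.Build _ _ _ nuS nu_sigma.

End sigma_finite_copy.

Lemma sigma_finite_product d1 d2 (T1 : measurableType d1) (T2 : measurableType d2) (R : realType)
    (m1 : {sigma_finite_measure set T1 -> \bar R}) (m2 : {sigma_finite_measure set T2 -> \bar R}) :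
  sigma_finite setT (m1 \x m2)%E.
Proof.
have /sigma_finiteP[F [TF ndF Foo]] := sigma_finiteT m1.
have /sigma_finiteP[G [TG ndG Goo]] := sigma_finiteT m2.
exists (fun k => F k `*` G k) => [|k].
  apply/esym; rewrite -subTset => -[x y] _.
  have [i _ Fx] : (\bigcup_k F k) x by rewrite -TF.
  have [j _ Gy] : (\bigcup_k G k) y by rewrite -TG.
  exists (maxn i j) => //; split => /=.
    by move: x Fx; exact/subsetPset/ndF/leq_maxl.
  by move: y Gy; exact/subsetPset/ndG/leq_maxr.
have [mF Fk] := Foo k; have [mG Gk] := Goo k; split; first exact: measurableX.
by rewrite product_measure1E// lte_mul_pinfty// ge0_fin_numE.
Qed.

Section ou_jumps.
Context (R : realType) (n d : nat) (A : 'M[R]_n) (B : 'M[R]_(n, d)).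
Variables (nu : {sigma_finite_measure set 'cV[R]_d -> \bar R}).
Variables (Phi : 'cV[R]_d -> R[i]) (b : 'cV[R]_d).
Hypothesis hLK : levy_khintchine Phi 0 b nu.
Local Notation mu := (@lebesgue_measure R).
Local Notation E := (measurableTypeR R * 'cV[R]_d)%type.
Local Notation V0 := (~` [set (0 : 'cV[R]_d)]).

Let hnu : levy_measure nu. Proof. by case: hLK. Qed.

Let leb : {sigma_finite_measure set (measurableTypeR R) -> \bar R} := mu.

Definition time_jump_measure : {sigma_finite_measure set E -> \bar R} :=
  sigma_finite_copy (sigma_finite_product leb nu).
Local Notation m := time_jump_measure.

Lemma time_jump_tonelli (f : E -> \bar R) : measurable_fun setT f -> (forall z, (0 <= f z)%E) ->
  (\int[m]_z f z = \int[mu]_s \int[nu]_z f (s, z))%E.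
Proof. exact: (@fubini_tonelli1 _ _ _ _ _ leb nu). Qed.

Lemma time_jump_fubini (f : E -> \bar R) : m.-integrable setT f ->
  (\int[m]_z f z = \int[mu]_s \int[nu]_z f (s, z))%E.
Proof. by move=> fi; rewrite -[LHS](@integral12_prod_meas1 _ _ _ _ _ leb nu f fi). Qed.

Definition ou_jump (z : E) : 'cV[R]_n := mexp (z.1 *: A) *m (B *m z.2).

Lemma continuous_mexp_coord i j : continuous (fun s : R => mexp (s *: A) i j).
Proof.
move=> s; have h := is_derive_mexp A s i j.
by apply: differentiable_continuous; apply/derivable1_diffP.
Qed.

Lemma measurable_ou_jump : measurable_fun setT ou_jump.
Proof.
apply: measurable_fun_coordP => i j; rewrite (ord1 j).
rewrite (_ : (fun _ => _) = fun z : E =>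
  \sum_k mexp (z.1 *: A) i k * \sum_l B k l * z.2 l 0); last first.
  by apply/funext => z; rewrite mxE; apply: eq_bigr => k _; rewrite mxE.
apply: measurable_sum => k; apply: measurable_funM.
  have h : measurable_fun setT (fun s : measurableTypeR R => mexp (s *: A) i k).
    exact: continuous_measurable_fun (@continuous_mexp_coord i k).
  exact: (measurableT_comp h measurable_fst).
apply: measurable_sum => l; apply: measurable_funM => //.
exact: (measurableT_comp (@measurable_coord R d 1 l 0) measurable_snd).
Qed.

Lemma dotv_ou_line xi s z : dotv (ou_line A B xi s) z = dotv xi (ou_jump (s, z)).
Proof. by rewrite /ou_line dotv_mulmxl -trmx_mexp dotv_mulmxl. Qed.

(** The Levy-Khintchine integrands vanish at the jump 0, so that the jump space can be taken to be
    all of R^d. *)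
Lemma integral_setC0 (f : 'cV[R]_d -> \bar R) : f 0 = 0%E ->
  (\int[nu]_(z in V0) f z = \int[nu]_z f z)%E.
Proof.
move=> f0; rewrite integral_mkcond; apply: eq_integral => z _; rewrite patchE.
case: ifPn => // /negP; rewrite in_setC => /negP/negPn/set_mem ->; by rewrite f0.
Qed.

Lemma measurable_ou_exponent (f : 'cV[R]_d -> 'cV[R]_d -> R) :
  (forall xi, measurable_fun setT (fun z : E => f (ou_line A B xi z.1) z.2)) ->
  (forall u, nu.-integrable V0 (EFin \o f u)) ->
  forall xi, measurable_fun setT (fun s : measurableTypeR R =>
    \int[nu]_(z in V0) f (ou_line A B xi s) z).
Proof.
move=> mf fi xi.
apply: (@measurable_Rintegral_param _ _ _ _ _ nu V0 (fun (s : measurableTypeR R) z =>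
  f (ou_line A B xi s) z)) => //; exact: measurable_setC0.
Qed.

Lemma measurable_ou_line xi : measurable_fun setT (fun z : E => ou_line A B xi z.1).
Proof.
apply: measurable_fun_coordP => i j; rewrite (ord1 j).
exact: (measurableT_comp (continuous_measurable_fun (@continuous_ou_line R n d A B xi i)) measurable_fst).
Qed.

Lemma measurable_levy_re_line xi :
  measurable_fun setT (fun z : E => levy_re (ou_line A B xi z.1) z.2).
Proof.
apply: measurable_funB => //.
apply: (measurableT_comp (continuous_measurable_fun (@continuous_cos R))).
by apply: measurable_dotv => //; exact: measurable_ou_line.
Qed.

Lemma measurable_levy_im_line xi :
  measurable_fun setT (fun z : E => levy_im (ou_line A B xi z.1) z.2).
Proof.
have m1 : measurable_fun setT (fun z : E => dotv (ou_line A B xi z.1) z.2).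
  by apply: measurable_dotv => //; exact: measurable_ou_line.
apply: measurable_funB.
  apply: measurable_funM => //.
  exact: (measurableT_comp (measurable_indic (@measurable_unit_ball R d)) measurable_snd).
exact: (measurableT_comp (continuous_measurable_fun (@continuous_sin R)) m1).
Qed.

Lemma levy_re0 xi : levy_re xi (0 : 'cV[R]_d) = 0.
Proof. by rewrite /levy_re dotv0r cos0 subrr. Qed.

Lemma levy_im0 xi : levy_im xi (0 : 'cV[R]_d) = 0.
Proof. by rewrite /levy_im dotv0r sin0 mul0r subrr. Qed.

(** Tonelli presents the time integral of Re Phi as the exponent of the jumps [ou_jump] under ds
    nu(dz). It holds in the extended reals for any measurable I, including the half-line of the last
    assertion. *)
Lemma re_exponentE (I : set (measurableTypeR R)) xi : measurable I ->
  re_exponent A B Phi I xi = exponent_on m (I `*` setT) ou_jump xi.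
Proof.
move=> mI; rewrite /exponent_on integral_mkcond.
rewrite (_ : (_ \_ _)%E = fun z : E => ((levy_re (ou_line A B xi z.1) z.2) * \1_I z.1)%:E); last first.
  apply/funext => -[s z]; rewrite patchE /levy_re dotv_ou_line /= indicE.
  have -> : ((s, z) \in I `*` setT) = (s \in I).
    by apply/idP/idP => /set_mem; [case=> Is _|move=> Is]; rewrite mem_set.
  by case: (s \in I); rewrite ?mulr1 ?mulr0.
have mre := measurable_levy_re_line xi.
rewrite time_jump_tonelli; last 2 first.
- apply/measurable_EFinP; apply: measurable_funM => //.
  exact: (measurableT_comp (measurable_indic mI) measurable_fst).
- by move=> z; rewrite lee_fin mulr_ge0// oneBcos_ge0.
rewrite /re_exponent integral_mkcond; apply: eq_integral => s _; rewrite patchE /=.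
have h : (\int[nu]_z (levy_re (ou_line A B xi s) z)%:E)%E = (complex.Re (Phi (ou_line A B xi s)))%:E.
  rewrite (levy_khintchineE hLK _).1 EFin_Rintegral; first last.
  - exact: integrable_levy_re.
  - exact: measurable_setC0.
  by rewrite integral_setC0// levy_re0.
rewrite indicE; case: ifP => _; last first.
  by under eq_integral do rewrite mulr0; rewrite integral0.
under eq_integral do rewrite mulr1.
by rewrite h /ou_line mulmxA.
Qed.

Section finite_horizon.
Variable t : R.
Hypothesis t0 : 0 < t.
Local Notation D := ((`[0, t[%classic : set (measurableTypeR R)) `*` [set: 'cV[R]_d]).

Let mI : measurable (`[0, t[%classic : set (measurableTypeR R)).
Proof. exact: measurable_itv. Qed.

Lemma measurable_horizon : measurable D.
Proof. exact: measurableX. Qed.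

Lemma ou_line_bounded xi : exists2 M : R, 0 <= M &
  forall s i, 0 <= s <= t -> `|ou_line A B xi s i 0| <= M.
Proof. have [M M0 hM] := cadlag_bounded (cadlag_continuous (@continuous_ou_line R n d A B xi)) t.
by exists M. Qed.

Lemma integrable_Phi_line xi :
  mu.-integrable `[0, t[ (EFin \o (fun s => complex.Re (Phi (ou_line A B xi s)))) /\
  mu.-integrable `[0, t[ (EFin \o (fun s => complex.Im (Phi (ou_line A B xi s)))).
Proof.
have [M M0 hM] := ou_line_bounded xi.
have [C hC] := levy_khintchine_bounded hnu M hLK.
have hCs s : `[0, t[%classic s -> forall i, `|ou_line A B xi s i 0| <= M.
  by move=> /=; rewrite in_itv/= => /andP[s0 st] i; rewrite hM// s0 ltW.
have sub : `[0, t[ `<=` `[0, t] by apply: subset_itvl; rewrite bnd_simp.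
split; apply: (@integrable_bounded_itv _ _ _ t C) => //.
- rewrite (_ : (fun s => _) = fun s => \int[nu]_(z in V0) levy_re (ou_line A B xi s) z); last first.
    by apply/funext => s; rewrite (levy_khintchineE hLK _).1.
  apply: measurable_funTS; apply: measurable_ou_exponent => [xi'|u].
    exact: measurable_levy_re_line.
  exact: integrable_levy_re.
- by move=> s st; have [] := hC _ (hCs s st).
- rewrite (_ : (fun s => _) = fun s => dotv b (ou_line A B xi s) + \int[nu]_(z in V0) levy_im (ou_line A B xi s) z); last first.
    by apply/funext => s; rewrite (levy_khintchineE hLK _).2.
  apply: measurable_funD.
    apply: measurable_funTS; apply: continuous_measurable_fun.
    rewrite (_ : (fun s => _) = fun s => dotv (ou_line A B xi s) b); last first.
      by apply/funext => s; rewrite dotvC.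
    have h : continuous (fun s : R => dotv (ou_line A B xi s) b).
      by apply: (@continuous_dotv R d (ou_line A B xi)) => i; exact: (@continuous_ou_line R n d A B xi i).
    exact: h.
  apply: measurable_funTS; apply: measurable_ou_exponent => [xi'|u].
    exact: measurable_levy_im_line.
  exact: integrable_levy_im.
- by move=> s st; have [] := hC _ (hCs s st).
Qed.

Lemma re_exponent_ou_psi xi :
  re_exponent A B Phi `[0, t] xi = (complex.Re (ou_psi A B Phi t xi))%:E.
Proof.
rewrite /= EFin_Rintegral//; last exact: (integrable_Phi_line xi).1.
rewrite integral_itv_bndo_bndc; last first.
  by have := integrable_measurable (integrable_Phi_line xi).1 => /measurable_EFinP.
by apply: eq_integral => s _; rewrite /ou_line mulmxA.
Qed.

Lemma exponent_on_ou_psi xi :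
  exponent_on m D ou_jump xi = (complex.Re (ou_psi A B Phi t xi))%:E.
Proof.
rewrite -re_exponentE// /= EFin_Rintegral//; last exact: (integrable_Phi_line xi).1.
by apply: eq_integral => s _; rewrite /ou_line mulmxA.
Qed.

Lemma levy_weight0 : levy_weight (0 : 'cV[R]_d) = 0.
Proof.
rewrite /levy_weight /enorm dotv0r sqrtr0 expr0n /=.
by apply/min_idPr.
Qed.

Lemma integrable_horizon_weight (f : E -> R) (K : R) : measurable_fun setT f ->
  (forall z, D z -> `|f z| <= K * levy_weight z.2) -> m.-integrable D (EFin \o f).
Proof.
move=> mf fK.
have mw : measurable_fun setT (fun z : E => levy_weight z.2).
  exact: (measurableT_comp (@measurable_levy_weight R d) measurable_snd).
have iw : m.-integrable D (EFin \o (fun z : E => levy_weight z.2)).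
  apply: ge0_integrable_lty => //; first exact: measurable_horizon.
  - exact: measurable_funTS.
  - by move=> z _; exact: levy_weight_ge0.
  rewrite integral_mkcond.
  rewrite (_ : (_ \_ _)%E = fun z : E => ((\1_(`[0, t[%classic : set (measurableTypeR R)) z.1) * levy_weight z.2)%:E); last first.
    apply/funext => -[s z]; rewrite patchE /= indicE.
    have -> : ((s, z) \in D) = (s \in (`[0, t[%classic : set (measurableTypeR R))).
      by apply/idP/idP => /set_mem; [case=> Is _|move=> Is]; rewrite mem_set.
    by case: (s \in _); rewrite ?mul1r ?mul0r.
  rewrite time_jump_tonelli; last 2 first.
  - apply/measurable_EFinP; apply: measurable_funM => //.
    exact: (measurableT_comp (measurable_indic mI) measurable_fst).
  - by move=> z; rewrite lee_fin mulr_ge0// levy_weight_ge0.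
  have [_ _ hoo] := hnu.
  pose W := (\int[nu]_z (levy_weight z)%:E)%E.
  have Woo : (W < +oo)%E.
    by rewrite /W -(@integral_setC0 (fun z => (levy_weight z)%:E)) ?levy_weight0.
  have W0 : (0 <= W)%E by apply: integral_ge0 => z _; rewrite lee_fin levy_weight_ge0.
  rewrite (_ : (fun s => _) = fun s => ((\1_(`[0, t[%classic : set (measurableTypeR R)) s)%:E * W)%E).
    rewrite ge0_integralZr//; last exact/measurable_EFinP/measurable_indic.
    rewrite integral_indic// setIT; apply: lte_mul_pinfty => //.
      by rewrite fin_numE gt_eqF ?(lt_le_trans _ (measure_ge0 _ _))//= lt_eqF//
        (le_lt_trans _ (ltry t))// (lebesgue_measure_itv `[0, t[)/= lte_fin t0 -EFinB subr0.
  apply/funext => s; rewrite /W -ge0_integralZl//; first last.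
  - by move=> z _; rewrite lee_fin levy_weight_ge0.
  - by apply/measurable_EFinP; exact: measurable_levy_weight.
apply: (integrable_le_norm measurable_horizon _ fK) => //; first exact: measurable_funTS.
exact: (integrableZl measurable_horizon K iw).
Qed.

Lemma Rintegral_horizon (f : E -> R) (K : R) : measurable_fun setT f ->
  (forall s, f (s, 0) = 0) -> (forall z, D z -> `|f z| <= K * levy_weight z.2) ->
  \int[m]_(z in D) f z = \int[mu]_(s in `[0, t[) \int[nu]_(z in V0) f (s, z).
Proof.
move=> mf f0 fK.
have fi := integrable_horizon_weight mf fK.
have fi' : m.-integrable setT ((EFin \o f) \_ D).
  by rewrite -integrable_mkcond//; exact: measurable_horizon.
rewrite /Rintegral; congr fine; rewrite integral_mkcond.
rewrite (time_jump_fubini fi') [RHS]integral_mkcond.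
apply: eq_integral => s _; rewrite [RHS]patchE.
have mfs : measurable_fun setT (fun z => f (s, z)).
  by apply: (measurableT_comp mf); exact: measurable_pair1.
case: ifPn => [/set_mem Is|nIs]; last first.
  rewrite integral0_eq// => z _; rewrite patchE memNset// => -[Is _].
  by move: nIs; rewrite mem_set.
have fis : nu.-integrable V0 (EFin \o (fun z => f (s, z))).
  have iw := integrableZl (@measurable_setC0 R d) K (integrable_levy_weight hnu).
  apply: (@integrable_le_norm _ _ _ _ _ _ (fun z => K * levy_weight z)) => //.
  - exact: measurable_setC0.
  - exact: measurable_funTS.
  - by move=> z _; exact: (fK (s, z)).
rewrite -/(Rintegral nu V0 (fun z => f (s, z))) EFin_Rintegral//; last exact: measurable_setC0.
rewrite integral_setC0 ?f0//; apply: eq_integral => z _.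
by rewrite patchE mem_set.
Qed.

Lemma ou_jump_bound : exists2 C : R, 0 <= C &
  forall z j, D z -> `|ou_jump z j 0| <= C * enorm z.2.
Proof.
have hj (j : 'I_n) : exists M : R, 0 <= M /\
    forall z, D z -> `|ou_jump z j 0| <= M * enorm z.2.
  have [M M0 hM] := ou_line_bounded (delta_mx j 0); exists (d%:R * M); split.
    by rewrite mulr_ge0.
  move=> -[s z] [/= st _]; rewrite -(dotv_delta j) -dotv_ou_line.
  apply: normr_dotv_le_enorm => i; apply: hM.
  by move: st; rewrite in_itv/= => /andP[-> /ltW].
exists (\sum_j xget 0 [set M | 0 <= M /\ forall z, D z -> `|ou_jump z j 0| <= M * enorm z.2]).
  by apply: sumr_ge0 => j _; case: (xgetPex 0 (hj j)).
move=> z j Dz; have [M0 /(_ z Dz) h] := xgetPex 0 (hj j).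
apply: (le_trans h); rewrite ler_wpM2r ?enorm_ge0// (bigD1 j)//= lerDl.
by apply: sumr_ge0 => i _; case: (xgetPex 0 (hj i)).
Qed.

Section truncation.
Variable r : R.
Hypothesis r0 : 0 < r.
Local Notation small := (small_set ou_jump r).
Hypothesis moo : (m (D `\` small) < +oo)%E.

Let msm : measurable small.
Proof. exact: measurable_small_set measurable_ou_jump _. Qed.

(* Passing from the cut-off at [|z| < 1] of the Levy-Khintchine formula to the
   cut-off at the small jumps only shifts the drift. *)
Definition drift_cut (z : E) : R :=
  \1_[set y : 'cV[R]_d | enorm y < 1] z.2 - \1_small z.

Definition ou_drift : 'cV[R]_n := \col_j
  (\int[mu]_(s in `[0, t[) dotv b (ou_line A B (delta_mx j 0) s) +
   \int[m]_(z in D) (ou_jump z j 0 * drift_cut z)).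

Lemma measurable_drift_cut j : measurable_fun setT (fun z => ou_jump z j 0 * drift_cut z).
Proof.
apply: measurable_funM.
  exact: (measurableT_comp (@measurable_coord R n 1 j 0) measurable_ou_jump).
apply: measurable_funB; last exact: measurable_indic.
exact: (measurableT_comp (measurable_indic (@measurable_unit_ball R d)) measurable_snd).
Qed.

(** The two cut-offs differ in two cases. If |z| < 1 but the jump is large, then 1 <= r C |z| and
    |T_j| <= C |z| <= r C^2 |z|^2; if |z| >= 1 but the jump is small, then |T_j| <= 1 / r. The
    constant adds both bounds. *)
Lemma integrable_drift_cut j : m.-integrable D (EFin \o (fun z => ou_jump z j 0 * drift_cut z)).
Proof.
have [C C0 hC] := ou_jump_bound.
apply: (@integrable_horizon_weight _ (r * C ^+ 2 + r^-1)); first exact: measurable_drift_cut.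
move=> z Dz; rewrite /drift_cut !indicE.
have k0 : 0 <= r * C ^+ 2 by rewrite mulr_ge0 ?sqr_ge0// ltW.
have ri : 0 <= r^-1 by rewrite invr_ge0 ltW.
have [z1|z1] := ltP (enorm z.2) 1.
  rewrite mem_set//.
  have -> : levy_weight z.2 = enorm z.2 ^+ 2.
    by apply/min_idPr; rewrite expr_le1 ?enorm_ge0// ltW.
  case: (boolP (z \in small)) => [_|zs].
    by rewrite subrr mulr0 normr0 mulr_ge0 ?addr_ge0// sqr_ge0.
  rewrite subr0 mulr1.
  have [i hi] : exists i, 1 < r * `|ou_jump z i 0|.
    move: zs; rewrite notin_setE => /existsNP[i /negP]; rewrite -ltNge => hi; by exists i.
  have hz := hC z i Dz.
  have h1 : 1 <= r * (C * enorm z.2).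
    by rewrite (le_trans (ltW hi))// ler_wpM2l// ltW.
  have h2 : 0 <= C * enorm z.2 by rewrite mulr_ge0// enorm_ge0.
  rewrite (le_trans (hC z j Dz))//.
  apply: (@le_trans _ _ (r * C ^+ 2 * enorm z.2 ^+ 2)); last first.
    by rewrite ler_wpM2r ?sqr_ge0// lerDl.
  rewrite -mulrA -exprMn expr2 [leRHS]mulrA.
  by rewrite -[leLHS]mul1r ler_wpM2r.
rewrite memNset/=; last by apply/negP; rewrite -leNgt.
have -> : levy_weight z.2 = 1 by apply/min_idPl; rewrite exprn_ege1.
case: (boolP (z \in small)) => [/set_mem zs|_].
  rewrite mulr1 sub0r mulrN1 normrN -(@ler_pM2l _ r)//.
  rewrite (le_trans (zs j))// mulrDr mulfV ?gt_eqF// lerDr mulr_ge0// ltW//.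
by rewrite subr0 mulr0 normr0 mulr1 addr_ge0.
Qed.

Lemma integrable_drift_line xi :
  mu.-integrable `[0, t[ (EFin \o (fun s => dotv b (ou_line A B xi s))).
Proof.
have [M M0 hM] := ou_line_bounded xi.
apply: (@integrable_bounded_itv _ _ _ t (d%:R * (l1norm b * M))) => //.
- by apply: subset_itvl; rewrite bnd_simp.
- apply: measurable_funTS.
  have h : continuous (fun s : R => dotv (ou_line A B xi s) b).
    by apply: (@continuous_dotv R d (ou_line A B _)) => i; exact: (@continuous_ou_line R n d A B _ i).
  rewrite (_ : (fun s => _) = fun s => dotv (ou_line A B xi s) b).
    exact: continuous_measurable_fun h.
  by apply/funext => s; rewrite dotvC.
- move=> s /=; rewrite in_itv/= => /andP[s0 st].
  apply: normr_dotv_bound => i; first exact: coord_le_l1norm.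
  by rewrite hM// s0 ltW.
Qed.

Lemma dotv_drift xi : dotv xi ou_drift =
  \int[mu]_(s in `[0, t[) dotv b (ou_line A B xi s) +
  \int[m]_(z in D) (dotv xi (ou_jump z) * drift_cut z).
Proof.
have iline j := integrable_drift_line (delta_mx j 0).
rewrite {1}/dotv; under eq_bigr do rewrite mxE mulrDr.
rewrite big_split/=; congr (_ + _).
  transitivity (\sum_j \int[mu]_(s in `[0, t[) (xi j 0 * dotv b (ou_line A B (delta_mx j 0) s))).
    by apply: eq_bigr => j _; rewrite RintegralZl.
  rewrite -Rintegral_sumr//; last first.
    by move=> j; apply: (@integrableZl _ _ _ _ _ _ (xi j 0) _ (iline j)).
  apply: eq_Rintegral => s _.
  rewrite dotvC dotv_ou_line; apply: eq_bigr => j _.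
  by rewrite [in LHS]dotvC dotv_ou_line dotv_delta.
transitivity (\sum_j \int[m]_(z in D) (xi j 0 * (ou_jump z j 0 * drift_cut z))).
  by apply: eq_bigr => j _; rewrite RintegralZl//; [exact: measurable_horizon|exact: integrable_drift_cut].
rewrite -Rintegral_sumr; [|exact: measurable_horizon|]; last first.
  move=> j; exact: (integrableZl measurable_horizon (xi j 0) (integrable_drift_cut j)).
apply: eq_Rintegral => z _; rewrite /dotv mulr_suml; apply: eq_bigr => j _.
by rewrite mulrA.
Qed.

Lemma Rintegral_small_large (f : E -> R) : m.-integrable D (EFin \o f) ->
  \int[m]_(z in D) f z = \int[m]_(z in D `&` small) f z + \int[m]_(z in D `\` small) f z.
Proof.
move=> fi; rewrite -[in LHS](setUIDK D small) Rintegral_setU ?setUIDK//.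
- by apply: measurableI => //; exact: measurable_horizon.
- by apply: measurableD => //; exact: measurable_horizon.
- by apply/disj_setPS => z [[_ ?] [_ ?]].
Qed.

Let mlarge : measurable (D `\` small).
Proof. by apply: measurableD => //; exact: measurable_horizon. Qed.

Let msmall : measurable (D `&` small).
Proof. by apply: measurableI => //; exact: measurable_horizon. Qed.

Let ilarge (f : E -> R) (C : R) : measurable_fun setT f -> (forall z, `|f z| <= C) ->
  m.-integrable (D `\` small) (EFin \o f).
Proof. exact: integrable_bounded_L. Qed.

Let msin xi : measurable_fun setT (fun z => sin (dotv xi (ou_jump z))).
Proof.
apply: (measurableT_comp (continuous_measurable_fun (@continuous_sin R))).
by apply: measurable_dotv => //; exact: measurable_ou_jump.
Qed.

Let mcos xi : measurable_fun setT (fun z => cos (dotv xi (ou_jump z))).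
Proof.
apply: (measurableT_comp (continuous_measurable_fun (@continuous_cos R))).
by apply: measurable_dotv => //; exact: measurable_ou_jump.
Qed.

Lemma ou_psi_Re xi : complex.Re (ou_psi A B Phi t xi) =
  complex.Re (levy_psi m (D `&` small) ou_jump xi) +
  complex.Re (jump_psi m (D `\` small) ou_jump xi).
Proof.
have [M M0 hM] := ou_line_bounded xi.
have le z : D z -> `|levy_re (ou_line A B xi z.1) z.2| <= levy_const d M * levy_weight z.2.
  move=> [/= +  _]; rewrite in_itv/= => /andP[z0 zt].
  by apply: normr_levy_re => i; rewrite hM// z0 ltW.
have mre := measurable_levy_re_line xi.
have ire := integrable_horizon_weight mre le.
rewrite (_ : complex.Re (ou_psi _ _ _ _ _) = \int[mu]_(s in `[0, t[) \int[nu]_(z in V0) levy_re (ou_line A B xi s) z); last first.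
  by apply: eq_Rintegral => s _; rewrite (levy_khintchineE hLK _).1.
rewrite -(Rintegral_horizon mre _ le); last by move=> s; exact: levy_re0.
rewrite Rintegral_small_large//; congr (_ + _).
  by apply: eq_Rintegral => -[s z] _; rewrite /levy_re dotv_ou_line.
transitivity (\int[m]_(z in D `\` small) (1 - cos (dotv xi (ou_jump z)))).
  by apply: eq_Rintegral => -[s z] _; rewrite /levy_re dotv_ou_line.
rewrite RintegralB//; first last.
- by apply: (ilarge (mcos xi) (C := 1)) => z; rewrite ler_norml cos_geN1 cos_le1.
- by apply: (@ilarge (cst 1) 1) => // z; rewrite /= normr1.
by rewrite ReImE /= Rintegral_cst// mul1r.
Qed.

Lemma ou_psi_Im xi : complex.Im (ou_psi A B Phi t xi) =
  complex.Im (levy_psi m (D `&` small) ou_jump xi) +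
  complex.Im (jump_psi m (D `\` small) ou_jump xi) + dotv xi ou_drift.
Proof.
have [M M0 hM] := ou_line_bounded xi.
have le z : D z -> `|levy_im (ou_line A B xi z.1) z.2| <= levy_const d M * levy_weight z.2.
  move=> [/= +  _]; rewrite in_itv/= => /andP[z0 zt].
  by apply: normr_levy_im => i; rewrite hM// z0 ltW.
have mim := measurable_levy_im_line xi.
have iim := integrable_horizon_weight mim le.
have icut : m.-integrable D (EFin \o (fun z => dotv xi (ou_jump z) * drift_cut z)).
  rewrite (_ : _ \o _ = fun z => (\sum_j (xi j 0 * (ou_jump z j 0 * drift_cut z))%:E)%E).
    apply: integrable_sum => [|j _]; first exact: measurable_horizon.
    exact: (integrableZl measurable_horizon (xi j 0) (integrable_drift_cut j)).
  apply/funext => z /=; rewrite sumEFin; congr EFin; rewrite /dotv mulr_suml.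
  by apply: eq_bigr => j _; rewrite mulrA.
(* Subtracting the drift correction exchanges the indicator of the unit ball for that of the small
   jumps: [k] is the compensated integrand on small jumps and - sin on large ones. *)
pose k z := levy_im (ou_line A B xi z.1) z.2 - dotv xi (ou_jump z) * drift_cut z.
have ik : m.-integrable D (EFin \o k).
  by apply: (integrableB measurable_horizon iim icut).
have kE z : k z = dotv xi (ou_jump z) * \1_small z - sin (dotv xi (ou_jump z)).
  by case: z => s z; rewrite /k /levy_im dotv_ou_line /drift_cut /=; ring.
rewrite (_ : complex.Im (ou_psi _ _ _ _ _) = \int[mu]_(s in `[0, t[) (dotv b (ou_line A B xi s) +
  \int[nu]_(z in V0) levy_im (ou_line A B xi s) z)); last first.
  by apply: eq_Rintegral => s _; rewrite (levy_khintchineE hLK _).2.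
have iinner : mu.-integrable `[0, t[ (EFin \o (fun s => \int[nu]_(z in V0) levy_im (ou_line A B xi s) z)).
  have := integrableB mI (integrable_Phi_line xi).2 (integrable_drift_line xi).
  apply: eq_integrable => // s _ /=.
  by rewrite (levy_khintchineE hLK _).2 -EFinB addrAC subrr add0r.
rewrite RintegralD//; last exact: integrable_drift_line.
rewrite -(Rintegral_horizon mim _ le); last by move=> s; exact: levy_im0.
rewrite [X in _ + X](_ : _ = \int[m]_(z in D) (k z + dotv xi (ou_jump z) * drift_cut z)); last first.
  by apply: eq_Rintegral => z _; rewrite /k subrK.
rewrite RintegralD//; last exact: measurable_horizon.
rewrite dotv_drift addrCA; congr (_ + _).
rewrite Rintegral_small_large//; congr (_ + _).
  apply: eq_Rintegral => z /set_mem[_ zs]; rewrite kE indicE mem_set// mulr1//.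
transitivity (\int[m]_(z in D `\` small) (- sin (dotv xi (ou_jump z)))).
  by apply: eq_Rintegral => z /set_mem[_ zs]; rewrite kE indicE memNset// mulr0 sub0r.
rewrite ReImE /= sub0r.
have := RintegralZl (-1) mlarge (ilarge (msin xi) (C := 1) _).
rewrite mulN1r => <-; first by apply: eq_Rintegral => z _; rewrite mulN1r.
by move=> z; rewrite ler_norml sin_geN1 sin_le1.
Qed.

Lemma ou_psi_decomposition xi : ou_psi A B Phi t xi =
  levy_psi m (D `&` small) ou_jump xi + jump_psi m (D `\` small) ou_jump xi +
  'i%C * (dotv xi ou_drift)%:C.
Proof.
apply/eqP; rewrite eq_complex; apply/andP; split; apply/eqP.
  by rewrite ou_psi_Re !cReD cReM /= mul0r mulr0 subrr addr0.
by rewrite ou_psi_Im !cImD; congr (_ + _); rewrite cImM /= mul0r mul1r add0r.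
Qed.

End truncation.
End finite_horizon.
End ou_jumps.

Lemma fourier_L1_modulation (R : realType) n (f : 'cV[R]_n -> R[i]) c : cintegrable f ->
  fourier_L1 (fun xi => cis (dotv xi c) * f xi) = fourier_L1 f.
Proof.
move=> fi.
have mF : measurable_fun setT (fun y => `|fourier f y|%:E).
  by apply/measurable_EFinP; apply: measurableT_comp => //; exact: measurable_fourier.
have F0 y : (0 <= `|fourier f y|%:E)%E by rewrite lee_fin.
apply: (etrans _ (ge0_integral_shiftv (- c) mF F0)).
by apply: eq_integral => y _; rewrite fourier_modulation.
Qed.

(** * Inverse transform of the difference at a fixed time *)

Section fixed_time_estimate.
Context (R : realType) (n : nat) (i0 : 'I_n) (d : nat) (A : 'M[R]_n) (B : 'M[R]_(n, d)).
Variables (nu : {sigma_finite_measure set 'cV[R]_d -> \bar R}).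
Variables (Phi : 'cV[R]_d -> R[i]) (b : 'cV[R]_d).
Hypothesis hLK : levy_khintchine Phi 0 b nu.
Local Notation lv := (lebesgue_vec R n).
Local Notation m := (time_jump_measure nu).
Local Notation T := (ou_jump A B).
Local Notation psi := (ou_psi A B Phi).
Variables t r I : R.
Hypothesis t0 : 0 < t.
Hypothesis r0 : 0 < r.
Local Notation D := ((`[0, t[%classic : set (measurableTypeR R)) `*` [set: 'cV[R]_d]).
Local Notation S := (D `&` small_set T r).
Local Notation L := (D `\` small_set T r).
Hypothesis exp1 : forall (j : 'I_n) u, 0 <= u <= 2 * r ->
  (exponent_on m D T (axis j u) <= 1%:E)%E.
Hypothesis intI : (\int[lv]_xi (enorm xi ^+ (n + 2) * expR (- complex.Re (psi t xi)))%:E <= I%:E)%E.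

Let mD : measurable D. Proof. by apply: measurableX => //; exact: measurable_itv. Qed.
Let mT := measurable_ou_jump A B.
Let msm := measurable_small_set mT r.
Let mS : measurable S. Proof. exact: measurableI. Qed.
Let mL : measurable L. Proof. exact: measurableD. Qed.

Let isq : m.-integrable S (EFin \o (fun z => l1norm (T z) ^+ 2)).
Proof.
apply: ge0_integrable_lty => //.
  by apply: measurable_funTS; apply: measurable_funX; exact: measurable_l1norm.
  by move=> z _; exact: sqr_ge0.
exact: le_lt_trans (integral_small_jumps mD mT r0 ler01 exp1) (ltry _).
Qed.

Let lam_le : (m L <= (2 * n%:R)%:E)%E.
Proof. by have := measure_large_jumps mD mT r0 ler01 exp1; rewrite mulr1. Qed.

Let Loo : (m L < +oo)%E. Proof. exact: le_lt_trans lam_le (ltry _). Qed.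

Let K : R := 11 * n%:R ^+ 2.

Let sqK : \int[m]_(z in S) (l1norm (T z) ^+ 2) <= K / r ^+ 2.
Proof.
rewrite -lee_fin EFin_Rintegral//.
by have := integral_small_jumps mD mT r0 ler01 exp1; rewrite mulr1.
Qed.

Let K0 : 0 <= K. Proof. by rewrite mulr_ge0// sqr_ge0. Qed.

Let psiS := levy_psi m S T.
Let psiL := jump_psi m L T.
Let mpsiS : cmeasurable psiS. Proof. exact: cmeasurable_levy_psi mS mT isq i0. Qed.
Let mpsiL : cmeasurable psiL.
Proof. by apply: cmeasurableB; [exact: cmeasurable_cst|exact: cmeasurable_jump_mean]. Qed.

(** The constant is 3 times the bound 2 n on the mass of the large jumps. It allows Re psi_S to be
    replaced by Re psi_t at the cost of a fixed factor. *)
Let Re_psiL xi : 0 <= complex.Re (psiL xi) <= 6 * n%:R.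
Proof.
apply/andP; split; first exact: jump_psi_Re_ge0.
rewrite (le_trans (ler_norm _))// (le_trans (normr_Re_cmod _))//.
rewrite (le_trans (cmod_jump_psi mL mT Loo _))//.
have : fine (m L) <= 2 * n%:R.
  by rewrite -lee_fin fineK// ge0_fin_numE.
by have n0 : 0 <= n%:R :> R by []; lra.
Qed.

Let Re_psiE xi : complex.Re (psi t xi) = complex.Re (psiS xi) + complex.Re (psiL xi).
Proof. exact: (ou_psi_Re hLK t0 Loo). Qed.

(** Bound for the integral of [weight]. For |xi| <= r the weight is at most 2^(n+2), on a ball
    inside a cube of volume (2 r)^n; for |xi| > r one has 1 + |xi| / r <= 2 |xi| / r, and the
    exponential loses at most e^(6n). *)
Definition symbol_mass : R :=
  2 ^+ (n + 2) * ((2 * r) ^+ n + expR (6 * n%:R) * I / r ^+ (n + 2)).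

Let weight xi := japanese r xi ^+ (n + 2) * expR (- complex.Re (psiS xi)).

Let weight_ge0 xi : 0 <= weight xi.
Proof. by rewrite mulr_ge0 ?expR_ge0// exprn_ge0// addr_ge0// divr_ge0 ?enorm_ge0// ltW. Qed.

Let mweight : measurable_fun setT weight.
Proof.
apply: measurable_funM.
  apply: measurable_funX; apply: measurable_funD => //; apply: measurable_funM => //.
  exact: measurable_enorm.
by apply: (measurableT_comp (@measurable_expR R)); apply: measurable_funN; exact: mpsiS.1.
Qed.

Let box : set 'cV[R]_n := [set v | forall i, v i 0 \in `[- r, r]].

Let mbox : measurable box.
Proof.
have := @measurable_coord_box R n (fun=> `[- r, r]%classic) (fun=> measurable_itv _).
by rewrite (_ : [set y | _] = box).
Qed.

Let weight_le xi : weight xi <= 2 ^+ (n + 2) * (\1_box xi +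
  expR (6 * n%:R) / r ^+ (n + 2) * (enorm xi ^+ (n + 2) * expR (- complex.Re (psi t xi)))).
Proof.
have e0 := enorm_ge0 xi.
have Re0 : 0 <= complex.Re (psiS xi) by apply: Rintegral_ge0 => z _; exact: oneBcos_ge0.
have c0 : 0 <= expR (6 * n%:R) / r ^+ (n + 2) * (enorm xi ^+ (n + 2) * expR (- complex.Re (psi t xi))).
  by rewrite !mulr_ge0 ?expR_ge0 ?exprn_ge0// invr_ge0 exprn_ge0// ltW.
rewrite /weight; have [xir|rxi] := leP (enorm xi) r.
  have -> : \1_box xi = 1 :> R.
    rewrite indicE mem_set// => i; rewrite in_itv/=.
    by have := le_trans (coord_le_enorm xi i) xir; rewrite ler_norml.
  have j0 : 0 <= japanese r xi by rewrite addr_ge0// divr_ge0// ltW.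
  have j2 : japanese r xi <= 2.
    by have : enorm xi / r <= 1 by [rewrite ler_pdivrMr// mul1r]; rewrite /japanese; lra.
  apply: ler_pM; [exact: exprn_ge0|exact: expR_ge0|by apply: lerXn2r; rewrite ?nnegrE|].
  rewrite (@le_trans _ _ 1)//; last by rewrite lerDl.
    by rewrite -expR0 ler_expR lerNl oppr0.
apply: (@le_trans _ _ ((2 * (enorm xi / r)) ^+ (n + 2) *
  (expR (6 * n%:R) * expR (- complex.Re (psi t xi))))).
  have xr1 : 1 <= enorm xi / r by rewrite ler_pdivlMr// mul1r ltW.
  have j0 : 0 <= japanese r xi by rewrite /japanese; lra.
  apply: ler_pM; rewrite ?expR_ge0 ?exprn_ge0//.
    by apply: lerXn2r; rewrite ?nnegrE /japanese; lra.
  rewrite -expRD ler_expR Re_psiE; have /andP[] := Re_psiL xi; lra.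
rewrite (_ : (2 * (enorm xi / r)) ^+ (n + 2) = 2 ^+ (n + 2) * (enorm xi / r) ^+ (n + 2)); last exact: exprMn.
rewrite -[leLHS]mulrA ler_wpM2l ?exprn_ge0// expr_div_n.
have i1 : 0 <= (\1_box xi : R) by [].
rewrite -[leLHS]add0r lerD// le_eqVlt; apply/orP; left; apply/eqP.
by ring.
Qed.

Lemma integral_weight_le : (\int[lv]_xi (weight xi)%:E <= symbol_mass%:E)%E.
Proof.
have mpsi : measurable_fun setT (fun xi => complex.Re (psi t xi)).
  rewrite (_ : (fun xi => _) = fun xi => complex.Re (psiS xi) + complex.Re (psiL xi)).
    by apply: measurable_funD; [exact: mpsiS.1|exact: mpsiL.1].
  by apply/funext => xi; exact: Re_psiE.
pose g xi := enorm xi ^+ (n + 2) * expR (- complex.Re (psi t xi)).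
have g0 xi : 0 <= g xi by rewrite mulr_ge0 ?expR_ge0// exprn_ge0// enorm_ge0.
have mg : measurable_fun setT g.
  apply: measurable_funM; first by apply: measurable_funX; exact: measurable_enorm.
  by apply: (measurableT_comp (@measurable_expR R)); exact: measurable_funN.
have k0 : 0 <= expR (6 * n%:R) / r ^+ (n + 2) by rewrite divr_ge0 ?expR_ge0// exprn_ge0// ltW.
apply: (@le_trans _ _ (\int[lv]_xi ((2 ^+ (n + 2))%:E * ((\1_box xi)%:E +
    (expR (6 * n%:R) / r ^+ (n + 2))%:E * (g xi)%:E)))%E).
  apply: ge0_le_integral => //.
  - by move=> xi _; rewrite lee_fin.
  - exact/measurable_EFinP.
  - apply: emeasurable_funM => //; apply: emeasurable_funD.
      exact/measurable_EFinP/measurable_indic.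
    by apply: emeasurable_funM => //; exact/measurable_EFinP.
  - by move=> xi _; have h := weight_le xi; rewrite -lee_fin in h; exact: h.
have mg2 : measurable_fun setT (fun xi => (expR (6 * n%:R) / r ^+ (n + 2))%:E * (g xi)%:E)%E.
  by apply: emeasurable_funM => //; exact/measurable_EFinP.
have mi : measurable_fun setT (fun xi => (\1_box xi)%:E : \bar R).
  exact/measurable_EFinP/measurable_indic.
have g20 xi : (0 <= (expR (6 * n%:R) / r ^+ (n + 2))%:E * (g xi)%:E)%E.
  by rewrite -EFinM lee_fin mulr_ge0.
rewrite (ge0_integralZl lv measurableT); first last.
- by rewrite lee_fin exprn_ge0.
- by move=> xi _; rewrite adde_ge0.
- exact: emeasurable_funD.
rewrite [symbol_mass%:E]EFinM lee_wpmul2l ?lee_fin ?exprn_ge0//.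
rewrite (ge0_integralD lv measurableT)// [leRHS]EFinD leeD//.
  rewrite integral_indic// setIT.
  have hr : - r <= r by have := r0; lra.
  have := @lebesgue_vec_box R n (fun=> - r) (fun=> r) (fun=> hr).
  rewrite prodr_const card_ord opprK -mulr2n -(mulr_natl r 2) => hb.
  by rewrite le_eqVlt; apply/orP; left; apply/eqP; exact: hb.
rewrite (ge0_integralZl lv measurableT)//; last 2 first.
- exact/measurable_EFinP.
- by move=> xi _; rewrite lee_fin.
by rewrite mulrAC [leRHS]EFinM lee_wpmul2l ?lee_fin.
Qed.

Let iweight : lv.-integrable setT (EFin \o weight).
Proof.
by apply: ge0_integrable_lty => //; exact: le_lt_trans integral_weight_le (ltry _).
Qed.

Definition ou_chi (y xi : 'cV[R]_n) : R[i] := cis (dotv xi y) * cexp (- psi t xi).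

Let drift : 'cV[R]_n := ou_drift A B nu b t r.

Let ou_chiE y xi : ou_chi y xi =
  cis (dotv xi (y - drift)) * (cexp (- psiL xi) * cexp (- psiS xi)).
Proof.
rewrite /ou_chi (ou_psi_decomposition hLK t0 r0 Loo).
have -> : cexp (- (psiS xi + psiL xi + 'i%C * (dotv xi drift)%:C)) =
    cexp (- psiS xi) * cexp (- psiL xi) * cis (- dotv xi drift).
  rewrite !opprD !cexpD; congr (_ * _); rewrite cexpE !ReImE /=.
  by rewrite !(mul0r, mul1r, mulr0, subrr, oppr0, add0r) expR0 mul1r.
by rewrite dotvBr cisD; ring.
Qed.

Lemma cintegrable_ou_chi y : cintegrable (ou_chi y).
Proof.
have mchi : cmeasurable (ou_chi y).
  rewrite (_ : ou_chi y = fun xi =>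
    cis (dotv xi (y - drift)) * (cexp (- psiL xi) * cexp (- psiS xi))).
    apply: cmeasurableM; first exact: cmeasurable_cis_dotv.
    by apply: cmeasurableM; apply: cmeasurable_cexp; exact: cmeasurableN.
  by apply/funext => xi; exact: ou_chiE.
apply: (cintegrable_le mchi _ iweight) => xi.
rewrite ou_chiE cmodM (cmodM (cexp _)) cmod_cis mul1r !cmod_cexp !cReN.
have /andP[L0 _] := Re_psiL xi.
apply: ler_pM; rewrite ?expR_ge0//.
rewrite (@le_trans _ _ 1)//; first by rewrite -expR0 ler_expR lerNl oppr0.
by rewrite exprn_ege1// lerDl divr_ge0 ?enorm_ge0// ltW.
Qed.

(** The difference factors as a modulation, the compound Poisson factor, and ([cis <xi, y1 - y2>] -
    1) e^(- psi_S). The first preserves the L1 norm, and with it the drift disappears; the second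
    does not increase it; the third is a symbol times an exponential. *)
Lemma fourier_ou_chi_difference (y1 y2 : 'cV[R]_n) :
  (forall j, r * `|(y1 - y2) j 0| <= 1) ->
  (\int[lv]_y `|fourier (fun xi => ou_chi y1 xi - ou_chi y2 xi) y|%:E <=
   (2 ^+ n.+1 * ibp_constant (2 * K) n.+1 * (2 * n%:R) ^+ n *
    (2 * (r * l1norm (y1 - y2))) * (r ^- n * symbol_mass))%:E)%E.
Proof.
move=> c1.
pose f xi := cis (dotv xi (y1 - y2)) - 1.
pose g xi := f xi * cexp (- psiS xi).
have sf j : is_symbol j r n.+1 1 (2 * (r * l1norm (y1 - y2))) f by exact: is_symbol_cisB1.
have ig : cintegrable g.
  by apply: (cintegrable_symbol r0 mpsiS iweight _ (sf i0)); rewrite addn2.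
have -> : (fun xi => ou_chi y1 xi - ou_chi y2 xi) =
    (fun xi => cis (dotv xi (y2 - drift)) * (cexp (- psiL xi) * g xi)).
  apply/funext => xi; rewrite !ou_chiE /g /f.
  have -> : y1 - drift = (y2 - drift) + (y1 - y2) by rewrite [RHS]addrC addrA subrK.
  by rewrite dotvDr cisD; ring.
have iLg : cintegrable (fun xi => cexp (- psiL xi) * g xi).
  apply: (cintegrableMbounded (C := 1) _ _ ig).
    by apply: cmeasurable_cexp; exact: cmeasurableN.
  by move=> xi; rewrite cmod_cexp cReN -expR0 ler_expR lerNl oppr0; case/andP: (Re_psiL xi).
rewrite -[leLHS]/(fourier_L1 _) (fourier_L1_modulation _ iLg).
apply: (le_trans (fourier_L1_jump_psi mL mT Loo ig)).
have J_le : \int[lv]_xi weight xi <= symbol_mass.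
  by rewrite -lee_fin EFin_Rintegral//; exact: integral_weight_le.
have spsi j a := is_symbol_psi' r0 mS mT (fun x j Sx => Sx.2 j) isq sqK j a.
have dpsi j := is_cpartial_levy_psi mS mT isq j.
have K20 : 0 <= 2 * K by rewrite mulr_ge0.
apply: (le_trans (integral_fourier_symbol i0 r0 K20 mpsiS dpsi spsi iweight sf)).
rewrite lee_fin ler_wpM2l//.
  rewrite !mulr_ge0// ?exprn_ge0 ?mulr_ge0 ?l1norm_ge0 ?(ltW r0)//.
  by apply: prodr_ge0 => k _; rewrite addr_ge0// mulr_ge0// exprn_ge0.
by rewrite ler_wpM2l// invr_ge0 exprn_ge0// ltW.
Qed.

End fixed_time_estimate.

(** * The rate function and the coupling estimate *)

Section rate_function.
Context (R : realType) (n d : nat) (A : 'M[R]_n) (B : 'M[R]_(n, d)).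
Variables (nu : {sigma_finite_measure set 'cV[R]_d -> \bar R}).
Variables (Phi : 'cV[R]_d -> R[i]) (b : 'cV[R]_d).
Hypothesis hLK : levy_khintchine Phi 0 b nu.
Local Notation rexp := (re_exponent A B Phi).
Local Notation ph := (phi A B Phi).
Local Notation rho := (phi_inv A B Phi).
Local Notation m := (time_jump_measure nu).
Local Notation T := (ou_jump A B).

Lemma re_exponent_ge0 (I : set (measurableTypeR R)) xi : measurable I -> (0 <= rexp I xi)%E.
Proof.
move=> mI; rewrite (re_exponentE A B hLK)//.
by apply: integral_ge0 => z _; rewrite lee_fin oneBcos_ge0.
Qed.

Lemma le_re_exponent (I J : set (measurableTypeR R)) xi : measurable I -> measurable J ->
  I `<=` J -> (rexp I xi <= rexp J xi)%E.
Proof.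
move=> mI mJ IJ; rewrite !(re_exponentE A B hLK)//.
apply: ge0_subset_integral; try exact: measurableX.
- apply/measurable_EFinP; apply: measurable_funTS; apply: measurable_oneBcos.
  exact: measurable_ou_jump.
- by move=> z _; rewrite lee_fin oneBcos_ge0.
- by move=> z [Iz _]; split => //; exact: IJ.
Qed.

Lemma le_re_exponent_horizon s t xi : s <= t -> (rexp `[0%R, s] xi <= rexp `[0%R, t] xi)%E.
Proof.
move=> st; apply: le_re_exponent; try exact: measurable_itv.
by apply: subset_itvl; rewrite bnd_simp.
Qed.

Lemma re_exponent_small (I : set (measurableTypeR R)) r M : measurable I -> 0 < r -> 0 <= M ->
  (forall (j : 'I_n) u, 0 <= u <= 2 * r -> (rexp I (axis j u) <= M%:E)%E) ->
  exists2 r1, 0 < r1 & forall xi : 'cV[R]_n, enorm xi <= r1 -> (rexp I xi <= (2^-1)%:E)%E.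
Proof.
move=> mI r0 M0 h.
have mIX : measurable (I `*` [set: 'cV[R]_d]) by exact: measurableX.
have h' (j : 'I_n) u : 0 <= u <= 2 * r -> (exponent_on m (I `*` setT) T (axis j u) <= M%:E)%E.
  by move=> ur; rewrite -(re_exponentE A B hLK)// h.
have [r1 r10 h1] := exponent_on_small mIX (measurable_ou_jump A B) r0 M0 h'.
by exists r1 => // xi xir; rewrite (re_exponentE A B hLK)// h1.
Qed.

(** A crude bound from the boundedness of Phi on bounded sets, just enough to feed
    [re_exponent_small] at each fixed t. *)
Lemma re_exponent_axis_bounded t : 0 < t -> exists2 M, 0 <= M &
  forall (j : 'I_n) u, 0 <= u <= 2 -> (rexp `[0%R, t] (axis j u) <= M%:E)%E.
Proof.
move=> t0.
have hnu : levy_measure nu by case: hLK.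
have hj (j : 'I_n) : exists M : R, 0 <= M /\
    forall u, 0 <= u <= 2 -> (rexp `[0%R, t] (axis j u) <= M%:E)%E.
  have [M M0 hM] := ou_line_bounded A B t (delta_mx j 0).
  have [C hC] := levy_khintchine_bounded hnu (2 * M) hLK.
  exists (`|C| * t); split; first by rewrite mulr_ge0// ltW.
  move=> u /andP[u0 u2]; rewrite (re_exponent_ou_psi A B hLK) lee_fin /=.
  have bd s : `[0, t[%classic s -> `|complex.Re (Phi (ou_line A B (axis j u) s))| <= `|C|.
    rewrite /= in_itv/= => /andP[s0 st].
    have ub i : `|ou_line A B (axis j u) s i 0| <= 2 * M.
      rewrite /ou_line /axis -!scalemxAr mxE normrM (ger0_norm u0).
      by apply: ler_pM => //; apply: hM; rewrite s0 ltW.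
    by rewrite (le_trans (hC _ ub).1)// ler_norm.
  have ire := (integrable_Phi_line A B hLK t (axis j u)).1.
  rewrite (le_trans (ler_norm _))// (le_trans (le_normr_Rintegral _ ire))//.
  have mI : measurable (`[0, t[%classic : set (measurableTypeR R)) by exact: measurable_itv.
  have ic : (@lebesgue_measure R).-integrable `[0, t[ (EFin \o cst `|C|).
    apply: (@integrable_bounded_itv _ _ _ t `|C|) => //.
    - by apply: subset_itvl; rewrite bnd_simp.
    - by move=> s _; rewrite /= normr_id.
  apply: (@le_trans _ _ (\int[lebesgue_measure]_(s in `[0, t[) (cst `|C| s))).
    by apply: le_Rintegral => //; exact: (integrable_norm ire).
  have mut : (@lebesgue_measure R) `[0, t[ = t%:E.
    apply: (etrans (lebesgue_measure_itv `[0, t[)).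
    by rewrite /= lte_fin t0 -EFinB subr0.
  by rewrite Rintegral_cst// (_ : fine _ = t)//; exact: (congr1 fine mut).
exists (\sum_j xget 0 [set M | 0 <= M /\ forall u, 0 <= u <= 2 -> (rexp `[0%R, t] (axis j u) <= M%:E)%E]).
  by apply: sumr_ge0 => j _; case: (xgetPex 0 (hj j)).
move=> j u ur; have [M0 /(_ u ur) h] := xgetPex 0 (hj j).
apply: (le_trans h); rewrite lee_fin (bigD1 j)//= lerDl.
by apply: sumr_ge0 => i _; case: (xgetPex 0 (hj i)).
Qed.

(** On the ball of radius r1 the exponent stays below 1, so no radius smaller than r1 enters the
    infimum defining the rate. *)
Lemma phi_inv_ge t r1 : 0 <= r1 ->
  (forall xi : 'cV[R]_n, enorm xi <= r1 -> (rexp `[0%R, t] xi <= (2^-1)%:E)%E) ->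
  (r1%:E <= rho t 1)%E.
Proof.
move=> r10 h; apply/ereal_infP => _ [s [s0 hs] <-]; rewrite lee_fin leNgt.
apply/negP => sr; move: hs; apply/negP; rewrite -ltNge.
apply: (@le_lt_trans _ _ (2^-1)%:E); last by rewrite lte_fin invf_lt1// ltr1n.
by apply: ge_ereal_sup => _ [xi /= xis <-]; apply: h; rewrite (le_trans xis)// ltW.
Qed.

Lemma phi_inv_gt0 t : 0 < t -> exists2 r1, 0 < r1 & (r1%:E <= rho t 1)%E.
Proof.
move=> t0; have [M M0 hM] := re_exponent_axis_bounded t0.
have mI : measurable (`[0, t]%classic : set (measurableTypeR R)) by exact: measurable_itv.
have [|r1 r10 h1] := @re_exponent_small `[0, t]%classic 1 M mI ltr01 M0.
  by move=> j u; rewrite mulr1; exact: hM.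
by exists r1 => //; apply: phi_inv_ge => //; exact: ltW.
Qed.

(** An exponent above 1 at xi would put every radius beyond |xi| in the set defining the rate,
    including one strictly between |xi| and the rate. Such a radius is sought through a real s, as
    the rate may be infinite. *)
Lemma re_exponent_below t (xi : 'cV[R]_n) : ((enorm xi)%:E < rho t 1)%E -> (rexp `[0%R, t] xi <= 1)%E.
Proof.
move=> xir; rewrite leNgt; apply/negP => h.
have [s xis sr] : exists2 s, enorm xi < s & (s%:E <= rho t 1)%E.
  have e0 := enorm_ge0 xi; move: xir; case: (rho t 1) => [q|_|//].
    by rewrite lte_fin => xq; exists q.
  by exists (enorm xi + 1); rewrite ?ltrDl// leey.
pose s' := (enorm xi + s) / 2.
have s'0 : 0 < s' by have := enorm_ge0 xi; rewrite /s'; lra.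
have : (rho t 1 <= s'%:E)%E.
  apply: ereal_inf_lbound; exists s' => //; split => //.
  apply: (le_trans (ltW h)); apply: ereal_sup_ubound; exists xi => //=.
  by rewrite /s'; lra.
by move=> /(le_trans sr); rewrite lee_fin /s'; lra.
Qed.

Lemma log_growthP : log_growth_condition A B Phi -> exists t0 c r1 : R,
  [/\ 0 < t0, (2 * n + 2)%N%:R < c, 0 < r1 & forall xi : 'cV[R]_n, r1 < enorm xi ->
    ((c * ln (1 + enorm xi))%:E <= rexp `[0%R, t0] xi)%E].
Proof.
case=> t0 t00; rewrite /limf_einf lteNr => /ereal_inf_ltP[_ [V [q _ qV] <-]].
set s := ereal_sup _ => hs.
(* The midpoint of 2n + 2 and - s when s is finite; any larger number does when s is -oo. *)
have [c nc cs] : exists2 c : R, (2 * n + 2)%N%:R < c & (s <= (- c)%:E)%E.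
  move: hs; case: s => [s|//|_].
    rewrite -EFinN lte_fin => hs; exists (((2 * n + 2)%N%:R - s) / 2); first by lra.
    by rewrite lee_fin; lra.
  by exists ((2 * n + 2)%N%:R + 1); rewrite ?ltrDl// leNye.
exists t0, c, (`|q| + 1); split => //.
move=> xi xiq; have xi0 : 0 < enorm xi by apply: lt_trans xiq; rewrite ltr_wpDl.
have Vxi : V xi by apply: qV => /=; apply: lt_trans xiq; have := ler_norm q; lra.
have ln0 : 0 < ln (1 + enorm xi) by rewrite ln_gt0// ltrDl.
have : (- (rexp `[0%R, t0] xi * ((ln (1 + enorm xi))^-1)%:E) <= (- c)%:E)%E.
  by apply: le_trans cs; apply: ereal_sup_ubound; exists xi.
rewrite (re_exponent_ou_psi A B hLK) -EFinM -EFinN !lee_fin lerN2.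
by rewrite ler_pdivlMr.
Qed.

Lemma enorm_axis (i : 'I_n) (u : R) : 0 <= u -> enorm (axis i u) = u.
Proof.
move=> u0; rewrite /enorm dotv_axis mxE mxE !eqxx mulr1.
by rewrite -expr2 sqrtr_sqr ger0_norm.
Qed.

Lemma phi_inv_finite (i0 : 'I_n) t0 c r1 : 1 <= c ->
  (forall xi : 'cV[R]_n, r1 < enorm xi -> ((c * ln (1 + enorm xi))%:E <= rexp `[0%R, t0] xi)%E) ->
  exists q : R, forall t, t0 <= t -> (rho t 1 <= q%:E)%E.
Proof.
(* This q exceeds r1 and satisfies ln (1 + q) >= 1, so that the exponent at an axis vector of length
   q is at least c >= 1 from time t0 on. *)
move=> c1 h; pose q := `|r1| + expR 1.
have q0 : 0 < q by rewrite ltr_wpDl// expR_gt0.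
exists q => t t0t; apply: ereal_inf_lbound; exists q => //; split => //.
apply: (@le_trans _ _ (rexp `[0%R, t] (axis i0 q))); last first.
  by apply: ereal_sup_ubound; exists (axis i0 q) => //=; rewrite enorm_axis// ltW.
apply: le_trans (le_re_exponent_horizon _ t0t).
have qr1 : r1 < q by rewrite (le_lt_trans (ler_norm _))// ltrDl expR_gt0.
apply: le_trans (h _ _); rewrite enorm_axis ?(ltW q0)// lee_fin -[leLHS]mul1r ler_pM//.
rewrite -[leLHS]expRK ler_ln ?posrE ?expR_gt0 ?(addr_gt0 ltr01 q0)//.
by rewrite /q; have := normr_ge0 r1; lra.
Qed.

End rate_function.

(** * Variation distance of the transition functions *)

Section coupling.
Context (R : realType) (n d : nat) (A : 'M[R]_n) (B : 'M[R]_(n, d)).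
Context (dO : measure_display) (Omega : measurableType dO) (P : probability Omega R).
Variables (Z : R -> Omega -> 'cV[R]_d) (Phi : 'cV[R]_d -> R[i]) (b : 'cV[R]_d).
Variables (nu : {sigma_finite_measure set 'cV[R]_d -> \bar R}).
Variable (X : 'cV[R]_n -> R -> Omega -> 'cV[R]_n).
Hypothesis hZ : levy_process P Z.
Hypothesis hPhi : char_exponent P Z Phi.
Hypothesis hLK : levy_khintchine Phi 0 b nu.
Hypothesis hX : forall x, ou_process P A B Z x (X x).
Local Notation lv := (lebesgue_vec R n).
Local Notation rexp := (re_exponent A B Phi).
Local Notation rho := (phi_inv A B Phi).
Local Notation psi := (ou_psi A B Phi).

(** All starting points coincide; the case is kept apart because the estimates in positive dimension
    select a coordinate, and the rate may here be infinite, with 0 times +oo equal to 0. *)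
Lemma coupling_estimate_dim0 : n = 0%N -> coupling_estimate A B Phi (ou_transition P X).
Proof.
move=> n0; exists 1, 1; split => // x y t t1.
have -> : x = y by apply/colP => i; have := ltn_ord i; rewrite {2}n0.
rewrite subrr mulmx0 /enorm dotv0r sqrtr0 mulr0 mul0e.
by apply: var_dist_self; apply: (ou_measurable (hX y)); rewrite (le_trans _ t1).
Qed.

Lemma expeR_re_exponent t (xi : 'cV[R]_n) k :
  (expeR (- rexp `[0%R, t] xi) * (enorm xi ^+ k)%:E)%E =
  (enorm xi ^+ k * expR (- complex.Re (psi t xi)))%:E.
Proof. by rewrite (re_exponent_ou_psi A B hLK) mulrC. Qed.

(** The number 11 n^2 bounds the second moments, doubled for real and imaginary parts; n / 2
    combines 2 r = q / 2 with the comparison of norms |c|_1 <= n |c|; 4^(2n+2) comes from q = 4 r.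
    The final 1 makes the constant at least 1, which covers the case of distant points. *)
Definition coupling_constant (M : R) : R :=
  ((2 * pi) ^+ n)^-1 * (2 ^+ n.+1 * ibp_constant (2 * (11 * n%:R ^+ 2)) n.+1 * (2 * n%:R) ^+ n *
    (n%:R / 2) * (2 ^+ (n + 2) * (2 ^+ n + expR (6 * n%:R) * 4 ^+ (2 * n + 2) * M))) + 1.

Lemma ibp_constant_ge0 (K : R) k : 0 <= K -> 0 <= ibp_constant K k.
Proof. by move=> K0; apply: prodr_ge0 => i _; rewrite addr_ge0// mulr_ge0// exprn_ge0. Qed.

Lemma coupling_constant_ge1 M : 0 <= M -> 1 <= coupling_constant M.
Proof.
move=> M0; have pi0 := pi_ge0 R.
have i0 : 0 <= ibp_constant (2 * (11 * n%:R ^+ 2)) n.+1 :> R.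
  by apply: ibp_constant_ge0; rewrite !mulr_ge0// sqr_ge0.
have e0 := expR_ge0 (6 * n%:R : R).
rewrite lerDr mulr_ge0 ?invr_ge0 ?exprn_ge0 ?mulr_ge0//.
by rewrite ?mulr_ge0 ?exprn_ge0 ?addr_ge0 ?mulr_ge0 ?exprn_ge0.
Qed.

Lemma l1norm_le_enorm (v : 'cV[R]_n) : l1norm v <= n%:R * enorm v.
Proof.
apply: (@le_trans _ _ (\sum_(i < n) enorm v)).
  by apply: ler_sum => i _; exact: coord_le_enorm.
by rewrite sumr_const card_ord mulr_natl.
Qed.

(** The powers of r cancel: r^-n from the majorant and r^-(n+2) from the weight meet the power 2n +
    2 that (b) allows. *)
Lemma symbol_mass_scaling (r M : R) : 0 < r ->
  r ^- n * symbol_mass n r (M * (4 * r) ^+ (2 * n + 2)) =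
  2 ^+ (n + 2) * (2 ^+ n + expR (6 * n%:R) * 4 ^+ (2 * n + 2) * M).
Proof.
move=> r0; rewrite /symbol_mass !exprMn.
have -> : r ^+ (2 * n + 2) = r ^+ n * r ^+ (n + 2) by rewrite -exprD; rewrite mul2n -addnn addnA.
have a0 : r ^+ n != 0 by rewrite expf_neq0// gt_eqF.
have b0 : r ^+ (n + 2) != 0 by rewrite expf_neq0// gt_eqF.
move: (r ^+ n) (r ^+ (n + 2)) (expR _) (2 ^+ n) (4 ^+ _) (2 ^+ (n + 2)) a0 b0 => u v e k l w u0 v0.
by field; rewrite u0 v0.
Qed.

Lemma var_dist_ou (i0 : 'I_n) x y t q M : 0 < t -> 0 < q -> 0 <= M -> rho t 1 = q%:E ->
  (\int[lv]_xi (expeR (- rexp `[0%R, t] xi) * (enorm xi ^+ (n + 2))%:E) <= (M * q ^+ (2 * n + 2))%:E)%E ->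
  (var_dist (ou_transition P X t x) (ou_transition P X t y) <=
   (coupling_constant M * enorm (mexp (t *: A) *m (x - y)) * q)%:E)%E.
Proof.
move=> t0 q0 M0 rq intM; set c := mexp (t *: A) *m (x - y).
have C1 := coupling_constant_ge1 M0.
have c0 := enorm_ge0 c.
have mX z : measurable_fun setT (X z t) by apply: (ou_measurable (hX z)); exact: ltW.
(* With this choice the test points of the jump estimates, of length at most 2 r = q / 2, lie
   strictly below the rate, where the exponent is at most 1. *)
pose r := q / 4; have r0 : 0 < r by rewrite divr_gt0.
have [small|/existsNP[j /negP]] := pselect (forall j, r * `|c j 0| <= 1); last first.
  (* If some r |c_j| exceeds 1, then |c| q >= 4, and the trivial bound 2 is enough. *)
  rewrite -ltNge => hj; have /le_trans := var_dist_le2 P (mX x) (mX y); apply; rewrite lee_fin.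
  have h : 1 <= r * enorm c.
    by rewrite (le_trans (ltW hj))// ler_wpM2l ?(ltW r0)// coord_le_enorm.
  apply: (@le_trans _ _ (enorm c * q)); first by move: h; rewrite /r; lra.
  by rewrite -mulrA ler_peMl// mulr_ge0// ltW.
pose D := (`[0, t[%classic : set (measurableTypeR R)) `*` [set: 'cV[R]_d].
have exp1 (j : 'I_n) u : 0 <= u <= 2 * r ->
    (exponent_on (time_jump_measure nu) D (ou_jump A B) (axis j u) <= 1%:E)%E.
  move=> /andP[u0 ur]; rewrite (exponent_on_ou_psi A B hLK) -(re_exponent_ou_psi A B hLK).
  apply: re_exponent_below; rewrite enorm_axis// rq lte_fin.
  by move: ur; rewrite /r; have := q0; lra.
have intI : (\int[lv]_xi (enorm xi ^+ (n + 2) * expR (- complex.Re (psi t xi)))%:E <=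
    (M * (4 * r) ^+ (2 * n + 2))%:E)%E.
  have -> : 4 * r = q by rewrite /r; field.
  by apply: le_trans intM; under eq_integral do rewrite -expeR_re_exponent.
have cE : c = mexp (t *: A) *m x - mexp (t *: A) *m y by rewrite /c mulmxBr.
have ichi z := cintegrable_ou_chi i0 hLK t0 r0 exp1 intI z.
have := var_dist_charfun (mX x) (mX y) (ichi (mexp (t *: A) *m x)) (ichi (mexp (t *: A) *m y))
  (fun xi al => ou_charfun hZ hPhi hLK (hX x) xi t0 al)
  (fun xi al => ou_charfun hZ hPhi hLK (hX y) xi t0 al).
move=> /le_trans; apply.
have := fourier_ou_chi_difference i0 hLK t0 r0 exp1 intI (y1 := mexp (t *: A) *m x)
  (y2 := mexp (t *: A) *m y).
rewrite -cE => /(_ small) hF.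
have k0 : 0 <= ((2 * pi) ^+ n)^-1 :> R by rewrite invr_ge0 exprn_ge0// mulr_ge0// pi_ge0.
apply: (@le_trans _ _ (((2 * pi) ^+ n)^-1%:E * (2 ^+ n.+1 * ibp_constant (2 * (11 * n%:R ^+ 2)) n.+1 *
  (2 * n%:R) ^+ n * (2 * (r * l1norm c)) * (r ^- n * symbol_mass n r (M * (4 * r) ^+ (2 * n + 2))))%:E)%E).
  by rewrite lee_wpmul2l// lee_fin.
rewrite symbol_mass_scaling// -EFinM lee_fin /coupling_constant.
set a := 2 ^+ n.+1 * _ * _; set w := 2 ^+ (n + 2) * _; set p := ((2 * pi) ^+ n)^-1.
have a0 : 0 <= a.
  rewrite !mulr_ge0 ?exprn_ge0 ?mulr_ge0//; apply: ibp_constant_ge0.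
  by rewrite !mulr_ge0// sqr_ge0.
have w0 : 0 <= w.
  by rewrite !mulr_ge0 ?exprn_ge0 ?addr_ge0 ?mulr_ge0 ?exprn_ge0 ?expR_ge0.
have l1 := l1norm_le_enorm c.
apply: (@le_trans _ _ (p * (a * (n%:R / 2) * w) * (enorm c * q))); last first.
  by rewrite -[leRHS]mulrA ler_wpM2r ?mulr_ge0 ?(ltW q0)// lerDl.
rewrite [leRHS](_ : _ = p * (a * (2 * (r * (n%:R * enorm c)) * w))); last by rewrite /r; field.
rewrite [leLHS](_ : _ = p * (a * (2 * (r * l1norm c) * w))); last by ring.
rewrite ler_wpM2l// ler_wpM2l//.
by rewrite ler_wpM2r// ler_wpM2l// ler_wpM2l// ltW.
Qed.

Lemma coupling_of_bigO : log_growth_condition A B Phi -> integral_bigO_condition A B Phi ->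
  coupling_estimate A B Phi (ou_transition P X).
Proof.
move=> hlog [M [t2 [_ hM]]].
have [n0|n_gt0] := posnP n; first exact: coupling_estimate_dim0.
pose i0 : 'I_n := Ordinal n_gt0.
have [t0 [c [r1 [t00 nc r10 hc]]]] := log_growthP hLK hlog.
have c1 : 1 <= c by rewrite (le_trans _ (ltW nc))// ler1n addn2.
have [Q hQ] := phi_inv_finite hLK i0 c1 hc.
(* The rate is bounded from t0 on and the bound of (b) holds for t > t2, a strict inequality secured
   by the added 1. The absolute value is taken because M in (b) may be negative. *)
exists (Num.max t0 t2 + 1), (coupling_constant `|M|).
have C1 := coupling_constant_ge1 (normr_ge0 M).
split; first by rewrite ltr_wpDl// le_max ltW.
  exact: lt_le_trans C1.
move=> x y t tt.
have tt0 : t0 <= t by rewrite (le_trans _ tt)// ler_wpDr// le_max lexx.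
have tt2 : t2 < t by rewrite (lt_le_trans _ tt)// ltr_pwDr// le_max lexx orbT.
have t_gt0 : 0 < t by exact: lt_le_trans tt0.
have [e e0 he] := phi_inv_gt0 A B hLK t_gt0.
have rf : rho t 1 \is a fin_num.
  rewrite fin_numElt (lt_le_trans _ he) ?ltNyr//=.
  exact: le_lt_trans (hQ t tt0) (ltry _).
have q0 : 0 < fine (rho t 1).
  by rewrite -lte_fin fineK// (lt_le_trans _ he)// lte_fin.
rewrite -[X in (_ * X)%E]fineK// -EFinM.
apply: (var_dist_ou i0) => //; first by rewrite fineK.
apply: (le_trans (hM t tt2)); rewrite -[X in (_ * X ^+ _)%E]fineK// -EFin_expe -EFinM lee_fin.
by rewrite ler_wpM2r ?exprn_ge0 ?ler_norm// ltW.
Qed.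

Lemma cvg_axis (j : 'I_n) : axis j u @[u --> (0 : R)] --> (0 : 'cV[R]_n).
Proof.
apply: cvg_mx_coordP => i k; pose a := (delta_mx j 0 : 'cV[R]_n) i k.
rewrite (_ : (fun u => axis j u i k) = fun u : R => u * a); last first.
  by apply/funext => u; rewrite mxE.
rewrite (_ : (0 : 'cV[R]_n) i k = 0 * a); last by rewrite mxE mul0r.
by apply: cvgM; [exact: cvg_id|exact: cvg_cst].
Qed.

(** The jump representation shows it as a Tonelli integral of a jointly measurable nonnegative
    function of xi and the jump. *)
Lemma measurable_re_exponent t : measurable_fun setT (fun xi => complex.Re (psi t xi)).
Proof.
pose D := (`[0, t[%classic : set (measurableTypeR R)) `*` [set: 'cV[R]_d].
have mD : measurable D by apply: measurableX => //; exact: measurable_itv.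
pose m := time_jump_measure nu.
pose f (z : 'cV[R]_n * (measurableTypeR R * 'cV[R]_d)) :=
  ((1 - cos (dotv z.1 (ou_jump A B z.2))) * \1_D z.2)%:E.
apply/measurable_EFinP.
rewrite (_ : _ \o _ = fun xi => \int[m]_z f (xi, z))%E.
  apply: (@measurable_fun_fubini_tonelli_F _ _ _ _ _ m f) => [|z]; last first.
    by rewrite lee_fin mulr_ge0// oneBcos_ge0.
  apply/measurable_EFinP; apply: measurable_funM; last first.
    exact: (measurableT_comp (measurable_indic mD)).
  apply: measurable_funB => //.
  apply: (measurableT_comp (continuous_measurable_fun (@continuous_cos R))).
  apply: measurable_dotv => //.
  exact: (measurableT_comp (measurable_ou_jump A B) measurable_snd).
apply/funext => xi /=; rewrite -(exponent_on_ou_psi A B hLK) /exponent_on integral_mkcond.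
apply: eq_integral => z _; rewrite patchE /f /= indicE -/D.
by case: (z \in D); rewrite ?mulr1 ?mulr0.
Qed.

Lemma measurable_decay t k : measurable_fun setT (fun xi : 'cV[R]_n =>
  expeR (- rexp `[0%R, t] xi) * (enorm xi ^+ k)%:E)%E.
Proof.
under eq_fun do rewrite expeR_re_exponent.
apply/measurable_EFinP; apply: measurable_funM.
  by apply: measurable_funX; exact: measurable_enorm.
apply: (measurableT_comp (@measurable_expR R)); apply: measurable_funN.
exact: measurable_re_exponent.
Qed.

Lemma re_exponent_infinite_small : locally_bounded_exponent A B Phi ->
  exists2 r1, 0 < r1 & forall xi : 'cV[R]_n, enorm xi <= r1 -> (rexp `[0%R, +oo[ xi <= (2^-1)%:E)%E.
Proof.
move=> /(_ 0)[M hM].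
have hax : \forall u \near (0 : R), forall j : 'I_n, (rexp `[0%R, +oo[ (axis j u) <= M%:E)%E.
  have hj (j : 'I_n) : \forall u \near (0 : R), (rexp `[0%R, +oo[ (axis j u) <= M%:E)%E.
    exact: (cvg_axis j hM).
  exact: (filter_forall _ hj).
have /nbhs_ballP[e /= e0 he] := hax.
(* With scale e / 4 the axis points in question have length at most e / 2, inside the ball where the
   local bound holds. *)
apply: (@re_exponent_small _ _ _ A B _ _ _ hLK `[0%R, +oo[%classic (e / 4) `|M|) => //.
- by rewrite divr_gt0.
- move=> j u /andP[u0 ue]; apply: (@le_trans _ _ M%:E); last by rewrite lee_fin ler_norm.
  have bu : ball (0 : R) e u by rewrite /ball /= sub0r normrN ger0_norm//; lra.
  exact: he bu j.
Qed.

(** Here e stands for |xi| and w for the exponent. Beyond r1 the left side is at most (1 + e)^(n + 2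
    - c), and n al = c - (n + 2); up to r1, where only w >= 0 is known, the factor (1 + r1)^c
    compensates. *)
Lemma decay_le (c r1 e w al : R) (i0 : 'I_n) : 0 <= e -> 0 <= w -> 0 <= r1 ->
  al = (c - (n + 2)%:R) / n%:R -> 0 <= c ->
  (r1 < e -> c * ln (1 + e) <= w) ->
  e ^+ (n + 2) * expR (- w) <= (1 + r1) `^ c * ((1 + e) `^ (- al)) ^+ n.
Proof.
move=> e0 w0 r10 alE c0 hc.
have n0 : n%:R != 0 :> R by rewrite pnatr_eq0 -lt0n (leq_ltn_trans _ (ltn_ord i0)).
have E0 : 0 < 1 + e by rewrite ltr_wpDr.
have r1E : 0 < 1 + r1 by rewrite ltr_wpDr.
rewrite /powR (gt_eqF E0) (gt_eqF r1E) -expRM_natl.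
set Le := ln (1 + e); set Lr := ln (1 + r1).
have Le0 : 0 <= Le by rewrite ln_ge0// lerDl.
have Lr0 : 0 <= Lr by rewrite ln_ge0// lerDl.
have -> : n%:R * (- al * Le) = (n + 2)%:R * Le - c * Le by rewrite alE; field.
have h1 : e ^+ (n + 2) <= expR ((n + 2)%:R * Le).
  by rewrite expRM_natl lnK ?posrE//; apply: lerXn2r; rewrite ?nnegrE// ?lerDr// ltW.
rewrite -expRD; apply: (@le_trans _ _ (expR ((n + 2)%:R * Le) * expR (- w))).
  by rewrite ler_wpM2r// expR_ge0.
rewrite -expRD ler_expR.
have cL : 0 <= c * Lr by rewrite mulr_ge0.
have [er|re] := leP e r1; last by have := hc re; rewrite -/Le; lra.
have : c * Le <= c * Lr by rewrite ler_wpM2l// ler_ln ?posrE// lerD2l.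
by lra.
Qed.

Lemma integral_decay (i0 : 'I_n) t0 c r1 : 0 < t0 -> (2 * n + 2)%N%:R < c -> 0 < r1 ->
  (forall xi : 'cV[R]_n, r1 < enorm xi -> ((c * ln (1 + enorm xi))%:E <= rexp `[0%R, t0] xi)%E) ->
  exists2 K : R, 0 <= K &
    (\int[lv]_xi (expeR (- rexp `[0%R, t0] xi) * (enorm xi ^+ (n + 2))%:E) <= K%:E)%E.
Proof.
move=> t00 nc r10 hc.
have n0 : 0 < n%:R :> R by rewrite ltr0n (leq_ltn_trans _ (ltn_ord i0)).
pose al : R := (c - (n + 2)%:R) / n%:R.
(* This is where 2n + 2 in (a) is used: al > 1 means c - (n + 2) > n, and makes each one-dimensional
   weight integrable. *)
have al1 : 1 < al.
  by rewrite ltr_pdivlMr// mul1r; move: nc; rewrite (natrD _ (2 * n)%N) natrM natrD; lra.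
have c0 : 0 <= c by rewrite (le_trans _ (ltW nc)).
pose g (xi : 'cV[R]_n) := \prod_i (1 + 1 * `|xi i 0|) `^ (- al).
have intg : (\int[lv]_xi (g xi)%:E = (\prod_(i < n) (2 / (1 * (al - 1))))%:E)%E.
  apply: (@ge0_integral_prod R n (fun i x => (1 + 1 * `|x|) `^ (- al)) (fun i => 2 / (1 * (al - 1)))).
  - move=> i; apply: (measurableT_comp (@measurable_powR R (- al))).
    by apply: measurable_funD => //; apply: measurable_funM => //; exact: normr_measurable.
  - by move=> i x; exact: powR_ge0.
  - by move=> i; exact: integral_weight1.
have g0 xi : 0 <= g xi by apply: prodr_ge0 => i _; exact: powR_ge0.
have mg : measurable_fun setT g.
  apply: measurable_prod => i _; apply: (measurableT_comp (@measurable_powR R (- al))).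
  apply: measurable_funD => //; apply: measurable_funM => //.
  apply: (measurableT_comp (@normr_measurable R setT)).
  exact: (@measurable_coord R n 1 i 0).
exists ((1 + r1) `^ c * \prod_(i < n) (2 / (1 * (al - 1)))).
  rewrite mulr_ge0 ?powR_ge0//; apply: prodr_ge0 => i _.
  by rewrite divr_ge0// mul1r subr_ge0 ltW.
rewrite EFinM -intg -ge0_integralZl//; first last.
- by rewrite lee_fin powR_ge0.
- by move=> xi _; rewrite lee_fin.
- exact/measurable_EFinP.
apply: ge0_le_integral => //.
- by move=> xi _; rewrite mule_ge0 ?expeR_ge0// lee_fin exprn_ge0// enorm_ge0.
- exact: measurable_decay.
- by apply: emeasurable_funM => //; exact/measurable_EFinP.
move=> xi _; rewrite expeR_re_exponent -EFinM lee_fin.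
have e0 := enorm_ge0 xi.
apply: (@le_trans _ _ ((1 + r1) `^ c * ((1 + enorm xi) `^ (- al)) ^+ n)).
  apply: (decay_le i0 (al := al)) => //.
  - by have := re_exponent_ge0 A B hLK xi (@measurable_itv _ `[0, t0]); rewrite (re_exponent_ou_psi A B hLK) lee_fin.
  - exact: ltW.
  - by move=> re; have := hc xi re; rewrite (re_exponent_ou_psi A B hLK) lee_fin.
rewrite ler_wpM2l ?powR_ge0//.
(* The n powers of the Euclidean norm are distributed over the coordinates, each of which is at most
   that norm; the majorant becomes a product of one-dimensional weights. *)
rewrite (_ : ((1 + enorm xi) `^ (- al)) ^+ n = \prod_(i < n) (1 + enorm xi) `^ (- al)); last first.
  by rewrite prodr_const card_ord.
apply: ler_prod => i _; rewrite powR_ge0/= mul1r.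
rewrite !powRN lef_pV2 ?posrE ?powR_gt0 ?ltr_pwDl//.
apply: ge0_ler_powR; rewrite ?nnegrE ?addr_ge0 ?lerD2l ?coord_le_enorm//.
by rewrite (le_trans ler01)// ltW.
Qed.

Lemma bigO_of_locally_bounded (i0 : 'I_n) : log_growth_condition A B Phi ->
  locally_bounded_exponent A B Phi -> integral_bigO_condition A B Phi.
Proof.
move=> /(log_growthP hLK)[t0 [c [r1 [t00 nc r10 hc]]]] hloc.
have [K K0 hK] := integral_decay i0 t00 nc r10 hc.
have c1 : 1 <= c by rewrite (le_trans _ (ltW nc))// ler1n addn2.
have [Q hQ] := phi_inv_finite hLK i0 c1 hc.
have [e e0 he] := re_exponent_infinite_small hloc.
(* K bounds the left-hand side of (b) at t0 and hence at all later times, and e bounds the rate from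
   below uniformly in t. *)
exists (K / e ^+ (2 * n + 2)); exists t0; split; first exact: num_real.
move=> t t0t.
have et : (e%:E <= rho t 1)%E.
  apply: phi_inv_ge; first exact: ltW.
  move=> xi xie; apply: (le_trans _ (he xi xie)); apply: (le_re_exponent A B hLK).
  - exact: measurable_itv.
  - exact: measurable_itv.
  - by apply: subset_itvl.
have rf : rho t 1 \is a fin_num.
  rewrite fin_numElt (lt_le_trans _ et) ?ltNyr//=.
  exact: le_lt_trans (hQ t (ltW t0t)) (ltry _).
apply: (@le_trans _ _ K%:E).
  apply: le_trans hK; apply: ge0_le_integral => //.
  - by move=> xi _; rewrite mule_ge0 ?expeR_ge0// lee_fin exprn_ge0// enorm_ge0.
  - exact: measurable_decay.
  - exact: measurable_decay.
  - move=> xi _; rewrite lee_wpmul2r ?lee_fin ?exprn_ge0 ?enorm_ge0// lee_expeR leeN2.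
    by apply: (le_re_exponent_horizon A B hLK); exact: ltW.
rewrite -[X in (_ * X ^+ _)%E]fineK// -EFin_expe -EFinM lee_fin.
rewrite mulrAC -mulrA ler_peMr// ler_pdivlMr ?exprn_gt0// mul1r.
apply: lerXn2r; rewrite ?nnegrE ?(ltW e0)//.
- by rewrite -lee_fin fineK// (le_trans _ et)// lee_fin ltW.
- by rewrite -lee_fin fineK.
Qed.

End coupling.

Theorem theorem1p7 (R : realType) (n d : nat)
    (A : 'M[R]_n) (B : 'M[R]_(n, d))
    (dO : measure_display) (Omega : measurableType dO) (P : probability Omega R)
    (Z : R -> Omega -> 'cV[R]_d) (Phi : 'cV[R]_d -> R[i])
    (b : 'cV[R]_d) (nu : {measure set 'cV[R]_d -> \bar R}%R)
    (X : 'cV[R]_n -> R -> Omega -> 'cV[R]_n)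
    (hZ : levy_process P Z)
    (hPhi : char_exponent P Z Phi)
    (hLK : levy_khintchine Phi 0%R b nu)
    (hX : forall x : 'cV[R]_n, ou_process P A B Z x (X x))
    (ha : log_growth_condition A B Phi) :
  (integral_bigO_condition A B Phi -> coupling_estimate A B Phi (ou_transition P X)) /\
  (locally_bounded_exponent A B Phi ->
     coupling_estimate A B Phi (ou_transition P X)).
Proof.
(* Sigma-finiteness of nu is part of the Levy-Khintchine data; attaching it to a copy of nu gives
   access to the product measure ds nu(dz). *)
have [_ [_ nu_sigma _] _] := hLK.
pose nuS : {sigma_finite_measure set 'cV[R]_d -> \bar R} := sigma_finite_copy nu_sigma.
have hLKS : levy_khintchine Phi 0%R b nuS by exact: hLK.
split=> [hb|hloc]; first exact: (coupling_of_bigO hZ hPhi hLKS hX ha hb).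
have [n0|n_gt0] := posnP n; first exact: coupling_estimate_dim0.
apply: (coupling_of_bigO hZ hPhi hLKS hX ha).
exact: (bigO_of_locally_bounded hLKS (Ordinal n_gt0) ha hloc).
Qed.
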